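(* Let $q$ be a power of $2$. Then every involutory translation of the polar unital $\mathbb{U}_{\mathrm{Fig}(q^6)}$ has its center in $\mathbb{H}$, and is induced by an elation of the Figueroa plane $\mathrm{Fig}(q^6)$ that leaves $\mathbb{U}_{\mathrm{Fig}(q^6)}$ invariant. In particular, $\mathbb{H}=\mathbb{U}_2=(\Omega_2,\mathcal{B}_2)$, the subunital $\mathbb{H}$ is invariant under $\operatorname{Aut}\mathbb{U}_{\mathrm{Fig}(q^6)}$, and every non-trivial translation of $\mathbb{U}_{\mathrm{Fig}(q^6)}$ is an involution.
   Context: For a prime power $r$, the Figueroa plane $\mathrm{Fig}(r^3)$ is Figueroa's projective plane of order $r^3$; it contains a pappian (desarguesian) subplane $\mathbb{D}$ of order $r$, and all automorphisms of $\mathbb{D}$ extend to automorphisms of $\mathrm{Fig}(r^3)$. For $r=q^2$ the plane $\mathrm{Fig}(q^6)$ admits a polarity $\pi$ (extending a unitary polarity of $\mathbb{D}$) whose absolute points, with blocks induced by lines meeting the absolute point set in more than one point, form a unital $\mathbb{U}_{\mathrm{Fig}(q^6)}$ of order $q^3$; $\mathbb{H}$ denotes its intersection with $\mathbb{D}$, a hermitian unital of order $q$. A unital of order $m$ is a $2$-$(m^3+1,m+1,1)$ design; a translation with center $c$ is an automorphism fixing $c$ and every block through $c$. $\Omega_2$ is the set of centers of translations of order $2$, $\mathcal{B}_2$ the set of blocks containing at least two points of $\Omega_2$, and $\mathbb{U}_2=(\Omega_2,\mathcal{B}_2,\in)$. An elation of a projective plane is a collineation fixing all points of a line (axis) and all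 lines through a point (center) on that axis. *)

(* Defs.v *)
From mathcomp Require Import all_boot all_order all_fingroup all_algebra.

Set Implicit Arguments.
Unset Strict Implicit.
Unset Printing Implicit Defensive.

Import GRing.Theory.
Local Open Scope ring_scope.

(** * Incidence structures [(T, B, \in)] with blocks [B] *)

Section BlockStructures.
Variables (T : finType) (B : {set {set T}}).

Definition block_aut (s : {perm T}) : bool :=
  [forall b : {set T}, (s @: b \in B) == (b \in B)].

Definition translation (c : T) (s : {perm T}) : bool :=
  [&& block_aut s, s c == c &
      [forall b : {set T}, (b \in B) ==> (c \in b) ==> (s @: b == b)]].

Definition involutory_translation (c : T) (s : {perm T}) : bool :=
  translation c s && (#[s]%g == 2%N).

Definition Omega2 : {set T} :=
  [set c | [exists s, involutory_translation c s]].

Definition blocks2 : {set {set T}} :=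
  [set b in B | (1 < #|b :&: Omega2|)%N].

End BlockStructures.

(** * Planes given by points, lines and an incidence relation *)

Section Planes.
Variables (P L : finType) (inc : P -> L -> bool).

Definition collineation (f : {perm P}) (g : {perm L}) : Prop :=
  forall p l, inc (f p) (g l) = inc p l.

Definition elation (f : {perm P}) (g : {perm L}) : Prop :=
  collineation f g /\
  exists (c : P) (a : L),
    [/\ inc c a, forall p, inc p a -> f p = p & forall l, inc c l -> g l = l].

Definition polarity (f : P -> L) (g : L -> P) : Prop :=
  [/\ cancel f g, cancel g f & forall p l, inc (g l) (f p) = inc p l].

End Planes.

(** * The Figueroa plane *)

(* A subspace of K^3 is encoded by the matrix A = <<A>>%MS which MathComp
   chooses as representative of its row space. *)
Definition subsp (K : finFieldType) (d : nat) : finType :=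
  {A : 'M[K]_3 | (<<A>>%MS == A) && (\rank A == d)}.

(* The Figueroa plane has the same points and lines as PG(2,K). *)
Notation fpoint K := (subsp K 1).
Notation fline K := (subsp K 2).

Section Figueroa.
Variables (K : finFieldType) (r : nat).

(* Used with #|K| = r ^ 3: the map [frob] induces a collineation of order 3 of
   PG(2,K) whose fixed elements form the subplane PG(2,r). *)
Definition frob (A : 'M[K]_3) : 'M[K]_3 := map_mx (fun x => x ^+ r) A.

(* The points and lines of the subplane PG(2,r). *)
Definition inD (d : nat) (A : subsp K d) : bool := (frob (val A) == val A)%MS.

Definition triangle_point (p : fpoint K) : bool :=
  \rank (val p + frob (val p) + frob (frob (val p)))%MS == 3%N.

Definition triangle_line (l : fline K) : bool :=
  \rank (val l :&: frob (val l) :&: frob (frob (val l)))%MS == 0%N.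

Definition mu_point (p : fpoint K) : 'M[K]_3 :=
  (frob (val p) + frob (frob (val p)))%MS.

Definition mu_line (l : fline K) : 'M[K]_3 :=
  (frob (val l) :&: frob (frob (val l)))%MS.

(* Grundhoefer's synthetic description of the Figueroa plane: incidence is that
   of PG(2,K), except between a point p and a line l whose orbits under [frob]
   are a triangle and a trilateral; then p is on l iff the point [mu_line l]
   lies on the line [mu_point p] in PG(2,K). *)
Definition fig_inc (p : fpoint K) (l : fline K) : bool :=
  if triangle_point p && triangle_line l then (mu_line l <= mu_point p)%MS
  else (val p <= val l)%MS.

End Figueroa.

(** * Polar unitals *)

Section PolarUnital.
Variables (K : finFieldType) (q : nat) (pi : fpoint K -> fline K).

(* On the points <x> of the subplane PG(2,q^2) of Fig(q^6), [pi] is the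
   polarity <x> |-> {y | x^(q) H y^T = 0} of a non-degenerate hermitian form
   over the field of order q^2. *)
Definition extends_unitary_polarity : Prop :=
  exists H : 'M[K]_3,
    [/\ map_mx (fun x => x ^+ (q ^ 2)) H = H,
        H^T = map_mx (fun x => x ^+ q) H,
        H \in unitmx &
        forall p : fpoint K, inD (q ^ 2) p ->
          (val (pi p) == kermx (map_mx (fun x => x ^+ q) (val p) *m H)^T)%MS].

Definition absolute (p : fpoint K) : bool := fig_inc (q ^ 2) p (pi p).

Definition upoint : finType := {p : fpoint K | absolute p}.

Definition utrace (l : fline K) : {set upoint} :=
  [set x : upoint | fig_inc (q ^ 2) (val x) l].

Definition ublocks : {set {set upoint}} :=
  [set utrace l | l : fline K & (1 < #|utrace l|)%N].

Definition hpoints : {set upoint} := [set x : upoint | inD (q ^ 2) (val x)].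

(* A block of the subunital is identified with the block of the polar unital
   that is induced by the same line. *)
Definition hblocks : {set {set upoint}} :=
  [set utrace l | l : fline K &
     inD (q ^ 2) l && (1 < #|utrace l :&: hpoints|)%N].

End PolarUnital.

(* Main.v *)
From HB Require Import structures.
Require Import Defs.
From mathcomp Require Import all_boot all_order all_fingroup all_algebra all_solvable all_field.
From mathcomp Require Import ring zify.

(** Write [phi x = x^(q^2)] and [bar x = x^(q^3)].  Points are of type I (in the
    subplane), II (on exactly one line of the subplane) or III (triangle points).
    A collineation of the Figueroa plane that fixes the subplane pointwise is a
    power of [phi], so the polarity is [v |-> bar v H] on all points; an absolute
    point [v] of type III satisfies [h(v,v) <> 0] for the hermitian form [h], which
    replaces the hermitian curve condition there.  A variance count shows that every
    block has [q^3 + 1] points, hence a non-trivial translation fixes its center only.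

    For a center in [H], taken as the point at infinity of a hyperbolic frame, the
    translation commutes with the homologies [diag(z,1,1)], [z^(q+1) = 1], whose fixed
    points are the points of a line of the subplane; an image of the wrong type would
    be an isotropic absolute point of type III, so the translation is an elation of
    the plane with parameter in [F_q].

    Suppose an involutory translation has its center outside [H].  The involutions
    [diag(z,1,1) bar] provide one whose center is a type II point [(0,1,a)] with
    [a] in [F_{q^3}] but not in [F_q], and a count of translations commuting with a
    suitable field automorphism makes it commute with [t phi] for a prescribed
    [t] in [SL_2(q)].  Writing [q = 2^e], let [k] be a primitive cube root of unity.
    If [e] is even, [bar k = k] and [diag(1,k,1/k) phi] acts on the translations with
    center at infinity without non-trivial fixed points, a contradiction.  If [e] is
    odd, in an orthonormal frame the translation swaps two lines of the subplane, maps
    the line [(1,1,1)] to a type III line, and the Gram determinants of the images of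
    the points [(1,t,1+t)], [t] of trace 0, are incompatible. *)

Set Implicit Arguments.
Unset Strict Implicit.
Unset Printing Implicit Defensive.

Import GRing.Theory.

(** A translation is given only as a permutation of points that preserves blocks; nothing says in
    advance that it extends to the plane or is semilinear. All information comes from the known
    semilinear automorphisms: one that fixes the center, a further point and the image of that point
    commutes with the translation, because a translation is determined by one image off its center.
    Images are thereby confined to fixed points of explicit maps, which can be computed.

    The prescribed [t phi] has order 3. To find a translation commuting with it, one lets it act on
    a set of translations whose size is not 1 modulo 3, so that not only the identity is fixed. Such
    a set consists of the translations commuting with x^(2^(3o)), where [o] is the odd part of [e]:
    there are 2^o of them, and 2^o is 2 modulo 3. That field automorphism has 2-power order, so it
    commutes with an involution to begin with.

    In the plane only uniqueness of joins and a lower bound for the number of lines through a point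
    are proved; existence of joins and the block sizes follow by counting. *)

Module TranslationsOfUnitals.
(** The cyclic group generated by [t] is a [p]-group, so fixed points can be counted modulo [p].
    Stability under the inverse of [t] comes from the finite order. *)
Lemma card_fix_mod (X : finType) (t : {perm X}) p k (A : {set X}) : prime p -> (t ^+ (p ^ k) = 1)%g ->
  (forall x, x \in A -> t x \in A) -> #|A| = #|[set x in A | t x == x]| %[mod p].
Proof.
move=> pp tk tA.
have pg : (p.-group <[t]>)%g.
  apply/pgroupP => l lp; rewrite -orderE => lt.
  have : (l %| p ^ k)%N by apply: dvdn_trans lt _; rewrite order_dvdn tk.
  by rewrite Euclid_dvdX // => /andP[]; rewrite dvdn_prime2 // => /eqP ->; rewrite inE.
have acts : [acts <[t]>, on A | 'P]%g.
  rewrite cycle_subG; apply/astabsP => x /=; rewrite apermE.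
  apply/idP/idP => [|/tA//].
  have : (t ^+ (#[t]).-1)%g (t x) = x.
    by rewrite -permM -expgS prednK ?order_gt0 // expg_order perm1.
  move=> {2}<- h; elim: (#[t]%g).-1 => [|j IH]; first by rewrite expg0 perm1.
  by rewrite expgSr permM tA.
rewrite (pgroup_fix_mod pg acts); congr (_ %% _)%N; apply: eq_card => x.
rewrite in_setI in_set; congr (_ && _); apply/afixP/eqP => [/(_ t (cycle_id t)) //|tx a].
case/cycleP => i ->; rewrite /= apermE; elim: i => [|i IH]; first by rewrite expg0 perm1.
by rewrite expgSr permM IH.
Qed.

(** * Absolute points of a polarity: a variance count *)

Section PolarCount.
Variables (P : finType) (r : rel P) (s : nat).
Hypothesis s0 : (0 < s)%N.
Let n := (s ^ 2)%N.
(** Read [r x y] as: the point x lies on the polar line of y. Identifying lines with their poles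
    turns the plane into one symmetric relation. The bounds [rD], [rN] and [rA] are one-sided and
    turn out to be sharp. *)
Hypotheses (rC : symmetric r)
  (rU : forall x y z w, r x z -> r y z -> r x w -> r y w -> x = y \/ z = w)
  (rD : forall x, (n < #|[set y | r x y]|)%N) (rN : (#|P| <= n ^ 2 + n + 1)%N)
  (rA : (s ^ 3 < #|[set x | r x x]|)%N).
Let A := [set x | r x x].
Let deg x := #|[set y | r x y]|.

(** Counts paths x, y, z with z different from x: by [rU] such a z is reached through at most one y.
    The last summand collects the points that are not joined to x. *)
Lemma path_count x : (\sum_(y | r x y) (deg y).-1 + 1 + #|[set z | (z != x) && ~~ [exists y, r x y && r z y]]| = #|P|)%N.
Proof.
have Exy y z : z != x -> r x y -> r z y -> forall y', (r x y' && r z y') = (y' == y).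
  move=> zx xy zy y'; apply/andP/eqP => [[h1 h2]|->//].
  by case: (rU xy zy h1 h2) => // h; rewrite h eqxx in zx.
have -> : (\sum_(y | r x y) (deg y).-1 = \sum_(y | r x y) \sum_(z | r z y && (z != x)) 1)%N.
  apply: eq_bigr => y xy; rewrite sum1_card /deg.
  rewrite (cardsD1 x) inE rC xy /=; apply: eq_card => z; by rewrite !inE rC andbC.
have -> : (\sum_(y | r x y) \sum_(z | r z y && (z != x)) 1 = \sum_(z | z != x) \sum_(y | r x y && r z y) 1)%N.
  rewrite (exchange_big_dep (fun z => z != x)) //=; last by move=> y z _ /andP[].
  by apply: eq_bigr => z zx; apply: eq_bigl => y; rewrite zx andbT.
rewrite (bigID (fun z => [exists y, r x y && r z y])) /=.
rewrite [X in (_ + X + 1 + _)%N]big1 ?addn0; last first.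
  move=> z /andP[_ /existsPn h]; rewrite big_pred0 // => y; exact/negbTE.
rewrite (eq_bigr (fun=> 1%N)); last first.
  move=> z /andP[zx /existsP[y /andP[xy zy]]].
  by rewrite (eq_bigl (pred1 y)) ?big_pred1_eq //; apply: Exy.
rewrite sum1_card -(cardsT P) (cardsD1 x [set: P]) in_setT.
rewrite -(cardsID [set z | [exists y, r x y && r z y]] ([set: P] :\ x)) addnAC addnC.
congr (_ + (_ + _))%N; apply: eq_card => z; rewrite !inE ?andbT //.
by rewrite andbC.
Qed.

(** In [path_count] the lower bound for the degrees and the upper bound for the number of points
    leave no room, so both are attained and no point is left without a join. *)
Lemma deg_join : [/\ forall x, deg x = n.+1, #|P| = (n ^ 2 + n + 1)%N & forall x z, x != z -> exists y, r x y && r z y].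
Proof.
have key x : [/\ deg x = n.+1, forall y, r x y -> deg y = n.+1, #|P| = (n ^ 2 + n + 1)%N &
    forall z, z != x -> exists y, r x y && r z y].
  have pc := path_count x.
  have n0 : (0 < n)%N by rewrite expn_gt0 s0.
  have ge y : (n <= (deg y).-1)%N by have := rD y; rewrite -/(deg y); lia.
  have lb : (deg x * n <= \sum_(y | r x y) (deg y).-1)%N.
    rewrite /deg -sum_nat_const (eq_bigl (r x)) => [|y]; last by rewrite inE.
    by apply: leq_sum => y _; apply: ge.
  have dx := rD x; rewrite -/(deg x) in dx.
  have e1 : (n.+1 * n <= deg x * n)%N by rewrite leq_mul2r dx orbT.
  have e2 : (n.+1 * n = n ^ 2 + n)%N by rewrite mulSn addnC -mulnn.
  have dxE : deg x = n.+1.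
    apply/eqP; rewrite eqn_leq dx andbT -(leq_pmul2r n0); move: pc lb rN; rewrite e2; lia.
  split=> //.
  - move=> y xy; apply/eqP; rewrite eqn_leq (rD y) andbT leqNgt; apply/negP => dy.
    have : (deg x * n < \sum_(y | r x y) (deg y).-1)%N.
      rewrite (bigD1 y) //= {1}/deg -sum_nat_const (eq_bigl (r x)) => [|y']; last by rewrite inE.
      rewrite (bigD1 y) //= -addSn; apply: leq_add; first by move: dy; lia.
      by apply: leq_sum => y' _; apply: ge.
    by rewrite dxE e2; move: pc rN; lia.
  - by apply/eqP; rewrite eqn_leq rN; move: pc lb; rewrite dxE e2; lia.
  - move=> z zx; case: (boolP [exists y, r x y && r z y]) => [/existsP //|nz]; exfalso.
    have : (0 < #|[set z | (z != x) && ~~ [exists y, r x y && r z y]]|)%N.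
      by apply/card_gt0P; exists z; rewrite inE zx.
    by move: pc lb rN; rewrite dxE e2; lia.
have [x0 _] : exists x, x \in A by apply/card_gt0P; apply: leq_ltn_trans rA.
split=> [x||x z xz]; [by case: (key x)|by case: (key x0)|case: (key x) => _ _ _; apply].
by rewrite eq_sym.
Qed.

Let a x := #|[set y in A | r y x]|.

Lemma abs_tangent x y : r x x -> r y y -> r x y -> x = y.
Proof. by move=> xx yy xy; case: (@rU x y x y) => //; rewrite rC. Qed.

(** Double counting yields the sums of [a] and of its square over the nonabsolute points.
    Nonnegative variance gives (u - 1)^2 <= s^6, which meets [rA]; with this value of u the variance
    about [s + 1] vanishes, so [a] is constant there. *)
Lemma polar_count : #|A| = (s ^ 3).+1 /\ forall x, ~~ r x x -> a x = s.+1.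
Proof.
have [dE NE jE] := deg_join.
have aA x : r x x -> a x = 1%N.
  move=> xx; rewrite /a -(cards1 x); apply: eq_card => y; rewrite !inE.
  by apply/andP/eqP => [[yy yx]|->//]; apply: abs_tangent.
set u := #|A|.
have S1 : (\sum_x a x = u * n.+1)%N.
  rewrite -sum_nat_const /a.
  rewrite (eq_bigr (fun x => \sum_(y | (y \in A) && r y x) 1)%N) => [|x _]; last first.
    by rewrite sum1_card; apply: eq_card => y; rewrite inE.
  rewrite (exchange_big_dep (fun y => y \in A)) /=; last by move=> x y _ /andP[].
  by apply: eq_bigr => y yA; rewrite -(dE y) /deg -sum1_card; apply: eq_bigl => x; rewrite inE yA.
(* Ordered pairs of absolute points are counted with the polars that contain both: equal points lie
   on n + 1 polars, distinct ones on exactly one. *)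
have S2 : (\sum_x a x ^ 2 = u * n.+1 + u * (u - 1))%N.
  have -> : (\sum_x a x ^ 2 = \sum_x \sum_(y in A) \sum_(z in A) (r y x && r z x))%N.
    apply: eq_bigr => x _; rewrite -mulnn {1}/a -sum1_card big_distrl /=.
    rewrite (eq_bigl (fun y => (y \in A) && r y x)) => [|y]; last by rewrite inE.
    rewrite big_mkcondr /=; apply: eq_bigr => y _; case: ifP => _; last by rewrite big1.
    rewrite mul1n /a -sum1_card (eq_bigl (fun y => (y \in A) && r y x)) => [|z]; last by rewrite inE.
    by rewrite big_mkcondr; apply: eq_bigr => z _; case: ifP.
  rewrite exchange_big /=.
  have -> : (u * n.+1 + u * (u - 1) = \sum_(y in A) (n.+1 + (u - 1)))%N by rewrite sum_nat_const mulnDr.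
  apply: eq_bigr => y yA; rewrite exchange_big (bigD1 y) //=; congr (_ + _)%N.
    rewrite -(dE y) /deg -sum1_card big_mkcond [RHS]big_mkcond; apply: eq_bigr => x _.
    by rewrite inE andbb; case: (r y x).
  rewrite (eq_bigr (fun=> 1%N)) => [|z /andP[zA zy]].
    have -> : (u - 1 = #|A :\ y|)%N by rewrite /u (cardsD1 y A) yA addKn.
    by rewrite -sum1_card; apply: eq_bigl => z; rewrite !inE andbC.
  have [|w /andP[zw yw]] := jE z y; first by [].
  rewrite (bigD1 w) //= yw zw /= big1 // => x xw; apply/eqP; rewrite eqb0; apply/negP => /andP[h1 h2].
  by case: (rU zw yw h2 h1) => h; [rewrite h eqxx in zy|rewrite h eqxx in xw].
have NA : (\sum_(x | ~~ r x x) 1 = #|P| - u)%N.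
  rewrite sum1_card -cardsT -(cardsID A) setTI addKn.
  by apply: eq_card => x; rewrite !inE /= andbT.
have uP : (u <= #|P|)%N by apply: max_card.
have u0 : (0 < u)%N by apply: leq_ltn_trans rA.
have splitA (f : P -> nat) : (forall x, r x x -> f x = 1%N) -> (\sum_x f x = u + \sum_(x | ~~ r x x) f x)%N.
  move=> h; rewrite (bigID (fun x => r x x)) /=; congr (_ + _)%N.
  rewrite (eq_bigr (fun=> 1%N)) // sum1_card /u; by apply: eq_card => x; rewrite !inE.
have T1 : ((\sum_(x | ~~ r x x) a x)%N%:R = u%:R * n%:R :> int)%R.
  have := splitA a aA; rewrite S1 => T1.
  have := congr1 (fun k : nat => k%:R : int)%R T1; rewrite natrM natrD -natr1 => h.
  by apply: (addrI (u%:R)%R); rewrite -h; ring.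
have T2 : ((\sum_(x | ~~ r x x) a x ^ 2)%N%:R = u%:R * (n%:R + u%:R - 1) :> int)%R.
  have := splitA (fun x => a x ^ 2)%N; rewrite S2 => T2.
  have {}T2 : (u * n.+1 + u * (u - 1) = u + \sum_(x | ~~ r x x) a x ^ 2)%N by apply: T2 => x /aA ->.
  have {}T2 : (\sum_(x | ~~ r x x) a x ^ 2 = u * n + u * (u - 1))%N by move: T2; rewrite mulnS -addnA => /addnI.
  by rewrite T2 natrD !natrM natrB //; ring.
(* The deviation of [a] from [be / al], cleared of denominators. It is used with [al] the number of
   nonabsolute points and [be] the sum of [a] over them, then with 1 and s + 1. *)
pose d (al be : int) x : int := (al * (a x)%:R - be)%R.
have V al be : (\sum_(x | ~~ r x x) d al be x ^+ 2 = al ^+ 2 * (u%:R * (n%:R + u%:R - 1)) - 2 * al * be * (u%:R * n%:R)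
    + be ^+ 2 * (n%:R ^+ 2 + n%:R + 1 - u%:R))%R.
  have -> : (\sum_(x | ~~ r x x) d al be x ^+ 2 = al ^+ 2 * (\sum_(x | ~~ r x x) a x ^ 2)%N%:R
      - 2 * al * be * (\sum_(x | ~~ r x x) a x)%N%:R + be ^+ 2 * (\sum_(x | ~~ r x x) 1)%N%:R :> int)%R.
    rewrite !natr_sum !mulr_sumr -sumrB -big_split /=; apply: eq_bigr => x _.
    by rewrite /d natrX; ring.
  by rewrite T1 T2 NA natrB // NE !natrD natrX; ring.
have pos al be : (0 <= \sum_(x | ~~ r x x) d al be x ^+ 2 :> int)%R.
  by apply: Num.Theory.sumr_ge0 => x _; apply: Num.Theory.sqr_ge0.
have uE : u = (s ^ 3).+1.
  apply/eqP; rewrite eqn_leq rA andbT leqNgt; apply/negP => lt.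
  have uP' : (u < #|P|)%N.
    rewrite ltn_neqAle uP andbT; apply/eqP => uN.
    move: T1; rewrite (_ : \sum_(x | ~~ r x x) a x = 0)%N; last first.
      apply: big1 => x xx; exfalso; move: NA; rewrite uN subnn => /eqP.
      by rewrite sum_nat_eq0 => /forallP/(_ x); rewrite xx.
    by move/eqP; rewrite eq_sym mulf_eq0 !Num.Theory.pnatr_eq0 !eqn0Ngt u0 expn_gt0 s0.
  have ME : ((#|P| - u)%N%:R = n%:R ^+ 2 + n%:R + 1 - u%:R :> int)%R.
    by rewrite natrB // NE !natrD natrX.
  have := pos ((#|P| - u)%N%:R)%R (u%:R * n%:R)%R; rewrite V -ME.
  rewrite (_ : (_ + _)%R = ((#|P| - u)%N%:R * u%:R * (n%:R ^+ 3 - (u%:R - 1) ^+ 2))%R); last by rewrite ME; ring.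
  rewrite Num.Theory.pmulr_rge0; last first.
    by rewrite Num.Theory.mulr_gt0 // Num.Theory.ltr0n // subn_gt0.
  have -> : (u%:R - 1 = (u - 1)%N%:R :> int)%R by rewrite natrB.
  rewrite Num.Theory.subr_ge0 -!natrX Num.Theory.ler_nat /n -expnM mulnC expnM.
  by rewrite leq_exp2r // leq_subLR add1n => h; move: lt; rewrite ltnNge h.
split=> // x xx.
suff /eqP : (d 1 s.+1%:R x ^+ 2 = 0)%R.
  by rewrite sqrf_eq0 subr_eq0 mul1r Num.Theory.eqr_nat => /eqP.
have pz y : ~~ r y y -> (0 <= d 1 s.+1%:R y ^+ 2)%R by move=> _; exact: Num.Theory.sqr_ge0.
have sz : (\sum_(y | ~~ r y y) d 1 s.+1%:R y ^+ 2 = 0)%R; last by have := Num.Theory.psumr_eq0P pz sz; apply.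
by rewrite V uE /n -!natr1 !natrX; ring.
Qed.

End PolarCount.

(** * Translations of unitals whose order is a power of 2 *)

Section Unital.
Variables (T : finType) (B : {set {set T}}) (m k : nat).
Hypotheses (mE : m = (2 ^ k)%N) (k0 : (0 < k)%N) (cT : #|T| = (m ^ 3).+1)
  (cB : forall b, b \in B -> #|b| = m.+1)
  (jB : forall x y, x != y -> exists2 b, b \in B & (x \in b) && (y \in b))
  (uB : forall x y b b', x != y -> b \in B -> b' \in B ->
     x \in b -> y \in b -> x \in b' -> y \in b' -> b = b').
Implicit Types (x y c d : T) (b : {set T}) (s t : {perm T}).

Let m2 : (1 < m)%N. Proof. by rewrite mE -[1%N](expn0 2) ltn_exp2l. Qed.

Definition bl x y := odflt set0 [pick b in B | (x \in b) && (y \in b)].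

Lemma blP x y : x != y -> [/\ bl x y \in B, x \in bl x y & y \in bl x y].
Proof.
move=> xy; rewrite /bl; case: pickP => [b /and3P[]//|h].
by have [b bB xyb] := jB xy; have := h b; rewrite bB xyb.
Qed.

Lemma blU x y b : x != y -> b \in B -> x \in b -> y \in b -> bl x y = b.
Proof. by move=> xy bB xb yb; have [h1 h2 h3] := blP xy; apply: (uB xy). Qed.

Definition pencil x := [set b in B | x \in b].

Lemma card_pencil x : #|pencil x| = (m ^ 2)%N.
Proof.
have m0 : (0 < m)%N by apply: ltnW.
apply/eqP; rewrite -(eqn_pmul2r m0) -expnSr; apply/eqP.
have <- : #|[set~ x]| = (m ^ 3)%N by rewrite cardsC1 cT.
apply/esym; rewrite -[LHS]sum1_card (partition_big (bl x) (mem (pencil x))) => [|y]; last first.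
  by rewrite !inE eq_sym => /blP[-> ->].
rewrite -sum_nat_const; apply: eq_bigr => b /= bp.
have /andP[bB xb] : (b \in B) && (x \in b) by move: bp; rewrite inE.
rewrite sum1_card; have := cB bB; rewrite (cardsD1 x) xb add1n => -[<-].
apply: eq_card => y; rewrite in_setD1 unfold_in /= in_setC1.
have [->|yx] //= := eqVneq y x; have xy : x != y by rewrite eq_sym.
by apply/eqP/idP => [<-|yb]; [have [] := blP xy|apply: blU].
Qed.

Lemma autP s b : block_aut B s -> b \in B -> s @: b \in B.
Proof. by move/forallP/(_ b)/eqP ->. Qed.

Lemma imsetM s t b : (s * t)%g @: b = t @: (s @: b).
Proof. by rewrite -imset_comp; apply: eq_imset => x; rewrite permM. Qed.

Lemma imset_perm1 b : (1%g : {perm T}) @: b = b.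
Proof. by rewrite -[RHS]imset_id; apply: eq_imset => x; rewrite perm1. Qed.

Definition autg := [set s | block_aut B s].
Lemma autg_group : group_set autg.
Proof.
apply/group_setP; split=> [|s t]; rewrite !inE.
  by apply/forallP => b; rewrite imset_perm1.
by move=> /forallP hs /forallP ht; apply/forallP => b; rewrite imsetM (eqP (ht _)) hs.
Qed.
Canonical autG := Group autg_group.

Definition trans c := [set s | translation B c s].

Lemma transP c s : reflect [/\ block_aut B s, s c = c & forall b, b \in B -> c \in b -> s @: b = b] (s \in trans c).
Proof.
rewrite inE; apply: (iffP and3P) => [[h1 /eqP h2 /forallP h3]|[h1 h2 h3]]; split=> //.
- by move=> b bB cb; have := h3 b; rewrite bB cb => /eqP.
- exact/eqP.
- by apply/forallP => b; apply/implyP => bB; apply/implyP => cb; apply/eqP/h3.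
Qed.

Lemma trans_group c : group_set (trans c).
Proof.
apply/group_setP; split=> [|s t].
  apply/transP; split=> [||b _ _]; rewrite ?perm1 ?imset_perm1 //.
  by have := group1 autG; rewrite inE.
move=> /transP[s1 s2 s3] /transP[t1 t2 t3]; apply/transP; split.
- by have := @groupM _ autG s t; rewrite !inE; apply.
- by rewrite permM s2 t2.
- by move=> b bB cb; rewrite imsetM s3 ?t3.
Qed.
Canonical transG c := Group (trans_group c).

Lemma trans_aut c s : s \in trans c -> block_aut B s. Proof. by case/transP. Qed.
Lemma trans_c c s : s \in trans c -> s c = c. Proof. by case/transP. Qed.
Lemma trans_in c s b x : s \in trans c -> b \in B -> c \in b -> x \in b -> s x \in b.
Proof. by case/transP => _ _ h bB cb xb; rewrite -(h b bB cb); apply: imset_f. Qed.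

Lemma transJ a c s : block_aut B a -> s \in trans c -> (s ^ a)%g \in trans (a c).
Proof.
move=> aB /transP[s1 s2 s3]; have aB' : block_aut B a^-1%g.
  by have := @groupV _ autG a; rewrite !inE aB.
apply/transP; split.
- by have := @groupJ _ autG s a; rewrite !inE; apply.
- by rewrite permJ s2.
- move=> b bB cb; rewrite conjgE !imsetM s3; last 1 first.
  + by apply/imsetP; exists (a c); rewrite // permK.
  + by rewrite -imsetM mulVg imset_perm1.
  + exact: autP.
Qed.

Section Prime.
Variables (c : T) (s : {perm T}) (p : nat).
Hypotheses (pp : prime p) (sp : (s ^+ p = 1)%g) (tr : s \in trans c).
Variable x0 : T.
Hypothesis sx0 : s x0 != x0.
Let F := [set x | (x != c) && (s x == x)].

Lemma unfix_c x : s x != x -> x != c.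
Proof. by apply: contraNneq => ->; rewrite (trans_c tr). Qed.

(** The block [b] is invariant because two of its points are fixed, and the blocks through the
    center are invariant anyway; each point of [b] is the intersection of [b] with its join to the
    center. *)
Lemma fixblk b d d' x : b \in B -> c \notin b -> d != d' -> d \in b -> d' \in b -> s d = d -> s d' = d' ->
  x \in b -> s x = x.
Proof.
move=> bB cb dd db d'b sd sd' xb.
have sb : s @: b = b.
  apply: (uB dd) => //; first exact: autP (trans_aut tr) bB.
    by rewrite -sd; apply: imset_f.
  by rewrite -sd'; apply: imset_f.
have xc : c != x by apply: contraNneq cb => ->.
have [h1 h2 h3] := blP xc.
apply/eqP; apply: contraNT cb => sx.
have -> // : b = bl c x.
apply: (@uB x (s x)); rewrite // 1?eq_sym //; first by rewrite -sb; apply: imset_f.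
exact: trans_in tr _ _ _.
Qed.

(** By [fixblk], a block through the moved point [x] that misses the center carries at most one
    fixed point, and there are [m ^ 2 - 1] such blocks. *)
Lemma fix_ub x : s x != x -> (#|F :\: bl c x| <= m ^ 2 - 1)%N.
Proof.
move=> sx; have xc := unfix_c sx; rewrite eq_sym in xc; have [h1 h2 h3] := blP xc.
have -> : (m ^ 2 - 1 = #|pencil x :\ bl c x|)%N.
  by rewrite -(card_pencil x) (cardsD1 (bl c x)) inE h1 h3 addKn.
have xd d : d \in F -> x != d by rewrite inE => /andP[_ sd]; apply: contraNneq sx => ->.
have notc d : d \in F :\: bl c x -> c \notin bl x d.
  rewrite inE => /andP[db dF]; apply: contra db => cb.
  have [k1 k2 k3] := blP (xd _ dF).
  by rewrite (blU xc k1 cb k2).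
rewrite -(card_in_imset (f := bl x) (D := F :\: bl c x)).
  apply: subset_leq_card; apply/subsetP => b /imsetP[d dF ->].
  have [k1 k2 k3] := blP (xd d (subsetP (subsetDl _ _) _ dF)).
  rewrite in_setD1 inE k1 k2 !andbT; apply: contraTneq dF => e.
  by rewrite inE -e k3.
move=> d d' dF d'F e; apply/eqP; apply: contraNT sx => dd.
have dF' := subsetP (subsetDl _ _) _ dF; have d'F' := subsetP (subsetDl _ _) _ d'F.
have [k1 k2 k3] := blP (xd _ dF'); have [l1 l2 l3] := blP (xd _ d'F').
apply/eqP; apply: (@fixblk (bl x d) d d') => //; first exact: notc.
- by rewrite e.
- by move: dF'; rewrite inE => /andP[_ /eqP].
- by move: d'F'; rewrite inE => /andP[_ /eqP].
Qed.

(** A fixed point besides the center would produce so many pointwise fixed blocks that [fix_ub] is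
    violated. *)
Lemma prime2 d0 : p = 2%N -> d0 \in F -> False.
Proof.
move=> p2 d0F.
(* The blocks through [d] that miss the center number m^2 - 1, which is odd, so one is invariant. It
   is fixed pointwise, its points being intersections with blocks through the center. *)
have stepA d : d \in F -> exists2 b, b \in pencil d & c \notin b /\ forall x, x \in b -> s x = x.
  rewrite inE => /andP[dc /eqP sd]; have cd : c != d by rewrite eq_sym.
  have [h1 h2 h3] := blP cd.
  pose ts : {perm {set T}} := perm (imset_inj (@perm_inj _ s)).
  have tsE b : ts b = s @: b by rewrite permE.
  have ts2 : (ts ^+ (2 ^ 1) = 1)%g.
    apply/permP => b; rewrite perm1 permM !tsE -imsetM.
    by rewrite -[RHS]imset_perm1 -sp p2.
  have cfm := @card_fix_mod _ ts 2 1 (pencil d :\ bl c d) isT ts2.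
  have /cfm{cfm} : forall b, b \in pencil d :\ bl c d -> ts b \in pencil d :\ bl c d.
    move=> b; rewrite !inE tsE => /and3P[bb bB db].
    rewrite (autP (trans_aut tr) bB) -{2}sd imset_f // !andbT.
    apply: contraNneq bb => e; apply/eqP; apply: (imset_inj (@perm_inj _ s)); rewrite e.
    by case/transP: tr => _ _ ->.
  have -> : #|pencil d :\ bl c d| = (m ^ 2 - 1)%N.
    by rewrite -(card_pencil d) (cardsD1 (bl c d) (pencil d)) in_set h1 h3 addKn.
  have [->|[b bF]] := set_0Vmem [set x in pencil d :\ bl c d | ts x == x].
    rewrite cards0 mod0n => /eqP; rewrite modn2 oddB ?expn_gt0 ?(ltnW m2) //.
    by rewrite oddX mE oddX; case: (k) k0.
  move=> _; move: bF; rewrite in_set in_setD1 => /andP[/andP[bb bp] /eqP]; rewrite tsE => sb.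
  have := bp; rewrite inE => /andP[bB db].
  have cb : c \notin b by apply: contra bb => cb; rewrite (blU cd bB).
  exists b => //; split=> // x xb.
  have [->//|xd] := eqVneq x d.
  have xc : c != x by apply: contraNneq cb => ->.
  have [k1 k2 k3] := blP xc; apply/eqP; apply: contraNT cb => sx.
  have -> // : b = bl c x.
  apply: (@uB x (s x)); rewrite // 1?eq_sym //; first by rewrite -{1}sb; apply: imset_f.
  exact: trans_in tr _ _ _.
(* A block through the center has m further points, an even number, so the fixed ones among them are
   even in number. *)
have stepB d : d \in F -> exists d', [/\ d' \in F, d' != d & d' \in bl c d].
  rewrite inE => /andP[dc sd]; have cd : c != d by rewrite eq_sym.
  have [h1 h2 h3] := blP cd.
  have cfm := @card_fix_mod _ s 2 1 (bl c d :\ c) isT; rewrite expn1 -p2 in cfm.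
  have := cfm sp; rewrite p2.
  have st : forall x, x \in bl c d :\ c -> s x \in bl c d :\ c.
    move=> x; rewrite !inE => /andP[xc xb]; rewrite (trans_in tr) // andbT.
    by rewrite -{1}(trans_c tr) (inj_eq (@perm_inj _ s)).
  move/(_ st); have := cB h1; rewrite (cardsD1 c) h2 add1n => -[->].
  have -> : (m %% 2 = 0)%N by rewrite modn2 mE oddX; case: (k) k0.
  set S := [set x in _ | _]; have dS : d \in S by rewrite !inE dc h3.
  have [e|[d' d'S]] := set_0Vmem (S :\ d).
    by rewrite (cardsD1 d) dS e cards0.
  by move=> _; exists d'; move: d'S; rewrite !inE => /andP[-> /andP[/andP[-> ->] ->]].
(* Joining [d'] to the m points of [b] other than [d] gives m pointwise fixed blocks, each with m
   points besides [d'], all of them off [bl c d]. *)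
have stepC d : d \in F -> (m ^ 2 <= #|F :\: bl c d|)%N.
  move=> dF; have [b bp [cb fb]] := stepA d dF; have [d' [d'F d'd d'b]] := stepB d dF.
  move: bp; rewrite inE => /andP[bB db].
  have := dF; rewrite inE => /andP[dc /eqP sd]; have cd : c != d by rewrite eq_sym.
  have := d'F; rewrite inE => /andP[d'c /eqP sd']; have cd' : c != d' by rewrite eq_sym.
  have [h1 h2 h3] := blP cd.
  have d'nb : d' \notin b.
    apply: contra cb => d'b'; suff -> : b = bl c d by [].
    exact: (@uB d' d).
  have yd y : y \in b -> d' != y by move=> yb; apply: contraNneq d'nb => ->.
  have ncb y : y \in b -> y != d -> c \notin bl d' y.
    move=> yb yd'; have [k1 k2 k3] := blP (yd _ yb); apply: contra cb => cby.
    have e1 : bl d' y = bl c d by apply: (@uB d' c); rewrite // eq_sym.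
    suff -> : b = bl c d by [].
    by apply: (@uB y d); rewrite // -e1.
  pose img := [set bl d' y | y in b :\ d].
  have cimg : #|img| = m.
    rewrite card_in_imset; first by have := cB bB; rewrite (cardsD1 d) db add1n => -[].
    move=> y y'; rewrite !inE => /andP[yd1 yb] /andP[yd2 y'b] e; apply/eqP; apply: contraNT d'nb => yy.
    have [k1 k2 k3] := blP (yd _ yb); have [l1 l2 l3] := blP (yd _ y'b).
    have -> // : b = bl d' y by apply: (@uB y y') => //; rewrite e.
  rewrite -sum1_card (bigID (fun x => bl d' x \in img)) /=.
  apply: leq_trans (leq_addr _ _).
  rewrite (partition_big (bl d') (mem img)) => [|x /andP[]//].
  rewrite -mulnn -{1}cimg -sum_nat_const; apply: leq_sum => be /imsetP[y]; rewrite in_setD1 => /andP[yd1 yb] ->.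
  have [k1 k2 k3] := blP (yd _ yb).
  have := cB k1; rewrite (cardsD1 d') k2 add1n => -[<-]; rewrite sum1_card; apply: subset_leq_card.
  apply/subsetP => x; rewrite in_setD1 => /andP[xd xb].
  have xd' : d' != x by rewrite eq_sym.
  have e : bl d' x = bl d' y by apply: blU.
  rewrite unfold_in /= e eqxx andbT imset_f ?andbT; last by rewrite in_setD1 yd1.
  rewrite !inE; apply/and3P; split.
  - apply: contra (ncb y yb yd1) => xcd.
    by have -> // : bl d' y = bl c d by apply: (@uB x d').
  - by apply: contraNneq (ncb y yb yd1) => <-.
  - by apply/eqP; apply: (@fixblk (bl d' y) d' y) => //; [apply: ncb|apply: yd|apply: fb].
have m1 N : (N <= m ^ 2 - 1)%N -> (m ^ 2 <= N)%N -> False.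
  by move=> h1 h2; have := leq_trans h2 h1; rewrite leqNgt subn1 prednK ?leqnn // expn_gt0 (ltnW m2).
have ux := fix_ub sx0; have x0c := unfix_c sx0; rewrite eq_sym in x0c; have [h1 h2 h3] := blP x0c.
have [e|[d]] := set_0Vmem (F :&: bl c x0).
  have : (m ^ 2 <= #|F :\: bl c x0|)%N.
    apply: leq_trans (stepC d0 d0F) _; apply: subset_leq_card; apply/subsetP => x; rewrite !(in_setD) => /andP[_ xF].
    rewrite xF andbT; apply/negP => xb; have : x \in F :&: bl c x0 by rewrite in_setI xF.
    by rewrite e inE.
  exact: m1.
rewrite in_setI => /andP[dF db]; have := stepC d dF.
have cd : c != d by move: dF; rewrite inE eq_sym => /andP[].
by rewrite (blU cd h1 h2 db); apply: m1.
Qed.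

(** An odd prime does not divide the number m of points other than [c] on a block through [c], so
    every such block carries a further fixed point. There is in fact exactly one on each, and this
    structure of m^2 fixed points is ruled out by divisibility. *)
Lemma prime_odd : p != 2%N -> False.
Proof.
move=> p2.
have cblk b : b \in pencil c -> exists2 d, d \in F & d \in b.
  rewrite inE => /andP[bB cb].
  have cfm := @card_fix_mod _ s p 1 (b :\ c) pp; rewrite expn1 in cfm.
  have st : forall x, x \in b :\ c -> s x \in b :\ c.
    move=> x; rewrite !inE => /andP[xc xb]; rewrite (trans_in tr) // andbT.
    by rewrite -{1}(trans_c tr) (inj_eq (@perm_inj _ s)).
  have := cfm sp st; have := cB bB; rewrite (cardsD1 c) cb add1n => -[->].
  have [->|[d]] := set_0Vmem [set x in b :\ c | s x == x].
    rewrite cards0 mod0n => /eqP; rewrite -/(dvdn p m) mE Euclid_dvdX // => /andP[].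
    by rewrite dvdn_prime2 // (negbTE p2).
  by rewrite !inE => /andP[/andP[dc db] sd] _; exists d; rewrite // inE dc.
(* Every block through [c] contributes a fixed point; a second one on a block other than [bl c x]
   would give m^2 of them off [bl c x], against [fix_ub]. *)
have star x d d' : s x != x -> d \in F -> d' \in F -> bl c d = bl c d' -> bl c d != bl c x -> d = d'.
  move=> sx dF d'F e ne; apply/eqP; apply: contraT => dd; exfalso.
  have xc := unfix_c sx; rewrite eq_sym in xc; have [h1 h2 h3] := blP xc.
  have dc : c != d by move: dF; rewrite inE eq_sym => /andP[].
  have d'c : c != d' by move: d'F; rewrite inE eq_sym => /andP[].
  have [k1 k2 k3] := blP dc; have [l1 l2 l3] := blP d'c.
  have notin y : y \in F -> bl c y != bl c x -> y \in F :\: bl c x.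
    move=> yF ny; rewrite in_setD yF andbT; apply: contra ny => yb.
    by apply/eqP; apply: blU => //; move: yF; rewrite inE eq_sym => /andP[].
  have d'D : d' \in F :\: bl c x by apply: notin; rewrite -?e.
  have := fix_ub sx; rewrite (cardsD1 d') d'D add1n ltnNge => /negP; apply.
  have -> : (m ^ 2 - 1 = #|pencil c :\ bl c x|)%N.
    by rewrite -(card_pencil c) (cardsD1 (bl c x)) inE h1 h2 addKn.
  apply: leq_trans (leq_imset_card (bl c) _); apply: subset_leq_card; apply/subsetP => b.
  rewrite in_setD1 => /andP[bx bp].
  have [y yF yb] := cblk b bp; have := bp; rewrite inE => /andP[bB cb].
  have yc : c != y by move: yF; rewrite inE eq_sym => /andP[].
  have bE : bl c y = b by apply: blU.
  have [yd|yd] := eqVneq y d'; last first.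
    by apply/imsetP; exists y => //; rewrite in_setD1 yd notin // bE.
  by apply/imsetP; exists d; rewrite -?bE ?yd // in_setD1 dd notin.
have m1 : (1 < m ^ 2)%N by rewrite (leq_trans m2) // -mulnn leq_pmull // ltnW.
(* If both points lie on the block of [x0], another block through [c] provides a moved point [x1]
   that replaces [x0]; two fixed points on that block are excluded by [star] for [x0]. *)
have inj d d' : d \in F -> d' \in F -> bl c d = bl c d' -> d = d'.
  move=> dF d'F e; have [ex|/(star x0 d d' sx0 dF d'F e)//] := eqVneq (bl c d) (bl c x0).
  have [b] : exists b, b \in pencil c :\ bl c x0.
    apply/card_gt0P; rewrite -(ltn_add2l (bl c x0 \in pencil c)) addn0 -cardsD1 card_pencil.
    exact: leq_ltn_trans (leq_b1 _) m1.
  rewrite in_setD1 => /andP[bx bp]; have := bp; rewrite inE => /andP[bB cb].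
  suff [x1 x1b sx1] : exists2 x1, x1 \in b & s x1 != x1.
    apply: (star x1) => //; have x1c := unfix_c sx1; rewrite eq_sym in x1c.
    by rewrite ex (blU x1c bB cb x1b) eq_sym.
  have : (1 < #|b :\ c|)%N by have := cB bB; rewrite (cardsD1 c) cb add1n => -[->].
  case/card_gt1P => y [z [yb zb yz]]; move: yb zb; rewrite !in_setD1 => /andP[yc yb] /andP[zc zb].
  have [sy|] := eqVneq (s y) y; last by exists y.
  have [sz|] := eqVneq (s z) z; last by exists z.
  have yF : y \in F by rewrite inE yc sy eqxx.
  have zF : z \in F by rewrite inE zc sz eqxx.
  have ey : bl c y = b by apply: blU; rewrite // eq_sym.
  have ez : bl c z = b by apply: blU; rewrite // eq_sym.
  by case/eqP: yz; apply: (star x0); rewrite // ?ey ?ez.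
have cF : #|F| = (m ^ 2)%N.
  rewrite -(card_pencil c) -(card_in_imset inj); apply: eq_card => b; apply/imsetP/idP => [[d dF ->]|bp].
    have dc : c != d by move: dF; rewrite inE eq_sym => /andP[].
    by rewrite inE; have [-> -> _] := blP dc.
  have [d dF db] := cblk b bp; exists d => //; move: bp; rewrite inE => /andP[bB cb].
  by rewrite (blU _ bB) //; move: dF; rewrite inE eq_sym => /andP[].
have [d dF] : exists d, d \in F by apply/card_gt0P; rewrite cF ltnW.
(* A block through [d] with a second point of [F] misses [c], so its m points besides [d] are all
   fixed. Thus m divides m^2 - 1, which is absurd. *)
suff : (m %| #|F :\ d|)%N.
  have := cF; rewrite (cardsD1 d) dF -mulnn => e dv.
  have : (m %| 1 + #|F :\ d|)%N by rewrite e dvdn_mulr.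
  by rewrite dvdn_addl // dvdn1; case: (m) m2 => [|[]].
rewrite -sum1_card (partition_big (bl d) predT) //=; apply: dvdn_sum => be _.
rewrite sum1_card.
have [e|[x]] := set_0Vmem [set i in F :\ d | bl d i == be].
  by rewrite -cardsE e cards0.
rewrite in_set in_setD1 => /andP[/andP[xd xF] /eqP eb].
have dx : d != x by rewrite eq_sym.
have [k1 k2 k3] := blP dx; rewrite eb in k1 k2 k3.
have dc : c != d by move: dF; rewrite inE eq_sym => /andP[].
have xc : c != x by move: xF; rewrite inE eq_sym => /andP[].
have cbe : c \notin be.
  by apply: contra xd => cb; apply/eqP; apply: inj => //; rewrite (blU dc k1 cb k2) (blU xc k1 cb k3).
have -> : #|[pred i in F :\ d | bl d i == be]| = m; last by [].
have := cB k1; rewrite (cardsD1 d) k2 add1n => -[<-]; apply: eq_card => y.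
rewrite unfold_in /= !in_setD1 -andbA; have [->|yd] //= := eqVneq y d.
have dy : d != y by rewrite eq_sym.
apply/andP/idP => [[yF /eqP <-]|yb]; first by have [] := blP dy.
rewrite (blU dy k1 k2 yb) eqxx inE; split=> //; apply/andP; split.
  by apply: contraNneq cbe => <-.
apply/eqP; apply: (@fixblk be d x) => //.
  by move: dF; rewrite inE => /andP[_ /eqP].
by move: xF; rewrite inE => /andP[_ /eqP].
Qed.

End Prime.

Lemma prime_power s : (s != 1)%g -> exists p i, [/\ prime p, (s ^+ i != 1)%g & #[s ^+ i]%g = p].
Proof.
move=> s1; have o1 : (1 < #[s]%g)%N by rewrite ltn_neqAle eq_sym order_eq1 s1 order_gt0.
pose p := pdiv #[s]%g; have pp : prime p by apply: pdiv_prime.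
exists p, (#[s]%g %/ p)%N; have o : #[s ^+ (#[s] %/ p)]%g = p.
  have pd : (p %| #[s]%g)%N := pdiv_dvd _.
  rewrite orderXdiv ?dvdn_div //; rewrite -{1}(divnK pd) mulKn // divn_gt0 ?prime_gt0 // dvdn_leq //.
by split=> //; rewrite -order_eq1 o; case: (p) pp => [|[]].
Qed.

(** A point fixed by [s] is fixed by its powers, so it suffices to treat a power of prime order. *)
Lemma trans_fix c s x : s \in trans c -> (s != 1)%g -> s x = x -> x = c.
Proof.
move=> tr s1 sx; have [p [i [pp u1 oi]]] := prime_power s1.
have ut : (s ^+ i)%g \in trans c by apply: (@groupX _ (transG c)).
have ux : (s ^+ i)%g x = x by elim: i {u1 oi ut} => [|i IH]; rewrite ?perm1 // expgSr permM IH.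
have up : ((s ^+ i) ^+ p = 1)%g by rewrite -oi expg_order.
have [y uy] : exists y, (s ^+ i)%g y != y.
  apply/existsP; apply: contraNT u1 => /existsPn h; apply/eqP/permP => y.
  by rewrite perm1; apply/eqP; have := h y; rewrite negbK.
apply/eqP; apply: contraT => xc; exfalso.
have [p2|p2] := eqVneq p 2%N; last exact: (prime_odd pp up ut uy p2).
by apply: (prime2 up ut uy (d0 := x) p2); rewrite inE xc ux eqxx.
Qed.

Lemma trans_eq c s t x : s \in trans c -> t \in trans c -> x != c -> s x = t x -> s = t.
Proof.
move=> st tt xc e; apply/eqP; rewrite eq_mulgV1; apply: contraNT xc => h.
apply/eqP; apply: (@trans_fix c (s * t^-1)%g) => //.
  by apply: (@groupM _ (transG c)) => //; apply: (@groupVr _ (transG c)).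
by rewrite permM e permK.
Qed.

(** A power of prime order [p] has no fixed point among the [m] points other than the center on a
    block through it; hence [p] divides a power of 2. *)
Lemma trans_order2 c s : s \in trans c -> (s != 1)%g -> exists i, #[s ^+ i]%g = 2.
Proof.
move=> tr s1; have [p [i [pp u1 oi]]] := prime_power s1.
have ut : (s ^+ i)%g \in trans c by apply: (@groupX _ (transG c)).
have up : ((s ^+ i) ^+ (p ^ 1) = 1)%g by rewrite expn1 -oi expg_order.
exists i; rewrite oi.
have [x xc] : exists x, c != x.
  have : (0 < #|[set~ c]|)%N by rewrite cardsC1 cT expn_gt0 (ltnW m2).
  by case/card_gt0P => x; rewrite !inE eq_sym; exists x.
have [h1 h2 h3] := blP xc.
have st : forall y, y \in bl c x :\ c -> (s ^+ i)%g y \in bl c x :\ c.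
  move=> y; rewrite !inE => /andP[yc yb]; rewrite (trans_in ut) // andbT.
  by rewrite -{1}(trans_c ut) (inj_eq (@perm_inj _ _)).
have := card_fix_mod pp up st; have := cB h1; rewrite (cardsD1 c) h2 add1n => -[->].
rewrite (_ : [set y in _ | _] = set0) ?cards0 ?mod0n; last first.
  apply/setP => y; rewrite in_set0 in_set in_setD1; apply/negP => /andP[/andP[yc _] /eqP uy].
  by case/eqP: yc; apply: trans_fix ut u1 uy.
by move/eqP; rewrite -/(dvdn p m) mE Euclid_dvdX // dvdn_prime2 // => /andP[/eqP].
Qed.

Lemma trans_Omega2 c s : s \in trans c -> (s != 1)%g -> c \in Omega2 B.
Proof.
move=> tr s1; have [i oi] := trans_order2 tr s1; rewrite inE; apply/existsP; exists (s ^+ i)%g.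
by rewrite /involutory_translation oi eqxx andbT; have := @groupX _ (transG c) s i tr; rewrite inE.
Qed.

Lemma Omega2P c : reflect (exists2 s, s \in trans c & #[s]%g = 2) (c \in Omega2 B).
Proof.
rewrite inE; apply: (iffP existsP) => [[s /andP[h /eqP o]]|[s h o]]; exists s; rewrite ?inE //.
by rewrite /involutory_translation o eqxx andbT; move: h; rewrite inE.
Qed.

Lemma Omega2J a c : block_aut B a -> c \in Omega2 B -> a c \in Omega2 B.
Proof.
move=> aB /Omega2P[s st o]; apply/Omega2P; exists (s ^ a)%g; first exact: transJ.
by rewrite orderJ.
Qed.

(** Both [s] and its conjugate are translations with center [c] and agree at [x], so they coincide.
    This is the main tool for extracting coordinates from an abstract translation. *)
Lemma trans_comm a c s x : block_aut B a -> s \in trans c -> a c = c -> x != c -> a x = x -> a (s x) = s x ->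
  (s ^ a = s)%g.
Proof.
move=> aB st ac xc ax asx; apply: (trans_eq _ st xc); first by rewrite -{1}ac; apply: transJ.
by rewrite -{1}ax permJ asx.
Qed.

End Unital.

End TranslationsOfUnitals.
Import TranslationsOfUnitals.

(** * Frobenius powers in characteristic 2 and cyclicity of the group of units *)

Module FrobeniusPowers.
Local Open Scope ring_scope.

Section FrobPower.
Variables (K : fieldType) (ch : 2 \in [pchar K]).

(** The proof of characteristic 2 is an argument of the map so that its ring morphism structure can
    be inferred from the term. With q = 2^e, the indices e, 2e, 3e give the powers q, q^2, q^3. *)
Definition fr_of (_ : 2 \in [pchar K]) (i : nat) (x : K) : K := x ^+ (2 ^ i).

Lemma pnat_2X i : [pchar K].-nat (2 ^ i)%N.
Proof. by rewrite pnatX (eq_pnat _ (pcharf_eq ch)) pnat_id. Qed.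

Lemma fr_zmod i : zmod_morphism (fr_of ch i).
Proof.
move=> x y; rewrite /fr_of exprDn_pchar ?pnat_2X // exprNn.
by rewrite -signr_odd oddX; case: i => [|i]; rewrite ?expr1 ?expr0 ?mulN1r //= mul1r oppr_pchar2.
Qed.

Lemma fr_monoid i : monoid_morphism (fr_of ch i).
Proof. by split=> [|x y]; rewrite /fr_of ?expr1n // exprMn. Qed.

HB.instance Definition _ i := GRing.isZmodMorphism.Build K K (fr_of ch i) (fr_zmod i).
HB.instance Definition _ i := GRing.isMonoidMorphism.Build K K (fr_of ch i) (fr_monoid i).

Lemma frC i j x : fr_of ch i (fr_of ch j x) = fr_of ch j (fr_of ch i x).
Proof. by rewrite /fr_of -!exprM mulnC. Qed.

Lemma frD i j x : fr_of ch i (fr_of ch j x) = fr_of ch (i + j) x.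
Proof. by rewrite /fr_of -exprM expnD mulnC. Qed.

Lemma frM i x y : fr_of ch i (x * y) = fr_of ch i x * fr_of ch i y.
Proof. exact: exprMn. Qed.
Lemma frA i x y : fr_of ch i (x + y) = fr_of ch i x + fr_of ch i y.
Proof. exact: (rmorphD (fr_of ch i)). Qed.
Lemma frN i x : fr_of ch i (- x) = - fr_of ch i x.
Proof. exact: (rmorphN (fr_of ch i)). Qed.
Lemma frB i x y : fr_of ch i (x - y) = fr_of ch i x - fr_of ch i y.
Proof. exact: (rmorphB (fr_of ch i)). Qed.
Lemma frV i x : fr_of ch i x^-1 = (fr_of ch i x)^-1.
Proof. exact: exprVn. Qed.
Lemma fr0 i : fr_of ch i 0 = 0.
Proof. exact: (rmorph0 (fr_of ch i)). Qed.
Lemma fr1 i : fr_of ch i 1 = 1.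
Proof. exact: expr1n. Qed.
Lemma frX i x n : fr_of ch i (x ^+ n) = fr_of ch i x ^+ n.
Proof. exact: exprAC. Qed.
Lemma fr_eq0 i x : (fr_of ch i x == 0) = (x == 0).
Proof. exact: (fmorph_eq0 (fr_of ch i)). Qed.
Lemma fr_inj i : injective (fr_of ch i).
Proof. exact: (fmorph_inj (fr_of ch i)). Qed.
Lemma adddK (x : K) : x + x = 0.
Proof. by rewrite addrr_pchar2. Qed.
Lemma addr_eq0C (x y : K) : (x + y == 0) = (x == y).
Proof. by rewrite addr_eq0 oppr_pchar2. Qed.

End FrobPower.

Section FiniteField.
Variable K : finFieldType.

Lemma finField_prim_root : exists w : K, (#|K|.-1).-primitive_root w.
Proof.
have K1 : (1 < #|K|)%N by apply: finNzRing_gt1.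
pose rs := [seq x <- enum K | x != 0].
have szrs : size rs = #|K|.-1.
  rewrite -(cardC1 (0 : K)) cardE /rs enumT; congr size.
have /hasP[w _ pw] : has (#|K|.-1).-primitive_root rs.
  apply: has_prim_root; rewrite ?szrs //; first by lia.
    apply/allP => x; rewrite mem_filter => /andP[x0 _].
    apply/unity_rootP; apply: (mulfI x0); rewrite mulr1 -exprS prednK ?expf_card //; lia.
  by rewrite filter_uniq // enum_uniq.
by exists w.
Qed.

Lemma expf_root m m' (x : K) : (m * m' = #|K|.-1)%N -> x ^+ m = 1 -> exists y, x = y ^+ m'.
Proof.
move=> mm x1; have [w pw] := finField_prim_root.
have m0 : (0 < m)%N.
  by have := prim_order_gt0 pw; rewrite -mm; case: (m).
have : x ^+ (#|K|.-1) = 1 by rewrite -mm exprM x1 expr1n.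
case/(prim_rootP pw) => -[i _] /= xE.
have : (#|K|.-1 %| i * m)%N.
  by rewrite (prim_order_dvd pw) exprM -xE x1.
rewrite -mm mulnC dvdn_pmul2r // => /dvdnP[j ij].
by exists (w ^+ j); rewrite xE ij exprM.
Qed.

Lemma card_expf_eq1 m : (m %| #|K|.-1)%N -> #|[set x : K | x ^+ m == 1]| = m.
Proof.
move=> md; have [w pw] := finField_prim_root.
have pz := dvdn_prim_root pw md; set z := w ^+ _ in pz.
have -> : [set x : K | x ^+ m == 1] = [set z ^+ (i : 'I_m) | i : 'I_m].
  apply/setP => x; rewrite inE; apply/eqP/imsetP => [/(prim_rootP pz)[i ->]|[i _ ->]].
    by exists i.
  by rewrite exprAC (prim_expr_order pz) expr1n.
rewrite card_imset ?card_ord // => i j /eqP.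
by rewrite (eq_prim_root_expr pz) !modn_small // => /eqP/val_inj.
Qed.

End FiniteField.

Lemma dvdn_pred_exp2 j n : (j %| n)%N -> ((2 ^ j).-1 %| (2 ^ n).-1)%N.
Proof.
case/dvdnP => k ->; rewrite mulnC expnM -!subn1.
have -> : ((2 ^ j) ^ k - 1 = (2 ^ j) ^ k - 1 ^ k)%N by rewrite exp1n.
by rewrite subn_exp dvdn_mulr.
Qed.

End FrobeniusPowers.
Import FrobeniusPowers.

(** * Vectors in dimension 3 *)

Module Vectors.
Local Open Scope ring_scope.

Section Vec3.
Variable F : fieldType.
(** Nested pairs rather than matrices, so that [ring] settles identities between coordinates. The
    same type serves for points and for normal vectors of lines. *)
Definition vec := (F * F * F)%type.
Implicit Types a b c v w n : vec.

Definition dot v w : F := v.1.1 * w.1.1 + v.1.2 * w.1.2 + v.2 * w.2.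
Definition cross v w : vec :=
  (v.1.2 * w.2 - v.2 * w.1.2, v.2 * w.1.1 - v.1.1 * w.2, v.1.1 * w.1.2 - v.1.2 * w.1.1).
Definition det3 a b c : F := dot a (cross b c).
Definition vscale (k : F) v : vec := (k * v.1.1, k * v.1.2, k * v.2).
Definition vadd v w : vec := (v.1.1 + w.1.1, v.1.2 + w.1.2, v.2 + w.2).
Definition vmap (f : F -> F) v : vec := (f v.1.1, f v.1.2, f v.2).
Definition v0 : vec := (0, 0, 0).

Lemma vecP v w : v.1.1 = w.1.1 -> v.1.2 = w.1.2 -> v.2 = w.2 -> v = w.
Proof. by case: v w => [[? ?] ?] [[? ?] ?] /= -> -> ->. Qed.

Lemma vec_neq0 v : v != v0 -> [\/ v.1.1 != 0, v.1.2 != 0 | v.2 != 0].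
Proof.
case: v => [[x y] z] /=; have [->|x0] := eqVneq x 0; last by constructor 1.
have [->|y0] := eqVneq y 0; last by constructor 2.
have [->|z0] := eqVneq z 0; last by constructor 3.
by rewrite eqxx.
Qed.

Lemma dotC v w : dot v w = dot w v. Proof. rewrite /dot; ring. Qed.
Lemma dotDl v w n : dot (vadd v w) n = dot v n + dot w n. Proof. rewrite /dot /=; ring. Qed.
Lemma dotZl k v n : dot (vscale k v) n = k * dot v n. Proof. rewrite /dot /=; ring. Qed.
Lemma dotZr k v n : dot v (vscale k n) = k * dot v n. Proof. rewrite /dot /=; ring. Qed.
Lemma dot_crossl v w : dot v (cross v w) = 0. Proof. rewrite /dot /cross /=; ring. Qed.
Lemma dot_crossr v w : dot w (cross v w) = 0. Proof. rewrite /dot /cross /=; ring. Qed.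
Lemma det3_rot a b c : det3 a b c = det3 b c a.
Proof. rewrite /det3 /dot /cross /=; ring. Qed.

Lemma binet a b v w : dot (cross a b) (cross v w) = dot a v * dot b w - dot a w * dot b v.
Proof. rewrite /dot /cross /=; ring. Qed.

Lemma vmap_dot (f : {rmorphism F -> F}) v w : f (dot v w) = dot (vmap f v) (vmap f w).
Proof. by rewrite /dot !rmorphD !rmorphM. Qed.
Lemma vmap_cross (f : {rmorphism F -> F}) v w : vmap f (cross v w) = cross (vmap f v) (vmap f w).
Proof. by apply: vecP; rewrite /= rmorphB !rmorphM. Qed.
Lemma vmap_det3 (f : {rmorphism F -> F}) a b c :
  f (det3 a b c) = det3 (vmap f a) (vmap f b) (vmap f c).
Proof. by rewrite /det3 vmap_dot vmap_cross. Qed.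
Lemma vmapZ (f : {rmorphism F -> F}) k v : vmap f (vscale k v) = vscale (f k) (vmap f v).
Proof. by apply: vecP; rewrite /= rmorphM. Qed.
Lemma vmap_eq0 (f : {rmorphism F -> F}) v : (vmap f v == v0) = (v == v0).
Proof. by case: v => [[x y] z]; rewrite !xpair_eqE !fmorph_eq0. Qed.
Lemma vscale_eq0 k v : k != 0 -> (vscale k v == v0) = (v == v0).
Proof. by move=> k0; case: v => [[x y] z]; rewrite !xpair_eqE /= !mulf_eq0 !(negbTE k0). Qed.
Lemma vscaleA k l v : vscale k (vscale l v) = vscale (k * l) v.
Proof. by apply: vecP; rewrite /= mulrA. Qed.
Lemma vscale1 v : vscale 1 v = v. Proof. by apply: vecP; rewrite /= mul1r. Qed.

Lemma cross_par v w : v != v0 -> cross v w = v0 -> exists k, w = vscale k v.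
Proof.
move=> vn; case: v w vn => [[x y] z] [[x' y'] z'] vn /= [] h1 h2 h3.
have aux (s t m : F) : m != 0 -> s * t = m * (s / m * t) by move=> m0; field.
case: (vec_neq0 vn) => /= n0.
- exists (x' / x); apply: vecP; rewrite /=; apply: (mulfI n0); rewrite -aux //; first by ring.
  + by rewrite (subr0_eq h3); ring.
  + by rewrite -(subr0_eq h2); ring.
- exists (y' / y); apply: vecP; rewrite /=; apply: (mulfI n0); rewrite -aux //; last 2 first.
  + by ring.
  + by rewrite (subr0_eq h1); ring.
  + by rewrite -(subr0_eq h3); ring.
- exists (z' / z); apply: vecP; rewrite /=; apply: (mulfI n0); rewrite -aux //; last by ring.
  + by rewrite (subr0_eq h2); ring.
  + by rewrite -(subr0_eq h1); ring.
Qed.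

Lemma cross_scale k v w : cross (vscale k v) w = vscale k (cross v w).
Proof. by apply: vecP; rewrite /=; ring. Qed.
Lemma cross_scaler k v w : cross v (vscale k w) = vscale k (cross v w).
Proof. by apply: vecP; rewrite /=; ring. Qed.
Lemma crossvv v : cross v v = v0.
Proof. by apply: vecP; rewrite /=; ring. Qed.

Lemma perp_cross v w n : cross v w != v0 -> dot v n = 0 -> dot w n = 0 ->
  exists k, n = vscale k (cross v w).
Proof.
move=> c0 vn wn; apply: cross_par => //.
have -> : cross (cross v w) n = vadd (vscale (dot v n) w) (vscale (- dot w n) v).
  by apply: vecP; rewrite /dot /=; ring.
by rewrite vn wn; apply: vecP; rewrite /=; ring.
Qed.

Lemma span_cross v w x : cross v w != v0 -> dot x (cross v w) = 0 ->
  exists k l, x = vadd (vscale k v) (vscale l w).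
Proof.
move=> c0 xc.
suff [t t0] : exists t, det3 t v w != 0.
  exists (det3 x w t / det3 t v w), (det3 x t v / det3 t v w).
  have := xc; rewrite -/(det3 x v w) => x0.
  have : vscale (det3 t v w) x = vadd (vscale (det3 x v w) t)
           (vadd (vscale (det3 x w t) v) (vscale (det3 x t v) w)).
    by apply: vecP; rewrite /det3 /dot /cross /=; ring.
  rewrite x0 => E; apply: vecP; apply: (mulfI t0).
  - by have := congr1 (fun u : vec => u.1.1) E; rewrite /= => ->; field.
  - by have := congr1 (fun u : vec => u.1.2) E; rewrite /= => ->; field.
  - by have := congr1 (fun u : vec => u.2) E; rewrite /= => ->; field.
rewrite /det3; case: (vec_neq0 c0) => n0.
- by exists (1, 0, 0); rewrite /dot /= mul1r !mul0r !addr0.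
- by exists (0, 1, 0); rewrite /dot /= mul1r !mul0r addr0 add0r.
- by exists (0, 0, 1); rewrite /dot /= mul1r !mul0r !add0r.
Qed.

Lemma det3_perp a b c n : det3 a b c != 0 -> dot a n = 0 -> dot b n = 0 -> dot c n = 0 -> n = v0.
Proof.
move=> d0 an bn cn.
have : vscale (det3 a b c) n = vadd (vscale (dot a n) (cross b c))
    (vadd (vscale (dot b n) (cross c a)) (vscale (dot c n) (cross a b))).
  by apply: vecP; rewrite /det3 /dot /cross /=; ring.
rewrite an bn cn => E; apply/eqP; rewrite -(vscale_eq0 _ d0) E; apply/eqP.
by apply: vecP; rewrite /=; ring.
Qed.

Lemma ortho_ex v : exists2 n, n != v0 & dot v n = 0.
Proof.
have [->|vn] := eqVneq v v0.
  by exists (1, 0, 0); rewrite ?xpair_eqE ?oner_eq0 // /dot /=; ring.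
case: (vec_neq0 vn) => z0.
- exists (- v.1.2, v.1.1, 0); last by rewrite /dot /=; ring.
  by rewrite !xpair_eqE (negbTE z0) andbF.
- exists (- v.1.2, v.1.1, 0); last by rewrite /dot /=; ring.
  by rewrite !xpair_eqE oppr_eq0 (negbTE z0).
- exists (- v.2, 0, v.1.1); last by rewrite /dot /=; ring.
  by rewrite !xpair_eqE oppr_eq0 (negbTE z0).
Qed.

Lemma det3_eq0 a b c : det3 a b c = 0 ->
  exists2 n, n != v0 & [/\ dot a n = 0, dot b n = 0 & dot c n = 0].
Proof.
move=> d0.
have [bc|bc] := eqVneq (cross b c) v0; last first.
  by exists (cross b c) => //; split; rewrite ?dot_crossl ?dot_crossr.
have [ab|ab] := eqVneq (cross a b) v0; last first.
  exists (cross a b) => //; split; rewrite ?dot_crossl ?dot_crossr //.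
  by rewrite -/(det3 c a b) det3_rot.
have [ca|ca] := eqVneq (cross c a) v0; last first.
  exists (cross c a) => //; split; rewrite ?dot_crossl ?dot_crossr //.
  by rewrite -/(det3 b c a) -det3_rot.
have [a0|a0] := eqVneq a v0.
  have [b0|b0] := eqVneq b v0.
    have [n n0 cn] := ortho_ex c; exists n => //; split=> //.
      by rewrite a0 /dot /=; ring.
    by rewrite b0 /dot /=; ring.
  have [k ck] := cross_par b0 bc; have [n n0 bn] := ortho_ex b; exists n => //.
  by split; rewrite ?ck ?dotZl ?bn ?mulr0 // a0 /dot /=; ring.
have [k bk] := cross_par a0 ab.
have ac : cross a c = v0.
  have -> : cross a c = vscale (-1) (cross c a) by apply: vecP; rewrite /=; ring.
  by rewrite ca; apply: vecP; rewrite /=; ring.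
have [l cl] := cross_par a0 ac.
have [n n0 an] := ortho_ex a; exists n => //.
by split; rewrite ?bk ?cl ?dotZl ?an ?mulr0.
Qed.

Definition rv v : 'rV[F]_3 := \row_(j < 3) nth 0 [:: v.1.1; v.1.2; v.2] j.
Definition vr (u : 'rV[F]_3) : vec := (u 0 0, u 0 1, u 0 2%:R).

Lemma rvK : cancel rv vr.
Proof. by case=> [[x y] z]; rewrite /vr !mxE. Qed.
Lemma vrK : cancel vr rv.
Proof.
move=> u; apply/rowP => j; rewrite mxE.
by case: j => [[|[|[|//]]] i]; rewrite /vr /=; congr (u _ _); apply: val_inj.
Qed.
Lemma rv_dot v w : rv v *m (rv w)^T = (dot v w)%:M.
Proof.
apply/matrixP => i j; rewrite !ord1 !mxE !big_ord_recl big_ord0 !mxE /= addr0 /dot.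
by rewrite ?mulr1n addrA.
Qed.
Lemma rvZ k v : rv (vscale k v) = k *: rv v.
Proof. by apply/rowP => j; rewrite !mxE; case: j => [[|[|[|//]]] i]. Qed.
Lemma rvD v w : rv (vadd v w) = rv v + rv w.
Proof. by apply/rowP => j; rewrite !mxE; case: j => [[|[|[|//]]] i]. Qed.
Lemma rv_eq0 v : (rv v == 0) = (v == v0).
Proof.
apply/eqP/eqP => [E|->]; last by apply/rowP => j; rewrite !mxE; case: j => [[|[|[|//]]] i].
by rewrite -[v]rvK E /vr !mxE.
Qed.
Lemma map_rv (f : {rmorphism F -> F}) v : map_mx f (rv v) = rv (vmap f v).
Proof. by apply/rowP => j; rewrite !mxE; case: j => [[|[|[|//]]] i]. Qed.

End Vec3.

End Vectors.
Import Vectors.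

(** * Coordinates for points and lines of the Figueroa plane *)

Module Frames.
Local Open Scope ring_scope.

Section Frame.
Variables (K : finFieldType) (ch : 2 \in [pchar K]) (e : nat).
Hypothesis cardK : #|K| = ((2 ^ e) ^ 6)%N.
Notation phi := (fr_of ch (2 * e)).
Notation vphi := (vmap phi).

Lemma fr6e x : fr_of ch (6 * e) x = x :> K.
Proof. by rewrite /fr_of mulnC expnM -cardK expf_card. Qed.

Lemma phi3 x : phi (phi (phi x)) = x.
Proof. by rewrite !frD -mulnDr !addnn -{2}(fr6e x); congr fr_of; lia. Qed.

Lemma vphi3 (v : vec K) : vphi (vphi (vphi v)) = v.
Proof. by apply: vecP; rewrite /= phi3. Qed.

Lemma phi_dot v w : phi (dot v w) = dot (vphi v) (vphi w).
Proof. exact: (vmap_dot (fr_of ch (2 * e))). Qed.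

Lemma frobE A : frob ((2 ^ e) ^ 2) A = map_mx phi A.
Proof. by apply: eq_map_mx => x; rewrite /fr_of mulnC expnM. Qed.

Definition type3 (v : vec K) := det3 v (vphi v) (vphi (vphi v)) != 0.

Lemma type3_phi v : type3 (vphi v) = type3 v.
Proof. by rewrite /type3; congr (~~ _); rewrite -[RHS](fmorph_eq0 phi) vmap_det3. Qed.

Lemma type3_neq0 v : type3 v -> v != v0 K.
Proof.
apply: contraNneq => ->; rewrite /type3 /det3.
by have -> x : dot (v0 K) x = 0 by rewrite /dot /=; ring.
Qed.

Lemma type3_cross v : type3 v -> cross v (vphi v) != v0 K.
Proof.
move=> t; apply: contraTneq t => c0; rewrite /type3 negbK -det3_rot /det3 c0.
by rewrite /dot /=; apply/eqP; ring.
Qed.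

Lemma type3Z k v : k != 0 -> type3 (vscale k v) = type3 v.
Proof.
move=> k0; rewrite /type3 !vmapZ.
have -> : det3 (vscale k v) (vscale (phi k) (vphi v)) (vscale (phi (phi k)) (vphi (vphi v)))
   = k * phi k * phi (phi k) * det3 v (vphi v) (vphi (vphi v)).
  by rewrite /det3 /dot /cross /=; ring.
by rewrite !mulf_eq0 !fmorph_eq0 (negbTE k0).
Qed.

(* A subspace of K^3 that is mapped to itself by the Frobenius map is spanned by fixed vectors. *)
Lemma phi_line v : v != v0 K -> cross v (vphi v) = v0 K ->
  exists2 w, vphi w = w & exists2 k, k != 0 & v = vscale k w.
Proof.
move=> vn /(cross_par vn)[c vc].
have key x : x != 0 -> phi x = c * x ->
  exists2 w, vphi w = w & exists2 k, k != 0 & v = vscale k w.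
  move=> x0 px; have c0 : c != 0.
    by apply: contraNneq x0 => c0; rewrite -(fr_eq0 ch (2 * e)) px c0 mul0r.
  exists (vscale x^-1 v); last by exists x; rewrite // vscaleA mulfV // vscale1.
  by rewrite vmapZ vc vscaleA /= frV px invfM mulrAC mulVf ?mul1r.
have [h1 h2 h3] : [/\ phi v.1.1 = c * v.1.1, phi v.1.2 = c * v.1.2 & phi v.2 = c * v.2].
  by case: v vc {vn key} => [[x y] z] [].
by case: (vec_neq0 vn) => n0; [apply: key h1|apply: key h2|apply: key h3].
Qed.

(** If [v] and [vphi v] are independent, vanishing of the determinant makes their cross product
    proportional to its own image, so a multiple of it is fixed. Otherwise [v] is a multiple of a
    fixed vector and a perpendicular vector can be written down. *)
Lemma type3N_perp v : v != v0 K -> ~~ type3 v -> exists n, [/\ n != v0 K, vphi n = n & dot v n = 0].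
Proof.
move=> vn; rewrite /type3 negbK => /eqP d0.
have [c0|c0] := eqVneq (cross v (vphi v)) (v0 K).
  have [w wf [k k0 vE]] := phi_line vn c0.
  have wn : w != v0 K by rewrite -(vscale_eq0 _ k0) -vE.
  rewrite vE {vE}.
  have fx : [/\ phi w.1.1 = w.1.1, phi w.1.2 = w.1.2 & phi w.2 = w.2].
    by case: w wf {wn} => [[x y] z] [-> -> ->].
  case: fx => f1 f2 f3; case: (vec_neq0 wn) => z0.
  - exists (- w.1.2, w.1.1, 0); split.
    + by rewrite !xpair_eqE (negbTE z0) andbF.
    + by apply: vecP; rewrite /= ?frN ?fr0 ?f1 ?f2 ?f3.
    + by rewrite /dot /=; ring.
  - exists (- w.1.2, w.1.1, 0); split.
    + by rewrite !xpair_eqE oppr_eq0 (negbTE z0).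
    + by apply: vecP; rewrite /= ?frN ?fr0 ?f1 ?f2 ?f3.
    + by rewrite /dot /=; ring.
  - exists (- w.2, 0, w.1.1); split.
    + by rewrite !xpair_eqE oppr_eq0 (negbTE z0).
    + by apply: vecP; rewrite /= ?frN ?fr0 ?f1 ?f2 ?f3.
    + by rewrite /dot /=; ring.
have vpn : vphi v != v0 K by rewrite vmap_eq0.
have cp : cross (cross v (vphi v)) (vphi (cross v (vphi v))) = v0 K.
  rewrite vmap_cross; set a := v in d0 *; set b := vphi a; set c := vphi b.
  have -> : cross (cross a b) (cross b c) = vscale (det3 a b c) b.
    by apply: vecP; rewrite /det3 /dot /cross /=; ring.
  by rewrite d0; apply: vecP; rewrite /= mul0r.
have [n nf [k k0 nE]] := phi_line c0 cp.
exists n; split=> //.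
  by apply: contraNneq c0 => n0; rewrite nE n0; apply/eqP; apply: vecP; rewrite /= mulr0.
by apply: (mulfI k0); rewrite -dotZr -nE dot_crossl mulr0.
Qed.

Lemma perp_type3N v n : n != v0 K -> vphi n = n -> dot v n = 0 -> ~~ type3 v.
Proof.
move=> nn nf vn; apply/negP => t; move/eqP: nn; apply.
apply: (det3_perp t) => //; first by rewrite -nf -vmap_dot vn rmorph0.
by rewrite -nf -vmap_dot -nf -vmap_dot vn !rmorph0.
Qed.

Variable E : 'M[K]_3.
Hypotheses (Eu : E \in unitmx) (EF : map_mx phi E = E).

(** Coordinates refer to the basis formed by the rows of [E]. As [E] is fixed by the Frobenius map,
    the collineation of order 3 acts on coordinates as [vphi]. *)
Definition ptm (v : vec K) : 'M[K]_3 := <<rv v *m E>>%MS.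
Definition lnm (n : vec K) : 'M[K]_3 := <<kermx (invmx E *m (rv n)^T)>>%MS.

Lemma rvE_eq0 v : (rv v *m E == 0) = (v == v0 K).
Proof.
rewrite -rv_eq0; apply/eqP/eqP => [h|->]; last by rewrite mul0mx.
by rewrite -[rv v](mulmxK Eu) h mul0mx.
Qed.

Lemma ptm_prf v : v != v0 K -> (<<ptm v>>%MS == ptm v) && (\rank (ptm v) == 1%N).
Proof.
by move=> vn; rewrite genmx_id eqxx /= mxrank_gen rank_rV rvE_eq0 vn.
Qed.

Lemma EinvF : map_mx phi (invmx E) = invmx E.
Proof. by rewrite map_invmx EF. Qed.

Lemma lncol_eq0 n : (invmx E *m (rv n)^T == 0) = (n == v0 K).
Proof.
rewrite -rv_eq0 -[RHS](trmx_eq0); apply/eqP/eqP => [h|->]; last by rewrite mulmx0.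
by rewrite -[(rv n)^T](mulKVmx Eu) h mulmx0.
Qed.

Lemma lnm_prf n : n != v0 K -> (<<lnm n>>%MS == lnm n) && (\rank (lnm n) == 2%N).
Proof.
move=> nn; rewrite genmx_id eqxx /= mxrank_gen mxrank_ker -mxrank_tr rank_rV.
by rewrite trmx_eq0 lncol_eq0 nn.
Qed.

Lemma e1_neq0 : (1, 0, 0) != v0 K.
Proof. by rewrite !xpair_eqE oner_eq0. Qed.

(** Totalized: the zero vector is sent to the point, respectively the line, with coordinates
    [(1, 0, 0)]. *)
Definition pt (v : vec K) : fpoint K :=
  insubd (exist (fun A : 'M[K]_3 => (<<A>>%MS == A) && (\rank A == 1%N)) _ (ptm_prf e1_neq0)) (ptm v).
Definition ln (n : vec K) : fline K :=
  insubd (exist (fun A : 'M[K]_3 => (<<A>>%MS == A) && (\rank A == 2%N)) _ (lnm_prf e1_neq0)) (lnm n).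

Lemma val_pt v : v != v0 K -> val (pt v) = ptm v.
Proof. by move=> vn; rewrite val_insubd ptm_prf. Qed.
Lemma val_ln n : n != v0 K -> val (ln n) = lnm n.
Proof. by move=> nn; rewrite val_insubd lnm_prf. Qed.

Lemma sub_lnm v n : (rv v *m E <= lnm n)%MS = (dot v n == 0).
Proof.
rewrite genmxE; apply/sub_kermxP/eqP.
  rewrite -mulmxA mulKVmx // rv_dot => /matrixP/(_ 0 0).
  by rewrite !mxE mulr1n.
by move=> d0; rewrite -mulmxA mulKVmx // rv_dot d0 raddf0.
Qed.

Lemma row_vec (u : 'rV[K]_3) : exists v, u = rv v *m E.
Proof. by exists (vr (u *m invmx E)); rewrite vrK mulmxKV. Qed.

Lemma ptP (p : fpoint K) : exists2 v, v != v0 K & p = pt v.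
Proof.
case: p => A pA; have /andP[/eqP gA /eqP rA] := pA.
have [v vE] := row_vec (nz_row A).
have An : A != 0 by rewrite -mxrank_eq0 rA.
have vn : v != v0 K by rewrite -rvE_eq0 -vE nz_row_eq0.
exists v => //; apply: val_inj; rewrite val_pt //= -gA /ptm.
apply/genmxP; rewrite -vE nz_row_sub -(geq_leqif (mxrank_leqif_sup (nz_row_sub A))).
by rewrite rA rank_rV nz_row_eq0 An.
Qed.

Lemma lnP (l : fline K) : exists2 n, n != v0 K & l = ln n.
Proof.
case: l => A pA; have /andP[/eqP gA /eqP rA] := pA.
pose C := kermx A^T.
have Cn : C != 0 by rewrite -mxrank_eq0 mxrank_ker mxrank_tr rA.
have : nz_row C *m A^T = 0 by apply/sub_kermxP; apply: nz_row_sub.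
set c := nz_row C => cA.
have cn : c != 0 by rewrite nz_row_eq0.
pose n := vr (c *m E^T).
have nE : invmx E *m (rv n)^T = c^T.
  by rewrite vrK trmx_mul trmxK mulmxA mulVmx // mul1mx.
have nn : n != v0 K by rewrite -lncol_eq0 nE trmx_eq0.
exists n => //; apply: val_inj; rewrite val_ln //= -gA /lnm nE.
have sA : (A <= kermx c^T)%MS by apply/sub_kermxP; apply: trmx_inj; rewrite trmx_mul trmxK cA trmx0.
apply/genmxP; rewrite sA -(geq_leqif (mxrank_leqif_sup sA)).
by rewrite rA mxrank_ker mxrank_tr rank_rV cn.
Qed.

Lemma inc_pg v n : v != v0 K -> n != v0 K -> (val (pt v) <= val (ln n))%MS = (dot v n == 0).
Proof. by move=> vn nn; rewrite val_pt // val_ln // genmxE sub_lnm. Qed.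

Lemma pt_eqP v w : v != v0 K -> w != v0 K ->
  reflect (exists2 k, k != 0 & w = vscale k v) (pt v == pt w).
Proof.
move=> vn wn; apply: (iffP eqP) => [h|[k k0 ->]].
  have : (rv w *m E <= rv v *m E)%MS.
    have : (ptm w <= ptm v)%MS by rewrite -!val_pt // h.
    by rewrite !genmxE.
  case/sub_rVP => k kE; exists k.
    apply: contraNneq wn => k0; rewrite -rvE_eq0 kE k0 scale0r eqxx //.
  by apply: (can_inj (@rvK K)); rewrite rvZ; apply: (can_inj (mulmxK Eu)); rewrite kE scalemxAl.
apply: val_inj; rewrite !val_pt ?vscale_eq0 //; apply/genmxP.
by rewrite rvZ -scalemxAl !(eqmx_scale _ k0) submx_refl.
Qed.

Lemma ln_eqP v w : v != v0 K -> w != v0 K ->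
  reflect (exists2 k, k != 0 & w = vscale k v) (ln v == ln w).
Proof.
move=> vn wn; apply: (iffP eqP) => [h|[k k0 ->]].
  have key u : dot u v = 0 -> dot u w = 0.
    by move/eqP; rewrite -sub_lnm -val_ln // h val_ln // sub_lnm => /eqP.
  have : cross v w = v0 K.
    have := key (cross v (1,0,0)); have := key (cross v (0,1,0)); have := key (cross v (0,0,1)).
    have d0 t : dot (cross v t) v = 0 by rewrite dotC dot_crossl.
    move=> /(_ (d0 _)) h3 /(_ (d0 _)) h2 /(_ (d0 _)) h1.
    by apply: vecP; apply/eqP; rewrite -oppr_eq0; apply/eqP;
      [rewrite -[RHS]h1|rewrite -[RHS]h2|rewrite -[RHS]h3]; rewrite /dot /=; ring.
  case/(cross_par vn) => k kE; exists k => //.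
  by apply: contraNneq wn => k0; rewrite kE k0; apply/eqP; apply: vecP; rewrite /= mul0r.
apply: val_inj; rewrite !val_ln ?vscale_eq0 // /lnm.
have -> : invmx E *m (rv (vscale k v))^T = k *: (invmx E *m (rv v)^T).
  by rewrite rvZ [X in _ *m X = _]linearZ /= -scalemxAr.
move: (invmx E *m _) => A.
apply/genmxP; apply/andP; split; apply/sub_kermxP.
  by rewrite -scalemxAr mulmx_ker scaler0.
by apply: (scalerI k0); rewrite scalemxAr mulmx_ker scaler0.
Qed.

Lemma frob_ptm v : (frob ((2 ^ e) ^ 2) (ptm v) :=: rv (vphi v) *m E)%MS.
Proof.
rewrite frobE; apply: (eqmx_trans (map_genmx _ _)); rewrite map_mxM EF map_rv.
exact: genmxE.
Qed.

Lemma frob_lnm n : (frob ((2 ^ e) ^ 2) (lnm n) :=: lnm (vphi n))%MS.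
Proof.
rewrite frobE; apply: (eqmx_trans (map_genmx _ _)).
by rewrite map_kermx map_mxM EinvF -map_trmx map_rv.
Qed.

Lemma frob_eqmx (A B : 'M[K]_3) : (A :=: B)%MS -> (frob ((2 ^ e) ^ 2) A :=: frob ((2 ^ e) ^ 2) B)%MS.
Proof. by move=> /eqmxP AB; rewrite !frobE; apply/eqmxP; rewrite !map_submx. Qed.

Lemma inD_pt v : v != v0 K -> inD ((2 ^ e) ^ 2) (pt v) = (cross v (vphi v) == v0 K).
Proof.
move=> vn; rewrite /inD val_pt // !frob_ptm !genmxE.
have vpn : vphi v != v0 K by rewrite vmap_eq0.
apply/andP/eqP => [[/sub_rVP[k]]|c0].
  rewrite scalemxAl -rvZ => /(can_inj (mulmxK Eu))/(can_inj (@rvK K)) -> _.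
  by rewrite cross_scaler crossvv; apply: vecP; rewrite /= mulr0.
have [k kE] := cross_par vn c0.
have k0 : k != 0.
  by apply: contraNneq vpn => k0; rewrite kE k0; apply/eqP; apply: vecP; rewrite /= mul0r.
by rewrite kE rvZ -scalemxAl !(eqmx_scale _ k0).
Qed.

Lemma row_fullP (S : 'M[K]_3) : (\rank S == 3%N) <->
  forall n, (forall v, (rv v *m E <= S)%MS -> dot v n = 0) -> n = v0 K.
Proof.
split=> [rS n h|h].
  have fS : row_full S by rewrite /row_full.
  have h' v : dot v n = 0 by apply: h; apply: submx_full.
  by apply: vecP; [rewrite -[RHS](h' (1, 0, 0))|rewrite -[RHS](h' (0, 1, 0))|rewrite -[RHS](h' (0, 0, 1))];
     rewrite /dot /=; ring.
rewrite -/(row_full S) -cokermx_eq0; apply/eqP; apply: trmx_inj; rewrite trmx0.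
apply/eqP; rewrite -nz_row_eq0; set c := nz_row _.
have cS : S *m c^T = 0.
  apply: trmx_inj; rewrite trmx_mul trmxK trmx0.
  have /submxP[D ->] : (c <= (cokermx S)^T)%MS by apply: nz_row_sub.
  by rewrite -mulmxA -trmx_mul mulmx_coker trmx0 mulmx0.
have : vr (c *m E^T) = v0 K.
  apply: h => v /submxP[D DE].
  have : rv v *m (c *m E^T)^T = 0 by rewrite trmx_mul trmxK mulmxA DE -mulmxA cS mulmx0.
  set n := vr _; have -> : c *m E^T = rv n by rewrite vrK.
  by rewrite rv_dot => /matrixP/(_ 0 0); rewrite !mxE mulr1n.
move/(congr1 (@rv K)); rewrite vrK => h0; apply/eqP.
have : c *m E^T == 0 by rewrite h0 rv_eq0.
have Etu : E^T \in unitmx by rewrite unitmx_tr.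
by rewrite -[X in _ -> X = _](mulmxK Etu) => /eqP ->; rewrite mul0mx.
Qed.

Lemma tri_pt v : v != v0 K -> triangle_point ((2 ^ e) ^ 2) (pt v) = type3 v.
Proof.
move=> vn; rewrite /triangle_point val_pt //.
set S := (_ + _)%MS.
have s1 : (rv v *m E <= S)%MS.
  by apply: submx_trans (addsmxSl _ _); apply: submx_trans (addsmxSl _ _); rewrite genmxE.
have s2 : (rv (vphi v) *m E <= S)%MS.
  by apply: submx_trans (addsmxSl _ _); apply: submx_trans (addsmxSr _ _); rewrite frob_ptm.
have ff : (frob ((2 ^ e) ^ 2) (frob ((2 ^ e) ^ 2) (ptm v)) :=: rv (vphi (vphi v)) *m E)%MS.
  have h : (frob ((2 ^ e) ^ 2) (ptm v) :=: ptm (vphi v))%MS.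
    by apply: eqmx_trans (frob_ptm v) (eqmx_sym (genmxE _)).
  by apply: eqmx_trans (frob_eqmx h) (frob_ptm _).
have s3 : (rv (vphi (vphi v)) *m E <= S)%MS.
  by apply: submx_trans (addsmxSr _ _); rewrite ff.
apply/idP/idP => [/row_fullP h|t].
  apply/negP => /eqP/det3_eq0[n n0 [d1 d2 d3]]; move/eqP: n0; apply; apply: h => w ws.
  have : (S <= lnm n)%MS.
    rewrite !addsmx_sub ff frob_ptm genmxE.
    by rewrite !sub_lnm d1 d2 d3 eqxx.
  by move/(submx_trans ws); rewrite sub_lnm => /eqP.
by apply/row_fullP => n h; apply: (det3_perp t); apply: h.
Qed.

Lemma frob2_lnm n : (frob ((2 ^ e) ^ 2) (frob ((2 ^ e) ^ 2) (lnm n)) :=: lnm (vphi (vphi n)))%MS.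
Proof. by apply: eqmx_trans (frob_eqmx (frob_lnm n)) (frob_lnm _). Qed.

Lemma tri_ln n : n != v0 K -> triangle_line ((2 ^ e) ^ 2) (ln n) = type3 n.
Proof.
move=> nn; rewrite /triangle_line val_ln // mxrank_eq0.
set S := (_ :&: _)%MS.
have SP v : (rv v *m E <= S)%MS =
   [&& dot v n == 0, dot v (vphi n) == 0 & dot v (vphi (vphi n)) == 0].
  by rewrite !sub_capmx frob2_lnm frob_lnm !sub_lnm andbA.
apply/eqP/idP => [S0|t].
  apply/negP => /eqP/det3_eq0[v v_n0 [d1 d2 d3]].
  have : (rv v *m E <= S)%MS by rewrite SP !(dotC v) d1 d2 d3 eqxx.
  by rewrite S0 submx0 rvE_eq0 (negbTE v_n0).
apply/eqP; rewrite -nz_row_eq0; have [v vE] := row_vec (nz_row S).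
have := nz_row_sub S; rewrite vE SP => /and3P[/eqP d1 /eqP d2 /eqP d3].
by rewrite rvE_eq0; apply/eqP; apply: (det3_perp t); rewrite dotC.
Qed.

(** With [X] and [L] the coordinate vectors of [mu_line] and [mu_point], incidence is [dot X L = 0].
    The Binet-Cauchy identity turns this into the image under [phi] of the asserted equation. *)
Lemma mu_incE v n : type3 v -> type3 n ->
  (mu_line ((2 ^ e) ^ 2) (ln n) <= mu_point ((2 ^ e) ^ 2) (pt v))%MS =
  (dot v n * phi (dot v n) == dot v (vphi n) * dot (vphi v) n).
Proof.
move=> tv tn; have vn := type3_neq0 tv; have nn := type3_neq0 tn.
rewrite /mu_line /mu_point val_pt // val_ln //.
have ff : (frob ((2 ^ e) ^ 2) (frob ((2 ^ e) ^ 2) (ptm v)) :=: rv (vphi (vphi v)) *m E)%MS.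
  have h : (frob ((2 ^ e) ^ 2) (ptm v) :=: ptm (vphi v))%MS.
    by apply: eqmx_trans (frob_ptm v) (eqmx_sym (genmxE _)).
  by apply: eqmx_trans (frob_eqmx h) (frob_ptm _).
set S := (_ :&: _)%MS; set R := (_ + _)%MS.
have SP w : (rv w *m E <= S)%MS = (dot w (vphi n) == 0) && (dot w (vphi (vphi n)) == 0).
  by rewrite !sub_capmx frob2_lnm frob_lnm !sub_lnm.
have tv1 : type3 (vphi v) by rewrite type3_phi.
have tn1 : type3 (vphi n) by rewrite type3_phi.
have cv := type3_cross tv1; have cn := type3_cross tn1.
have s1 : (rv (vphi v) *m E <= R)%MS.
  by apply: submx_trans (addsmxSl _ _); rewrite frob_ptm.
have s2 : (rv (vphi (vphi v)) *m E <= R)%MS.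
  by apply: submx_trans (addsmxSr _ _); rewrite ff.
set L := cross (vphi v) (vphi (vphi v)) in cv.
set X := cross (vphi n) (vphi (vphi n)) in cn.
have RP w : (rv w *m E <= R)%MS = (dot w L == 0).
  apply/idP/eqP => [h|].
    have : (R <= lnm L)%MS.
      by rewrite addsmx_sub ff frob_ptm !sub_lnm dot_crossl dot_crossr eqxx.
    by move/(submx_trans h); rewrite sub_lnm => /eqP.
  case/(span_cross cv) => k [l ->]; rewrite rvD !rvZ mulmxDl -!scalemxAl.
  by apply: addmx_sub; apply: scalemx_sub.
have -> : (S <= R)%MS = (dot X L == 0).
  apply/idP/idP => [h|h].
    by rewrite -RP; apply: submx_trans h; rewrite SP ![dot X _]dotC dot_crossl dot_crossr eqxx.
  apply/row_subP => i; have [w wE] := row_vec (row i S).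
  have := row_sub i S; rewrite wE SP => /andP[/eqP d1 /eqP d2].
  rewrite dotC in d1; rewrite dotC in d2.
  have [k ->] := perp_cross cn d1 d2.
  by rewrite RP dotZl (eqP h) mulr0.
rewrite /X /L binet -[RHS]subr_eq0 -[RHS](fr_eq0 ch (2 * e)) frB !frM !phi_dot.
by rewrite ![dot (vphi n) _]dotC ![dot (vphi (vphi n)) _]dotC [X in _ - X]mulrC.
Qed.

Lemma fig_incE v n : v != v0 K -> n != v0 K ->
  fig_inc ((2 ^ e) ^ 2) (pt v) (ln n) =
  if type3 v && type3 n then dot v n * phi (dot v n) == dot v (vphi n) * dot (vphi v) n
  else dot v n == 0.
Proof.
move=> vn nn; rewrite /fig_inc tri_pt // tri_ln //.
by case: ifP => [/andP[tv tn]|_]; rewrite ?mu_incE // inc_pg.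
Qed.

End Frame.

End Frames.
Import Frames.

(** * Figueroa incidence in coordinates and mixed joins *)

Module FigueroaIncidence.
Local Open Scope ring_scope.

Section Plane.
Variables (K : finFieldType) (ch : 2 \in [pchar K]) (e : nat).
Hypothesis cardK : #|K| = ((2 ^ e) ^ 6)%N.
Notation phi := (fr_of ch (2 * e)).
Notation vphi := (vmap phi).
Notation type3 := (type3 ch e).
Implicit Types u v w n : vec K.
Let phi3 := phi3 ch cardK.
Let vphi3 := vphi3 ch cardK.

(** The formula is symmetric in point and line, so every statement about joins also yields its
    dual. *)
Definition finc (v n : vec K) : bool :=
  if type3 v && type3 n then dot v n * phi (dot v n) == dot v (vphi n) * dot (vphi v) n
  else dot v n == 0.

Lemma vphiZ k v : vphi (vscale k v) = vscale (phi k) (vphi v).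
Proof. by apply: vecP; rewrite /= frM. Qed.

Lemma fincC v n : finc v n = finc n v.
Proof.
by rewrite /finc andbC ![dot n _]dotC [dot (vphi n) v]dotC [dot v (vphi n) * _]mulrC.
Qed.

Lemma fincZ k v n : k != 0 -> finc (vscale k v) n = finc v n.
Proof.
move=> k0; rewrite /finc type3Z // vphiZ !dotZl frM; case: ifP => _.
  have -> : k * dot v n * (phi k * phi (dot v n)) = k * phi k * (dot v n * phi (dot v n)) by ring.
  have -> : k * dot v (vphi n) * (phi k * dot (vphi v) n) =
            k * phi k * (dot v (vphi n) * dot (vphi v) n) by ring.
  by rewrite (inj_eq (mulfI _)) // mulf_neq0 // fr_eq0.
by rewrite mulf_eq0 (negbTE k0).
Qed.

(** Up to a power of [phi] the cross products are the coordinates of the images under mu, so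
    incidence between elements of type III becomes ordinary incidence. *)
Lemma finc_cross v n : type3 v -> type3 n ->
  finc v n = (dot (cross v (vphi v)) (cross n (vphi n)) == 0).
Proof.
move=> tv tn; rewrite /finc tv tn binet subr_eq0 -phi_dot.
by [].
Qed.

Lemma type3_nperp v n : type3 v -> n != v0 K -> vphi n = n -> dot v n != 0.
Proof.
move=> tv nn nf; apply/negP => /eqP d0.
by have := perp_type3N nn nf d0; rewrite tv.
Qed.

Lemma vphiD v w : vphi (vadd v w) = vadd (vphi v) (vphi w).
Proof. by apply: vecP; rewrite /= frA. Qed.

Lemma fix_split v n : v != v0 K -> n != v0 K -> vphi n = n -> dot v n = 0 ->
  exists u w g k, [/\ vphi u = u, vphi w = w, k != 0, v = vscale k (vadd u (vscale g w)) &
                      exists2 c, c != 0 & cross u w = vscale c n].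
Proof.
move=> vn nn nf vn0.
have suff_ a b : vphi a = a -> vphi b = b -> (exists2 c, c != 0 & cross a b = vscale c n) ->
  exists u w g k, [/\ vphi u = u, vphi w = w, k != 0, v = vscale k (vadd u (vscale g w)) &
                      exists2 c, c != 0 & cross u w = vscale c n].
  move=> af bf [c c0 cE].
  have cn : cross a b != v0 K by rewrite cE vscale_eq0.
  have vc : dot v (cross a b) = 0 by rewrite cE dotZr vn0 mulr0.
  have [s [t vE]] := span_cross cn vc.
  have [s0|s0] := eqVneq s 0; last first.
    exists a, b, (t / s), s; split=> //; last by exists c.
    by rewrite vE; apply: vecP; rewrite /=; field.
  have t0 : t != 0.
    by apply: contraNneq vn => t0; rewrite vE s0 t0; apply/eqP; apply: vecP; rewrite /=; ring.
  exists b, a, 0, t; split=> //.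
    by rewrite vE s0; apply: vecP; rewrite /=; ring.
  exists (- c); first by rewrite oppr_eq0.
  have -> : cross b a = vscale (-1) (cross a b) by apply: vecP; rewrite /=; ring.
  by rewrite cE vscaleA mulN1r.
have [f1 f2 f3] : [/\ phi n.1.1 = n.1.1, phi n.1.2 = n.1.2 & phi n.2 = n.2].
  by case: n nf {nn vn0 suff_} => [[x y] z] [-> -> ->].
case: (vec_neq0 nn) => z0.
- apply: (suff_ (- n.1.2, n.1.1, 0) (- n.2, 0, n.1.1)).
  + by apply: vecP; rewrite /= ?frN ?fr0 ?f1 ?f2 ?f3.
  + by apply: vecP; rewrite /= ?frN ?fr0 ?f1 ?f2 ?f3.
  + by exists n.1.1 => //; apply: vecP; rewrite /=; ring.
- apply: (suff_ (n.1.2, - n.1.1, 0) (0, - n.2, n.1.2)).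
  + by apply: vecP; rewrite /= ?frN ?fr0 ?f1 ?f2 ?f3.
  + by apply: vecP; rewrite /= ?frN ?fr0 ?f1 ?f2 ?f3.
  + exists (- n.1.2); first by rewrite oppr_eq0.
    by apply: vecP; rewrite /=; ring.
- apply: (suff_ (n.2, 0, - n.1.1) (0, n.2, - n.1.2)).
  + by apply: vecP; rewrite /= ?frN ?fr0 ?f1 ?f2 ?f3.
  + by apply: vecP; rewrite /= ?frN ?fr0 ?f1 ?f2 ?f3.
  + by exists n.2 => //; apply: vecP; rewrite /=; ring.
Qed.

Lemma fix_combP u w (a b : K) : cross u w != v0 K ->
  vadd (vscale a u) (vscale b w) = v0 K -> a = 0 /\ b = 0.
Proof.
move=> c0 h.
have ha : vscale a (cross u w) = v0 K.
  rewrite -cross_scale.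
  have -> : vscale a u = vadd (v0 K) (vscale (- b) w).
    by rewrite -h; apply: vecP; rewrite /=; ring.
  by apply: vecP; rewrite /=; ring.
have hb : vscale b (cross u w) = v0 K.
  rewrite -cross_scaler.
  have -> : vscale b w = vadd (v0 K) (vscale (- a) u).
    by rewrite -h; apply: vecP; rewrite /=; ring.
  by apply: vecP; rewrite /=; ring.
split; apply/eqP; apply: contraNT c0 => k0.
  by rewrite -(vscale_eq0 _ k0) ha.
by rewrite -(vscale_eq0 _ k0) hb.
Qed.

(* The line through a point of type III and a point of type II is not at the same time
   of type II and of type III. *)
Lemma join_mixed v v' l m : type3 v -> ~~ type3 v' -> v' != v0 K -> type3 l -> ~~ type3 m ->
  m != v0 K -> dot v m = 0 -> dot v' m = 0 -> dot v' l = 0 -> finc v l -> False.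
Proof.
move=> tv tv' v'n tl tm mn vm v'm v'l vl.
have [d [dn df v'd]] := type3N_perp v'n tv'.
(* Dually to the case of points, the line [m], not being of type III, carries a point [w] of the
   subplane. Together with points [u], [x] of the subplane on the line [d] through [v'] it provides
   coordinates. *)
have [w [wn wf mw]] := type3N_perp mn tm.
have lw : dot w l != 0 by rewrite dotC; apply: type3_nperp.
have [u [x [g [k [uf xf k0 v'E [c c0 ux]]]]]] := fix_split v'n dn df v'd.
have uxn : cross u x != v0 K by rewrite ux vscale_eq0.
have xn : x != v0 K.
  by apply: contraNneq uxn => ->; apply/eqP; apply: vecP; rewrite /=; ring.
have lx : dot x l != 0 by rewrite dotC; apply: type3_nperp.
have vn := type3_neq0 tv.
have cvw : cross v w != v0 K.
  apply/negP => /eqP; rewrite -(vscale1 w) => /(cross_par vn)[j wj].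
  have j0 : j != 0.
    by apply: contraNneq wn => j0; rewrite -(vscale1 w) wj j0; apply/eqP; apply: vecP; rewrite /= mul0r.
  have : ~~ type3 w.
    by rewrite /Frames.type3 wf /det3 negbK dot_crossl.
  by rewrite -(vscale1 w) wj type3Z // tv.
have [s [t wst]] : exists s t, v' = vadd (vscale s v) (vscale t w).
  have mE : dot v' (cross v w) = 0.
    have [j jE] : exists j, m = vscale j (cross v w) by apply: perp_cross; rewrite // dotC.
    have j0 : j != 0.
      by apply: contraNneq mn => j0; rewrite jE j0; apply/eqP; apply: vecP; rewrite /= mul0r.
    by apply: (mulfI j0); rewrite -dotZr -jE v'm mulr0.
  exact: span_cross cvw mE.
have s0 : s != 0.
  apply: contraNneq lw => s0; have t0 : t != 0.
    by apply: contraNneq v'n => t0; rewrite wst s0 t0; apply/eqP; apply: vecP; rewrite /=; ring.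
  apply/eqP; apply: (mulfI t0); rewrite mulr0 -v'l wst s0 dotDl !dotZl; ring.
have [b vE] : exists b, vscale (s / k) v = vadd (vadd u (vscale g x)) (vscale b w).
  exists (- (t / k)).
  have -> : vscale (s / k) v = vscale k^-1 (vadd v' (vscale (- t) w)).
    by rewrite wst; apply: vecP; rewrite /=; field.
  by rewrite v'E; apply: vecP; rewrite /=; field.
have sk0 : s / k != 0 by rewrite mulf_neq0 ?invr_eq0.
have ud : dot u d = 0 by apply: (mulfI c0); rewrite mulr0 -dotZr -ux dot_crossl.
have xd : dot x d = 0 by apply: (mulfI c0); rewrite mulr0 -dotZr -ux dot_crossr.
have wd : dot w d != 0.
  apply: contraTneq tv => wd0; have : dot v d = 0.
    by apply: (mulfI sk0); rewrite mulr0 -dotZl vE !dotDl !dotZl ud xd wd0 !mulr0 !addr0.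
  exact: perp_type3N.
have dot0l y : dot (v0 K) y = 0 by rewrite /dot /=; ring.
have tP : type3 (vscale (s / k) v) by rewrite type3Z.
have : finc (vscale (s / k) v) l by rewrite fincZ.
rewrite /finc tP tl vE /= => /eqP.
have lu : dot u l = - g * dot x l.
  have : dot (vadd u (vscale g x)) l = 0.
    by apply: (mulfI k0); rewrite -dotZl -v'E v'l mulr0.
  by rewrite dotDl dotZl => /eqP; rewrite addr_eq0 => /eqP ->; ring.
have fd y : vphi y = y -> dot y (vphi l) = phi (dot y l) by move=> yf; rewrite phi_dot yf.
rewrite !vphiD !vphiZ uf xf wf !dotDl !dotZl !fd // lu.
have [X XE] : exists X, X = dot x l by exists (dot x l).
have [W WE] : exists W, W = dot w l by exists (dot w l).
rewrite -XE -WE in lx lw lu *; rewrite !(frA, frM, frN).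
have X1 : phi X != 0 by rewrite fr_eq0.
move=> H.
have [xi WX] : exists xi, W = xi * X by exists (W / X); rewrite mulfVK.
(* The incidence of [v] and [l] after cancelling [X], [phi X] and [phi g - g]. The last factor is
   nonzero because a line of type III carries no point of the subplane. *)
have D : phi g - g = b * phi xi - phi b * xi.
  apply: (mulfI lx); apply: (mulfI X1).
  have gne : phi g - g != 0.
    apply: contraTneq tl => /eqP; rewrite subr_eq0 => /eqP gf.
    have : dot (vadd u (vscale g x)) l = 0 by rewrite dotDl dotZl lu -XE; ring.
    rewrite dotC; apply: (perp_type3N); last by rewrite vphiD vphiZ uf xf gf.
    apply/eqP => h; have := @fix_combP u x 1 g uxn.
    rewrite vscale1 => /(_ h)[/eqP]; by rewrite oner_eq0.
  apply: (mulfI gne).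
  apply/eqP; rewrite -subr_eq0; apply/eqP.
  transitivity ((- g * X + g * X + b * W) * (- phi g * phi X + phi g * phi X + phi b * phi W)
      - (- phi g * phi X + g * phi X + b * phi W) * (- g * X + phi g * X + phi b * W)).
    by rewrite WX frM; ring.
  by rewrite H subrr.
(* Summed over the conjugates, the left sides of [D] cancel and the right sides add up to the
   determinant of [(1, b, xi)] and its conjugates. So this vector is not of type III, and [1], [b],
   [xi] satisfy a linear relation with fixed coefficients. *)
have [n3|n3] := boolP (type3 (1, b, xi)).
  move: n3; rewrite /Frames.type3 => /eqP; case.
  have D1 := congr1 phi D; have D2 := congr1 phi D1.
  rewrite !(frB, frM) !phi3 in D1 D2.
  have := congr2 +%R (congr2 +%R D D1) D2.
  rewrite /det3 /dot /cross /= fr1 => S.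
  have -> : 0 = phi g - g + (phi (phi g) - phi g) + (g - phi (phi g)) :> K by ring.
  by rewrite S !fr1; ring.
have bn : (1, b, xi) != v0 K by rewrite !xpair_eqE oner_eq0.
have [[[a1 a2] a3] [an [f1 f2 f3]]] := type3N_perp bn n3.
rewrite /dot /= mul1r => rel.
have [a20|a20] := eqVneq a2 0.
  have a30 : a3 != 0.
    apply: contraNneq an => a30; move: rel; rewrite a20 a30 !mulr0 !addr0 => ->.
    by rewrite eqxx.
  have : dot (vadd (vscale a3 w) (vscale a1 x)) l = 0.
    rewrite dotDl !dotZl -XE -WE WX.
    by have := congr1 (fun z => z * X) rel; rewrite a20 => h; rewrite -[RHS](mul0r X) -rel a20; ring.
  move/eqP; rewrite dotC; apply/negP; apply: type3_nperp => //.
    apply/eqP => h; have := congr1 (fun z => dot z d) h.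
    by rewrite dotDl !dotZl xd mulr0 addr0 dot0l => /eqP; rewrite mulf_eq0 (negbTE a30) (negbTE wd).
  by rewrite vphiD !vphiZ xf wf f1 f3.
(* [D] and the relation show that [ka] is fixed; then [u + ka x - (a1 / a2) w] is a point of the
   subplane on [l], which is impossible. *)
pose ka := g + a1 / a2 * xi.
have kf : phi ka = ka.
  rewrite /ka frA !frM frV f1 f2; apply/eqP; rewrite -subr_eq0; apply/eqP.
  have bE : b = - (a1 + a3 * xi) / a2.
    apply: (mulfI a20); have -> : a2 * (- (a1 + a3 * xi) / a2) = - (a1 + a3 * xi) by field.
    by apply/eqP; rewrite -subr_eq0 -rel; apply/eqP; ring.
  have b1E : phi b = - (a1 + a3 * phi xi) / a2 by rewrite bE !(frM, frN, frA, frV) f1 f2 f3.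
  transitivity ((phi g - g) + (a1 / a2) * (phi xi - xi)); first by ring.
  by rewrite D b1E bE; field.
have : dot (vadd (vadd u (vscale ka x)) (vscale (- (a1 / a2)) w)) l = 0.
  rewrite !dotDl !dotZl lu -XE -WE WX.
  by rewrite /ka; ring.
move/eqP; rewrite dotC; apply/negP; apply: type3_nperp => //; last first.
  by rewrite !vphiD !vphiZ uf xf wf kf frN frM frV f1 f2.
apply/eqP => h; have := congr1 (fun z => dot z d) h.
rewrite !dotDl !dotZl ud xd mulr0 !add0r dot0l => /eqP.
rewrite mulf_eq0 (negbTE wd) orbF oppr_eq0 => /eqP aa.
have := @fix_combP u x 1 ka uxn; rewrite vscale1.
have -> : vadd u (vscale ka x) = v0 K.
  by rewrite -h aa; apply: vecP; rewrite /=; ring.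
by case=> // /eqP; rewrite oner_eq0.
Qed.

End Plane.

End FigueroaIncidence.
Import FigueroaIncidence.

(** * Uniqueness of joins and the number of lines through a point *)

Module FigueroaStars.
Local Open Scope ring_scope.

Section Plane2.
Variables (K : finFieldType) (ch : 2 \in [pchar K]) (e : nat).
Hypothesis cardK : #|K| = ((2 ^ e) ^ 6)%N.
Notation phi := (fr_of ch (2 * e)).
Notation vphi := (vmap phi).
Notation type3 := (type3 ch e).
Notation finc := (finc ch e).
Implicit Types u v w n : vec K.
Let phi3 := phi3 ch cardK.
Let vphi3 := vphi3 ch cardK.

Lemma dot0l n : dot (v0 K) n = 0. Proof. by rewrite /dot /=; ring. Qed.
Lemma vscale0 v : vscale 0 v = v0 K. Proof. by apply: vecP; rewrite /= mul0r. Qed.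
Lemma vscale_v0 k : vscale k (v0 K) = v0 K. Proof. by apply: vecP; rewrite /= mulr0. Qed.

Lemma dot_comb3 (a b c : K) u x w n :
  dot (vadd (vadd (vscale a u) (vscale b x)) (vscale c w)) n = a * dot u n + b * dot x n + c * dot w n.
Proof. by rewrite !dotDl !dotZl. Qed.

Lemma det3_comb u x w (c d f : vec K) :
  let cb c := vadd (vadd (vscale c.1.1 u) (vscale c.1.2 x)) (vscale c.2 w) in
  det3 (cb c) (cb d) (cb f) = det3 c d f * det3 u x w.
Proof. by rewrite /det3 /dot /cross /=; ring. Qed.

Lemma type3_coord u x w (c : vec K) : vphi u = u -> vphi x = x -> vphi w = w ->
  type3 (vadd (vadd (vscale c.1.1 u) (vscale c.1.2 x)) (vscale c.2 w)) -> type3 c.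
Proof.
move=> uf xf wf; rewrite /Frames.type3; apply: contraNN => /eqP d0.
rewrite !vphiD !vphiZ !uf !xf !wf.
by have /= -> := det3_comb u x w c (vphi c) (vphi (vphi c)); rewrite d0 mul0r.
Qed.

Lemma det3_basis a b c v : det3 a b c != 0 ->
  v = vadd (vadd (vscale (det3 v b c / det3 a b c) a) (vscale (det3 v c a / det3 a b c) b))
        (vscale (det3 v a b / det3 a b c) c).
Proof.
move=> d0; apply: vecP; apply: (mulfI d0); rewrite /=.
- have -> x y z t : t * (x / t * a.1.1 + y / t * b.1.1 + z / t * c.1.1) =
     t / t * (x * a.1.1 + y * b.1.1 + z * c.1.1) by ring.
  by rewrite mulfV // mul1r /det3 /dot /cross /=; ring.
- have -> x y z t : t * (x / t * a.1.2 + y / t * b.1.2 + z / t * c.1.2) =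
     t / t * (x * a.1.2 + y * b.1.2 + z * c.1.2) by ring.
  by rewrite mulfV // mul1r /det3 /dot /cross /=; ring.
- have -> x y z t : t * (x / t * a.2 + y / t * b.2 + z / t * c.2) =
     t / t * (x * a.2 + y * b.2 + z * c.2) by ring.
  by rewrite mulfV // mul1r /det3 /dot /cross /=; ring.
Qed.

(** Two different such lines would force a point of the subplane onto the ordinary join of [v] and
    [v']. That join would then be a Figueroa line not of type III through both points, contrary to
    [join_mixed]. *)
Lemma join_II v v' l l' : type3 v -> ~~ type3 v' -> v' != v0 K -> type3 l -> type3 l' ->
  dot v' l = 0 -> dot v' l' = 0 -> finc v l -> finc v l' -> cross l l' = v0 K.
Proof.
move=> tv tv' v'n tl tl' v'l v'l' vl vl'.
have [d [dn df v'd]] := type3N_perp v'n tv'.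
have [u [x [g [k [uf xf k0 v'E [c c0 ux]]]]]] := fix_split v'n dn df v'd.
have uxn : cross u x != v0 K by rewrite ux vscale_eq0.
have ud : dot u d = 0 by apply: (mulfI c0); rewrite mulr0 -dotZr -ux dot_crossl.
have xd : dot x d = 0 by apply: (mulfI c0); rewrite mulr0 -dotZr -ux dot_crossr.
have xn : x != v0 K.
  by apply: contraNneq uxn => ->; apply/eqP; apply: vecP; rewrite /=; ring.
have [w wf wd] : exists2 w, vphi w = w & dot w d != 0.
  case: (vec_neq0 dn) => z0.
  - by exists (1, 0, 0); [apply: vecP; rewrite /= ?fr0 ?fr1|rewrite /dot /= mul1r !mul0r !addr0].
  - by exists (0, 1, 0); [apply: vecP; rewrite /= ?fr0 ?fr1|rewrite /dot /= mul1r !mul0r addr0 add0r].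
  - by exists (0, 0, 1); [apply: vecP; rewrite /= ?fr0 ?fr1|rewrite /dot /= mul1r !mul0r !add0r].
have D0 : det3 u x w != 0 by rewrite -det3_rot /det3 ux dotZr mulf_neq0.
have [ka [la [p vE]]] : exists ka la p,
    v = vadd (vadd (vscale ka u) (vscale la x)) (vscale p w).
  by eexists; eexists; eexists; apply: (det3_basis v D0).
have p0 : p != 0.
  have := type3_nperp tv dn df; apply: contraNneq => p0.
  by rewrite vE p0 dot_comb3 ud xd !mulr0 mul0r !addr0.
have pi0 : p^-1 != 0 by rewrite invr_eq0.
wlog p1 : v ka la p p0 pi0 tv vl vl' vE / p = 1.
  move=> W; apply: (W (vscale p^-1 v) (ka / p) (la / p) 1).
  - exact: oner_neq0.
  - by rewrite invr_eq0 oner_neq0.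
  - by rewrite type3Z.
  - by rewrite fincZ.
  - by rewrite fincZ.
  - by rewrite vE; apply: vecP; rewrite /=; field.
  - by [].
rewrite p1 vscale1 in vE.
have lx : dot x l != 0 by rewrite dotC; exact: (type3_nperp tl xn xf).
have lx' : dot x l' != 0 by rewrite dotC; exact: (type3_nperp tl' xn xf).
have par y z : cross y z = v0 K -> forall s t, s != 0 -> t != 0 -> cross (vscale s^-1 y) (vscale t^-1 z) = v0 K.
  by move=> h s t _ _; rewrite cross_scale cross_scaler h !vscale_v0.
wlog lx1 : l tl v'l vl lx / dot x l = 1.
  move=> W; have li : (dot x l)^-1 != 0 by rewrite invr_eq0.
  have := W (vscale (dot x l)^-1 l); rewrite type3Z // dotZr v'l mulr0 fincC fincZ // fincC dotZr mulVf //.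
  move=> /(_ tl erefl vl (oner_neq0 _) erefl); rewrite cross_scale => h.
  by apply/eqP; rewrite -(vscale_eq0 _ li) h.
wlog lx1' : l' tl' v'l' vl' lx' / dot x l' = 1.
  move=> W; have li : (dot x l')^-1 != 0 by rewrite invr_eq0.
  have := W (vscale (dot x l')^-1 l'); rewrite type3Z // dotZr v'l' mulr0 fincC fincZ // fincC dotZr mulVf //.
  move=> /(_ tl' erefl vl' (oner_neq0 _) erefl); rewrite cross_scaler => h.
  by apply/eqP; rewrite -(vscale_eq0 _ li) h.
have luE y : dot v' y = 0 -> dot x y = 1 -> dot u y = - g.
  move=> v'y xy; have : dot (vadd u (vscale g x)) y = 0.
    by apply: (mulfI k0); rewrite -dotZl -v'E v'y mulr0.
  by rewrite dotDl dotZl xy mulr1 => /eqP; rewrite addr_eq0 => /eqP.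
have lu := luE _ v'l lx1; have lu' := luE _ v'l' lx1'.
have fd z y : vphi z = z -> dot z (vphi y) = phi (dot z y) by move=> zf; rewrite phi_dot zf.
have eqn y : type3 y -> dot u y = - g -> dot x y = 1 -> finc v y ->
  (ka * - g + la + dot w y) * (phi ka * - phi g + phi la + phi (dot w y)) =
  (ka * - phi g + la + phi (dot w y)) * (phi ka * - g + phi la + dot w y).
  move=> ty uy xy; rewrite /FigueroaIncidence.finc tv ty /= => /eqP; rewrite vE.
  rewrite !vphiD !vphiZ uf xf wf !dotDl !dotZl !fd // uy xy !(frA, frM, frN, fr1).
  by rewrite !mulr1.
have := eqn _ tl lu lx1 vl; have := eqn _ tl' lu' lx1' vl'.
have [xi xiE] : exists xi, xi = dot w l by exists (dot w l).
have [xi' xiE'] : exists xi', xi' = dot w l' by exists (dot w l').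
rewrite -xiE -xiE' => Q' Q.
have [eta etaE] : exists eta, xi = xi' + eta by exists (xi - xi'); ring.
(* The products [xi * phi xi] cancel in the incidence equation, which is therefore affine in [xi]
   and [phi xi]; subtracting its two instances leaves a relation linear in [eta] and [phi eta]. *)
have E1 : eta * (phi g * (ka - phi ka) + (phi la - la)) = phi eta * (g * (ka - phi ka) + (phi la - la)).
  rewrite etaE frA in Q; apply/eqP; rewrite -subr_eq0; apply/eqP.
  have -> : eta * (phi g * (ka - phi ka) + (phi la - la)) - phi eta * (g * (ka - phi ka) + (phi la - la))
   = ((ka * - g + la + (xi' + eta)) * (phi ka * - phi g + phi la + (phi xi' + phi eta)) -
      (ka * - phi g + la + (phi xi' + phi eta)) * (phi ka * - g + phi la + (xi' + eta)))
   - ((ka * - g + la + xi') * (phi ka * - phi g + phi la + phi xi') -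
      (ka * - phi g + la + phi xi') * (phi ka * - g + phi la + xi')) by ring.
  by rewrite Q Q' !subrr.
have [eta0|eta0] := eqVneq eta 0.
  have : vadd l (vscale (-1) l') = v0 K.
    apply: (det3_perp D0); rewrite dotC dotDl dotZl [dot l _]dotC [dot l' _]dotC.
    - by rewrite lu lu'; ring.
    - by rewrite lx1 lx1'; ring.
    - by rewrite -xiE -xiE' etaE eta0; ring.
  move=> h; have -> : l = l'.
    apply: vecP; apply/eqP; rewrite -subr_eq0; apply/eqP.
    - by have := congr1 (fun z : vec K => z.1.1) h; rewrite /= mulN1r.
    - by have := congr1 (fun z : vec K => z.1.2) h; rewrite /= mulN1r.
    - by have := congr1 (fun z : vec K => z.2) h; rewrite /= mulN1r.
  exact: crossvv.
exfalso.
have [ze zeE] : exists ze, ze * eta = 1 by exists eta^-1; rewrite mulVf.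
have ze0 : ze != 0.
  by apply/eqP => z0; have := oner_neq0 K; rewrite -zeE z0 mul0r eqxx.
have zeE1 : phi ze * phi eta = 1 by rewrite -frM zeE fr1.
have E2 : (phi ka - ka) * (phi (g * ze) - g * ze) = (phi la - la) * (phi ze - ze).
  have := congr1 (fun z => ze * phi ze * z) E1; rewrite frM => E1'.
  apply/eqP; rewrite -subr_eq0; apply/eqP.
  transitivity (ze * phi ze * (phi eta * (g * (ka - phi ka) + (phi la - la)))
     - ze * phi ze * (eta * (phi g * (ka - phi ka) + (phi la - la)))); last by rewrite E1' subrr.
  transitivity ((phi ze * phi eta) * ze * (g * (ka - phi ka) + (phi la - la))
    - (ze * eta) * phi ze * (phi g * (ka - phi ka) + (phi la - la))); last by ring.
  by rewrite zeE zeE1; ring.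
have tc : type3 (ka, la, 1).
  by apply: (@type3_coord u x w (ka, la, 1)) => //; rewrite /= vscale1 -vE.
have x0 : phi ka - ka != 0.
  apply: contraTneq tc => /eqP; rewrite subr_eq0 => /eqP kf.
  apply: (@perp_type3N _ ch e (ka, la, 1) (1, 0, - ka)).
  - by rewrite !xpair_eqE oner_eq0.
  - by apply: vecP; rewrite /= ?fr1 ?fr0 // frN kf.
  - by rewrite /dot /=; ring.
have x1 : phi (phi ka) - phi ka != 0 by rewrite -frB fr_eq0.
have xy : (phi ka - ka) * (phi (phi la) - phi la) - (phi (phi ka) - phi ka) * (phi la - la) != 0.
  move: tc; rewrite /Frames.type3; congr (_ != 0).
  by rewrite /det3 /dot /cross /= !fr1; ring.
have E3 := congr1 phi E2; have E4 := congr1 phi E3.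
rewrite !(frM, frB) !phi3 in E3 E4; rewrite frM in E2.
(* A combination of the three conjugates of [E2] in which the terms with [g * ze] telescope. What
   remains is the claim times the determinant [xy], nonzero because [v] has type III. *)
have par2 : (phi ze - ze) * (phi (phi ka) - phi ka) = (phi (phi ze) - phi ze) * (phi ka - ka).
  apply: (mulfI xy); apply/eqP; rewrite -subr_eq0; apply/eqP.
  move: E2 E3 E4.
  move: (phi ka) (phi (phi ka)) (phi la) (phi (phi la)) (phi ze) (phi (phi ze)) (phi g) (phi (phi g)).
  move=> k1 k2 l1 l2 z1 z2 g1 g2 E2 E3 E4.
  transitivity ((k2 - k1) * ((k1 - ka) + (k2 - k1)) * ((k1 - ka) * (g1 * z1 - g * ze) - (l1 - la) * (z1 - ze))
     + (k1 - ka) * ((k1 - ka) + (k2 - k1)) * ((k2 - k1) * (g2 * z2 - g1 * z1) - (l2 - l1) * (z2 - z1))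
     - (k1 - ka) * (k2 - k1) * ((ka - k2) * (g * ze - g2 * z2) - (la - l2) * (ze - z2))).
    by ring.
  by rewrite E2 E3 E4; ring.
pose ta := (phi ze - ze) / (phi ka - ka).
have taf : phi ta = ta.
  rewrite /ta frM frV !frB; apply: (mulIf x0); apply: (mulIf x1).
  by rewrite mulfVK // [in LHS]mulrAC mulfVK // par2.
have ta0 : ta != 0.
  rewrite /ta mulf_neq0 ?invr_eq0 //; apply/negP => /eqP zf.
  rewrite zf mulr0 in E2; move/eqP: E2; rewrite mulf_eq0 (negbTE x0) /=.
  rewrite (subr0_eq zf) -mulrBl mulf_eq0 (negbTE ze0) orbF subr_eq0 => /eqP gf.
  have : dot (vadd u (vscale g x)) l = 0 by rewrite dotDl dotZl lu lx1; ring.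
  have Df : vphi (vadd u (vscale g x)) = vadd u (vscale g x) by rewrite vphiD vphiZ uf xf gf.
  have Dn : vadd u (vscale g x) != v0 K.
    apply/eqP => h; have := @fix_combP _ u x 1 g uxn.
    by rewrite vscale1 => /(_ h)[/eqP]; rewrite oner_eq0.
  by move/eqP; rewrite dotC (negbTE (type3_nperp tl Dn Df)).
have zeta : phi ze - ze = ta * (phi ka - ka) by rewrite /ta mulfVK.
have zg : phi (g * ze) - g * ze = ta * (phi la - la).
  by apply: (mulfI x0); rewrite frM E2 zeta; ring.
(* By [zeta] and [zg], [phi] changes [ze] and [g * ze] by [ta] times the changes of [ka] and [la],
   so this combination of [v] and [v'] is fixed. *)
pose wp := vadd (vscale ta v) (vscale (- ze / k) v').
have wpE : wp = vadd (vadd (vscale (ta * ka - ze) u) (vscale (ta * la - g * ze) x)) (vscale ta w).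
  by rewrite /wp v'E vE; apply: vecP; rewrite /=; field.
have wpf : vphi wp = wp.
  rewrite wpE !vphiD !vphiZ uf xf wf taf !frB frM taf frM taf.
  have -> : ta * phi ka - phi ze = ta * ka - ze.
    by apply/eqP; rewrite -subr_eq0; apply/eqP; transitivity (ta * (phi ka - ka) - (phi ze - ze)); [ring|rewrite zeta subrr].
  have -> // : ta * phi la - phi (g * ze) = ta * la - g * ze.
  by apply/eqP; rewrite -subr_eq0; apply/eqP; transitivity (ta * (phi la - la) - (phi (g * ze) - g * ze)); [ring|rewrite zg subrr].
have wpn : wp != v0 K.
  apply/eqP => h; have := congr1 (fun z => dot z d) h; rewrite wpE dot_comb3 ud xd !mulr0 !add0r dot0l => /eqP.
  by rewrite mulf_eq0 (negbTE ta0) (negbTE wd).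
have vn := type3_neq0 tv.
have mn : cross v v' != v0 K.
  apply/negP => /eqP/(cross_par vn)[j jE]; move: tv' v'n; rewrite jE => tj jn.
  by move: tj; rewrite type3Z ?tv //; apply: contraNneq jn => ->; rewrite vscale0.
apply: (@join_mixed _ ch e cardK v v' l (cross v v')) => //; rewrite ?dot_crossl ?dot_crossr //.
apply: (@perp_type3N _ ch e _ wp) => //.
by rewrite dotC /wp dotDl !dotZl dot_crossl dot_crossr !mulr0 addr0.
Qed.

(** Forming the cross product with a conjugate twice returns a multiple of the original vector, so
    nothing is lost up to scalars. *)
Lemma mu_par n n' : type3 n -> type3 n' -> cross (cross n (vphi n)) (cross n' (vphi n')) = v0 K ->
  cross n n' = v0 K.
Proof.
move=> tn tn' /(cross_par (type3_cross tn))[k kE].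
have rec y : cross (cross y (vphi y)) (vphi (vphi (cross y (vphi y)))) =
   vscale (- det3 y (vphi y) (vphi (vphi y))) y.
  rewrite !(vmap_cross (fr_of ch (2 * e))) vphi3.
  by apply: vecP; rewrite /det3 /dot /cross /=; ring.
have := rec n'; rewrite kE !vphiZ cross_scale cross_scaler vscaleA rec vscaleA => h.
have D0 : - det3 n' (vphi n') (vphi (vphi n')) != 0 by rewrite oppr_eq0.
apply/eqP; rewrite -(vscale_eq0 _ D0) -cross_scaler -h cross_scaler crossvv vscale_v0; exact/eqP.
Qed.

(** If all four elements have type III, mu reduces the claim to the ordinary plane; if all four
    incidences are ordinary, there is nothing new. The mixed distributions of types are covered by
    [join_II], its dual, and [join_mixed]. *)
Theorem finc_unique v v' n n' : v != v0 K -> v' != v0 K -> n != v0 K -> n' != v0 K ->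
  finc v n -> finc v' n -> finc v n' -> finc v' n' -> cross v v' = v0 K \/ cross n n' = v0 K.
Proof.
move=> vn v'n nn n'n i1 i2 i3 i4.
have lin a b c d : dot a c = 0 -> dot b c = 0 -> dot a d = 0 -> dot b d = 0 ->
    cross a b = v0 K \/ cross c d = v0 K.
  move=> h1 h2 h3 h4; have [z|z] := eqVneq (cross a b) (v0 K); first by left.
  have [k ->] := perp_cross z h1 h2; have [k' ->] := perp_cross z h3 h4.
  by right; rewrite cross_scale cross_scaler crossvv !vscale_v0.
have ord a b : ~~ type3 a || ~~ type3 b -> finc a b -> dot a b = 0.
  by rewrite /FigueroaIncidence.finc -negb_and => /negbTE -> /eqP.
case tv: (type3 v); case tv': (type3 v'); case tn: (type3 n); case tn': (type3 n').
- have [z|z] := eqVneq (cross (cross v (vphi v)) (cross v' (vphi v'))) (v0 K).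
    by left; apply: mu_par.
  right; apply: mu_par => //; move: i1 i2 i3 i4; rewrite !finc_cross //.
  move=> /eqP h1 /eqP h2 /eqP h3 /eqP h4.
  have [k ->] := perp_cross z h1 h2; have [k' ->] := perp_cross z h3 h4.
  by rewrite cross_scale cross_scaler crossvv !vscale_v0.
- left; apply: (@join_II n n' v v'); rewrite ?tn ?tn' 1?fincC //; rewrite dotC; apply: ord => //; by rewrite ?tn' ?orbT.
- left; apply: (@join_II n' n v v'); rewrite ?tn ?tn' 1?fincC //; rewrite dotC; apply: ord => //; by rewrite ?tn ?orbT.
- by apply: lin; apply: ord; rewrite ?tn ?tn' ?orbT.
- right; apply: (@join_II v v' n n'); rewrite ?tv ?tv' //; apply: ord => //; by rewrite tv'.
- exfalso; apply: (@join_mixed _ ch e cardK v v' n n'); rewrite ?tv ?tv' ?tn ?tn' //; apply: ord => //; by rewrite ?tv' ?tn' ?orbT.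
- exfalso; apply: (@join_mixed _ ch e cardK v v' n' n); rewrite ?tv ?tv' ?tn ?tn' //; apply: ord => //; by rewrite ?tv' ?tn ?orbT.
- by apply: lin; apply: ord; rewrite ?tn ?tn' ?orbT.
- right; apply: (@join_II v' v n n'); rewrite ?tv ?tv' //; apply: ord => //; by rewrite tv.
- exfalso; apply: (@join_mixed _ ch e cardK v' v n n'); rewrite ?tv ?tv' ?tn ?tn' //; apply: ord => //; by rewrite ?tv ?tn' ?orbT.
- exfalso; apply: (@join_mixed _ ch e cardK v' v n' n); rewrite ?tv ?tv' ?tn ?tn' //; apply: ord => //; by rewrite ?tv ?tn ?orbT.
- by apply: lin; apply: ord; rewrite ?tn ?tn' ?orbT.
- by apply: lin; apply: ord; rewrite ?tv ?tv'.
- by apply: lin; apply: ord; rewrite ?tv ?tv'.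
- by apply: lin; apply: ord; rewrite ?tv ?tv'.
- by apply: lin; apply: ord; rewrite ?tv ?tv'.
Qed.

Lemma perp_basis v : v != v0 K -> exists a b,
  [/\ cross a b != v0 K, dot v a = 0 & dot v b = 0].
Proof.
move=> vn; case: (vec_neq0 vn) => z0.
- exists (- v.1.2, v.1.1, 0), (- v.2, 0, v.1.1); split; rewrite /dot /=; try ring.
  rewrite !xpair_eqE /= negb_and negb_and; apply/orP; left; apply/orP; left.
  by rewrite !mulr0 subr0 mulf_neq0.
- exists (v.1.2, - v.1.1, 0), (0, - v.2, v.1.2); split; rewrite /dot /=; try ring.
  rewrite !xpair_eqE /= negb_and negb_and; apply/orP; left; apply/orP; right.
  by rewrite !mulr0 sub0r oppr_eq0 mulf_neq0.
- exists (v.2, 0, - v.1.1), (0, v.2, - v.1.2); split; rewrite /dot /=; try ring.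
  rewrite !xpair_eqE /= negb_and; apply/orP; right.
  by rewrite !mulr0 subr0 mulf_neq0.
Qed.

(* [star v] maps the ordinary lines of type III through a point v of type III to the Figueroa
   lines of type III through v: it sends n to the line m with [mu m] on n and [mu v]. *)
Definition starX v n := vadd (vscale (dot n (vphi (vphi v))) (vphi v)) (vscale (dot n (vphi v)) (vphi (vphi v))).
Definition star v n := cross (vphi (starX v n)) (vphi (vphi (starX v n))).

Lemma vphi_starX v n : dot v n = 0 ->
  vphi (starX v n) = vadd (vscale (phi (dot n (vphi (vphi v)))) (vphi (vphi v))) (vscale (phi (dot n (vphi v))) v).
Proof. by move=> h; rewrite /starX vphiD !vphiZ vphi3. Qed.

Lemma gram_det3 (a b c x y z : vec K) : det3 a b c * det3 x y z =
  det3 (dot a x, dot a y, dot a z) (dot b x, dot b y, dot b z) (dot c x, dot c y, dot c z).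
Proof. by rewrite /det3 /dot /cross /=; ring. Qed.

(** The determinants of [n] and [v] multiply to a Gram determinant with zero diagonal, in which only
    the norms of [t] and [s] to the fixed field of [phi] survive. The same sum of norms is the
    factor in the determinant of [starX v n]. *)
Lemma starX_type3 v n : type3 v -> type3 n -> dot v n = 0 -> type3 (starX v n).
Proof.
move=> tv tn vn; rewrite /Frames.type3 vphi_starX //.
set t := dot n _; set s := dot n (vphi v).
have -> : vphi (vadd (vscale (phi t) (vphi (vphi v))) (vscale (phi s) v)) =
   vadd (vscale (phi (phi t)) v) (vscale (phi (phi s)) (vphi v)).
  by rewrite vphiD !vphiZ vphi3.
have -> : det3 (starX v n) (vadd (vscale (phi t) (vphi (vphi v))) (vscale (phi s) v))
    (vadd (vscale (phi (phi t)) v) (vscale (phi (phi s)) (vphi v))) =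
  (t * phi t * phi (phi t) + s * phi s * phi (phi s)) * det3 v (vphi v) (vphi (vphi v)).
  by rewrite /starX -/t -/s /det3 /dot /cross /=; ring.
have : det3 n (vphi n) (vphi (vphi n)) * det3 v (vphi v) (vphi (vphi v)) != 0 by rewrite mulf_neq0.
have d00 : dot n v = 0 by rewrite dotC.
have d11 : dot (vphi n) (vphi v) = 0 by rewrite -phi_dot d00 fr0.
have d22 : dot (vphi (vphi n)) (vphi (vphi v)) = 0 by rewrite -phi_dot d11 fr0.
have d10 : dot (vphi n) v = phi t by rewrite /t phi_dot vphi3.
have d12 : dot (vphi n) (vphi (vphi v)) = phi s by rewrite phi_dot.
have d20 : dot (vphi (vphi n)) v = phi (phi s) by rewrite !phi_dot vphi3.
have d21 : dot (vphi (vphi n)) (vphi v) = phi (phi t) by rewrite /t !phi_dot vphi3.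
rewrite gram_det3 d00 d11 d22 d10 d12 d20 d21 -/t -/s => h.
rewrite mulf_neq0 //; apply: contraNneq h => h0.
by apply/eqP; rewrite -[RHS]h0 /det3 /dot /cross /=; ring.
Qed.

Lemma star_type3 v n : type3 v -> type3 n -> dot v n = 0 -> type3 (star v n).
Proof.
move=> tv tn vn; have tX := starX_type3 tv tn vn; move: tX; rewrite /Frames.type3 /star.
set X := starX v n; rewrite !(vmap_cross (fr_of ch (2 * e))) vphi3 => tX.
have -> : det3 (cross (vphi X) (vphi (vphi X))) (cross (vphi (vphi X)) X) (cross X (vphi X)) =
   det3 X (vphi X) (vphi (vphi X)) ^+ 2 by rewrite /det3 /dot /cross /=; ring.
by rewrite expf_eq0.
Qed.

Lemma star_finc v n : type3 v -> type3 n -> dot v n = 0 -> finc v (star v n).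
Proof.
move=> tv tn vn; rewrite finc_cross ?star_type3 // /star.
set X := starX v n; rewrite !(vmap_cross (fr_of ch (2 * e))) vphi3.
have -> : cross (cross (vphi X) (vphi (vphi X))) (cross (vphi (vphi X)) X) =
   vscale (det3 X (vphi X) (vphi (vphi X))) (vphi (vphi X)).
  by apply: vecP; rewrite /det3 /dot /cross /=; ring.
rewrite dotZr /X vphi_starX // vphiD !vphiZ vphi3.
by rewrite /dot /cross /=; apply/eqP; ring.
Qed.

Lemma star_inj v n n' : type3 v -> type3 n -> type3 n' -> dot v n = 0 -> dot v n' = 0 ->
  cross (star v n) (star v n') = v0 K -> cross n n' = v0 K.
Proof.
move=> tv tn tn' vn vn' h.
have sn : star v n != v0 K by apply: type3_neq0 (star_type3 tv tn vn).
have rec m : cross (vphi (star v m)) (vphi (vphi (star v m))) =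
   vscale (det3 (starX v m) (vphi (starX v m)) (vphi (vphi (starX v m)))) (starX v m).
  rewrite /star; set X := starX v m; rewrite !(vmap_cross (fr_of ch (2 * e))) !vphi3.
  by apply: vecP; rewrite /det3 /dot /cross /=; ring.
have [k kE] := cross_par sn h.
have := rec n'; rewrite kE !vphiZ cross_scale cross_scaler vscaleA rec vscaleA.
have tX' : det3 (starX v n') (vphi (starX v n')) (vphi (vphi (starX v n'))) != 0.
  exact: starX_type3.
set c := _ * _; set c' := det3 _ _ _ in tX' * => E.
have {}E : starX v n' = vscale (c'^-1 * c) (starX v n).
  by rewrite -vscaleA E vscaleA mulVf // vscale1.
move: (c'^-1 * c) E => {c c' tX'} c E.
have cv : cross (vphi v) (vphi (vphi v)) != v0 K by apply: type3_cross; rewrite type3_phi.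
have [|t0 s0] := @fix_combP _ (vphi v) (vphi (vphi v))
   (dot n' (vphi (vphi v)) - c * dot n (vphi (vphi v))) (dot n' (vphi v) - c * dot n (vphi v)) cv.
  apply: vecP; apply/eqP; rewrite -subr_eq0; apply/eqP.
  - have := congr1 (fun z : vec K => z.1.1) E; rewrite /= => E'; transitivity
      ((starX v n').1.1 - (vscale c (starX v n)).1.1); [by rewrite /=; ring|by rewrite E subrr].
  - have := congr1 (fun z : vec K => z.1.2) E; rewrite /= => E'; transitivity
      ((starX v n').1.2 - (vscale c (starX v n)).1.2); [by rewrite /=; ring|by rewrite E subrr].
  - have := congr1 (fun z : vec K => z.2) E; rewrite /= => E'; transitivity
      ((starX v n').2 - (vscale c (starX v n)).2); [by rewrite /=; ring|by rewrite E subrr].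
have : vadd n' (vscale (- c) n) = v0 K.
  apply: (det3_perp tv); rewrite dotC dotDl dotZl.
  - by rewrite ![dot _ v]dotC vn vn'; ring.
  - by rewrite -[RHS]s0; ring.
  - by rewrite -[RHS]t0; ring.
move=> z; have -> : n' = vscale c n.
  apply: vecP; apply/eqP; rewrite -subr_eq0; apply/eqP.
  - by rewrite -[RHS](congr1 (fun z : vec K => z.1.1) z) /=; ring.
  - by rewrite -[RHS](congr1 (fun z : vec K => z.1.2) z) /=; ring.
  - by rewrite -[RHS](congr1 (fun z : vec K => z.2) z) /=; ring.
by rewrite cross_scaler crossvv vscale_v0.
Qed.

(** The ordinary pencil of [v], parametrized by [option K], is mapped injectively into the Figueroa
    pencil: lines of type III on a point of type III are replaced by their images under [star]. The
    map [pr] may be any one that separates nonproportional vectors. *)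
Lemma deg_lb (T : finType) (pr : vec K -> T) v : v != v0 K ->
  (forall n n', n != v0 K -> n' != v0 K -> pr n = pr n' -> cross n n' = v0 K) ->
  (#|K|.+1 <= #|[set pr n | n in [set n : vec K | (n != v0 K) && finc v n]]|)%N.
Proof.
move=> vn prP.
have [a [b [ab va vb]]] := perp_basis vn.
pose N (o : option K) := if o is Some t then vadd a (vscale t b) else b.
pose G n := if type3 v && type3 n then star v n else n.
have vN o : dot v (N o) = 0.
  by case: o => [t|] //=; rewrite dotC dotDl dotZl ![dot _ v]dotC va vb mulr0 addr0.
have Ninj o o' : cross (N o) (N o') = v0 K -> o = o'.
  case: o o' => [t|] [t'|] //= h.
  - have : vscale (t' - t) (cross a b) = v0 K by rewrite -h; apply: vecP; rewrite /=; ring.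
    have [->//|tt] := eqVneq t t'; move/eqP; rewrite vscale_eq0 ?(negbTE ab) //.
    by rewrite subr_eq0 eq_sym.
  - by move/eqP: ab; case; rewrite -h; apply: vecP; rewrite /=; ring.
  - by move/eqP: ab; case; apply: vecP; apply/eqP; rewrite -oppr_eq0; apply/eqP;
      [rewrite -[RHS](congr1 (fun z : vec K => z.1.1) h)|rewrite -[RHS](congr1 (fun z : vec K => z.1.2) h)
      |rewrite -[RHS](congr1 (fun z : vec K => z.2) h)]; rewrite /=; ring.
have N0 o : N o != v0 K.
  apply: contraNneq ab => N0; case: o N0 => [t|] /= h; last by rewrite h; apply/eqP; apply: vecP; rewrite /=; ring.
  have -> : cross a b = cross (vadd a (vscale t b)) b by apply: vecP; rewrite /=; ring.
  by rewrite h; apply/eqP; apply: vecP; rewrite /=; ring.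
have G0 o : G (N o) != v0 K.
  rewrite /G; case: ifP => // /andP[tv tn]; exact: type3_neq0 (star_type3 tv tn (vN o)).
have Gf o : finc v (G (N o)).
  rewrite /G; case: ifP => [/andP[tv tn]|h]; first exact: star_finc.
  by rewrite /FigueroaIncidence.finc h vN.
have Ginj : injective (fun o => pr (G (N o))).
  move=> o o' /prP h; apply: Ninj; have {h} := h (G0 _) (G0 _).
  have nt x y : type3 x -> ~~ type3 y -> x != v0 K -> y != v0 K -> cross x y = v0 K -> False.
    move=> tx ty xn yn /(cross_par xn)[k kE]; move: ty; rewrite kE type3Z ?tx //.
    by apply: contraNneq yn => k0; rewrite kE k0 vscale0.
  have cC x y : cross x y = v0 K -> cross y x = v0 K.
    move=> h; apply: vecP; apply/eqP; rewrite -oppr_eq0; apply/eqP;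
      [rewrite -[RHS](congr1 (fun z : vec K => z.1.1) h)|rewrite -[RHS](congr1 (fun z : vec K => z.1.2) h)
      |rewrite -[RHS](congr1 (fun z : vec K => z.2) h)]; rewrite /=; ring.
  have := G0 o; have := G0 o'; rewrite /G.
  case tv: (type3 v) => //=; case tn: (type3 (N o)); case tn': (type3 (N o')) => // g g' h.
  - by apply: (star_inj tv tn tn').
  - by exfalso; apply: nt h; rewrite ?tn' // star_type3.
  - by exfalso; move/cC: h => h; apply: nt h; rewrite ?tn // star_type3.
rewrite -card_option -[X in (X <= _)%N](card_imset _ Ginj); apply: subset_leq_card.
apply/subsetP => t /imsetP[o _ ->]; apply: imset_f; rewrite inE G0; exact: Gf.
Qed.

End Plane2.

End FigueroaStars.
Import FigueroaStars.

(** * The polarity is given by a hermitian form on all points *)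

Module PolarityForm.
Local Open Scope ring_scope.

Section Polarity.
Variables (K : finFieldType) (ch : 2 \in [pchar K]) (e : nat).
Hypothesis cardK : #|K| = ((2 ^ e) ^ 6)%N.
Notation phi := (fr_of ch (2 * e)).
Notation bar := (fr_of ch (3 * e)).
Notation vphi := (vmap phi).
Notation vbar := (vmap bar).
Notation type3 := (type3 ch e).
Notation finc := (finc ch e).
Implicit Types u v w n : vec K.
Let phi3 := phi3 ch cardK.
Let vphi3 := vphi3 ch cardK.

Lemma barK x : bar (bar x) = x.
Proof. by rewrite frD -mulnDl -[RHS](fr6e ch cardK x). Qed.

Variable H : 'M[K]_3.
Hypotheses (HF : map_mx phi H = H) (Hh : H^T = map_mx bar H) (Hu : H \in unitmx).

Definition pol v : vec K := vr (rv (vbar v) *m H).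
Definition herm v w := dot w (pol v).

Lemma rv_pol v : rv (pol v) = rv (vbar v) *m H.
Proof. exact: vrK. Qed.

Lemma rv_inj : injective (@rv K). Proof. exact: can_inj (@rvK K). Qed.

Lemma polZ k v : pol (vscale k v) = vscale (bar k) (pol v).
Proof.
apply: rv_inj; rewrite rvZ !rv_pol scalemxAl -rvZ; congr (rv _ *m _).
by apply: vecP; rewrite /= frM.
Qed.

Lemma polD v w : pol (vadd v w) = vadd (pol v) (pol w).
Proof.
apply: rv_inj; rewrite rvD !rv_pol -mulmxDl -rvD; congr (rv _ *m _).
by apply: vecP; rewrite /= frA.
Qed.

Lemma pol_eq0 v : (pol v == v0 K) = (v == v0 K).
Proof.
rewrite -rv_eq0 rv_pol -(vmap_eq0 bar v) -rv_eq0.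
apply/eqP/eqP => [h|->]; last by rewrite mul0mx.
by rewrite -[rv _](mulmxK Hu) h mul0mx.
Qed.

Lemma pol_phi v : vphi (pol v) = pol (vphi v).
Proof.
apply: rv_inj; rewrite -map_rv !rv_pol map_mxM HF map_rv; congr (rv _ *m _).
by apply: vecP; rewrite /= frC.
Qed.

Lemma pol_inj : injective pol.
Proof.
move=> v w /(congr1 (@rv K)); rewrite !rv_pol => /(can_inj (mulmxK Hu))/rv_inj.
case: v w => [[a b] c] [[a' b'] c'] [] h1 h2 h3.
by rewrite (fr_inj h1) (fr_inj h2) (fr_inj h3).
Qed.

Lemma hermE v w : herm v w = (rv (vbar v) *m H *m (rv w)^T) 0 0.
Proof. by rewrite /herm dotC -rv_pol rv_dot !mxE mulr1n. Qed.

Lemma hermC v w : bar (herm v w) = herm w v.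
Proof.
have tr : (rv (vbar v) *m H *m (rv w)^T)^T = rv w *m (H^T *m (rv (vbar v))^T).
  by rewrite trmx_mul trmxK trmx_mul.
rewrite !hermE; have -> : (rv (vbar v) *m H *m (rv w)^T) 0 0 = (rv w *m (H^T *m (rv (vbar v))^T)) 0 0.
  by rewrite -tr [RHS]mxE.
rewrite Hh.
have -> : bar ((rv w *m (map_mx bar H *m (rv (vbar v))^T)) 0 0) =
   (map_mx bar (rv w *m (map_mx bar H *m (rv (vbar v))^T))) 0 0 by rewrite [RHS]mxE.
rewrite !map_mxM map_rv -map_trmx map_rv mulmxA.
have -> : map_mx bar (map_mx bar H) = H by apply/matrixP => i j; rewrite !mxE barK.
have -> // : vbar (vbar v) = v by apply: vecP; rewrite /= barK.
Qed.

Lemma hermDl u v w : herm (vadd u v) w = herm u w + herm v w.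
Proof. by rewrite /herm polD ![dot w _]dotC dotDl. Qed.
Lemma hermDr u v w : herm u (vadd v w) = herm u v + herm u w.
Proof. by rewrite /herm dotDl. Qed.
Lemma hermZl k v w : herm (vscale k v) w = bar k * herm v w.
Proof. by rewrite /herm polZ dotZr. Qed.
Lemma hermZr k v w : herm v (vscale k w) = k * herm v w.
Proof. by rewrite /herm dotZl. Qed.
Lemma herm_phi v w : phi (herm v w) = herm (vphi v) (vphi w).
Proof. by rewrite /herm phi_dot pol_phi. Qed.

Lemma pol_type3 v : type3 (pol v) = type3 v.
Proof.
rewrite /Frames.type3 !pol_phi.
have E : forall a b c, det3 (pol a) (pol b) (pol c) = bar (det3 a b c) * det3 (pol (1,0,0)) (pol (0,1,0)) (pol (0,0,1)).
  move=> a b c; have dec y : pol y = vadd (vadd (vscale (bar y.1.1) (pol (1,0,0)))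
     (vscale (bar y.1.2) (pol (0,1,0)))) (vscale (bar y.2) (pol (0,0,1))).
    by rewrite -!polZ -!polD; congr pol; apply: vecP; rewrite /=; ring.
  rewrite (dec a) (dec b) (dec c).
  have /= -> := det3_comb (pol (1,0,0)) (pol (0,1,0)) (pol (0,0,1)) (vbar a) (vbar b) (vbar c).
  by rewrite -(vmap_det3 bar).
have d0 : det3 (pol (1,0,0)) (pol (0,1,0)) (pol (0,0,1)) != 0.
  apply/eqP => /det3_eq0[n n0 [h1 h2 h3]].
  have : herm n (1,0,0) = 0 /\ herm n (0,1,0) = 0 /\ herm n (0,0,1) = 0.
    by rewrite -![herm n _]hermC /herm ![dot n _]dotC h1 h2 h3 fr0.
  case=> k1 [k2 k3]; move: n0; rewrite -pol_eq0 => /eqP; apply.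
  by apply: vecP; [rewrite -[RHS]k1|rewrite -[RHS]k2|rewrite -[RHS]k3]; rewrite /herm /dot /=; ring.
by rewrite E mulf_eq0 (negbTE d0) orbF fr_eq0.
Qed.

Lemma dot_pol_phi v w : dot w (vphi (pol v)) = herm (vphi v) w.
Proof. by rewrite pol_phi. Qed.

Lemma finc_pol v w : finc v (pol w) = finc w (pol v).
Proof.
rewrite /FigueroaIncidence.finc !pol_type3 [type3 w && _]andbC !dot_pol_phi -!/(herm _ _).
case: ifP => _.
  rewrite -[in LHS](hermC v w) -[in LHS](hermC v (vphi w)) -[in LHS](hermC (vphi v) w) frC -!frM.
  by rewrite (inj_eq (fr_inj (ch := ch) (i := 3 * e))) [X in _ == X]mulrC.
by rewrite -(hermC v w) fr_eq0.
Qed.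

Definition P v := pt (unitmx1 K 3) v.
Definition L n := ln (unitmx1 K 3) n.
Let EF1 : map_mx phi (1%:M : 'M[K]_3) = 1%:M. Proof. exact: map_mx1. Qed.

Lemma incPL v n : v != v0 K -> n != v0 K -> fig_inc ((2 ^ e) ^ 2) (P v) (L n) = finc v n.
Proof. by move=> vn nn; rewrite /P /L (fig_incE (unitmx1 K 3) EF1). Qed.

Lemma L_par v w : v != v0 K -> w != v0 K -> L v = L w -> exists2 k, k != 0 & w = vscale k v.
Proof. by move=> vn wn /eqP/(ln_eqP _ vn wn). Qed.
Lemma P_scale k v : k != 0 -> v != v0 K -> P (vscale k v) = P v.
Proof. by move=> k0 vn; apply/esym/eqP/(pt_eqP _ vn); rewrite ?vscale_eq0 //; exists k. Qed.
Lemma L_scale k v : k != 0 -> v != v0 K -> L (vscale k v) = L v.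
Proof. by move=> k0 vn; apply/esym/eqP/(ln_eqP _ vn); rewrite ?vscale_eq0 //; exists k. Qed.

Variables (pi : fpoint K -> fline K) (pi' : fline K -> fpoint K).
Hypothesis Hpol : polarity (@fig_inc K ((2 ^ e) ^ 2)) pi pi'.
Hypothesis HpiD : forall p : fpoint K, inD ((2 ^ e) ^ 2) p ->
  (val (pi p) == kermx (map_mx (fun x => x ^+ (2 ^ e)) (val p) *m H)^T)%MS.

Lemma piC p p' : fig_inc ((2 ^ e) ^ 2) p (pi p') = fig_inc ((2 ^ e) ^ 2) p' (pi p).
Proof. by case: Hpol => c1 c2 h; rewrite -h c1. Qed.

(** The correspondence from v to v' is the collineation composed of [pi] and the inverse of the
    polarity belonging to [pol]. It fixes the subplane pointwise and is to be shown trivial. *)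
Definition rel v v' := pi (P v) = L (pol v').

Lemma rel_fix w : w != v0 K -> vphi w = w -> rel w w.
Proof.
move=> wn wf; rewrite /rel; apply: val_inj.
have pn : pol w != v0 K by rewrite pol_eq0.
have : inD ((2 ^ e) ^ 2) (P w) by rewrite inD_pt // wf crossvv eqxx.
move/HpiD; rewrite val_pt // val_ln // => /eqmxP piE.
have /andP[/eqP <- _] := valP (pi (P w)).
apply/genmxP; apply/eqmxP; apply: eqmx_trans piE _; apply/eqmxP.
have fE : map_mx (fun x : K => x ^+ (2 ^ e)) (ptm 1%:M w) = map_mx (fr_of ch e) (ptm 1%:M w) by apply: eq_map_mx.
(* The hypothesis on the subplane uses x^q, while [pol] uses x^(q^3); the two agree on the field of
   order q^2. *)
have bw : vmap (fr_of ch e) w = vbar w.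
  case: w wf {wn pn fE} => [[x y] z] [f1 f2 f3]; apply: vecP; rewrite /=.
  - by rewrite (_ : 3 * e = e + 2 * e)%N; [rewrite -frD f1|lia].
  - by rewrite (_ : 3 * e = e + 2 * e)%N; [rewrite -frD f2|lia].
  - by rewrite (_ : 3 * e = e + 2 * e)%N; [rewrite -frD f3|lia].
have AE : (map_mx (fr_of ch e) (ptm 1%:M w) :=: rv (vbar w))%MS.
  apply: (eqmx_trans (map_genmx _ _)); apply: eqmx_trans (genmxE _) _.
  by rewrite mulmx1 map_rv bw.
rewrite fE invmx1 mul1mx rv_pol.
have sub1 (A B : 'M[K]_3) (C : 'rV[K]_3) : (A :=: C)%MS -> (B *m (A *m H)^T == 0) = (B *m (C *m H)^T == 0).
  move=> AC; apply/eqP/eqP => h.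
    have /submxP[D ->] : (C <= A)%MS by rewrite AC.
    by rewrite -mulmxA trmx_mul mulmxA h mul0mx.
  have /submxP[D ->] : (A <= C)%MS by rewrite AC.
  by rewrite -mulmxA trmx_mul mulmxA h mul0mx.
apply/andP; split; rewrite ?genmxE; apply/sub_kermxP/eqP.
  by rewrite -(sub1 _ _ _ AE) mulmx_ker.
by rewrite (sub1 _ _ _ AE); rewrite mulmx_ker.
Qed.

Lemma rel_ex v : v != v0 K -> exists2 v', v' != v0 K & rel v v'.
Proof.
move=> vn; have [n nn nE] := @lnP _ _ (unitmx1 K 3) (pi (P v)).
pose v' := vbar (vr (rv n *m invmx H)).
have v'E : pol v' = n.
  apply: rv_inj; rewrite rv_pol /v'.
  have -> : vbar (vbar (vr (rv n *m invmx H))) = vr (rv n *m invmx H) by apply: vecP; rewrite /= barK.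
  by rewrite vrK mulmxKV.
by exists v'; [rewrite -pol_eq0 v'E|rewrite /rel v'E].
Qed.

Lemma pol_surj n : n != v0 K -> exists2 w, w != v0 K & pol w = n.
Proof.
move=> nn; pose v' := vbar (vr (rv n *m invmx H)).
have v'E : pol v' = n.
  apply: rv_inj; rewrite rv_pol /v'.
  have -> : vbar (vbar (vr (rv n *m invmx H))) = vr (rv n *m invmx H) by apply: vecP; rewrite /= barK.
  by rewrite vrK mulmxKV.
by exists v'; first by rewrite -pol_eq0 v'E.
Qed.

Lemma rel_sym v v' w w' : v != v0 K -> v' != v0 K -> w != v0 K -> w' != v0 K ->
  rel v v' -> rel w w' -> finc v (pol w') = finc w (pol v').
Proof.
move=> vn v'n wn w'n r1 r2; rewrite -(incPL vn) ?pol_eq0 // -(incPL wn) ?pol_eq0 //.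
by move: r1 r2; rewrite /rel => <- <-; exact: piC.
Qed.

(** Both polarities reverse incidence, so the correspondence acts on lines too: the image of [n] is
    the [pol] of its pole under [pi]. *)
Lemma rel_line n : n != v0 K -> exists2 n', n' != v0 K &
  forall v v', v != v0 K -> v' != v0 K -> rel v v' -> finc v n = finc v' n'.
Proof.
move=> nn; have [w' w'n w'E] := pol_surj nn.
have [w wn wE] := @ptP _ _ (unitmx1 K 3) (pi' (L n)).
exists (pol w); first by rewrite pol_eq0.
move=> v v' vn v'n r; rewrite -w'E [RHS]finc_pol.
apply: (rel_sym (v := v) (w := w)) => //.
by rewrite /rel -/(P w) in wE *; rewrite w'E -wE; case: Hpol => _ ->.
Qed.

Lemma rel_uniq v v' v'' : v' != v0 K -> v'' != v0 K -> rel v v' -> rel v v'' ->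
  exists2 k, k != 0 & v'' = vscale k v'.
Proof.
move=> n1 n2 r1 r2; have : L (pol v') = L (pol v'') by rewrite -r1 -r2.
case/L_par; rewrite ?pol_eq0 // => k k0 h; exists (bar k); first by rewrite fr_eq0.
apply: rv_inj; rewrite rvZ; apply: (can_inj (mulmxK Hu)).
have : rv (pol v'') = k *: rv (pol v') by rewrite h rvZ.
rewrite !rv_pol => h2.
have bb (u : vec K) : rv u = map_mx bar (rv (vbar u)).
  by rewrite map_rv; congr rv; apply: vecP; rewrite /= barK.
have : rv (vbar v'') = k *: rv (vbar v').
  by apply: (can_inj (mulmxK Hu)); rewrite h2 scalemxAl.
by rewrite (bb v'') (bb v') => ->; rewrite map_mxZ.
Qed.

Lemma relZ k l v v' : k != 0 -> l != 0 -> v != v0 K -> v' != v0 K -> rel v v' ->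
  rel (vscale k v) (vscale l v').
Proof. by move=> k0 l0 vn v'n; rewrite /rel P_scale // polZ L_scale ?pol_eq0 // fr_eq0. Qed.

Lemma finc_fix v n : n != v0 K -> vphi n = n -> finc v n = (dot v n == 0).
Proof.
move=> nn nf; rewrite /FigueroaIncidence.finc; suff /negbTE -> : ~~ type3 n by rewrite andbF.
by rewrite /Frames.type3 nf /det3 dot_crossl eqxx.
Qed.

Lemma fix_neg3 n : vphi n = n -> ~~ type3 n.
Proof. by move=> nf; rewrite /Frames.type3 nf /det3 dot_crossl eqxx. Qed.

(* A collineation of the Figueroa plane that fixes the subplane pointwise is induced by a
   field automorphism, since all lines used to define sums and products meet the subplane. *)
Lemma rel_field_aut : exists f : K -> K,
  [/\ forall a b, f (a + b) = f a + f b, forall a b, f (a * b) = f a * f b, f 1 = 1,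
      forall a, phi a = a -> f a = a & forall v, v != v0 K -> rel v (vmap f v)].
Proof.
have nz1 a b : (a, b, 1) != v0 K by rewrite !xpair_eqE oner_eq0 andbF.
have nzx a b : (1, a, b) != v0 K by rewrite !xpair_eqE oner_eq0.
have nzy a b : (a, 1, b) != v0 K by rewrite !xpair_eqE oner_eq0 andbF.
have fx (a b c : K) : phi a = a -> phi b = b -> phi c = c -> vphi (a, b, c) = (a, b, c) by move=> h1 h2 h3; rewrite /vmap /= h1 h2 h3.
have p0 : phi 0 = 0 by rewrite fr0.
have p1 : phi 1 = 1 by rewrite fr1.
have pN1 : phi (-1) = -1 by rewrite frN fr1.
have fixl v v' n : v != v0 K -> v' != v0 K -> rel v v' -> n != v0 K -> vphi n = n ->
   (dot v n == 0) = (dot v' n == 0).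
  move=> vn v'n r nn nf; rewrite -!finc_fix //.
  have [m mn mE] := pol_surj nn.
  have mf : vphi m = m.
    by apply: pol_inj; rewrite -pol_phi mE nf.
  by rewrite -mE (rel_sym vn v'n mn mn r (rel_fix mn mf)) finc_pol.
(* The field automorphism is read off the points [(a, 0, 1)], whose line belongs to the subplane and
   is therefore invariant. *)
have fE a : exists b, pi (P (a, 0, 1)) == L (pol (b, 0, 1)).
  have [v' v'n r] := rel_ex (nz1 a 0).
  have h1 := fixl _ _ (0, 1, 0) (nz1 a 0) v'n r (nzy 0 0) (fx _ _ _ p0 p1 p0).
  have h2 := fixl _ _ (0, 0, 1) (nz1 a 0) v'n r (nz1 0 0) (fx _ _ _ p0 p0 p1).
  move: h1 h2; rewrite /dot /= !mulr0 !mulr1 !add0r !addr0 eqxx oner_eq0 => /esym/eqP y0 /esym/negbT z0.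
  exists (v'.1.1 / v'.2); apply/eqP; rewrite -/(rel _ _).
  have -> : (v'.1.1 / v'.2, 0, 1) = vscale v'.2^-1 v'.
    by apply: vecP; rewrite /= ?y0 ?mulr0 ?mulVf // mulrC.
  by rewrite -[X in rel X _]vscale1; apply: relZ; rewrite ?oner_eq0 ?invr_eq0.
have {fE} [f rf] : exists f : K -> K, forall a, rel (a, 0, 1) (f a, 0, 1).
  by exists (fun a => xchoose (fE a)) => a; apply/eqP; apply: (xchooseP (fE a)).
(* A line through two points whose images are known and not of type III goes to the ordinary join of
   these images. *)
have line2 n a b a' b' c : n != v0 K -> rel a a' -> rel b b' -> a != v0 K -> a' != v0 K ->
   b != v0 K -> b' != v0 K -> ~~ type3 a' -> ~~ type3 b' -> finc a n -> finc b n ->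
   cross a' b' != v0 K -> dot a' c = 0 -> dot b' c = 0 -> c != v0 K -> ~~ type3 n -> ~~ type3 c ->
   forall v v', v != v0 K -> v' != v0 K -> rel v v' -> dot v n = 0 -> dot v' c = 0.
  move=> nn ra rb an a'n bn b'n ta tb ia ib ab ac bc cn tn tc v v' vn v'n r vn0.
  have [n' n'n h] := rel_line nn.
  move: ia ib; rewrite (h _ _ an a'n ra) (h _ _ bn b'n rb) /FigueroaIncidence.finc (negbTE ta) (negbTE tb) /= => /eqP ia /eqP ib.
  have [k kE] := perp_cross ab ia ib; have [l lE] := perp_cross ab ac bc.
  have l0 : l != 0 by apply: contraNneq cn => l0; rewrite lE l0 vscale0.
  have k0 : k != 0 by apply: contraNneq n'n => k0; rewrite kE k0 vscale0.
  have : finc v n by rewrite /FigueroaIncidence.finc (negbTE tn) andbF vn0.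
  rewrite (h _ _ vn v'n r) fincC kE fincZ // => h2.
  have : finc c v' by rewrite lE fincZ.
  by rewrite /FigueroaIncidence.finc (negbTE tc) /= dotC => /eqP.
have perpN v n : n != v0 K -> vphi n = n -> dot v n = 0 -> ~~ type3 v by apply: perp_type3N.
have fincL v n : ~~ type3 v -> dot v n = 0 -> finc v n.
  by move=> t d; rewrite /FigueroaIncidence.finc (negbTE t) d eqxx.
have fincR v n : ~~ type3 n -> dot v n = 0 -> finc v n.
  by move=> t d; rewrite /FigueroaIncidence.finc (negbTE t) andbF d eqxx.
have rD w : w != v0 K -> vphi w = w -> rel w w by apply: rel_fix.
have t3 (a b c : K) x y z : phi x = x -> phi y = y -> phi z = z -> (x, y, z) != v0 K ->
   a * x + b * y + c * z = 0 -> ~~ type3 (a, b, c).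
  by move=> h1 h2 h3 h4 h5; apply: (perpN _ (x, y, z)) => //; apply: fx.
have tQ a : ~~ type3 (a, 0, 1) by apply: (t3 _ _ _ 0 1 0) => //; ring.
have vert a v v' : v != v0 K -> v' != v0 K -> rel v v' -> v.1.1 = a * v.2 -> v'.1.1 = f a * v'.2.
  move=> vn v'n r va.
  have := @line2 (1, 0, - a) (a, 0, 1) (0, 1, 0) (f a, 0, 1) (0, 1, 0) (1, 0, - f a) (nzx _ _) (rf a).
  have r010 : rel (0, 1, 0) (0, 1, 0) by apply: rD => //; apply: fx.
  have tv x : ~~ type3 (1, 0, x) by apply: (t3 _ _ _ 0 1 0) => //; ring.
  move=> /(_ r010 (nz1 _ _) (nz1 _ _) (nzy _ _) (nzy _ _) (tQ _)) W.
  have /W{}W : ~~ type3 (0, 1, 0) by apply: fix_neg3; apply: fx.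
  have /W{}W : finc (a, 0, 1) (1, 0, - a) by apply: fincL; [exact: tQ|rewrite /dot /=; ring].
  have /W{}W : finc (0, 1, 0) (1, 0, - a) by apply: fincR; [exact: tv|rewrite /dot /=; ring].
  have /W{}W : cross (f a, 0, 1) (0, 1, 0) != v0 K.
    by rewrite /cross /= !xpair_eqE /= !mulr0 mul1r sub0r oppr_eq0 oner_eq0.
  have := W; rewrite {1 2}/dot /= => {}W.
  have e1 : f a * 1 + 0 * 0 + 1 * (- f a) = 0 by ring.
  have e2 : 0 * 1 + 1 * 0 + 0 * (- f a) = 0 :> K by ring.
  have := W e1 e2 (nzx _ _) (tv _) (tv _) v v' vn v'n r.
  rewrite /dot va => h; have e3 : a * v.2 * 1 + v.1.2 * 0 + v.2 * - a = 0 by ring.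
  by apply/eqP; rewrite -subr_eq0 -(h e3); apply/eqP; rewrite /=; ring.
have third v v' : v != v0 K -> v' != v0 K -> rel v v' -> (v.2 == 0) = (v'.2 == 0).
  move=> vn v'n r; have := fixl _ _ (0, 0, 1) vn v'n r (nz1 0 0) (fx _ _ _ p0 p0 p1).
  by rewrite /dot /= !mulr0 !mulr1 !add0r.
have norm1 v a b : v.2 != 0 -> v.1.1 = a * v.2 -> v.1.2 = b * v.2 -> v = vscale v.2 (a, b, 1).
  by move=> z h1 h2; apply: vecP; rewrite /= ?h1 ?h2 ?mulr1 // mulrC.
have relN v v' a b : v != v0 K -> v'.2 != 0 -> v'.1.1 = a * v'.2 -> v'.1.2 = b * v'.2 ->
    v' != v0 K -> rel v v' -> rel v (a, b, 1).
  move=> vn z h1 h2 v'n r; have E := norm1 _ _ _ z h1 h2.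
  have -> : (a, b, 1) = vscale v'.2^-1 v' by rewrite {2}E vscaleA mulVf // vscale1.
  by rewrite -[v]vscale1; apply: relZ; rewrite ?oner_eq0 ?invr_eq0.
have diag b : rel (b, b, 1) (f b, f b, 1).
  have [v' v'n r] := rel_ex (nz1 b b).
  have h1 := fixl _ _ (1, -1, 0) (nz1 b b) v'n r (nzx _ _) (fx _ _ _ p1 pN1 p0).
  have z : v'.2 != 0 by rewrite -(third _ _ (nz1 b b) v'n r) /= oner_eq0.
  have h2 : v'.1.1 = f b * v'.2 by apply: (vert b _ _ (nz1 b b) v'n r); rewrite /= mulr1.
  apply: (relN _ v') => //.
  move: h1; rewrite /dot /= => h1.
  have : v'.1.1 * 1 + v'.1.2 * -1 + v'.2 * 0 == 0 by rewrite -h1; apply/eqP; ring.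
  by move/eqP => h; rewrite -h2; apply/eqP; rewrite -subr_eq0 -oppr_eq0 -h; apply/eqP; ring.
have tDg b : ~~ type3 (b, b, 1) by apply: (t3 _ _ _ 1 (-1) 0) => //; ring.
have horz b v v' : v != v0 K -> v' != v0 K -> rel v v' -> v.1.2 = b * v.2 -> v'.1.2 = f b * v'.2.
  move=> vn v'n r va.
  have := @line2 (0, 1, - b) (b, b, 1) (1, 0, 0) (f b, f b, 1) (1, 0, 0) (0, 1, - f b) (nzy _ _) (diag b).
  have r100 : rel (1, 0, 0) (1, 0, 0) by apply: rD => //; apply: fx.
  have tv x : ~~ type3 (0, 1, x) by apply: (t3 _ _ _ 1 0 0) => //; ring.
  move=> /(_ r100 (nz1 _ _) (nz1 _ _) (nzx _ _) (nzx _ _) (tDg _)) W.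
  have /W{}W : ~~ type3 (1, 0, 0) by apply: fix_neg3; apply: fx.
  have /W{}W : finc (b, b, 1) (0, 1, - b) by apply: fincL; [exact: tDg|rewrite /dot /=; ring].
  have /W{}W : finc (1, 0, 0) (0, 1, - b) by apply: fincR; [exact: tv|rewrite /dot /=; ring].
  have /W{}W : cross (f b, f b, 1) (1, 0, 0) != v0 K.
    by rewrite /cross /= !xpair_eqE /= !mulr0 !mulr1 !subr0 oner_eq0 andbF.
  have e1 : dot (f b, f b, 1) (0, 1, - f b) = 0 by rewrite /dot /=; ring.
  have e2 : dot (1, 0, 0) (0, 1, - f b) = 0 by rewrite /dot /=; ring.
  have := W e1 e2 (nzy _ _) (tv _) (tv _) v v' vn v'n r.
  rewrite /dot va => h; have e3 : v.1.1 * 0 + b * v.2 * 1 + v.2 * - b = 0 by ring.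
  by apply/eqP; rewrite -subr_eq0 -(h e3); apply/eqP; rewrite /=; ring.
have relA a b : rel (a, b, 1) (f a, f b, 1).
  have [v' v'n r] := rel_ex (nz1 a b).
  have z : v'.2 != 0 by rewrite -(third _ _ (nz1 a b) v'n r) /= oner_eq0.
  apply: (relN _ v') => //.
    by apply: (vert a _ _ (nz1 a b) v'n r); rewrite /= mulr1.
  by apply: (horz b _ _ (nz1 a b) v'n r); rewrite /= mulr1.
have fD a : phi a = a -> f a = a.
  move=> af; have r : rel (a, 0, 1) (a, 0, 1) by apply: rD => //; apply: fx.
  have [k k0 [h1 _ h3]] := rel_uniq (nz1 _ _) (nz1 _ _) (rf a) r.
  by move: h3 h1; rewrite mulr1 => <-; rewrite mul1r.
have f0 : f 0 = 0 by apply: fD.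
have f1 : f 1 = 1 by apply: fD.
(* The line [(1, -1, b)] joins [(0, b, 1)] to the fixed point [(1, 1, 0)] and contains all
   [(a, a + b, 1)]. Products are treated below in the same way, with lines through [(0, 0, 1)]. *)
have fadd a b : f (a + b) = f a + f b.
  have r110 : rel (1, 1, 0) (1, 1, 0) by apply: rD => //; apply: fx.
  have r0b : rel (0, b, 1) (0, f b, 1) by have := relA 0 b; rewrite f0.
  have tv x : ~~ type3 (1, -1, x) by apply: (t3 _ _ _ 1 1 0) => //; ring.
  have t0 x : ~~ type3 (0, x, 1) by apply: (t3 _ _ _ 1 0 0) => //; ring.
  have := @line2 (1, -1, b) (0, b, 1) (1, 1, 0) (0, f b, 1) (1, 1, 0) (1, -1, f b) (nzx _ _) r0b r110.
  move=> /(_ (nz1 _ _) (nz1 _ _) (nzx _ _) (nzx _ _) (t0 _)) W.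
  have /W{}W : ~~ type3 (1, 1, 0) by apply: fix_neg3; apply: fx.
  have /W{}W : finc (0, b, 1) (1, -1, b) by apply: fincL; [exact: t0|rewrite /dot /=; ring].
  have /W{}W : finc (1, 1, 0) (1, -1, b) by apply: fincR; [exact: tv|rewrite /dot /=; ring].
  have /W{}W : cross (0, f b, 1) (1, 1, 0) != v0 K.
    by rewrite /cross /= !xpair_eqE /= !mulr0 !mulr1 sub0r oppr_eq0 oner_eq0.
  have e1 : dot (0, f b, 1) (1, -1, f b) = 0 by rewrite /dot /=; ring.
  have e2 : dot (1, 1, 0) (1, -1, f b) = 0 by rewrite /dot /=; ring.
  have := W e1 e2 (nzx _ _) (tv _) (tv _) _ _ (nz1 _ _) (nz1 _ _) (relA a (a + b)).
  rewrite /dot /= => h; have e3 : a * 1 + (a + b) * -1 + 1 * b = 0 by ring.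
  by apply/eqP; rewrite -subr_eq0 -oppr_eq0 -(h e3); apply/eqP; ring.
have linem m : forall v v', v != v0 K -> v' != v0 K -> rel v v' -> dot v (m, -1, 0) = 0 -> dot v' (f m, -1, 0) = 0.
  have r001 : rel (0, 0, 1) (0, 0, 1) by apply: rD => //; apply: fx.
  have r1m : rel (1, m, 1) (1, f m, 1) by have := relA 1 m; rewrite f1.
  have tv x : ~~ type3 (x, -1, 0) by apply: (t3 _ _ _ 0 0 1) => //; ring.
  have t1 x : ~~ type3 (1, x, 1) by apply: (t3 _ _ _ 1 0 (-1)) => //; ring.
  have nm x : (x, -1, 0) != v0 K by rewrite !xpair_eqE oppr_eq0 oner_eq0 andbF.
  have := @line2 (m, -1, 0) (1, m, 1) (0, 0, 1) (1, f m, 1) (0, 0, 1) (f m, -1, 0) (nm _) r1m r001.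
  move=> /(_ (nz1 _ _) (nz1 _ _) (nz1 _ _) (nz1 _ _) (t1 _)) W.
  have /W{}W : ~~ type3 (0, 0, 1) by apply: fix_neg3; apply: fx.
  have /W{}W : finc (1, m, 1) (m, -1, 0) by apply: fincL; [exact: t1|rewrite /dot /=; ring].
  have /W{}W : finc (0, 0, 1) (m, -1, 0) by apply: fincR; [exact: tv|rewrite /dot /=; ring].
  have /W{}W : cross (1, f m, 1) (0, 0, 1) != v0 K.
    by rewrite /cross /= !xpair_eqE /= !mulr0 !mulr1 sub0r oppr_eq0 oner_eq0 andbF.
  have e1 : dot (1, f m, 1) (f m, -1, 0) = 0 by rewrite /dot /=; ring.
  have e2 : dot (0, 0, 1) (f m, -1, 0) = 0 by rewrite /dot /=; ring.
  exact: (W e1 e2 (nm _) (tv _) (tv _)).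
have fmul m a : f (m * a) = f m * f a.
  have := linem m _ _ (nz1 _ _) (nz1 _ _) (relA a (m * a)).
  rewrite /dot /= => h; have e3 : a * m + m * a * -1 + 1 * 0 = 0 by ring.
  by apply/eqP; rewrite -subr_eq0 -oppr_eq0 -(h e3); apply/eqP; ring.
have fn0 x : x != 0 -> f x != 0.
  move=> x0; apply/eqP => fx0; have := oner_neq0 K.
  by rewrite -f1 -(mulfV x0) fmul fx0 mul0r eqxx.
have fV x : f x^-1 = (f x)^-1.
  have [->|x0] := eqVneq x 0; first by rewrite invr0 f0 invr0.
  by apply: (mulfI (fn0 _ x0)); rewrite -fmul !mulfV ?fn0.
exists f; split=> // v vn.
have [z0|z0] := eqVneq v.2 0; last first.
  have -> : v = vscale v.2 (v.1.1 / v.2, v.1.2 / v.2, 1) by apply: vecP; rewrite /=; field.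
  have -> : vmap f (vscale v.2 (v.1.1 / v.2, v.1.2 / v.2, 1)) = vscale (f v.2) (f (v.1.1 / v.2), f (v.1.2 / v.2), 1).
    by apply: vecP; rewrite /= ?fmul // f1.
  by apply: relZ; rewrite ?fn0.
have [x0|x0] := eqVneq v.1.1 0.
  have y0 : v.1.2 != 0.
    by apply: contraNneq vn => y0; apply/eqP; apply: vecP; rewrite /= ?x0 ?y0 ?z0.
  have -> : v = vscale v.1.2 (0, 1, 0) by apply: vecP; rewrite /= ?x0 ?z0 ?mulr0 ?mulr1.
  have -> : vmap f (vscale v.1.2 (0, 1, 0)) = vscale (f v.1.2) (0, 1, 0).
    by apply: vecP; rewrite /= ?mulr0 ?mulr1 ?f0.
  by apply: relZ; rewrite ?fn0 //; apply: rD => //; apply: fx.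
pose m := v.1.2 / v.1.1.
have vE : v = vscale v.1.1 (1, m, 0).
  by apply: vecP; rewrite /= ?z0 ?mulr0 ?mulr1 // /m; field.
rewrite {}vE; move: v.1.1 x0 => x x0.
have -> : vmap f (vscale x (1, m, 0)) = vscale (f x) (1, f m, 0).
  by apply: vecP; rewrite /= ?mulr0 ?mulr1 ?f0 ?fmul.
apply: relZ; rewrite ?fn0 //.
have [v' v'n r] := rel_ex (nzx m 0).
have z' : v'.2 = 0 by apply/eqP; rewrite -(third _ _ (nzx m 0) v'n r) /=.
have l' := linem m _ _ (nzx m 0) v'n r.
have {l'} : dot v' (f m, -1, 0) = 0 by apply: l'; rewrite /dot /=; ring.
rewrite /dot /= z' mulr0 addr0 => l'.
have yE : v'.1.2 = v'.1.1 * f m by apply/eqP; rewrite -subr_eq0 -oppr_eq0 -l'; apply/eqP; ring.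
have x' : v'.1.1 != 0.
  by apply: contraNneq v'n => h; apply/eqP; apply: vecP; rewrite /= ?yE ?h ?z' ?mul0r.
have -> : (1, f m, 0) = vscale v'.1.1^-1 v'.
  by apply: vecP; rewrite /= ?z' ?mulr0 ?mulVf // yE mulrA mulVf // mul1r.
by rewrite -[X in rel X _]vscale1; apply: relZ; rewrite ?oner_eq0 ?invr_eq0.
Qed.

(** The field automorphism is trivial on the field of order q^2, so each element is sent to one of
    its three conjugates. Since [pi] is a polarity the automorphism is also involutory, and 2 is
    prime to 3. *)
Theorem pi_eq : forall v, v != v0 K -> pi (P v) = L (pol v).
Proof.
have [f [fadd fmul f1 fD frel]] := rel_field_aut.
have f0 : f 0 = 0 by apply: (addIr (f 0)); rewrite -fadd !add0r.
have fN x : f (- x) = - f x by apply: (addIr (f x)); rewrite -fadd !addNr f0.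
have fB x y : f (x - y) = f x - f y by rewrite fadd fN.
have fX x (n : nat) : f (x ^+ n) = f x ^+ n.
  by elim: n => [|n IH]; rewrite ?expr0 // !exprS fmul IH.
have ff a : f (f a) = a.
  (* Fixed vectors dual to the standard basis; with them [v] and [w] below can be placed on lines of
     the subplane with a prescribed value of the form. *)
  have dual i : exists u, [/\ vphi u = u, herm u (1,0,0) = (i == 0%N)%:R & herm u (0,0,1) = (i == 2%N)%:R
     /\ herm u (0,1,0) = (i == 1%N)%:R].
    pose n : vec K := ((i == 0%N)%:R, (i == 1%N)%:R, (i == 2%N)%:R).
    pose u := vbar (vr (rv n *m invmx H)).
    have uE : pol u = n.
      apply: rv_inj; rewrite rv_pol /u.
      have -> : vbar (vbar (vr (rv n *m invmx H))) = vr (rv n *m invmx H) by apply: vecP; rewrite /= barK.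
      by rewrite vrK mulmxKV.
    have nf : vphi n = n by apply: vecP; rewrite /=; case: (i == _); rewrite /= ?fr0 ?fr1.
    exists u; split.
    - by apply: pol_inj; rewrite -pol_phi uE nf.
    - by rewrite /herm uE /dot /=; ring.
    - by split; rewrite /herm uE /dot /=; ring.
  have [u1 [u1f h10 [h12 _]]] := dual 0%N.
  have [u2 [u2f h20 [h22 _]]] := dual 2%N.
  have fv w : vphi w = w -> vmap f w = w.
    by case: w => [[x y] z] [h1 h2 h3]; rewrite /vmap /= !fD.
  pose b := bar (f a).
  pose v : vec K := (b, 0, 1); pose w := vadd u1 (vscale a u2).
  have vn : v != v0 K by rewrite !xpair_eqE oner_eq0 andbF.
  have vE (g : K) : (g, 0, 1) = vadd (0, 0, 1) (vscale g (1, 0, 0)) by apply: vecP; rewrite /=; ring.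
  have wv (g g' : K) : herm (vadd u1 (vscale g u2)) (g', 0, 1) = g' + bar g.
    by rewrite (vE g') !(hermDl, hermDr, hermZl, hermZr) h10 h12 h20 h22 /=; ring.
  have wn : w != v0 K.
    apply/eqP => w0.
    have hz x : herm (v0 K) x = 0.
      rewrite /herm; have -> : pol (v0 K) = v0 K by apply/eqP; rewrite pol_eq0.
      by rewrite /dot /=; ring.
    have h1 := wv a 1; have h2 := wv a 0; rewrite -/w w0 !hz in h1 h2.
    case/eqP: (oner_neq0 K); rewrite -[LHS]addr0 [X in _ + X]h2.
    by rewrite add0r -h1.
  have fnz g : g != v0 K -> vmap f g != v0 K.
    move=> gn; have fn0 x : x != 0 -> f x != 0.
      move=> x0; apply/eqP => fx0; have := oner_neq0 K.
      by rewrite -f1 -(mulfV x0) fmul fx0 mul0r eqxx.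
    by case: (vec_neq0 gn) => /fn0 h; apply/eqP => /eqP; rewrite !xpair_eqE (negbTE h) ?andbF.
  have t3v : ~~ type3 v.
    apply: (@perp_type3N _ ch e v (0, 1, 0)); first by rewrite !xpair_eqE oner_eq0 andbF.
      by apply: vecP; rewrite /= ?fr0 ?fr1.
    by rewrite /dot /=; ring.
  have t3w : ~~ type3 w.
    have u2n : cross u1 u2 != v0 K.
      apply/eqP => c0; have u2n : u2 != v0 K.
        apply/eqP => z; move: h22; rewrite z /herm.
        have -> : pol (v0 K) = v0 K by apply/eqP; rewrite pol_eq0.
        by rewrite /dot /= => /eqP; rewrite !mulr0 !addr0 eq_sym oner_eq0.
      have : cross u2 u1 = v0 K.
        by apply: vecP; apply/eqP; rewrite -oppr_eq0; apply/eqP;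
        [rewrite -[RHS](congr1 (fun z : vec K => z.1.1) c0)|rewrite -[RHS](congr1 (fun z : vec K => z.1.2) c0)
        |rewrite -[RHS](congr1 (fun z : vec K => z.2) c0)]; rewrite /=; ring.
      case/(cross_par u2n) => k kE; move: h10; rewrite kE hermZl h20 mulr0 => /eqP.
      by rewrite eq_sym oner_eq0.
    apply: (@perp_type3N _ ch e w (cross u1 u2)) => //.
      by rewrite (vmap_cross (fr_of ch (2 * e))) u1f u2f.
    by rewrite /w dotDl dotZl dot_crossl dot_crossr mulr0 addr0.
  have fw : vmap f w = vadd u1 (vscale (f a) u2).
    have := fv _ u1f; have := fv _ u2f; rewrite /w; case: (u1) (u2) => [[x1 y1] z1] [[x2 y2] z2].
    by move=> [e4 e5 e6] [e1 e2 e3]; apply: vecP; rewrite /= fadd fmul ?e1 ?e2 ?e3 ?e4 ?e5 ?e6.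
  have fv' : vmap f v = (f b, 0, 1) by rewrite /vmap /= f0 f1.
  have e1 : herm (vmap f w) v = 0 by rewrite fw wv /b adddK.
  have e2 : herm (vmap f v) w = bar (f b + bar a) by rewrite fv' -(hermC w) wv.
  have fbar x : f (bar x) = bar (f x) by rewrite /fr_of fX.
  (* By the choice [b = bar (f a)] the left incidence holds, and the right one says [f b = bar a].
     As [f] commutes with [bar], it is an involution. *)
  have := rel_sym vn (fnz _ vn) wn (fnz _ wn) (frel _ vn) (frel _ wn).
  rewrite /FigueroaIncidence.finc (negbTE t3v) (negbTE t3w) /= -!/(herm _ _) e1 e2 eqxx fr_eq0 addr_eq0C // => /esym/eqP h.
  by apply: (fr_inj (ch := ch) (i := 3 * e)); rewrite -fbar.
have fid a : f a = a.
  have s1f : f (a + phi a + phi (phi a)) = a + phi a + phi (phi a).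
    by apply: fD; rewrite !frA phi3; ring.
  have s2f : f (a * phi a + phi a * phi (phi a) + phi (phi a) * a) = a * phi a + phi a * phi (phi a) + phi (phi a) * a.
    by apply: fD; rewrite !(frA, frM) phi3; ring.
  have s3f : f (a * phi a * phi (phi a)) = a * phi a * phi (phi a).
    by apply: fD; rewrite !frM phi3; ring.
  have fphi x : f (phi x) = phi (f x) by rewrite /fr_of fX.
  (* The cubic polynomial with roots [a], [phi a], [phi (phi a)] has coefficients fixed by [f], so
     [f a] is one of its roots. *)
  have : (f a - a) * (f a - phi a) * (f a - phi (phi a)) = 0.
    transitivity (f (a ^+ 3 - (a + phi a + phi (phi a)) * a ^+ 2 + (a * phi a + phi a * phi (phi a) + phi (phi a) * a) * a
       - a * phi a * phi (phi a))); last by rewrite -[RHS]f0; congr f; ring.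
    by rewrite fB fadd fB !(fmul (_ + _)) s1f s2f s3f !fX; ring.
  move/eqP; rewrite !mulf_eq0 !subr_eq0 => /orP[/orP[/eqP//|/eqP h]|/eqP h].
    have := ff a; rewrite h fphi h => h2; have := phi3 a; rewrite h2 => ->; by [].
  have := ff a; rewrite h !fphi h => h2; rewrite phi3 in h2.
  by rewrite !h2.
move=> v vn; have := frel _ vn; rewrite /rel; have -> // : vmap f v = v.
by apply: vecP; rewrite /= fid.
Qed.

End Polarity.

End PolarityForm.
Import PolarityForm.

(** * Subfields of the field of order q^6 and the action of SL_2(q) *)

Module FieldArithmetic.
Local Open Scope ring_scope.

Lemma predM_succ n : (0 < n)%N -> (n.-1 * n.+1 = (n * n).-1)%N.
Proof. by case: n => // n _; rewrite /=; nia. Qed.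

Section Arith.
Variables (K : finFieldType) (ch : 2 \in [pchar K]) (e : nat).
Hypothesis cardK : #|K| = ((2 ^ e) ^ 6)%N.
Hypothesis e0 : (0 < e)%N.
Notation fr := (fr_of ch).
Notation phi := (fr_of ch (2 * e)).
Notation bar := (fr_of ch (3 * e)).
Implicit Types x y z a b c : K.
Let phi3 := phi3 ch cardK.
Let dd (x : K) : x + x = 0. Proof. exact: adddK. Qed.
Let K6 : #|K| = (2 ^ (6 * e))%N. Proof. by rewrite cardK -expnM mulnC. Qed.

Lemma card_frfix i : (0 < i)%N -> (i %| 6 * e)%N -> #|[set x : K | fr i x == x]| = (2 ^ i)%N.
Proof.
move=> i0 id; have p0 : (0 < 2 ^ i)%N by rewrite expn_gt0.
have p1 : (1 < 2 ^ i)%N by rewrite -{1}(expn0 2) ltn_exp2l.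
have -> : [set x : K | fr i x == x] = 0 |: [set x : K | x ^+ (2 ^ i).-1 == 1].
  apply/setP => x; rewrite !inE; have [->|x0] /= := eqVneq x 0; first by rewrite fr0 eqxx.
  rewrite /fr_of; have := prednK p0; set m := _.-1 => mE; rewrite -mE exprS.
  by apply/eqP/eqP => [h|->]; rewrite ?mulr1 //; apply: (mulfI x0); rewrite h mulr1.
rewrite cardsU1 inE expr0n card_expf_eq1; last by rewrite K6; apply: dvdn_pred_exp2.
have -> : ((2 ^ i).-1 == 0)%N = false by lia.
by rewrite /= eq_sym oner_eq0 add1n prednK.
Qed.

Lemma fr_mul_fix i k x : fr i x = x -> fr (k * i) x = x.
Proof. by move=> h; elim: k => [|k IH]; rewrite ?mul0n /fr_of ?expr1 // -/(fr _ x) mulSn -frD IH. Qed.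

Lemma fr_gcd i j x : fr i x = x -> fr j x = x -> fr (gcdn i j) x = x.
Proof.
move=> hi hj; have [->|i0] := posnP i; first by rewrite gcd0n.
have [k _ /dvdnP[l lE]] := Bezoutl j i0.
by have := fr_mul_fix l hi; rewrite -lE -frD (fr_mul_fix k hj).
Qed.

Lemma fr_diff i j : (0 < i)%N -> (i < j)%N -> (i %| 6 * e)%N -> (j %| 6 * e)%N -> exists x, fr j x = x /\ fr i x != x.
Proof.
move=> i0 ij id jd; have j0 : (0 < j)%N by apply: leq_trans ij.
have : ~~ ([set x : K | fr j x == x] \subset [set x : K | fr i x == x]).
  apply/negP => /subset_leq_card; rewrite !card_frfix // leqNgt ltn_exp2l // ij //.
by case/subsetPn => x; rewrite !inE => /eqP h1 h2; exists x.
Qed.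

Lemma barK' x : bar (bar x) = x. Proof. by rewrite frD -mulnDl -[RHS](fr6e ch cardK x). Qed.
Lemma q_phi x : fr e x = x -> phi x = x. Proof. by move=> h; rewrite mulSn mul1n -frD h. Qed.
Lemma q_bar x : fr e x = x -> bar x = x. Proof. exact: fr_mul_fix. Qed.
Lemma rs_q x : phi x = x -> bar x = x -> fr e x = x.
Proof. by move=> h1 h2; rewrite -{1}h1 frD (_ : e + 2 * e = 3 * e)%N //; lia. Qed.
Lemma bar_r x : phi x = x -> bar x = fr e x.
Proof. by move=> h; rewrite -{2}h frD; congr (fr _ x); lia. Qed.
Lemma r_bar x : phi x = x -> phi (bar x) = bar x. Proof. by move=> h; rewrite frC h. Qed.
Lemma r_norm x : phi x = x -> fr e (x * bar x) = x * bar x.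
Proof. by move=> h; apply: rs_q; rewrite frM ?barK' 1?mulrC // r_bar // h mulrC. Qed.
Lemma r_trace x : phi x = x -> fr e (x + bar x) = x + bar x.
Proof. by move=> h; apply: rs_q; rewrite frA ?barK' 1?addrC // r_bar // h addrC. Qed.

Lemma q_sqrt x : fr e x = x -> exists y, fr e y = y /\ y ^+ 2 = x.
Proof.
move=> h; exists (fr e.-1 x); split; first by rewrite frC h.
have -> y : y ^+ 2 = fr 1 y by [].
by rewrite frD add1n prednK.
Qed.

Lemma dvd6 i : (i %| 6)%N -> (i * e %| 6 * e)%N. Proof. by move=> h; rewrite dvdn_pmul2r. Qed.

(** The norm from the field of order q^2 to that of order q is onto: as a (q - 1)-st root of unity,
    [c] has the form y^((q + 1) m), where m is the index of the units of the field of order q^2, and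
    y^m lies in that field. *)
Lemma norm_r c : fr e c = c -> exists t, phi t = t /\ t * bar t = c.
Proof.
move=> cq; have [->|c0] := eqVneq c 0; first by exists 0; rewrite !fr0 mulr0.
have q1 : (0 < 2 ^ e)%N by rewrite expn_gt0.
have d1 : ((2 ^ e).-1 %| (2 ^ (2 * e)).-1)%N by apply: dvdn_pred_exp2; rewrite dvdn_mull.
have d2 : ((2 ^ (2 * e)).-1 %| #|K|.-1)%N by rewrite K6; apply: dvdn_pred_exp2; rewrite dvdn_pmul2r.
have [m mE] := dvdnP d2.
have m0 : (0 < m)%N by case: (posnP m) => // m0; move: mE; rewrite m0 mul0n K6; have : (1 < 2 ^ (6 * e))%N; [rewrite -{1}(expn0 2) ltn_exp2l //; lia|lia].
have r1 : ((2 ^ (2 * e)).-1 = (2 ^ e).+1 * (2 ^ e).-1)%N.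
  by rewrite [RHS]mulnC predM_succ // -expnD addnn -mul2n.
have c1 : c ^+ (2 ^ e).-1 = 1.
  by apply: (mulfI c0); rewrite -exprS prednK // mulr1.
have [y yE] := @expf_root K (2 ^ e).-1 ((2 ^ e).+1 * m) c ltac:(by rewrite mE r1; lia) c1.
have y0 : y != 0 by apply: contraNneq c0 => y0; rewrite yE y0 expr0n muln_eq0 /= (gtn_eqF m0).
have tphi : phi (y ^+ m) = y ^+ m.
  have p0 : (0 < 2 ^ (2 * e))%N by rewrite expn_gt0.
  rewrite /fr_of -(prednK p0) exprS -exprM -mE.
  have -> : y ^+ #|K|.-1 = 1; last by rewrite mulr1.
  by apply: (mulfI y0); rewrite -exprS prednK ?expf_card ?mulr1 //; apply: ltnW (finNzRing_gt1 K).
exists (y ^+ m); split=> //; rewrite bar_r // yE /fr_of -exprS -exprM; congr (y ^+ _); exact: mulnC.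
Qed.

Lemma hilbert90 c : c * bar c = 1 -> exists2 y, y != 0 & bar y * c = y.
Proof.
move=> c1; have s1 : (0 < 2 ^ (3 * e))%N by rewrite expn_gt0.
have [||y yE] := @expf_root K (2 ^ (3 * e)).+1 (2 ^ (3 * e)).-1 c.
- by rewrite mulnC predM_succ // K6 -expnD; congr (2 ^ _).-1; lia.
- by rewrite exprS.
have c0 : c != 0 by apply: contra_eq_neq c1 => ->; rewrite mul0r eq_sym oner_eq0.
have p1 : (0 < (2 ^ (3 * e)).-1)%N.
  have : (2 ^ 1 < 2 ^ (3 * e))%N by rewrite ltn_exp2l //; lia.
  lia.
have y0 : y != 0 by apply: contraNneq c0 => y0; rewrite yE y0 expr0n; case: (_.-1) p1.
exists y^-1; first by rewrite invr_eq0.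
rewrite frV yE /fr_of; apply: (mulfI y0); rewrite mulfV // mulrCA -exprS prednK // mulVf //.
by rewrite expf_neq0.
Qed.

Lemma trace_r c : fr e c = c -> exists t, phi t = t /\ t + bar t = c.
Proof.
move=> cq; have [th [tr tq]] := @fr_diff e (2 * e) e0 ltac:(lia) (dvdn_mull _ (dvdnn _)) (dvd6 (i := 2) isT).
have d0 : th + bar th != 0 by rewrite addr_eq0C // bar_r // eq_sym.
have dq := r_trace tr; have dr := q_phi dq; have db := q_bar dq.
exists (c * th / (th + bar th)); split; first by rewrite !frM frV dr tr (q_phi cq).
by rewrite !frM frV db (q_bar cq); field.
Qed.

(** There are q^3 + 1 elements with [u * bar u = 1], more than the q^2 elements fixed by [phi]. *)
Lemma circle : exists u, u * bar u = 1 /\ phi u != u.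
Proof.
have : ~~ ([set x : K | x ^+ (2 ^ (3 * e)).+1 == 1] \subset [set x : K | phi x == x]).
  apply/negP => /subset_leq_card; rewrite card_frfix ?dvd6 ?muln_gt0 //.
  rewrite card_expf_eq1 => [|]; last first.
    apply/dvdnP; exists (2 ^ (3 * e)).-1; rewrite predM_succ ?expn_gt0 // K6 -expnD.
    by congr (2 ^ _).-1; lia.
  by rewrite leqNgt ltnS leq_exp2l //; lia.
by case/subsetPn => x; rewrite !inE => /eqP h1 h2; exists x; rewrite -h1 exprS.
Qed.

(** A primitive cube root of unity lies in the field with 4 elements, where [fr_of ch i] depends
    only on the parity of the index; 3e has the parity of e. *)
Lemma cube_root : exists w, [/\ 1 + w + w ^+ 2 = 0, phi w = w & bar w = if odd e then w ^+ 2 else w].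
Proof.
have d3 : (3 %| #|K|.-1)%N by rewrite K6; apply: (@dvdn_pred_exp2 2); rewrite dvdn_mulr.
have c3 := card_expf_eq1 d3.
have [w] : exists w, w \in [set x : K | x ^+ 3 == 1] :\ 1.
  by apply/card_gt0P; have := c3; rewrite (cardsD1 1) inE expr1n eqxx add1n => -[->].
rewrite !inE => /andP[w1 /eqP w3].
have wE : 1 + w + w ^+ 2 = 0.
  apply/eqP; have : (w - 1) * (1 + w + w ^+ 2) == 0.
    by rewrite (_ : _ * _ = w ^+ 3 - 1); [rewrite w3 subrr|ring].
  by rewrite mulf_eq0 subr_eq0 (negbTE w1).
have f2 : fr 2 w = w by rewrite /fr_of (_ : 2 ^ 2 = 3 + 1)%N // exprD w3 mul1r.
have fev k : fr (k * 2) w = w by apply: fr_mul_fix.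
exists w; split=> //; first by rewrite mulnC.
have -> : (3 * e = odd e + (3 * e)./2 * 2)%N by rewrite muln2 -{1}(odd_double_half (3 * e)) oddM.
by rewrite -frD fev; case: (odd e); rewrite /fr_of ?expr1.
Qed.

(** The Lagrange resolvent of the cubic extension; when it is nonzero, it is an eigenvector of [phi]
    with eigenvalue [w]. If it vanished for both [g] and [g ^ 2], then [g] would be fixed by
    [phi]. *)
Lemma resolvent w : 1 + w + w ^+ 2 = 0 -> phi w = w -> exists g, bar g = g /\ g + w ^+ 2 * phi g + w * phi (phi g) != 0.
Proof.
move=> w1 wr; have [g [gs gq]] := @fr_diff e (3 * e) e0 ltac:(lia) (dvdn_mull _ (dvdnn _)) (dvd6 (i := 3) isT).
have gr : phi g != g by apply: contraNneq gq => h; apply/eqP/rs_q.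
have [h1|] := eqVneq (g + w ^+ 2 * phi g + w * phi (phi g)) 0; last by exists g.
exists (g ^+ 2); rewrite !frX gs; split=> //; apply/eqP => h2.
have w0 : w != 0 by apply: contra_eq_neq w1 => ->; rewrite expr0n /= !addr0 oner_eq0.
have wn1 : w != 1.
  by apply: contra_eq_neq w1 => ->; rewrite expr1n adddK // add0r oner_eq0.
have wE : w = - (1 + w ^+ 2) by apply/eqP; rewrite -addr_eq0 addrCA addrA w1.
pose A := g - phi (phi g); pose B := phi g - phi (phi g).
have hA : A = - (w ^+ 2 * B).
  by apply/eqP; rewrite -addr_eq0 -h1 /A /B {3}wE; apply/eqP; ring.
have hA2 : A * (g + phi (phi g)) = - (w ^+ 2 * (B * (phi g + phi (phi g)))).
  apply/eqP; rewrite -addr_eq0; apply/eqP.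
  transitivity ((g ^+ 2 + w ^+ 2 * phi g ^+ 2 + w * phi (phi g) ^+ 2) - (1 + w + w ^+ 2) * phi (phi g) ^+ 2).
    by rewrite /A /B; ring.
  by rewrite h2 w1 mul0r subr0.
have : w ^+ 2 * B * (phi g - g) = 0.
  transitivity (A * (g + phi (phi g)) + w ^+ 2 * (B * (phi g + phi (phi g)))); first by rewrite hA; ring.
  by rewrite hA2 addNr.
move/eqP; rewrite !mulf_eq0 (negbTE w0) /= [phi g - g == 0]subr_eq0 (negbTE gr) orbF => /eqP B0.
case/eqP: gr; apply: (fr_inj (ch := ch) (i := 2 * e)); apply/eqP; rewrite eq_sym -subr_eq0; exact/eqP.
Qed.

(** A quadratic equation over the fixed field of [phi] with root [a] would have the three distinct
    conjugates of [a] as roots. *)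
Lemma indep3 a N T C : phi a != a -> bar a = a -> phi N = N -> phi T = T -> phi C = C ->
  N * a ^+ 2 + T * a + C = 0 -> [/\ N = 0, T = 0 & C = 0].
Proof.
move=> aq _ hN hT hC h.
have ph b : N * b ^+ 2 + T * b + C = 0 -> N * phi b ^+ 2 + T * phi b + C = 0.
  by move=> hb; rewrite -[RHS](fr0 ch (2 * e)) -hb !frA (frM ch (2 * e) N) frX (frM ch (2 * e) T) hN hT hC.
have h1 := ph _ h; have h2 := ph _ h1.
have d1 : a - phi a != 0 by rewrite subr_eq0 eq_sym.
have d2 : phi a - phi (phi a) != 0 by rewrite -frB fr_eq0.
have d3 : a - phi (phi a) != 0.
  by rewrite -(fr_eq0 ch (2 * e)) frB phi3 subr_eq0.
have e1 : N * (a + phi a) + T = 0.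
  apply: (mulfI d1); rewrite mulr0; transitivity ((N * a ^+ 2 + T * a + C) - (N * phi a ^+ 2 + T * phi a + C)); last by rewrite h h1 subr0.
  by ring.
have e2 : N * (phi a + phi (phi a)) + T = 0.
  apply: (mulfI d2); rewrite mulr0; transitivity ((N * phi a ^+ 2 + T * phi a + C) - (N * phi (phi a) ^+ 2 + T * phi (phi a) + C)); last by rewrite h2 h1 subr0.
  by ring.
have N0 : N = 0.
  apply: (mulIf d3); rewrite mul0r; transitivity ((N * (a + phi a) + T) - (N * (phi a + phi (phi a)) + T)); last by rewrite e1 e2 subr0.
  by ring.
have T0 : T = 0 by move: e1; rewrite N0 mul0r add0r.
by split=> //; move: h; rewrite N0 T0 !mul0r !add0r.
Qed.

(** A matrix acts on [(1, a)], hence on [a] by fractional linear maps. The q^4 quadruples over F_q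
    yield at most q^3 values of [f], so two of them collide; their difference is a matrix taking [a]
    to [y]. Its determinant is nonzero, and dividing by the square root of it gives determinant
    1. *)
Lemma sl2_trans a y : bar a = a -> phi a != a -> bar y = y -> phi y != y ->
  exists al be ga de, [/\ fr e al = al, fr e be = be, fr e ga = ga & fr e de = de] /\
    al * de + be * ga = 1 /\ ga + de * a = y * (al + be * a).
Proof.
move=> as_ ar ys yr.
pose Q := [set x : K | fr e x == x]; pose S := [set x : K | bar x == x].
have cQ : #|Q| = (2 ^ e)%N by apply: card_frfix; rewrite // dvdn_mull.
have cS : #|S| = (2 ^ (3 * e))%N by apply: card_frfix; rewrite ?muln_gt0 // dvd6.
pose f (z : (K * K) * (K * K)) := z.1.1 + z.1.2 * a + y * (z.2.1 + z.2.2 * a).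
pose D := setX (setX Q Q) (setX Q Q).
have : ~~ dinjectiveb f D.
  apply/negP => /dinjectiveP /card_in_imset cf.
  have : (#|f @: D| <= #|S|)%N.
    apply: subset_leq_card; apply/subsetP => _ /imsetP[[[z1 z2] [z3 z4]] zD ->].
    move: zD; rewrite !inE /f /= => /andP[/andP[/eqP h1 /eqP h2] /andP[/eqP h3 /eqP h4]].
    by rewrite !(frA, frM) as_ ys !(q_bar (x := _)).
  rewrite cf !cardsX cQ cS leqNgt => /negP; apply.
  by rewrite -!expnD ltn_exp2l //; lia.
case/dinjectivePn => -[[z1 z2] [z3 z4]] zD [[[t1 t2] [t3 t4]]]; rewrite inE /= => /andP[zt tD].
move: zD tD; rewrite !inE /f /= => /andP[/andP[/eqP p1 /eqP p2] /andP[/eqP p3 /eqP p4]].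
move=> /andP[/andP[/eqP o1 /eqP o2] /andP[/eqP o3 /eqP o4]] ff.
pose ga := z1 + t1; pose de := z2 + t2; pose al := z3 + t3; pose be := z4 + t4.
have qga : fr e ga = ga by rewrite frA p1 o1.
have qde : fr e de = de by rewrite frA p2 o2.
have qal : fr e al = al by rewrite frA p3 o3.
have qbe : fr e be = be by rewrite frA p4 o4.
have E : ga + de * a = y * (al + be * a).
  apply/eqP; rewrite -addr_eq0C //; apply/eqP.
  transitivity ((z1 + z2 * a + y * (z3 + z4 * a)) + (t1 + t2 * a + y * (t3 + t4 * a))); first by rewrite /ga /de /al /be; ring.
  by rewrite ff adddK.
have lin u v : fr e u = u -> fr e v = v -> u + v * a = 0 -> u = 0 /\ v = 0.
  move=> hu hv h; have [_ -> ->] // : [/\ 0 = 0 :> K, v = 0 & u = 0].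
  by apply: (@indep3 a 0 v u ar as_); rewrite ?fr0 ?q_phi // mul0r add0r addrC.
have nz : al + be * a != 0.
  apply/eqP => h; have [a0 b0] := lin _ _ qal qbe h.
  move: E; rewrite h mulr0 => /(lin _ _ qga qde)[g0 d0].
  have eqs (x z : K) : x + z = 0 -> x = z by move/eqP; rewrite addr_eq0C // => /eqP.
  by case/eqP: zt; rewrite (eqs z1 t1 g0) (eqs z2 t2 d0) (eqs z3 t3 a0) (eqs z4 t4 b0).
pose d := al * de + be * ga.
have d0 : d != 0.
  apply/eqP => h; case/eqP: yr.
  have yE t : phi t = t -> ga + de * a = t * (al + be * a) -> phi y = y.
    by move=> tr; rewrite E => /(mulIf nz) ->.
  have [b0|b0] := eqVneq be 0.
    have al0 : al != 0 by move: nz; rewrite b0 mul0r addr0.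
    have de0 : de = 0 by apply: (mulfI al0); rewrite mulr0 -[RHS]h /d b0; ring.
    apply: (yE (ga / al)); first by rewrite frM frV !q_phi.
    by rewrite de0 b0; field.
  apply: (yE (de / be)); first by rewrite frM frV !q_phi.
  have gaE : ga = al * de / be.
    apply: (mulfI b0); rewrite [RHS]mulrC divfK //.
    by apply/eqP; rewrite -addr_eq0C // addrC -/d h.
  by rewrite gaE; field.
have qd : fr e d = d by rewrite /d frA !frM qal qbe qga qde.
have [m [mq m2]] := q_sqrt qd.
have m0 : m != 0 by apply: contraNneq d0 => m0; rewrite -m2 m0 expr0n.
exists (al / m), (be / m), (ga / m), (de / m); split; first by rewrite !frM !frV mq qal qbe qga qde.
split; last by rewrite ![_ / m * a]mulrAC -!mulrDl E mulrA.
transitivity (d / m ^+ 2); first by rewrite /d; field.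
by rewrite m2 divff.
Qed.

(** A matrix fixing [a] gives a quadratic equation for [a], so it is scalar by [indep3], and 1 is
    the only scalar of determinant 1 in characteristic 2. Together with [sl2_trans] the action is
    regular. *)
Lemma sl2_free a al be ga de : bar a = a -> phi a != a ->
  fr e al = al -> fr e be = be -> fr e ga = ga -> fr e de = de -> al * de + be * ga = 1 ->
  ga + de * a = a * (al + be * a) -> [/\ al = 1, be = 0, ga = 0 & de = 1].
Proof.
move=> as_ ar h1 h2 h3 h4 d E.
have [||||b0 ad g0] := @indep3 a be (al + de) ga ar as_; rewrite ?frA ?q_phi //.
  transitivity (ga + de * a + a * (al + be * a)); first by ring.
  by rewrite E adddK.
move: d; rewrite b0 g0 mul0r addr0; have -> : de = al by apply/eqP; rewrite -addr_eq0C // addrC ad.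
rewrite -expr2 => /eqP; rewrite sqrf_eq1 oppr_pchar2 // orbb => /eqP a1.
by split.
Qed.

Lemma mob_comp (al be ga de al' be' ga' de' p y z : K) : ga + de * p = y * (al + be * p) -> ga' + de' * y = z * (al' + be' * y) ->
  (ga' * al + de' * ga) + (ga' * be + de' * de) * p = z * ((al' * al + be' * ga) + (al' * be + be' * de) * p).
Proof.
move=> h h'; transitivity (ga' * (al + be * p) + de' * (ga + de * p)); first by ring.
rewrite h; transitivity ((ga' + de' * y) * (al + be * p)); first by ring.
rewrite h'; transitivity (z * (al' * (al + be * p) + be' * (y * (al + be * p)))); first by ring.
by rewrite -h; ring.
Qed.

Lemma mob_inv (al be ga de p y : K) : ga + de * p = y * (al + be * p) -> ga + al * y = p * (de + be * y).
Proof.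
move=> h; apply/eqP; rewrite -addr_eq0C //; apply/eqP.
transitivity ((ga + de * p) + y * (al + be * p)); first by ring.
by rewrite h dd.
Qed.

Lemma c2K (x y z : K) : x = y + (z + z) -> x = y. Proof. by move=> ->; rewrite dd addr0. Qed.

Lemma sl2_uniq p y al be ga de al' be' ga' de' : bar p = p -> phi p != p ->
  [/\ fr e al = al, fr e be = be, fr e ga = ga & fr e de = de] -> al * de + be * ga = 1 ->
  [/\ fr e al' = al', fr e be' = be', fr e ga' = ga' & fr e de' = de'] -> al' * de' + be' * ga' = 1 ->
  ga + de * p = y * (al + be * p) -> ga' + de' * p = y * (al' + be' * p) ->
  [/\ al = al', be = be', ga = ga' & de = de'].
Proof.
move=> ps pr [h1 h2 h3 h4] d [k1 k2 k3 k4] d' E E'.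
have C := mob_comp E' (mob_inv E).
have [||||||u1 u2 u3 u4] := @sl2_free p (de * al' + be * ga') (de * be' + be * de') (ga * al' + al * ga') (ga * be' + al * de') ps pr;
  rewrite ?(frA, frM) ?h1 ?h2 ?h3 ?h4 ?k1 ?k2 ?k3 ?k4 //.
  transitivity ((al * de + be * ga) * (al' * de' + be' * ga')); last by rewrite d d' mulr1.
  apply: (c2K (z := de * ga * al' * be' + al * be * ga' * de')); by ring.
split.
- transitivity (al * (de * al' + be * ga') + be * (ga * al' + al * ga')); first by rewrite u1 u3 mulr1 mulr0 addr0.
  transitivity (al' * (al * de + be * ga)); last by rewrite d mulr1.
  by apply: (c2K (z := al * be * ga')); ring.
- transitivity (be * (ga * be' + al * de') + al * (de * be' + be * de')); first by rewrite u4 u2 mulr1 mulr0 addr0.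
  transitivity (be' * (al * de + be * ga)); last by rewrite d mulr1.
  by apply: (c2K (z := al * be * de')); ring.
- transitivity (ga * (de * al' + be * ga') + de * (ga * al' + al * ga')); first by rewrite u1 u3 mulr1 mulr0 addr0.
  transitivity (ga' * (al * de + be * ga)); last by rewrite d mulr1.
  by apply: (c2K (z := ga * de * al')); ring.
- transitivity (de * (ga * be' + al * de') + ga * (de * be' + be * de')); first by rewrite u4 u2 mulr1 mulr0 addr0.
  transitivity (de' * (al * de + be * ga)); last by rewrite d mulr1.
  by apply: (c2K (z := ga * de * be')); ring.
Qed.

(** Applying [phi] shows that the matrix permutes the conjugates of [a] in a 3-cycle. Its square and
    its inverse both take [phi a] to [phi (phi a)], so they agree by regularity; the inverse is the
    adjugate, without signs in characteristic 2. *)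
Lemma sl2_order3 a al be ga de : bar a = a -> phi a != a ->
  [/\ fr e al = al, fr e be = be, fr e ga = ga & fr e de = de] -> al * de + be * ga = 1 ->
  ga + de * phi a = a * (al + be * phi a) ->
  [/\ al * al + be * ga = de, al * be + be * de = be, ga * al + de * ga = ga & ga * be + de * de = al].
Proof.
move=> as_ ar hq d E; case: (hq) => h1 h2 h3 h4.
have [r1 r2 r3 r4] := And4 (q_phi h1) (q_phi h2) (q_phi h3) (q_phi h4).
have E2 : ga + de * phi (phi a) = phi a * (al + be * phi (phi a)).
  by rewrite -{1}r3 -{1}r4 -frM -frA E !(frA, frM) r1 r2.
have E3 : ga + de * a = phi (phi a) * (al + be * a).
  by rewrite -{1}r3 -{1}r4 -{1}(phi3 a) -frM -frA E2 !(frA, frM) phi3 r1 r2.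
have p1 : bar (phi a) = phi a by rewrite frC as_.
have p2 : phi (phi a) != phi a by rewrite (inj_eq (fr_inj (ch := ch) (i := 2 * e))).
apply: (@sl2_uniq (phi a) (phi (phi a))) => //.
- by rewrite !(frA, frM) h1 h2 h3 h4.
- transitivity ((al * de + be * ga) ^+ 2); last by rewrite d expr1n.
  by apply: (c2K (z := - (al * de * be * ga) + al ^+ 2 * be * ga + be * ga * de ^+ 2 + al * be * ga * de)); rewrite /=; ring.
- by rewrite addrC -d; ring.
- exact: mob_comp E E3.
- exact: mob_inv E2.
Qed.

Lemma cube_eq1_neq a w : 1 + w + w ^+ 2 = 0 -> a != 0 -> w * a != a.
Proof.
move=> h a0; apply/eqP => /eqP; rewrite -{2}[a]mul1r (inj_eq (mulIf a0)) => /eqP w1.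
by move: h; rewrite w1 expr1n dd add0r => /eqP; rewrite oner_eq0.
Qed.

End Arith.

End FieldArithmetic.
Import FieldArithmetic.

(** * The polar unital in a frame: absolute points, blocks, automorphisms *)

Module PolarUnitalCoordinates.
Local Open Scope ring_scope.

Lemma ltn_mul3 n : (0 < n)%N -> (n < 3 * n)%N.
Proof. by move=> n0; rewrite -{1}[n]mul1n ltn_pmul2r. Qed.

Lemma ltn1_neq n : (0 < n)%N -> n != 1%N -> (1 < n)%N.
Proof. by case: n => [|[|]]. Qed.

Section Coordinates.
Variables (K : finFieldType) (ch : 2 \in [pchar K]) (e : nat).
Hypothesis cardK : #|K| = ((2 ^ e) ^ 6)%N.
Notation phi := (fr_of ch (2 * e)).
Notation bar := (fr_of ch (3 * e)).
Notation vphi := (vmap phi).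
Notation vbar := (vmap bar).
Notation type3 := (type3 ch e).
Notation finc := (finc ch e).
Implicit Types u v w n : vec K.
Let phi3 := phi3 ch cardK.
Let vphi3 := vphi3 ch cardK.

Variables (pi : fpoint K -> fline K) (pi' : fline K -> fpoint K).
Hypothesis Hpol : polarity (@fig_inc K ((2 ^ e) ^ 2)) pi pi'.

Lemma frame_pi (H E : 'M[K]_3) (Eu : E \in unitmx) :
  (forall v, v != v0 K -> pi (P v) = L (pol ch e H v)) ->
  (map_mx bar E *m H *m E^T) \in unitmx -> H \in unitmx ->
  forall v, v != v0 K -> pi (pt Eu v) = ln Eu (pol ch e (map_mx bar E *m H *m E^T) v).
Proof using All.
move=> piH Gu Hu v vn; set G := _ *m _ in Gu *.
pose w := vr (rv v *m E).
have wn : w != v0 K by rewrite -rv_eq0 /w vrK rvE_eq0.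
have -> : pt Eu v = P w.
  by apply: val_inj; rewrite !val_pt // /ptm mulmx1 /w vrK.
have pn : pol ch e G v != v0 K by rewrite pol_eq0.
have pHn : pol ch e H w != v0 K by rewrite pol_eq0.
rewrite piH //; apply: val_inj; rewrite !val_ln // /lnm invmx1 mul1mx; congr (<<kermx _>>%MS).
rewrite !rv_pol /w /G trmx_mul.
have -> : vbar (vr (rv v *m E)) = vr (rv (vbar v) *m map_mx bar E).
  apply: (@rv_inj K); rewrite vrK -map_rv vrK map_mxM map_rv //.
by rewrite vrK !trmx_mul trmxK !mulmxA mulVmx // mul1mx.
Qed.

Variables (E : 'M[K]_3) (Eu : E \in unitmx) (EF : map_mx phi E = E).
Variable G : 'M[K]_3.
Hypotheses (GF : map_mx phi G = G) (Gh : G^T = map_mx bar G) (Gu : G \in unitmx).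
Notation pol := (pol ch e G).
Notation herm := (herm ch e G).
Notation pt := (pt Eu).
Notation ln := (ln Eu).
Hypothesis piE : forall v, v != v0 K -> pi (pt v) = ln (pol v).
Notation U := (upoint (2 ^ e) pi).
Notation inc := (fig_inc ((2 ^ e) ^ 2)).
Notation B := (ublocks (2 ^ e) pi).
Notation s := (2 ^ (3 * e))%N.

Let hC := hermC cardK Gh.
Let hphi v w : phi (herm v w) = herm (vphi v) (vphi w). Proof. exact: herm_phi. Qed.

Definition absv v := finc v (pol v).

Lemma inc_pt v n : v != v0 K -> n != v0 K -> inc (pt v) (ln n) = finc v n.
Proof. by move=> vn nn; rewrite (fig_incE Eu EF). Qed.

Lemma inc_pi v w : v != v0 K -> w != v0 K -> inc (pt v) (pi (pt w)) = finc v (pol w).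
Proof. by move=> vn wn; rewrite piE // inc_pt ?pol_eq0. Qed.

Lemma abs_pt v : v != v0 K -> absolute (2 ^ e) pi (pt v) = absv v.
Proof. by move=> vn; rewrite /absolute inc_pi. Qed.

Lemma finc_polE v w : finc v (pol w) = if type3 v && type3 w then
  herm w v * phi (herm w v) == herm (vphi w) v * herm w (vphi v) else herm w v == 0.
Proof. by rewrite /FigueroaIncidence.finc pol_type3 // pol_phi. Qed.

Lemma absvN v : ~~ type3 v -> absv v = (herm v v == 0).
Proof. by move=> t; rewrite /absv finc_polE (negbTE t). Qed.

(** If [herm v v] vanished, the incidence equation would force [herm v (vphi v) = 0] as well. Then
    [pol v] would annihilate [v] and its conjugates, which form a basis. *)
Lemma type3_abs_herm v : type3 v -> absv v -> herm v v != 0.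
Proof.
move=> t; rewrite /absv finc_polE t /= => /eqP h; apply/eqP => h0.
have h1 : herm v (vphi v) = 0.
  move: h; rewrite h0 mul0r -(hC v (vphi v)) => /esym/eqP.
  by rewrite mulf_eq0 fr_eq0 orbb => /eqP.
have h2 : herm v (vphi (vphi v)) = 0.
  by rewrite -hC -{2}(vphi3 v) -!hphi h1 !fr0.
have : pol v = v0 K by apply: (det3_perp t); rewrite // /PolarityForm.herm in h0 h1 h2 *.
by move/eqP; rewrite pol_eq0 // (negbTE (type3_neq0 t)).
Qed.

Lemma isotropic_type3N v : v != v0 K -> herm v v = 0 -> absv v -> ~~ type3 v.
Proof. by move=> vn h a; apply/negP => t; have := type3_abs_herm t a; rewrite h eqxx. Qed.

(** Sends a vector of type III to mu of its polar line and keeps the others. It maps isotropic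
    points injectively to absolute ones, so the hermitian curve of the ordinary plane supplies
    enough absolute points. *)
Definition tau w := if type3 w then cross (vphi (pol w)) (vphi (vphi (pol w))) else w.

Lemma cross_cross (a b c : vec K) : cross (cross a b) (cross b c) = vscale (det3 a b c) b.
Proof. by apply: vecP; rewrite /det3 /dot /cross /=; ring. Qed.

Lemma cross_type3 m : type3 m -> type3 (cross (vphi m) (vphi (vphi m))).
Proof.
move=> t; have t' := t; rewrite /Frames.type3 in t' *.
have cE x y : vphi (cross x y) = cross (vphi x) (vphi y) by exact: (vmap_cross phi).
rewrite !cE !vphi3.
have -> : det3 (cross (vphi m) (vphi (vphi m))) (cross (vphi (vphi m)) m) (cross m (vphi m)) =
   det3 m (vphi m) (vphi (vphi m)) ^+ 2 by rewrite /det3 /dot /cross /=; ring.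
by rewrite sqrf_eq0.
Qed.

Lemma tau_type3 w : type3 (tau w) = type3 w.
Proof. by rewrite /tau; case: ifP => // t; rewrite cross_type3 // pol_type3. Qed.

Lemma tau_cross w : type3 w -> exists2 k, k != 0 & cross (tau w) (vphi (tau w)) = vscale k (vphi (vphi (pol w))).
Proof.
move=> t; have t' : type3 (pol w) by rewrite pol_type3.
rewrite /tau t (vmap_cross phi) vphi3 cross_cross; eexists; last reflexivity.
by move: t'; rewrite /Frames.type3 det3_rot.
Qed.

(** For type III, the cross products describing [tau w] and its polar line are multiples of
    conjugates of [pol w] and [w]; incidence thus becomes isotropy of [w]. *)
Lemma tau_abs w : w != v0 K -> herm w w = 0 -> (tau w != v0 K) && absv (tau w).
Proof.
move=> wn h; have [t|t] := boolP (type3 w); last by rewrite /tau (negbTE t) wn absvN // h eqxx.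
have tt : type3 (tau w) by rewrite tau_type3.
rewrite (type3_neq0 tt) /= /absv finc_cross ?pol_type3 //.
have [k k0 kE] := tau_cross t; rewrite kE dotZl mulf_eq0 (negbTE k0) /=.
have c0 : cross (pol (tau w)) (vphi (pol (tau w))) != v0 K by apply: type3_cross; rewrite pol_type3.
have d1 : dot (tau w) (vphi (vphi (pol w))) = 0 by rewrite /tau t dotC dot_crossr.
have d2 : dot (vphi (tau w)) (vphi (vphi (pol w))) = 0.
  by rewrite /tau t (vmap_cross phi) vphi3 dotC dot_crossl.
have pd a : dot a (vphi (vphi (pol w))) = 0 -> dot (pol a) (vphi (vphi w)) = 0.
  by rewrite !pol_phi // -/(herm _ _) -[herm _ a]hC => /eqP; rewrite fr_eq0 dotC => /eqP.
have d3 : dot (vphi (pol (tau w))) (vphi (vphi w)) = 0 by rewrite pol_phi //; apply: pd.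
have [l lE] := perp_cross c0 (pd _ d1) d3.
have l0 : l != 0.
  by apply: contraNneq wn => l0; move: lE; rewrite l0 vscale0 => /eqP; rewrite !(vmap_eq0 phi).
have : dot (vphi (vphi (pol w))) (vphi (vphi w)) = 0.
  by rewrite -!phi_dot dotC -/(herm _ _) h !fr0.
by rewrite lE dotZr => /eqP; rewrite mulf_eq0 (negbTE l0).
Qed.

Lemma par_sym v w : v != v0 K -> w != v0 K -> cross v w = v0 K -> exists2 k, k != 0 & w = vscale k v.
Proof.
move=> vn wn /(cross_par vn)[k kE]; exists k => //.
by apply: contraNneq wn => k0; rewrite kE k0 vscale0.
Qed.

Lemma tau_inj v w : v != v0 K -> w != v0 K -> cross (tau v) (tau w) = v0 K -> cross v w = v0 K.
Proof.
move=> vn wn c; have t : type3 v = type3 w.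
  rewrite -tau_type3 -(tau_type3 w).
  have tn x : x != v0 K -> tau x != v0 K.
    by move=> xn; rewrite /tau; case: ifP => // t; apply: type3_neq0; apply: cross_type3; rewrite pol_type3.
  by have [k k0 ->] := par_sym (tn _ vn) (tn _ wn) c; rewrite type3Z.
have [tv|tv] := boolP (type3 v); last by move: c; rewrite /tau -t (negbTE tv).
have tw : type3 w by rewrite -t.
have t3v : type3 (tau v) by rewrite tau_type3.
have t3w : type3 (tau w) by rewrite tau_type3.
have [k k0 kE] := par_sym (type3_neq0 t3v) (type3_neq0 t3w) c.
have [l l0 lE] := tau_cross tv; have [m m0 mE] := tau_cross tw.
move: mE; rewrite kE vphiZ cross_scale cross_scaler lE !vscaleA => h.
have : cross (vphi (vphi (pol v))) (vphi (vphi (pol w))) = v0 K.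
  have : cross (vphi (vphi (pol v))) (vscale m (vphi (vphi (pol w)))) = v0 K.
    by rewrite -h cross_scaler crossvv vscale_v0.
  by rewrite cross_scaler => /eqP; rewrite vscale_eq0 // => /eqP.
rewrite -!(vmap_cross phi) => /eqP; rewrite !(vmap_eq0 phi) => /eqP.
case/par_sym; rewrite ?pol_eq0 // => j j0 jE.
have -> : w = vscale (bar j) v by apply: (@pol_inj K ch e G Gu); rewrite polZ (barK ch cardK).
by rewrite cross_scaler crossvv vscale_v0.
Qed.

Lemma pt_par v w : v != v0 K -> w != v0 K -> cross v w = v0 K -> pt v = pt w.
Proof. by move=> vn wn /(par_sym vn wn) h; apply/eqP/(pt_eqP Eu vn wn). Qed.

Lemma par_pt v w : v != v0 K -> w != v0 K -> pt v = pt w -> cross v w = v0 K.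
Proof. by move=> vn wn /eqP/(pt_eqP Eu vn wn)[k k0 ->]; rewrite cross_scaler crossvv vscale_v0. Qed.

Lemma pol_par v w : v != v0 K -> w != v0 K -> cross (pol v) (pol w) = v0 K -> cross v w = v0 K.
Proof.
move=> vn wn; case/par_sym; rewrite ?pol_eq0 // => j j0 jE.
have -> : w = vscale (bar j) v by apply: (@pol_inj K ch e G Gu); rewrite polZ (barK ch cardK).
by rewrite cross_scaler crossvv vscale_v0.
Qed.

Let r p p' := inc p (pi p').

Lemma r_sym : symmetric r.
Proof. by move=> p p'; rewrite /r; case: Hpol => c1 c2 h; rewrite -h c1. Qed.

Lemma r_uniq x y z t : r x z -> r y z -> r x t -> r y t -> x = y \/ z = t.
Proof.
have [a an ->] := ptP Eu x; have [b bn ->] := ptP Eu y; have [c cn ->] := ptP Eu z; have [d dn ->] := ptP Eu t.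
rewrite /r !inc_pi // => h1 h2 h3 h4.
case: (finc_unique cardK an bn _ _ h1 h2 h3 h4); rewrite ?pol_eq0 //.
  by left; apply: pt_par.
by move/(pol_par cn dn) => h; right; apply: pt_par.
Qed.

Lemma card_s2 : (s ^ 2)%N = #|K|. Proof. by rewrite cardK -!expnM; congr (_ ^ _)%N; lia. Qed.

Lemma r_deg x : (s ^ 2 < #|[set y | r x y]|)%N.
Proof.
have [a an ->] := ptP Eu x; rewrite card_s2; case: Hpol => c1 c2 _.
have dl := @deg_lb K ch e cardK _ (fun n => pi' (ln n)) a an.
apply: leq_trans (dl _) _ => {dl}.
  move=> n n' nn n'n /(can_inj c2)/eqP/(ln_eqP Eu nn n'n)[k k0 ->].
  by rewrite cross_scaler crossvv vscale_v0.
apply: subset_leq_card; apply/subsetP => y /imsetP[n]; rewrite inE => /andP[nn an'] ->.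
by rewrite inE /r c2 inc_pt.
Qed.

Lemma r_card : (#|{: fpoint K}| <= (s ^ 2) ^ 2 + s ^ 2 + 1)%N.
Proof.
pose f (z : (K * K) + K + unit) := match z with
  | inl (inl (a, b)) => pt (1, a, b) | inl (inr a) => pt (0, 1, a) | inr _ => pt (0, 0, 1) end.
have : #|f @: [set: (K * K) + K + unit]| = #|{: fpoint K}|.
  rewrite -cardsT; apply: eq_card => x; rewrite !inE; apply/imsetP.
  have [[[a b] c] an ->] := ptP Eu x.
  have sc k v w : k != 0 -> v != v0 K -> w = vscale k v -> pt v = pt w.
    by move=> k0 vn wE; apply/eqP/(pt_eqP Eu vn); [rewrite wE vscale_eq0|exists k].
  have [a0|a0] := eqVneq a 0; last first.
    exists (inl (inl (b / a, c / a))) => //; rewrite /f /=; apply/esym; apply: (sc a); rewrite //.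
      by rewrite !xpair_eqE oner_eq0.
    by apply: vecP; rewrite /= ?mulr1 // mulrC divfK.
  have [b0|b0] := eqVneq b 0; last first.
    exists (inl (inr (c / b))) => //; rewrite /f /=; apply/esym; apply: (sc b); rewrite //.
      by rewrite !xpair_eqE oner_eq0 andbF.
    by apply: vecP; rewrite /= ?mulr1 ?mulr0 // mulrC divfK.
  have c0 : c != 0 by apply: contraNneq an => c0; rewrite a0 b0 c0.
  exists (inr tt) => //; rewrite /f /=; apply/esym; apply: (sc c); rewrite //.
    by rewrite !xpair_eqE oner_eq0 andbF.
  by apply: vecP; rewrite /= ?mulr1 ?mulr0.
move=> <-; apply: leq_trans (leq_imset_card _ _) _.
by rewrite cardsT !card_sum card_prod card_unit -!card_s2 -mulnn.
Qed.

(** With s = q^3, the isotropic points are [(0, 0, 1)] and [(x, 1, y)] with [y + bar y = x * bar x].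
    Since [th / (th + bar th)] has trace 1, it yields one solution y for each x, and the s elements
    fixed by [bar] can be added to it. *)
Lemma isotropic_count : (0 < e)%N -> (forall a b c, pol (a, b, c) = (bar a, bar c, bar b)) ->
  (s ^ 3 < #|[set p | absolute (2 ^ e) pi p]|)%N.
Proof using All.
move=> e0 polE.
have [th [_ tq]] := @fr_diff K ch e cardK e0 (3 * e) (6 * e) ltac:(lia) ltac:(lia) (dvd6 e0 (i := 3) isT) (dvdnn _).
have d0 : th + bar th != 0 by rewrite addr_eq0C // eq_sym.
have db : bar (th + bar th) = th + bar th by rewrite frA (barK ch cardK) addrC.
pose S := [set x : K | bar x == x].
have cS : #|S| = s by apply: (card_frfix ch cardK e0); rewrite ?muln_gt0 // dvd6.
pose w (z : K * K) : vec K := (z.1, 1, z.1 * bar z.1 * th / (th + bar th) + z.2).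
have wn z : w z != v0 K by rewrite !xpair_eqE oner_eq0 andbF.
have wi z : z.2 \in S -> herm (w z) (w z) = 0.
  rewrite inE => /eqP zs; rewrite /PolarityForm.herm /w polE /dot /= !(frA, frM, frV) (barK ch cardK) -frA db fr1 zs.
  transitivity (z.1 * bar z.1 * (1 + (th + bar th) / (th + bar th)) + (z.2 + z.2)); first by field.
  by rewrite divff // !adddK // mulr0 addr0.
have in0 : herm (0, 0, 1) (0, 0, 1) = 0 by rewrite /PolarityForm.herm polE /dot /= !fr0 fr1; ring.
have n0 : (0, 0, 1) != v0 K by rewrite !xpair_eqE oner_eq0 andbF.
pose A := [set p | absolute (2 ^ e) pi p].
pose f z := pt (tau (w z)).
have fi : {in setX [set: K] S &, injective f}.
  move=> z z' _ _; rewrite /f => h.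
  have [t1 _] : tau (w z) != v0 K /\ True.
    by split=> //; rewrite /tau; case: ifP => // t; apply: type3_neq0 (cross_type3 _); rewrite pol_type3.
  have [t2 _] : tau (w z') != v0 K /\ True.
    by split=> //; rewrite /tau; case: ifP => // t; apply: type3_neq0 (cross_type3 _); rewrite pol_type3.
  have [k k0 [h1 h2 h3]] := par_sym (wn z) (wn z') (tau_inj (wn z) (wn z') (par_pt t1 t2 h)).
  move: h1 h2 h3; rewrite mulr1 => + k1; rewrite -k1 !mul1r => h1; rewrite h1 => /addrI h3.
  by case: z z' h1 h3 {h k1 t1 t2} => [a b] [c d] /= -> ->.
have ninf : pt (tau (0, 0, 1)) \notin f @: setX [set: K] S.
  apply/negP => /imsetP[z _ h].
  have t1 : tau (0, 0, 1) != v0 K by have /andP[] := tau_abs n0 in0.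
  have t2 : tau (w z) != v0 K.
    by rewrite /tau; case: ifP => // t; apply: type3_neq0 (cross_type3 _); rewrite pol_type3.
  have [k k0 [_ h2 _]] := par_sym n0 (wn z) (tau_inj n0 (wn z) (par_pt t1 t2 h)).
  by move/eqP: h2; rewrite mulr0 oner_eq0.
have sub : pt (tau (0, 0, 1)) |: f @: setX [set: K] S \subset A.
  apply/subsetP => p; rewrite in_setU1 => /orP[/eqP->|/imsetP[z]].
    by have /andP[t1 t2] := tau_abs n0 in0; rewrite inE abs_pt.
  rewrite inE => /andP[_ zS] ->; have /andP[t1 t2] := tau_abs (wn z) (wi z zS).
  by rewrite inE abs_pt.
have := subset_leq_card sub; rewrite cardsU1 ninf card_in_imset // cardsX cardsT cS -card_s2 add1n.
by rewrite -expnSr.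
Qed.

Hypothesis Hab : (s ^ 3 < #|[set p | absolute (2 ^ e) pi p]|)%N.

Lemma s_gt0 : (0 < s)%N. Proof. by rewrite expn_gt0. Qed.

Lemma U_card : #|U| = (s ^ 3).+1.
Proof.
have [h _] := polar_count s_gt0 r_sym r_uniq r_deg r_card Hab.
by rewrite -h card_sig; apply: eq_card => x; rewrite !inE.
Qed.

Lemma utrace_card l : #|utrace (2 ^ e) pi l| = #|[set y in [set x | r x x] | inc y l]|.
Proof.
rewrite -(card_imset _ val_inj); apply: eq_card => y; rewrite !inE; apply/imsetP/andP.
  by case=> x; rewrite inE => xl ->; split=> //; apply: (valP x).
by case=> yy yl; exists (exist (fun p => absolute (2 ^ e) pi p) y yy); rewrite ?inE.
Qed.

Lemma lineP l : exists y, l = pi y.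
Proof. by exists (pi' l); case: Hpol => _ ->. Qed.

(** A block has two points, so its pole is not absolute: the polar line of an absolute point meets
    the absolute points in that point alone. *)
Lemma block_card b : b \in B -> #|b| = s.+1.
Proof.
case/imsetP => l; rewrite inE => l1 ->; move: l1; have [y ->] := lineP l; rewrite utrace_card => l1.
have [_ h] := polar_count s_gt0 r_sym r_uniq r_deg r_card Hab.
have [yy|yy] := boolP (r y y); last by rewrite -(h y).
move: l1; rewrite ltnNge => /negP[]; apply: (@leq_trans #|[set y]|); last by rewrite cards1.
apply: subset_leq_card; apply/subsetP => x.
by rewrite !inE => /andP[xx xy]; apply/eqP; apply: (abs_tangent r_sym r_uniq).
Qed.

Lemma block_join (x y : U) : x != y -> exists2 b, b \in B & (x \in b) && (y \in b).
Proof.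
move=> xy; have [_ _ h] := deg_join s_gt0 r_sym r_uniq r_deg r_card Hab.
have xy' : val x != val y by rewrite (inj_eq val_inj).
have [z /andP[xz yz]] := h _ _ xy'.
exists (utrace (2 ^ e) pi (pi z)); last by rewrite !inE -/(r _ _) xz.
apply/imsetP; exists (pi z) => //; rewrite inE; apply/card_gt1P.
by exists x, y; rewrite !inE.
Qed.

Lemma block_uniq (x y : U) b b' : x != y -> b \in B -> b' \in B ->
     x \in b -> y \in b -> x \in b' -> y \in b' -> b = b'.
Proof.
move=> xy /imsetP[l _ ->] /imsetP[l' _ ->]; have [z ->] := lineP l; have [w ->] := lineP l'.
rewrite !inE => h1 h2 h3 h4; case: (r_uniq h1 h2 h3 h4) => [/val_inj h|->//].
by rewrite h eqxx in xy.
Qed.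

(* Semilinear maps of K^3 that commute with phi and preserve the form up to a field automorphism. *)
Definition sunit i (F : vec K -> vec K) := [/\ forall k v, F (vscale k v) = vscale (fr_of ch i k) (F v),
  forall v w, herm (F v) (F w) = fr_of ch i (herm v w) & forall v, F (vphi v) = vphi (F v)].

Lemma pol_hermP v w : (forall x, herm v x = herm w x) -> v = w.
Proof.
move=> h; apply: (@pol_inj K ch e G Gu); apply: vecP.
- by have := h (1, 0, 0); rewrite /PolarityForm.herm /dot /= !mul0r !mul1r !addr0.
- by have := h (0, 1, 0); rewrite /PolarityForm.herm /dot /= !mul0r !mul1r !addr0 !add0r.
- by have := h (0, 0, 1); rewrite /PolarityForm.herm /dot /= !mul0r !mul1r !add0r.
Qed.

Section Sunit.
Variables (i : nat) (F : vec K -> vec K).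
Hypothesis sF : sunit i F.

Lemma sunit_inj : injective F.
Proof.
case: sF => _ h _ v w vw; apply: pol_hermP => x; apply: (fr_inj (ch := ch) (i := i)).
by rewrite -!h vw.
Qed.

Lemma sunit_surj v : exists w, F w = v.
Proof.
by have [g _ gK] := injF_bij (sunit_inj : injective (F : (K * K * K)%type -> (K * K * K)%type)); exists (g v).
Qed.

Lemma sunit0 : F (v0 K) = v0 K.
Proof. by case: sF => h _ _; rewrite -{1}(vscale0 (v0 K)) h fr0 vscale0. Qed.

Lemma sunit_neq0 v : v != v0 K -> F v != v0 K.
Proof. by apply: contraNneq => h; apply/eqP/sunit_inj; rewrite sunit0. Qed.

(** Failing to be of type III means being orthogonal to a nonzero vector fixed by [phi], and [F]
    preserves this because it commutes with [phi] and respects orthogonality. *)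
Lemma sunit_type3 v : type3 (F v) = type3 v.
Proof.
have [->|vn] := eqVneq v (v0 K); first by rewrite sunit0.
case: sF => hZ hh hp.
have rat w : w != v0 K -> ~~ type3 w <-> exists m, [/\ m != v0 K, vphi m = m & herm m w = 0].
  move=> wn; split=> [t|[m [mn mf mw]]]; last first.
    by apply: (@perp_type3N _ ch e w (pol m)); rewrite ?pol_eq0 // pol_phi // mf.
  have [n [nn nf wn0]] := type3N_perp wn t; have [m mn mE] := pol_surj ch cardK Gu nn.
  exists m; split=> //; last by rewrite /PolarityForm.herm mE.
  by apply: (@pol_inj K ch e G Gu); rewrite -pol_phi // mE nf.
apply: negb_inj; apply/idP/idP => /rat h.
  have [m [mn mf mw]] := h (sunit_neq0 vn); apply/(rat v vn).
  have [m' mE] := sunit_surj m; exists m'; split.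
  - by apply: contraNneq mn => m0; rewrite -mE m0 sunit0.
  - by apply: sunit_inj; rewrite hp mE mf.
  - by apply/eqP; rewrite -(fr_eq0 ch i) -hh mE mw.
have [m [mn mf mw]] := h vn; apply/(rat _ (sunit_neq0 vn)).
exists (F m); split; [exact: sunit_neq0|by rewrite -hp mf|by rewrite hh mw fr0].
Qed.

Lemma sunit_finc v w : finc (F v) (pol (F w)) = finc v (pol w).
Proof.
case: (sF) => hZ hh hp; rewrite !finc_polE !sunit_type3 -!hp !hh.
case: ifP => _; last by rewrite fr_eq0.
by rewrite frC -!frM (inj_eq (fr_inj (ch := ch) (i := i))).
Qed.

Lemma sunit_perm : exists (f : {perm fpoint K}) (g : {perm fline K}) (a : {perm U}),
  [/\ collineation inc f g, f @: [set p | absolute (2 ^ e) pi p] = [set p | absolute (2 ^ e) pi p],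
     forall p, g (pi p) = pi (f p) & block_aut B a] /\
  (forall x : U, val (a x) = f (val x)) /\ (forall v, v != v0 K -> f (pt v) = pt (F v)).
Proof.
case: (sF) => hZ hh hp; case: Hpol => c1 c2 _.
have repP p : exists v, (v != v0 K) && (p == pt v) by have [v vn ->] := ptP Eu p; exists v; rewrite vn eqxx.
pose f0 p := pt (F (xchoose (repP p))).
have f0E v : v != v0 K -> f0 (pt v) = pt (F v).
  move=> vn; rewrite /f0; have := xchooseP (repP (pt v)); move: (xchoose _) => w /andP[wn /(pt_eqP Eu vn wn)[k k0 wE]].
  apply/esym/eqP/(pt_eqP Eu); rewrite ?sunit_neq0 //; exists (fr_of ch i k); first by rewrite fr_eq0.
  by rewrite wE hZ.
have frs k : exists k', fr_of ch i k' = k.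
  by have [g _ gK] := injF_bij (fr_inj (ch := ch) (i := i)); exists (g k).
have f0i : injective f0.
  move=> x y; have [v vn ->] := ptP Eu x; have [w wn ->] := ptP Eu y; rewrite !f0E // => /eqP.
  case/(pt_eqP Eu (sunit_neq0 vn) (sunit_neq0 wn)) => k k0 h; have [k' kE] := frs k.
  apply/eqP/(pt_eqP Eu vn wn); exists k'; first by rewrite -(fr_eq0 ch i) kE.
  by apply: sunit_inj; rewrite hZ kE.
pose f := perm f0i.
have fE v : v != v0 K -> f (pt v) = pt (F v) by move=> vn; rewrite permE f0E.
have fr x y : inc (f x) (pi (f y)) = inc x (pi y).
  have [v vn ->] := ptP Eu x; have [w wn ->] := ptP Eu y.
  by rewrite !fE // !inc_pi ?sunit_neq0 // sunit_finc.
pose g0 l := pi (f (pi' l)).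
have g0i : injective g0 by move=> l l' /(can_inj c1)/perm_inj/(can_inj c2).
pose g := perm g0i.
have gE p : g (pi p) = pi (f p) by rewrite permE /g0 c1.
have fg p l : inc (f p) (g l) = inc p l by have [y ->] := lineP l; rewrite gE fr.
have fa p : absolute (2 ^ e) pi (f p) = absolute (2 ^ e) pi p by rewrite /absolute fr.
pose a0 (x : U) : U := Sub (f (val x)) (etrans (fa _) (valP x)).
have a0E x : val (a0 x) = f (val x) by rewrite SubK.
have a0i : injective a0 by move=> x y /(congr1 val); rewrite !a0E => /perm_inj/val_inj.
pose a := perm a0i; have aE x : val (a x) = f (val x) by rewrite permE a0E.
have atr l : a @: utrace (2 ^ e) pi l = utrace (2 ^ e) pi (g l).
  apply/eqP; rewrite eqEsubset; apply/andP; split; apply/subsetP => y.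
    by case/imsetP => x; rewrite !inE => xl ->; rewrite aE fg.
  rewrite inE => yl; apply/imsetP; exists (a^-1%g y); last by rewrite permKV.
  by rewrite inE -fg -aE permKV.
exists f, g, a; split; last by [].
split=> //.
  apply/eqP; rewrite eqEcard card_imset ?leqnn ?andbT; last exact: perm_inj.
  by apply/subsetP => y /imsetP[x]; rewrite !inE => xa ->; rewrite fa.
apply/forallP => b; apply/eqP; apply/imsetP/imsetP => -[l]; rewrite inE => l1 bE.
  exists (g^-1%g l); last first.
    by apply: (imset_inj (@perm_inj _ a)); rewrite atr permKV.
  by rewrite inE -(card_imset _ (@perm_inj _ a)) atr permKV.
by exists (g l); rewrite ?bE -?atr // inE -atr card_imset //; apply: perm_inj.
Qed.

End Sunit.

Variable x0 : U.
(** The point [x0] is a default for vectors that do not represent absolute points. *)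
Definition X v : U := insubd x0 (pt v).

Lemma val_X v : v != v0 K -> absv v -> val (X v) = pt v.
Proof. by move=> vn va; apply: insubdK; change (is_true (absolute (2 ^ e) pi (pt v))); rewrite abs_pt. Qed.

Lemma X_surj x : exists v, [/\ v != v0 K, absv v & x = X v].
Proof.
have [v vn vE] := ptP Eu (val x); have va : absv v by rewrite -abs_pt // -vE (valP x).
by exists v; split=> //; apply: val_inj; rewrite val_X.
Qed.

Lemma X_par v w : v != v0 K -> absv v -> w != v0 K -> absv w -> X v = X w -> exists2 k, k != 0 & w = vscale k v.
Proof.
move=> vn va wn wa /(congr1 val); rewrite !val_X // => /eqP; exact: (pt_eqP Eu vn wn).
Qed.

Lemma absvZ k v : k != 0 -> absv (vscale k v) = absv v.
Proof. by move=> k0; rewrite /absv polZ fincZ // fincC fincZ ?fr_eq0 // fincC. Qed.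

Lemma X_scale k v : k != 0 -> v != v0 K -> absv v -> X (vscale k v) = X v.
Proof.
move=> k0 vn va; apply: val_inj; rewrite !val_X ?absvZ ?vscale_eq0 //.
by apply/esym/eqP/(pt_eqP Eu vn); rewrite ?vscale_eq0 //; exists k.
Qed.

Definition blk n : {set U} := utrace (2 ^ e) pi (ln n).

Lemma in_blk v n : v != v0 K -> absv v -> n != v0 K -> (X v \in blk n) = finc v n.
Proof. by move=> vn va nn; rewrite inE val_X // inc_pt. Qed.

Lemma blk_in n : (1 < #|blk n|)%N -> blk n \in B.
Proof. by move=> h; apply/imsetP; exists (ln n); rewrite ?inE. Qed.

Lemma blk_surj b : b \in B -> exists2 n, n != v0 K & b = blk n.
Proof. by case/imsetP => l _ ->; have [n nn ->] := lnP Eu l; exists n. Qed.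

Lemma blk_nabs w : w != v0 K -> blk (pol w) \in B -> ~~ absv w.
Proof.
move=> wn b; apply/negP => wa; have := block_card b; have : (#|blk (pol w)| <= 1)%N.
  apply: (@leq_trans #|[set X w]|); last by rewrite cards1.
  apply: subset_leq_card; apply/subsetP => x.
  have [v [vn va ->]] := X_surj x; rewrite in_blk ?pol_eq0 // !inE => vw.
  apply/eqP; apply: val_inj; rewrite !val_X //.
  by apply: (abs_tangent r_sym r_uniq); rewrite /r inc_pi.
by move=> h1 h2; move: h1; rewrite h2 ltnS leqNgt expn_gt0.
Qed.

Lemma sunit_aut i F : sunit i F -> exists a : {perm U}, block_aut B a /\ forall v, v != v0 K -> absv v -> a (X v) = X (F v).
Proof.
move=> sF; have [f [g [a [[_ _ _ aB] [aE fE]]]]] := sunit_perm sF; exists a; split=> // v vn va.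
by apply: val_inj; rewrite aE !val_X ?fE ?(sunit_neq0 sF) // /absv (sunit_finc sF).
Qed.

Lemma sunit_absv i F v : sunit i F -> absv (F v) = absv v.
Proof. by move=> sF; rewrite /absv (sunit_finc sF). Qed.


Lemma aut_eq (a b : {perm U}) : (forall v, v != v0 K -> absv v -> a (X v) = b (X v)) -> a = b.
Proof. by move=> h; apply/permP => x; have [v [vn va ->]] := X_surj x; apply: h. Qed.

Lemma sunit_comp i j F F' : sunit i F -> sunit j F' -> sunit (i + j) (F \o F').
Proof.
move=> [h1 h2 h3] [k1 k2 k3]; split=> [k v|v w|v] /=; first by rewrite k1 h1 frD.
  by rewrite h2 k2 frD.
by rewrite k3 h3.
Qed.

Lemma fincN v n : ~~ type3 n -> finc v n = (dot v n == 0).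
Proof. by move=> t; rewrite /FigueroaIncidence.finc (negbTE t) andbF. Qed.
Lemma fincNl v n : ~~ type3 v -> finc v n = (dot v n == 0).
Proof. by move=> t; rewrite /FigueroaIncidence.finc (negbTE t). Qed.

Lemma t3N v a b c : phi a = a -> phi b = b -> phi c = c -> (a, b, c) != v0 K ->
  v.1.1 * a + v.1.2 * b + v.2 * c = 0 -> ~~ type3 v.
Proof.
move=> ha hb hc n h; apply: (@perp_type3N _ ch e v (a, b, c)) => //.
by rewrite /vmap /= ha hb hc.
Qed.

Lemma nzl (a b : K) : (1, a, b) != v0 K. Proof. by rewrite !xpair_eqE oner_eq0. Qed.
Lemma nzm (a b : K) : (a, 1, b) != v0 K. Proof. by rewrite !xpair_eqE oner_eq0 andbF. Qed.
Lemma nzr (a b : K) : (a, b, 1) != v0 K. Proof. by rewrite !xpair_eqE oner_eq0 andbF. Qed.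

Lemma absI v : ~~ type3 v -> herm v v = 0 -> absv v.
Proof. by move=> t h; rewrite absvN // h. Qed.

Lemma blk2 n v w : n != v0 K -> v != v0 K -> w != v0 K -> absv v -> absv w -> X v != X w -> finc v n -> finc w n -> blk n \in B.
Proof. by move=> nn vn wn va wa vw hv hw; apply: blk_in; apply/card_gt1P; exists (X v), (X w); rewrite !in_blk. Qed.

Lemma X_neq v w : v != v0 K -> w != v0 K -> absv v -> absv w -> cross v w != v0 K -> X v != X w.
Proof.
move=> vn wn va wa; apply: contraNneq => /(X_par vn va wn wa)[k _ ->].
by rewrite cross_scaler crossvv vscale_v0.
Qed.

Lemma c2 (x y z : K) : x = y + (z + z) -> x = y. Proof. by move=> ->; rewrite adddK // addr0. Qed.
Lemma fr0e (x : K) : fr_of ch 0 x = x. Proof. exact: expr1. Qed.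

(** * Unitary maps in a hyperbolic frame *)

Hypothesis e0 : (0 < e)%N.
Hypothesis polE : forall a b c, pol (a, b, c) = (bar a, bar c, bar b).
Notation T := (trans B).
Let bK := barK ch cardK.
Let k3 : (0 < 3 * e)%N. Proof. by rewrite muln_gt0. Qed.
Let tE := @trans_eq U B s (3 * e) erefl k3 U_card block_card block_join block_uniq.
Let tF := @trans_fix U B s (3 * e) erefl k3 U_card block_card block_join block_uniq.
Let tC := @trans_comm U B s (3 * e) erefl k3 U_card block_card block_join block_uniq.

Lemma hE v w : herm v w = bar v.1.1 * w.1.1 + bar v.1.2 * w.2 + bar v.2 * w.1.2.
Proof. by case: v => [[a b] c]; rewrite /PolarityForm.herm polE /dot /=; ring. Qed.

(** Generators used throughout: homologies, elations with center [(0, 0, 1)], unipotent maps fixing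
    that point and adding [b] to the first coordinate of [(x, 1, y)], and SL_2(q) on the line of
    points with first coordinate 0. *)
Definition Fz z v : vec K := (z * v.1.1, v.1.2, v.2).
Definition FE g v : vec K := (v.1.1, v.1.2, v.2 + g * v.1.2).
Definition FH b d v : vec K := (v.1.1 + b * v.1.2, v.1.2, v.2 + bar b * v.1.1 + d * v.1.2).
Definition FS al be ga de v : vec K := (v.1.1, al * v.1.2 + be * v.2, ga * v.1.2 + de * v.2).

Lemma sunit_z z : phi z = z -> z * bar z = 1 -> sunit 0 (Fz z).
Proof.
move=> zr z1; split=> [k v|v w|v]; rewrite ?fr0e.
- by apply: vecP; rewrite /= //; ring.
- rewrite !hE /= frM; transitivity (z * bar z * (bar v.1.1 * w.1.1) + bar v.1.2 * w.2 + bar v.2 * w.1.2); first by ring.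
  by rewrite z1 mul1r.
- by apply: vecP; rewrite /= // frM zr.
Qed.

Lemma sunit_E g : fr_of ch e g = g -> sunit 0 (FE g).
Proof.
move=> gq; have gb := q_bar gq; have gr := q_phi gq; split=> [k v|v w|v]; rewrite ?fr0e.
- by apply: vecP; rewrite /= //; ring.
- by rewrite !hE /= frA frM gb; apply: (c2 (z := g * bar v.1.2 * w.1.2)); ring.
- by apply: vecP; rewrite /= // frA frM gr.
Qed.

Lemma sunit_H b d : phi b = b -> phi d = d -> d + bar d = b * bar b -> sunit 0 (FH b d).
Proof.
move=> br dr h; have bd : bar d = b * bar b - d by rewrite -h addrAC subrr add0r.
split=> [k v|v w|v]; rewrite ?fr0e.
- by apply: vecP; rewrite /= //; ring.
- rewrite !hE /= !(frA, frM) bK bd.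
  by apply: (c2 (z := bar v.1.1 * b * w.1.2 + bar b * bar v.1.2 * w.1.1 + b * bar b * bar v.1.2 * w.1.2)); ring.
- by apply: vecP; rewrite /= // !(frA, frM) ?br ?dr ?(r_bar br).
Qed.

Lemma sunit_S al be ga de : fr_of ch e al = al -> fr_of ch e be = be -> fr_of ch e ga = ga -> fr_of ch e de = de ->
  al * de + be * ga = 1 -> sunit 0 (FS al be ga de).
Proof.
move=> h1 h2 h3 h4 h; split=> [k v|v w|v]; rewrite ?fr0e.
- by apply: vecP; rewrite /= //; ring.
- rewrite !hE /= !(frA, frM) !(q_bar h1, q_bar h2, q_bar h3, q_bar h4).
  transitivity (bar v.1.1 * w.1.1 + (al * de + be * ga) * (bar v.1.2 * w.2 + bar v.2 * w.1.2)); last by rewrite h; ring.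
  by apply: (c2 (z := al * ga * bar v.1.2 * w.1.2 + be * de * bar v.2 * w.2)); ring.
- by apply: vecP; rewrite /= // !(frA, frM) !(q_phi h1, q_phi h2, q_phi h3, q_phi h4).
Qed.

Lemma sunit_fr i : sunit i (vmap (fr_of ch i)).
Proof.
split=> [k v|v w|v]; first by apply: vecP; rewrite /= frM.
  by rewrite !hE /= !(frA, frM) ![bar (fr_of ch i _)]frC.
by apply: vecP; rewrite /= frC.
Qed.

(** * Translations whose center is the point at infinity *)

Definition inft := X (0, 0, 1).
Notation lblk := (blk (1, 0, 0)).

Let ph0 : phi 0 = 0. Proof. exact: fr0. Qed.
Let ph1 : phi 1 = 1. Proof. exact: fr1. Qed.

Lemma t3N_l v : v.1.1 = 0 -> ~~ type3 v.
Proof. by move=> h; apply: (@t3N v 1 0 0); rewrite ?nzl // h; ring. Qed.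

Lemma t3N_r v : v.2 = 0 -> ~~ type3 v.
Proof. by move=> h; apply: (@t3N v 0 0 1); rewrite ?nzr // h; ring. Qed.

Lemma abs_inf : absv (0, 0, 1).
Proof. by apply: absI; [apply: t3N_l|rewrite hE /= !fr0; ring]. Qed.

Lemma absl a : absv (0, 1, a) = (bar a == a).
Proof. by rewrite absvN ?t3N_l // hE /= fr0 fr1 mul0r add0r mul1r mulr1 addr_eq0C // eq_sym. Qed.

Lemma lblkP v : v != v0 K -> absv v -> (X v \in lblk) = (v.1.1 == 0).
Proof.
move=> vn va; rewrite in_blk ?nzl // fincN; last by apply: t3N_r.
by rewrite /dot /= !mulr0 !addr0 mulr1.
Qed.

Lemma lblk_pts x : x \in lblk -> x = inft \/ exists2 a, bar a = a & x = X (0, 1, a).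
Proof.
have [v [vn va ->]] := X_surj x; rewrite lblkP // => /eqP v00.
have [v1|v1] := eqVneq v.1.2 0.
  left; have v20 : v.2 != 0.
    by apply: contraNneq vn => v20; apply/eqP; apply: vecP.
  have vE : v = vscale v.2 (0, 0, 1) by apply: vecP; rewrite /= ?mulr0 ?mulr1.
  by rewrite vE X_scale ?nzr ?abs_inf.
right; have vE : v = vscale v.1.2 (0, 1, v.2 / v.1.2).
  by apply: vecP; rewrite /= ?mulr0 ?mulr1 // mulrC divfK.
have a1 : absv (0, 1, v.2 / v.1.2) by move: va; rewrite {1}vE absvZ.
by exists (v.2 / v.1.2); [apply/eqP; rewrite -absl|rewrite {1}vE X_scale ?nzm].
Qed.

Lemma inf_l : inft \in lblk. Proof. by rewrite lblkP ?nzr ?abs_inf. Qed.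
Lemma pt_l a : bar a = a -> X (0, 1, a) \in lblk.
Proof. by move=> h; rewrite lblkP ?nzm // absl h. Qed.

Lemma inf_neq v : v != v0 K -> absv v -> v.1.2 != 0 -> X v != inft.
Proof.
move=> vn va v1; apply: X_neq; rewrite ?nzr ?abs_inf //.
by apply: contraNneq v1 => -[h _ _]; rewrite -h /= mulr1 mulr0 subr0.
Qed.

Lemma l_in : lblk \in B.
Proof.
apply: (@blk2 _ (0, 0, 1) (0, 1, 0)); rewrite ?nzl ?nzr ?nzm ?abs_inf ?absl ?fr0 //.
- by rewrite eq_sym; apply: inf_neq; rewrite ?nzm ?absl ?fr0 ?oner_eq0.
- by rewrite fincNl ?t3N_l // /dot /= !mulr0 !mul0r !addr0.
- by rewrite fincNl ?t3N_l // /dot /= !mulr0 !mul0r !addr0.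
Qed.

Lemma l_other c : exists x, [/\ x \in lblk, x != c & x = inft \/ x = X (0, 1, 0)].
Proof.
have h : inft != X (0, 1, 0) by rewrite eq_sym inf_neq ?nzm ?absl ?fr0 ?oner_eq0.
have [<-|ne] := eqVneq inft c.
  by exists (X (0, 1, 0)); split; [apply: pt_l; rewrite fr0|rewrite eq_sym|right].
by exists inft; split; [apply: inf_l| |left].
Qed.

Lemma z_fix a z x : (forall v, v != v0 K -> absv v -> a (X v) = X (Fz z v)) -> x \in lblk -> a x = x.
Proof.
move=> aE; have [v [vn va ->]] := X_surj x; rewrite lblkP // => /eqP v00.
by rewrite aE //; congr X; apply: vecP; rewrite /= // v00 mulr0.
Qed.

(** The homology fixes every point of the block, in particular the center, a further point and the
    image of that point, so [trans_comm] applies. *)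
Lemma z_comm a z c t : block_aut B a -> (forall v, v != v0 K -> absv v -> a (X v) = X (Fz z v)) ->
  c \in lblk -> t \in T c -> (t ^ a = t)%g.
Proof.
move=> aB aE cl tT; have [x [xl xc _]] := l_other c.
apply: (tC aB tT (z_fix aE cl) xc (z_fix aE xl)); apply: (z_fix aE).
exact: trans_in tT l_in cl xl.
Qed.

Lemma conj_comm (a t : {perm U}) x : (t ^ a = t)%g -> t (a x) = a (t x).
Proof. by move=> h; rewrite -{1}h permJ. Qed.

Lemma E_trans g : fr_of ch e g = g -> exists2 a, a \in T inft & forall v, v != v0 K -> absv v -> a (X v) = X (FE g v).
Proof.
move=> gq; have sE := sunit_E gq; have [a [aB aE]] := sunit_aut sE; exists a => //.
apply/transP; split=> //.
  by rewrite aE ?nzr ?abs_inf //; congr X; apply: vecP; rewrite /= // mulr0 addr0.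
move=> b bB; have [n nn bE] := blk_surj bB; rewrite bE in_blk ?nzr ?abs_inf // fincNl ?t3N_l // => /eqP.
rewrite /dot /= !mul0r !add0r mul1r => n2; have tn := t3N_r n2.
apply/eqP; rewrite eqEcard card_imset ?leqnn ?andbT; last exact: perm_inj.
apply/subsetP => y /imsetP[x]; have [v [vn va ->]] := X_surj x; rewrite in_blk // fincN // => /eqP vn0 ->.
rewrite aE // in_blk ?(sunit_neq0 sE) ?(sunit_absv _ sE) // fincN //; apply/eqP.
by rewrite -vn0 /dot /= n2 !mulr0.
Qed.

Lemma X_aff v a b : v != v0 K -> absv v -> v.1.1 = a * v.1.2 -> v.2 = b * v.1.2 ->
  absv (a, 1, b) /\ X v = X (a, 1, b).
Proof.
move=> vn va h1 h2; have v1 : v.1.2 != 0.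
  by apply: contraNneq vn => v1; apply/eqP; apply: vecP; rewrite ?h1 ?h2 ?v1 ?mulr0.
have vE : v = vscale v.1.2 (a, 1, b) by apply: vecP; rewrite /= ?mulr1 // ?h1 ?h2 mulrC.
have ab : absv (a, 1, b) by move: va; rewrite {1}vE absvZ.
by split=> //; rewrite {1}vE X_scale ?nzm.
Qed.

(** The block through infinity and [(u, 1, b)] lies on the line [(1, u, 0)], so a translation keeps
    the quotient [u] of the first two coordinates. *)
Lemma inf_join t (u b : K) : t \in T inft -> absv (u, 1, b) -> exists2 y, absv (u, 1, y) & t (X (u, 1, b)) = X (u, 1, y).
Proof.
move=> tT ua; have nT : ~~ type3 (1, u, 0) by apply: t3N_r.
have ni := inf_neq (nzm u b) ua (oner_neq0 K).
have f1 : finc (0, 0, 1) (1, u, 0) by rewrite fincN // /dot /=; apply/eqP; ring.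
have f2 : finc (u, 1, b) (1, u, 0) by rewrite fincN // /dot /= !mulr1 mul1r mulr0 addr0 adddK.
have nB : blk (1, u, 0) \in B by apply: (@blk2 _ (u, 1, b) (0, 0, 1)); rewrite ?nzm ?nzr ?nzl ?abs_inf.
have ib : inft \in blk (1, u, 0) by rewrite in_blk ?nzr ?nzl ?abs_inf.
have xb : X (u, 1, b) \in blk (1, u, 0) by rewrite in_blk ?nzm ?nzl.
have := trans_in tT nB ib xb; have tn : t (X (u, 1, b)) != inft.
  by rewrite -{1}(trans_c tT) (inj_eq (@perm_inj _ t)).
have [w [wn wa wE]] := X_surj (t (X (u, 1, b))); rewrite wE in tn *.
rewrite in_blk ?nzl // fincN // /dot /= mulr1 mulr0 addr0 addr_eq0C // => /eqP w0.
have w1 : w.1.2 != 0.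
  apply: contraNneq tn => w1; rewrite w1 mul0r in w0.
  have w2 : w.2 != 0 by apply: contraNneq wn => w2; apply/eqP; apply: vecP.
  have -> : w = vscale w.2 (0, 0, 1) by apply: vecP; rewrite /= ?mulr0 ?mulr1.
  by rewrite X_scale ?nzr ?abs_inf.
have [ab ->] := @X_aff w u (w.2 / w.1.2) wn wa (etrans w0 (mulrC _ _)) (esym (divfK w1 _)).
by exists (w.2 / w.1.2).
Qed.

Lemma absu (u b : K) : ~~ type3 (u, 1, b) -> absv (u, 1, b) = (u * bar u + (b + bar b) == 0).
Proof.
by move=> t; rewrite absvN // hE /= fr1 mul1r mulr1 [bar u * u]mulrC -addrA.
Qed.

Theorem trans_inf t : t \in T inft -> exists2 g, fr_of ch e g = g & forall v, v != v0 K -> absv v -> t (X v) = X (FE g v).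
Proof.
move=> tT.
(* For [be] in F_(q^2) but not in F_q and [a * bar a = be + bar be], the vectors [(a, 1, be)] and
   [(z * a, 1, be)] with [z = bar be / be] give two points of the subunital on the line
   [(0, be, 1)]. *)
have [be [ber beq]] := @fr_diff K ch e cardK e0 e (2 * e) e0 ltac:(lia) (dvdn_mull _ (dvdnn _)) (dvd6 e0 (i := 2) isT).
have k0 : be + bar be != 0 by rewrite addr_eq0C // bar_r // eq_sym.
have [a [ar aN]] := norm_r cardK e0 (r_trace cardK ber).
have a0 : a != 0 by apply: contraNneq k0 => a0; rewrite -aN a0 mul0r.
have be0 : be != 0 by apply: contraNneq k0 => b0; rewrite b0 fr0 addr0.
pose z := bar be / be.
have zr : phi z = z by rewrite frM frV ber r_bar.
have bb0 : bar be != 0 by rewrite fr_eq0.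
have z1 : z * bar z = 1 by rewrite /z frM frV bK; field; rewrite be0 bb0.
have zn1 : z != 1.
  apply: contraNneq k0 => zE; rewrite addr_eq0C // eq_sym; apply/eqP.
  by rewrite -[RHS]mul1r -zE divfK.
have pN (u b : K) : phi b = b -> u * bar u = be + bar be -> b = be -> absv (u, 1, b).
  move=> br uN bE; have tN : ~~ type3 (u, 1, b).
    by apply: (@t3N _ 0 b 1 ph0 br ph1 (nzr _ _)); rewrite /= mulr0 mul1r mulr1 add0r adddK.
  by rewrite absu // uN bE adddK.
have p0a : absv (a, 1, be) by apply: pN.
have [y ya tp0] := inf_join tT p0a.
have zaN : (z * a) * bar (z * a) = be + bar be by rewrite frM -aN; transitivity (z * bar z * (a * bar a)); [ring|rewrite z1 mul1r].
have p1a : absv (z * a, 1, be) by apply: pN.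
have [az [azB azE]] := sunit_aut (sunit_z zr z1).
have tz := z_comm azB azE inf_l tT.
have tp1 : t (X (z * a, 1, be)) = X (z * a, 1, y).
  have -> : X (z * a, 1, be) = az (X (a, 1, be)) by rewrite azE ?nzm.
  by rewrite (conj_comm _ tz) tp0 azE ?nzm.
have y1a : absv (z * a, 1, y).
  by have := sunit_absv (a, 1, y) (sunit_z zr z1); rewrite /Fz /= => ->.
have neq b : absv (a, 1, b) -> absv (z * a, 1, b) -> X (a, 1, b) != X (z * a, 1, b).
  move=> h1 h2; apply: X_neq; rewrite ?nzm //; apply: contraNneq zn1 => -[_ _ h].
  apply/eqP; apply: (mulIf a0); apply/eqP; rewrite mul1r -subr_eq0 -oppr_eq0 -h /=; apply/eqP; ring.
have lT b : ~~ type3 (0, b, 1) by apply: t3N_l.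
have onl (u b : K) : finc (u, 1, b) (0, b, 1) by rewrite fincN // /dot /= mulr0 mul1r mulr1 add0r adddK.
have bk b : absv (a, 1, b) -> absv (z * a, 1, b) -> blk (0, b, 1) \in B.
  by move=> h1 h2; apply: (@blk2 _ (a, 1, b) (z * a, 1, b)); rewrite ?nzm ?nzr ?neq ?onl.
have inb (u b b' : K) : absv (u, 1, b) -> b = b' -> X (u, 1, b) \in blk (0, b', 1).
  by move=> h <-; rewrite in_blk ?nzm ?nzr ?onl.
(* The translation commutes with the homology of factor [z], so both images have the same last
   coordinate [y]; this determines the image of the whole block. *)
have tl : t @: blk (0, be, 1) = blk (0, y, 1).
  apply: (@block_uniq (X (a, 1, y)) (X (z * a, 1, y))); rewrite ?neq ?bk ?inb //.
  - exact: autP (trans_aut tT) (bk _ p0a p1a).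
  - by rewrite -tp0 imset_f // inb.
  - by rewrite -tp1 imset_f // inb.
(* A further point [(v1, 1, be)] of this block, now off the subplane since [v1] is not in
   F_(q^2). *)
have [u [u1 ur]] := circle ch cardK e0.
pose v1 := u * a.
have v1N : v1 * bar v1 = be + bar be by rewrite frM -aN; transitivity (u * bar u * (a * bar a)); [rewrite /v1; ring|rewrite u1 mul1r].
have v1r : phi v1 != v1 by rewrite frM ar (inj_eq (mulIf a0)).
have q0a : absv (v1, 1, be) by apply: pN.
have [y' y'a tq0] := inf_join tT q0a.
have yy : y' = y.
  have : t (X (v1, 1, be)) \in blk (0, y, 1) by rewrite -tl imset_f // inb.
  by rewrite tq0 in_blk ?nzm ?nzr // fincN // /dot /= mulr0 mul1r mulr1 add0r addr_eq0C // => /eqP.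
rewrite {}yy in y'a tq0.
have yr0 : ~~ type3 (a, 1, y) by apply: (@t3N _ 1 a 0 ph1 ar ph0 (nzl _ _)); rewrite /= mulr1 mul1r mulr0 addr0 adddK.
have yT : y + bar y = be + bar be.
  by move: ya; rewrite absu // aN => /eqP h; apply/eqP; rewrite -addr_eq0C // addrC h.
(* The image is absolute and isotropic, hence not of type III: [v1], [1] and [y] satisfy a linear
   relation over F_(q^2). *)
have v3 : ~~ type3 (v1, 1, y).
  apply: isotropic_type3N y'a; rewrite ?nzm // hE /= fr1 mul1r mulr1 [bar v1 * v1]mulrC v1N -addrA yT.
  exact: adddK.
pose g := y + be.
have gs : bar g = g.
  by apply/eqP; rewrite -addr_eq0C // frA addrACA [bar y + y]addrC [bar be + be]addrC yT adddK.
have yE : y = g + be by rewrite /g -addrA adddK // addr0.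
(* Otherwise the relation reads [v1 = A + Bc * g] over F_(q^2) with [g] in F_(q^3) outside F_q. The
   norm of [v1] then gives a quadratic equation for [g], which forces [Bc = 0] and puts [v1] into
   F_(q^2). *)
have yr : phi y = y.
  apply/eqP; apply: contraT => yr; exfalso.
  have gr : phi g != g by rewrite frA ber (inj_eq (addIr be)).
  have [[[m0 m1] m2] [mn [f0 f1 f2] md]] := type3N_perp (nzm _ _) v3.
  rewrite /dot /= mul1r in md.
  have m00 : m0 != 0.
    apply/eqP => m00; rewrite m00 mulr0 add0r in md.
    have [m20|m20] := eqVneq m2 0.
      by case/eqP: mn; move: md; rewrite m20 mulr0 addr0 m00 => ->.
    case/eqP: yr; have -> : y = - m1 / m2 by apply: (mulIf m20); rewrite divfK //; apply/eqP; rewrite -subr_eq0 opprK addrC md.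
    by rewrite frM frN frV f1 f2.
  have [A AE] : exists A, A = - (m1 + m2 * be) / m0 by eexists.
  have [Bc BE] : exists Bc, Bc = - m2 / m0 by eexists.
  have v1E : v1 = A + Bc * g.
    apply: (mulIf m00); apply/eqP; rewrite -subr_eq0 -md yE AE BE; apply/eqP; field; exact: m00.
  have Ar : phi A = A by rewrite AE frM frN frA frM frV f0 f1 f2 ber.
  have Br : phi Bc = Bc by rewrite BE frM frN frV f0 f2.
  have h : Bc * bar Bc * g ^+ 2 + (A * bar Bc + bar A * Bc) * g + (A * bar A - (be + bar be)) = 0.
    by rewrite -v1N v1E frA (frM ch (3 * e) Bc) gs; ring.
  have [B0 _ _] : [/\ Bc * bar Bc = 0, A * bar Bc + bar A * Bc = 0 & A * bar A - (be + bar be) = 0].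
    apply: (indep3 cardK gr gs) h; rewrite ?frB !(frM, frA) ?Ar ?Br ?ber ?(r_bar Ar) ?(r_bar Br) ?(r_bar ber) //.
  move/eqP: B0; rewrite mulf_eq0 fr_eq0 orbb => /eqP B0.
  by case/eqP: v1r; rewrite v1E B0 mul0r addr0.
have gr : phi g = g by rewrite frA yr ber.
exists g; first exact: rs_q.
have [b bT bE] := E_trans (rs_q gr gs).
suff -> : t = b by [].
apply: (tE tT bT (inf_neq (nzm _ _) p0a (oner_neq0 K))).
by rewrite bE ?nzm // tp0; congr X; apply: vecP; rewrite /= // mulr1 addrC -yE.
Qed.


(** * Involutory centers outside the hermitian subunital: reduction to one line *)

Definition FB z := Fz z \o vmap bar.
Lemma sunit_B z : phi z = z -> z * bar z = 1 -> sunit (0 + 3 * e) (FB z).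
Proof. by move=> h1 h2; apply: sunit_comp; [apply: sunit_z|apply: sunit_fr]. Qed.

Lemma FBK z v : z * bar z = 1 -> FB z (FB z v) = v.
Proof. by move=> h; apply: vecP; rewrite /= ?bK // frM bK mulrA h mul1r. Qed.

(** By Hilbert 90 a fixed point has a representative that is fixed as a vector. If its first
    coordinate is nonzero, it is not isotropic, hence of type III; but then the incidence equation
    becomes [t' ^+ 2 = 0], which puts the point on a line of the subplane. *)
Lemma fixB z v : phi z = z -> z * bar z = 1 -> v != v0 K -> absv v -> X (FB z v) = X v -> v.1.1 = 0.
Proof.
move=> zr z1 vn va; have sB := sunit_B zr z1; case: (sB) => sZ _ _.
have key w : w != v0 K -> absv w -> FB z w = w -> w.1.1 = 0.
  move=> wn wa h; have w0 : z * bar w.1.1 = w.1.1 := congr1 (fun u : vec K => u.1.1) h.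
  have w1 : bar w.1.2 = w.1.2 := congr1 (fun u : vec K => u.1.2) h.
  have w2 : bar w.2 = w.2 := congr1 (fun u : vec K => u.2) h.
  move: h => _; apply/eqP; apply: contraT => w00; exfalso.
  have z0 : z != 0 by apply: contra_eq_neq z1 => ->; rewrite mul0r eq_sym oner_eq0.
  have bw0 : bar w.1.1 = w.1.1 / z by apply: (mulfI z0); rewrite w0 mulrC divfK.
  have hww : herm w w = bar w.1.1 * w.1.1 by rewrite hE w1 w2 [w.2 * _]mulrC -addrA adddK // addr0.
  have [t|t] := boolP (type3 w); last first.
    by move: wa; rewrite absvN // hww mulf_eq0 fr_eq0 orbb (negbTE w00).
  pose t' := w.1.2 * phi w.2 + w.2 * phi w.1.2.
  pose A := w.1.1 * phi w.1.1 / z.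
  have bp x : bar (phi x) = phi (bar x) by rewrite frC.
  have h1 : herm w (vphi w) = A + t' by rewrite hE /= w1 w2 bw0 /A /t'; field.
  have h2 : herm (vphi w) w = A + t' by rewrite hE /= !bp w1 w2 bw0 frM frV zr /A /t'; field.
  move: wa; rewrite /absv finc_polE t /= h1 h2 hww bw0 !(frM, frV) zr => /eqP h.
  have t0 : t' = 0.
    have : t' ^+ 2 = 0.
      apply: (addrI (A ^+ 2)); rewrite addr0; transitivity ((A + t') * (A + t')).
        by apply/esym; apply: (c2 (z := A * t')); ring.
      by rewrite -h /A; field.
    by move/eqP; rewrite sqrf_eq0 => /eqP.
  move: t; apply/negP; have [w10|w10] := eqVneq w.1.2 0.
    by apply: (@t3N w 0 1 0 ph0 ph1 ph0 (nzm _ _)); rewrite w10; ring.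
  have fr : phi (w.2 / w.1.2) = w.2 / w.1.2.
    have p10 : phi w.1.2 != 0 by rewrite fr_eq0.
    rewrite frM frV; apply/eqP; rewrite eqr_div // -addr_eq0C // -t0 /t'; apply/eqP; ring.
  apply: (@t3N w 0 (w.2 / w.1.2) 1 ph0 fr ph1 (nzr _ _)).
  by rewrite mulr0 add0r mulr1 mulrC divfK // adddK.
have Fn := sunit_neq0 sB vn; have Fa : absv (FB z v) by rewrite (sunit_absv _ sB).
move/esym/(X_par vn va Fn Fa) => [k k0 kE].
have kk : k * bar k = 1.
  have : v = vscale (bar k * k) v by rewrite -{1}(FBK v z1) kE sZ add0n kE vscaleA.
  case: (vec_neq0 vn) => h0 vE; apply: (mulIf h0); rewrite mul1r [k * _]mulrC.
  - by rewrite {2}vE.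
  - by rewrite {2}vE.
  - by rewrite {2}vE.
have [y y0 yE] := hilbert90 cardK e0 kk.
have wn : vscale y v != v0 K by rewrite vscale_eq0.
have wa : absv (vscale y v) by rewrite absvZ.
have : FB z (vscale y v) = vscale y v by rewrite sZ add0n kE vscaleA yE.
by move/(key _ wn wa)/eqP; rewrite mulf_eq0 (negbTE y0) => /eqP.
Qed.

Lemma hpX v : v != v0 K -> absv v -> (X v \in hpoints (2 ^ e) pi) = (cross v (vphi v) == v0 K).
Proof. by move=> vn va; rewrite inE val_X // (inD_pt Eu EF). Qed.

(** The homology with factor [z' / z] takes one image to the other and fixes [f], hence it fixes the
    block and its pole [w]. So [w] is [(1, 0, 0)], whose polar line contains no point with nonzero
    first coordinate, or [w] has first coordinate 0 and, being orthogonal to [f], is absolute, which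
    no pole of a block is. *)
Lemma blk_core c y z z' b f : c != 0 -> absv (c, 1, y) -> phi z = z -> z * bar z = 1 -> phi z' = z' -> z' * bar z' = 1 ->
  z != z' -> b \in B -> f \in b -> f \in lblk -> X (FB z (c, 1, y)) \in b -> X (FB z' (c, 1, y)) \in b -> False.
Proof.
move=> c0 ca zr z1 z'r z'1 zz bB fb fl xb x'b.
have sB := sunit_B zr z1; have sB' := sunit_B z'r z'1.
have [n nn bE] := blk_surj bB; have [w wn wE] := pol_surj ch cardK Gu nn; rewrite -wE in bE.
pose et := z' * bar z.
have etr : phi et = et by rewrite frM z'r r_bar.
have et1 : et * bar et = 1 by rewrite frM bK; transitivity ((z' * bar z') * (z * bar z)); [rewrite /et; ring|rewrite z1 z'1 mulr1].
have sZ := sunit_z etr et1; have [a [aB aE]] := sunit_aut sZ.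
pose x := FB z (c, 1, y); pose x' := FB z' (c, 1, y).
have xn : x != v0 K by apply: (sunit_neq0 sB); apply: nzm.
have xa : absv x by rewrite (sunit_absv _ sB).
have x'n : x' != v0 K by apply: (sunit_neq0 sB'); apply: nzm.
have x'a : absv x' by rewrite (sunit_absv _ sB').
have xx' : Fz et x = x'.
  apply: vecP; rewrite //= /et mulrA; congr (_ * _).
  by rewrite -mulrA [bar z * z]mulrC z1 mulr1.
have [g [gn ga] [gE g0]] : exists2 g, g != v0 K /\ absv g & f = X g /\ g.1.1 = 0.
  by have [g [gn ga gE]] := X_surj f; exists g => //; split=> //; apply/eqP; rewrite -lblkP // -gE.
have gz : Fz et g = g by apply: vecP; rewrite //= g0 mulr0.
have Fwn := sunit_neq0 sZ wn.
have f1 : finc x' (pol w) by move: x'b; rewrite bE in_blk ?pol_eq0.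
have f2 : finc g (pol w) by move: fb; rewrite bE gE in_blk ?pol_eq0.
have f3 : finc x' (pol (Fz et w)) by rewrite -xx' (sunit_finc sZ); move: xb; rewrite bE in_blk ?pol_eq0.
have f4 : finc g (pol (Fz et w)) by rewrite -gz (sunit_finc sZ).
have xg : cross x' g != v0 K.
  apply/eqP => /(par_sym x'n gn)[k k0 gk]; move: g0; rewrite gk /= => /eqP.
  rewrite !mulf_eq0 (negbTE k0) fr_eq0 (negbTE c0) orbF /=; apply/negP.
  by apply: contra_eq_neq z'1 => ->; rewrite mul0r eq_sym oner_eq0.
case: (finc_unique cardK x'n gn _ _ f1 f2 f3 f4); rewrite ?pol_eq0 //; first by move/eqP; rewrite (negbTE xg).
move/(pol_par wn Fwn)/(par_sym wn Fwn) => [k k0 [k1 k2 k3']].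
have etn : et != 1.
  apply: contraNneq zz => h; apply/eqP; have := congr1 (fun t => t * z) h.
  by rewrite /et mul1r -mulrA [bar z * z]mulrC z1 mulr1.
have [w0|w0] := eqVneq w.1.1 0; last first.
  have ke : et = k by apply: (mulIf w0).
  have kn x0' : x0' = k * x0' -> x0' = 0.
    move=> h; apply/eqP; apply: contraT => n0; case/eqP: etn; rewrite ke; apply: (mulIf n0).
    by rewrite mul1r -h.
  have w1 := kn _ k2; have w2 := kn _ k3'.
  have wEE : pol w = (bar w.1.1, 0, 0) by case: (w) w1 w2 => [[? ?] ?] /= -> ->; rewrite polE fr0.
  move: f1; rewrite wEE fincN; last by apply: t3N_r.
  rewrite /dot /= !mulr0 !addr0 !mulf_eq0 !fr_eq0 (negbTE c0) (negbTE w0) !orbF => /eqP z0.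
  by move: z'1; rewrite z0 mul0r => /eqP; rewrite eq_sym oner_eq0.
have wt := t3N_l w0.
suff wa : absv w by have := blk_nabs wn; rewrite -bE => /(_ bB); rewrite wa.
have pw : pol w = (0, bar w.2, bar w.1.2) by case: (w) w0 => [[? ?] ?] /= ->; rewrite polE fr0.
rewrite absvN // hE w0 fr0 mul0r add0r; apply/eqP.
move: fl; rewrite gE => /lblk_pts[ginf|[aa ab gaa]].
  have [k' k'0 gk] := X_par (nzr 0 0) abs_inf gn ga (esym ginf).
  move: f2; rewrite gk fincZ // fincNl ?t3N_l // pw /dot /= !mul0r !add0r mul1r fr_eq0 => /eqP ->.
  by rewrite fr0 mul0r mulr0 addr0.
have aaa : absv (0, 1, aa) by rewrite absl ab.
have [k' k'0 gk] := X_par (nzm 0 aa) aaa gn ga (esym gaa).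
move: f2; rewrite gk fincZ // fincNl ?t3N_l // pw /dot /= !mul0r !add0r mul1r addr_eq0C // => /eqP w2E.
have w2 : w.2 = aa * w.1.2 by rewrite -[LHS]bK w2E frM bK ab.
by rewrite w2E w2; apply: (c2 (z := aa * bar w.1.2 * w.1.2)); ring.
Qed.

(** For each of the q + 1 elements z of norm 1, [FB z] swaps the center x with another point. On
    their join the centers are odd in number, because an involution with center x fixes only x, so
    [FB z] fixes one of them, which lies on [lblk] by [fixB]. If all these points belonged to the q
    affine points of the subunital on [lblk], two would agree, against [blk_core]. *)
Lemma Omega2_line c y : absv (c, 1, y) -> X (c, 1, y) \in Omega2 B ->
  bar (c * fr_of ch e c) != c * fr_of ch e c ->
  exists a, [/\ bar a = a, phi a != a & X (0, 1, a) \in Omega2 B].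
Proof.
move=> va xO cN; have c0 : c != 0 by apply: contraNneq cN => ->; rewrite mul0r fr0.
have vn := nzm c y; set v := (c, 1, y) in va xO vn *; set x := X v in xO *.
have [/existsP[a /and3P[/eqP h1 h2 h3]]|/existsPn no] := boolP [exists a, [&& bar a == a, phi a != a & X (0, 1, a) \in Omega2 B]].
  by exists a.
exfalso; pose Z := [set z : K | z ^+ (2 ^ e).+1 == 1].
have cZ : #|Z| = (2 ^ e).+1.
  apply: card_expf_eq1; apply: (@dvdn_trans (2 ^ (2 * e)).-1).
    by rewrite mul2n -addnn expnD -predM_succ ?expn_gt0 // dvdn_mull.
  by rewrite cardK -expnM [(e * 6)%N]mulnC; apply: dvdn_pred_exp2; rewrite dvdn_pmul2r.
have ZP z : z \in Z -> phi z = z /\ z * bar z = 1.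
  rewrite inE => /eqP z1; have z1' : z * fr_of ch e z = 1 by rewrite -z1 exprS.
  have z0 : z != 0 by apply: contra_eq_neq z1' => ->; rewrite mul0r eq_sym oner_eq0.
  have fz : fr_of ch e z = z^-1 by apply: (mulfI z0); rewrite z1' mulfV.
  have zr : phi z = z by rewrite mul2n -addnn -frD fz frV fz invrK.
  by split=> //; rewrite bar_r.
pose b z := bl B x (X (FB z v)).
have bP z : z \in Z -> [/\ b z \in B, x \in b z & X (FB z v) \in b z].
  move=> /ZP[zr z1]; apply: (blP block_join); rewrite eq_sym; apply/eqP => h.
  by case/eqP: c0; apply: (fixB zr z1 vn va h).
have key z : z \in Z -> exists a, (fr_of ch e a == a) && (X (0, 1, a) \in b z).
  move=> zZ; have [zr z1] := ZP z zZ; have [bB xb x'b] := bP z zZ; have sB := sunit_B zr z1.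
  have Fn := sunit_neq0 sB vn; have Fa : absv (FB z v) by rewrite (sunit_absv _ sB).
  have xx' : x != X (FB z v) by apply/eqP => h; case/eqP: c0; apply: (fixB zr z1 vn va (esym h)).
  have [t tT t2] := Omega2P _ _ xO.
  have [a [aB aE]] := sunit_aut sB.
  have a2 : (a ^+ (2 ^ 1) = 1)%g.
    apply: aut_eq => u un ua; rewrite perm1 permM !aE ?FBK ?(sunit_neq0 sB) ?(sunit_absv _ sB) //.
  have ax : a x = X (FB z v) by rewrite aE.
  have ax' : a (X (FB z v)) = x by rewrite aE ?FBK.
  have ab : a @: b z = b z.
    apply: (block_uniq xx' (autP aB bB) bB) => //; first by rewrite -ax' imset_f.
    by rewrite -ax imset_f.
  have t2' : (t ^+ (2 ^ 1) = 1)%g by apply/eqP; rewrite expn1 -order_dvdn t2.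
  have t1 : (t != 1)%g by rewrite -order_eq1 t2.
  have st1 (u : U) : u \in b z :&: Omega2 B -> t u \in b z :&: Omega2 B.
    by rewrite !in_setI => /andP[ub uO]; rewrite (trans_in tT) // (Omega2J (trans_aut tT)).
  have st2 (u : U) : u \in b z :&: Omega2 B -> a u \in b z :&: Omega2 B.
    by rewrite !in_setI => /andP[ub uO]; rewrite (Omega2J aB) // andbT -ab imset_f.
  have := card_fix_mod (isT : prime 2) t2' st1.
  have -> : [set u in b z :&: Omega2 B | t u == u] = [set x].
    apply/setP => u; rewrite in_set in_set1 in_setI; apply/andP/eqP => [[_ /eqP tu]|->]; first exact: tF tT t1 tu.
    by rewrite xb xO (trans_c tT) eqxx.
  rewrite cards1 (card_fix_mod (isT : prime 2) a2 st2) => cf.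
  have [f] : exists f, f \in [set u in b z :&: Omega2 B | a u == u].
    by apply/card_gt0P; rewrite lt0n; apply/eqP => h; rewrite h in cf.
  rewrite in_set in_setI => /andP[/andP[fb fO] /eqP af].
  have [w [wn wa fE]] := X_surj f.
  have w0 : w.1.1 = 0 by apply: (fixB zr z1 wn wa); rewrite -aE // -fE af.
  have fl : f \in lblk by rewrite fE lblkP // w0.
  have [fi|[g gb gE]] := lblk_pts fl; last first.
    exists g; rewrite -gE fb andbT; apply/eqP; apply: rs_q => //; apply/eqP.
    by have := no g; rewrite gb eqxx -gE fO andbT negbK.
  (* A block through infinity would give [c = z * bar c], so that c^(q + 1) would be fixed by [bar],
     contrary to [cN]. *)
  exfalso; move: fb; rewrite fi; have [n nn bE] := blk_surj bB; rewrite bE in_blk ?nzr ?abs_inf // fincNl ?t3N_l // => /eqP.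
  rewrite /dot /= !mul0r !add0r mul1r => n2; have tn := t3N_r n2.
  move: xb x'b; rewrite bE !in_blk // !fincN // /dot /= n2 !mulr0 !addr0 fr1 !mul1r !addr_eq0C // => /eqP e1 /eqP e2.
  have n0 : n.1.1 != 0.
    by apply: contraNneq nn => n0; apply/eqP; apply: vecP; rewrite //= -e1 n0 mulr0.
  have cE : c = z * bar c by apply: (mulIf n0); rewrite e1 e2.
  have fz : fr_of ch e z = bar z by rewrite bar_r.
  have fc : fr_of ch e c = bar z * bar (fr_of ch e c) by rewrite {1}cE frM fz frC.
  case/eqP: cN; rewrite frM; transitivity ((z * bar z) * (bar c * bar (fr_of ch e c))); first by rewrite z1 mul1r.
  transitivity ((z * bar c) * (bar z * bar (fr_of ch e c))); first by ring.
  by rewrite -cE -fc.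
pose g z := odflt 0 [pick a | (fr_of ch e a == a) && (X (0, 1, a) \in b z)].
have gP z : z \in Z -> fr_of ch e (g z) = g z /\ X (0, 1, g z) \in b z.
  move=> /key[a ah]; rewrite /g; case: pickP => [a' /andP[/eqP h1 h2]//|/(_ a)]; by rewrite ah.
have : (#|g @: Z| <= #|[set y : K | fr_of ch e y == y]|)%N.
  by apply: subset_leq_card; apply/subsetP => _ /imsetP[z /gP[h _] ->]; rewrite inE h.
suff gi : {in Z &, injective g}.
  by rewrite (card_in_imset gi) cZ (card_frfix ch cardK e0 e0 (dvdn_mull 6 (dvdnn e))) ltnn.
move=> z z' zZ z'Z gg; apply/eqP; apply: contraT => zz; exfalso.
have [zr z1] := ZP z zZ; have [z'r z'1] := ZP z' z'Z.
have [gq gb] := gP z zZ; have [_ gb'] := gP z' z'Z; rewrite -gg in gb'.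
have [bB xb x1b] := bP z zZ; have [b'B xb' x1b'] := bP z' z'Z.
have gl : X (0, 1, g z) \in lblk by apply: pt_l; apply: q_bar.
have xg : x != X (0, 1, g z).
  by apply: contraTneq gl => <-; rewrite lblkP //=.
have bb : b z = b z' by apply: (block_uniq xg).
by apply: (blk_core c0 va zr z1 z'r z'1 zz bB gb gl x1b); rewrite bb.
Qed.

(** The maps [FH b d] add [b] to the first coordinate [al]. If [al] lies in F_(q^2), it can be made
    0. Otherwise some [b] meets the condition of [Omega2_line]: failure at 0, 1 and an element of
    F_(q^2) outside F_q would imply [fr_of ch e al = bar al], so [al] would lie in F_(q^2). *)
Lemma Omega2_II x : x \in Omega2 B -> x \notin hpoints (2 ^ e) pi ->
  exists a, [/\ bar a = a, phi a != a & X (0, 1, a) \in Omega2 B].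
Proof.
have [v [vn va ->]] := X_surj x => xO; rewrite hpX // => xH.
have v1 : v.1.2 != 0.
  apply: contraNneq xH => v1; have t : ~~ type3 v by apply: (@t3N v 0 1 0 ph0 ph1 ph0 (nzm _ _)); rewrite v1; ring.
  move: va; rewrite absvN // hE v1 fr0 mul0r mulr0 !addr0 mulf_eq0 fr_eq0 orbb => /eqP v00.
  by apply/eqP; apply: vecP; rewrite /= ?v1 ?v00 ?fr0; ring.
have [ab vE] := @X_aff v (v.1.1 / v.1.2) (v.2 / v.1.2) vn va (esym (divfK v1 _)) (esym (divfK v1 _)).
rewrite vE in xO; have {}xH : ~~ ((phi (v.1.1 / v.1.2) == v.1.1 / v.1.2) && (phi (v.2 / v.1.2) == v.2 / v.1.2)).
  have := xH; rewrite -(hpX vn va) vE hpX ?nzm //; apply: contra => /andP[/eqP h1 /eqP h2].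
  by rewrite /vmap /= h1 h2 fr1 crossvv.
move: (v.1.1 / v.1.2) (v.2 / v.1.2) ab xO xH => al y ab xO xH {v vn va v1 vE x}.
have [alr|alr] := eqVneq (phi al) al.
  have [d [dr dN]] := trace_r cardK e0 (r_norm cardK alr).
  have sH := sunit_H alr dr dN; have [a [aB aE]] := sunit_aut sH.
  have := Omega2J aB xO; rewrite aE ?nzm // /FH /= mulr1 adddK // mulr1 => xO'.
  have ab' : absv (0, 1, y + bar al * al + d).
    by have := sunit_absv (al, 1, y) sH; rewrite /FH /= mulr1 adddK // mulr1 => ->.
  exists (y + bar al * al + d); split=> //; first by apply/eqP; rewrite -absl.
  move: xH; rewrite alr eqxx /=; apply: contraNneq => h.
  have yE : y = (y + bar al * al + d) - bar al * al - d by ring.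
  by apply/eqP; rewrite yE !frB h frM alr (r_bar alr) dr.
pose N b := (al + b) * fr_of ch e (al + b).
have [b br bN] : exists2 b, phi b = b & bar (N b) != N b.
  have [/existsP[b /andP[/eqP h1 h2]]|/existsPn no] := boolP [exists b, (phi b == b) && (bar (N b) != N b)].
    by exists b.
  exfalso; have nb b : phi b = b -> (bar al + bar b) * (bar (fr_of ch e al) + b) = (al + b) * (fr_of ch e al + bar b).
    move=> br; have := no b; rewrite br eqxx /= negbK => /eqP; rewrite /N frM !frA -(bar_r br) bK => <-.
    by [].
  have [th [tr tq]] := @fr_diff K ch e cardK e0 e (2 * e) e0 ltac:(lia) (dvdn_mull _ (dvdnn _)) (dvd6 e0 (i := 2) isT).
  have tb : th - bar th != 0 by rewrite subr_eq0 bar_r // eq_sym.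
  have n0 := nb 0 ph0; have n1 := nb 1 ph1; have nt := nb th tr; rewrite !fr0 !addr0 in n0; rewrite fr1 in n1.
  have C1 : fr_of ch e al - bar al = bar (fr_of ch e al) - al.
    apply/eqP; rewrite -subr_eq0; apply/eqP.
    transitivity ((al + 1) * (fr_of ch e al + 1) - al * fr_of ch e al - ((bar al + 1) * (bar (fr_of ch e al) + 1) - bar al * bar (fr_of ch e al))); first by ring.
    by rewrite n1 n0 subrr.
  have C2 : th * (fr_of ch e al - bar al) = bar th * (bar (fr_of ch e al) - al).
    apply/eqP; rewrite -subr_eq0; apply/eqP.
    transitivity ((al + th) * (fr_of ch e al + bar th) - al * fr_of ch e al - ((bar al + bar th) * (bar (fr_of ch e al) + th) - bar al * bar (fr_of ch e al))); first by ring.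
    by rewrite nt n0 subrr.
  have : (th - bar th) * (fr_of ch e al - bar al) = 0 by rewrite mulrBl C2 -C1 subrr.
  move/eqP; rewrite mulf_eq0 (negbTE tb) subr_eq0 /= => /eqP h.
  case/eqP: alr; apply: (fr_inj (ch := ch) (i := e)); rewrite frD h.
  by congr (fr_of ch _ al); lia.
have [d [dr dN]] := trace_r cardK e0 (r_norm cardK br).
have sH := sunit_H br dr dN; have [a [aB aE]] := sunit_aut sH.
have := Omega2J aB xO; rewrite aE ?nzm // /FH /= !mulr1 => xO'.
apply: (Omega2_line _ xO' bN).
by have := sunit_absv (al, 1, y) sH; rewrite /FH /= !mulr1 => ->.
Qed.


Lemma X_line_inj a b : bar a = a -> bar b = b -> X (0, 1, a) = X (0, 1, b) -> a = b.
Proof.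
move=> ha hb /X_par[]; rewrite ?nzm ?absl ?ha ?hb // => k _ [_ k1 ->].
by move: k1; rewrite mulr1 => <-; rewrite mul1r.
Qed.

Lemma perm_commJ (a t : {perm U}) : (forall v, v != v0 K -> absv v -> t (a (X v)) = a (t (X v))) -> (a ^ t = a)%g.
Proof. by move=> h; apply: (mulgI t); rewrite -conjgC; apply: aut_eq => v vn va; rewrite !permM h. Qed.

Lemma inf_sq t : t \in T inft -> (t * t = 1)%g.
Proof.
move=> tT; have [g gq gE] := trans_inf tT; apply: aut_eq => v vn va; rewrite permM perm1.
have sE := sunit_E gq; rewrite !gE ?(sunit_neq0 sE) ?(sunit_absv _ sE) //.
by congr X; apply: vecP; rewrite //= -addrA adddK // addr0.
Qed.

Lemma sl2_act al be ga de p y a : [/\ fr_of ch e al = al, fr_of ch e be = be, fr_of ch e ga = ga & fr_of ch e de = de] ->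
  al * de + be * ga = 1 -> bar p = p -> bar y = y -> ga + de * p = y * (al + be * p) ->
  (forall v, v != v0 K -> absv v -> a (X v) = X (FS al be ga de v)) -> a (X (0, 1, p)) = X (0, 1, y).
Proof.
move=> [h1 h2 h3 h4] d ps ys mE aE; have pa : absv (0, 1, p) by rewrite absl ps.
have FSE : FS al be ga de (0, 1, p) = vscale (al + be * p) (0, 1, y).
  by apply: vecP; rewrite /= ?mulr0 ?mulr1 // mE mulrC.
have k0 : al + be * p != 0.
  have := sunit_neq0 (sunit_S h1 h2 h3 h4 d) (nzm 0 p); rewrite FSE; apply: contraNneq => ->.
  by rewrite vscale0.
by rewrite aE ?nzm // FSE X_scale ?nzm // absl ys.
Qed.

Lemma q_pt g : fr_of ch e g = g -> absv (0, 1, g).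
Proof. by move=> h; rewrite absl (q_bar h). Qed.

Lemma sq_tt (t : {perm U}) : #[t]%g = 2%N -> forall x, t (t x) = x.
Proof.
move=> t2 x; have t22 : (t ^+ 2 = 1)%g by apply/eqP; rewrite -order_dvdn t2.
by rewrite -permM -[(t * t)%g]/(t ^+ 2)%g t22 perm1.
Qed.

Lemma inf_pt g : absv (0, 1, g) -> X (0, 1, g) != inft.
Proof. by move=> h; apply: inf_neq; rewrite ?nzm ?oner_eq0. Qed.

(* If an involution with center off the hermitian subunital moved the point at infinity to a point of
   the subunital, it would act on the q + 1 points of the subunital on the line, q even. *)
Lemma swap_nrat a f t : bar a = a -> phi a != a -> t \in T (X (0, 1, a)) -> #[t]%g = 2%N ->
  bar f = f -> t inft = X (0, 1, f) -> phi f != f.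
Proof.
move=> as_ ar tT t2 fs tf; apply/negP => /eqP fr'; have fq := rs_q fr' fs; have tt := sq_tt t2.
pose Q := [set g : K | fr_of ch e g == g].
pose HL := inft |: [set X (0, 1, g) | g in Q].
have cHL : #|HL| = (2 ^ e).+1.
  rewrite cardsU1 card_in_imset ?(card_frfix ch cardK e0) ?dvdn_mull //.
    have -> // : inft \notin [set X (0, 1, g) | g in Q].
    apply/negP => /imsetP[g]; rewrite inE => /eqP gq h.
    by have := inf_pt (q_pt gq); rewrite -h eqxx.
  by move=> g g'; rewrite !inE => /eqP gq /eqP g'q; apply: X_line_inj; apply: q_bar.
have inHL g : fr_of ch e g = g -> X (0, 1, g) \in HL.
  by move=> gq; rewrite in_setU1; apply/orP; right; apply: imset_f; rewrite inE gq.
have st x : x \in HL -> t x \in HL.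
  rewrite {1}in_setU1 => /orP[/eqP->|/imsetP[g]]; first by rewrite tf inHL.
  rewrite inE => /eqP gq ->; have [->|gf] := eqVneq g f; first by rewrite -tf tt setU11.
  have fg0 : f + g != 0 by rewrite addr_eq0C // eq_sym.
  (* The matrix [(f, 1, 1, 0)] takes [f] to infinity and [g] to [g0]. So [u] below is a translation
     with center [f] that maps infinity to [g], and conjugation by [t] moves its center to infinity,
     where [trans_inf] applies. *)
  pose g0 := (f + g)^-1; have g0q : fr_of ch e g0 = g0 by rewrite frV frA fq gq.
  have dM : f * 0 + 1 * 1 = 1 :> K by ring.
  have sM := sunit_S fq (fr1 ch e) (fr1 ch e) (fr0 ch e) dM; have [aM [aMB aME]] := sunit_aut sM.
  have [u0 u0T u0E] := E_trans g0q.
  have aMB' : block_aut B aM^-1%g by have := @groupV _ (autG B) aM; rewrite !inE aMB.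
  have Mf : aM (X (0, 1, f)) = inft.
    rewrite aME ?nzm ?q_pt //; congr X; apply: vecP; rewrite /= ?mulr1 ?mul1r ?mul0r ?addr0 //.
    exact: adddK.
  have Mi : aM inft = X (0, 1, 0).
    by rewrite aME ?nzr ?abs_inf //; congr X; apply: vecP; rewrite /= ?mulr1 ?mulr0 ?add0r.
  have My : aM (X (0, 1, g)) = X (0, 1, g0).
    rewrite aME ?nzm ?q_pt // -[RHS](X_scale (k := f + g)) ?nzm ?q_pt //; congr X; apply: vecP; rewrite /= ?mulr1 ?mul1r ?mulr0 ?mul0r ?addr0 //.
    by rewrite /g0 mulfV.
  pose u := (u0 ^ aM^-1)%g.
  have uT : u \in T (X (0, 1, f)) by have := transJ aMB' u0T; rewrite -Mf permK.
  have ui : u inft = X (0, 1, g).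
    apply: (@perm_inj _ aM); rewrite My -{1}(permK aM inft) Mi /u permJ permKV u0E ?nzm ?q_pt ?fr0 //.
    by congr X; apply: vecP; rewrite //= add0r mulr1.
  have utT : (u ^ t)%g \in T inft by have := transJ (trans_aut tT) uT; rewrite -tf tt.
  have [g' g'q g'E] := trans_inf utT.
  rewrite -ui -permJ tf g'E ?nzm ?q_pt //.
  have -> : FE g' (0, 1, f) = (0, 1, f + g') by apply: vecP; rewrite //= mulr1.
  by apply: inHL; rewrite frA fq g'q.
have t22 : (t ^+ (2 ^ 1) = 1)%g by apply/eqP; rewrite expn1 -order_dvdn t2.
have t1 : (t != 1)%g by rewrite -order_eq1 t2.
have := card_fix_mod (isT : prime 2) t22 st; rewrite cHL.
have [->|[x]] := set_0Vmem [set x in HL | t x == x].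
  by rewrite cards0 mod0n => /eqP; rewrite modn2 oddS oddX; case: (e) e0.
rewrite in_set => /andP[xH /eqP tx] _; have xa := tF tT t1 tx.
move: xH; rewrite xa in_setU1 => /orP[/eqP h|/imsetP[g]].
  by have := inf_pt (_ : absv (0, 1, a)); rewrite absl as_ => /(_ (eqxx _)); rewrite h eqxx.
rewrite inE => /eqP gq /(X_line_inj as_ (q_bar gq)) ag.
by case/eqP: ar; rewrite ag; apply: q_phi.
Qed.

(** * Involutions commuting with a prescribed semilinear map *)

Lemma sigma_setup : exists o, [/\ odd o, (o %| e)%N, exists k, (6 * e = 2 ^ k * (3 * o))%N,
   (3 * o %| 3 * e)%N & forall x, fr_of ch (3 * o) x = x -> fr_of ch e x = x -> fr_of ch o x = x].
Proof.
(* Here [o] is the odd part of [e]. So x^(2^(3o)) has 2-power order on [K], and its fixed field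
   meets F_q in the field of order 2^o because 3 is prime to the power of 2 that was split off. *)
have [o co eE] := pfactor_coprime (isT : prime 2) e0.
exists o; split; first by rewrite -coprime2n.
- by rewrite {1}eE dvdn_mulr.
- by exists (logn 2 e).+1; rewrite {1}eE expnS; lia.
- by rewrite dvdn_pmul2l // {1}eE dvdn_mulr.
move=> x h1 h2; have := fr_gcd h1 h2; rewrite {1}eE [(3 * o)%N]mulnC -muln_gcdr.
have -> : gcdn 3 (2 ^ logn 2 e) = 1%N; last by rewrite muln1.
by apply/eqP; rewrite -/(coprime _ _) coprimeXr.
Qed.

(** Two fixed point counts in sequence: the field automorphism of 2-power order acts on a group of
    translations of even order, and a map of order 3 then acts on the 2^o translations commuting
    with that automorphism. Regularity of SL_2(q) moves the result to [b]. *)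
Theorem commuting_involution a0 : bar a0 = a0 -> phi a0 != a0 -> X (0, 1, a0) \in Omega2 B ->
  forall b al be ga de, bar b = b -> phi b != b ->
  [/\ fr_of ch e al = al, fr_of ch e be = be, fr_of ch e ga = ga & fr_of ch e de = de] ->
  al * de + be * ga = 1 -> ga + de * phi b = b * (al + be * phi b) ->
  forall ps, block_aut B ps -> (forall v, v != v0 K -> absv v -> ps (X v) = X (FS al be ga de (vphi v))) ->
  exists t, [/\ t \in T (X (0, 1, b)), #[t]%g = 2%N & (t ^ ps = t)%g].
Proof.
move=> a0s a0r a0O b al be ga de bs br bq bd bE ps psB psE.
have [o [oo oe [k ke] o3 og]] := sigma_setup.
have o0 : (0 < o)%N by case: (o) oo.
have o6 : (3 * o %| 6 * e)%N by apply: dvdn_trans o3 _; rewrite dvdn_pmul2r.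
have [a1 [a1s a1o]] := @fr_diff K ch e cardK e0 o (3 * o) o0 ltac:(lia) (dvdn_trans oe (dvdn_mull _ (dvdnn _))) o6.
have sfix x : fr_of ch (3 * o) x = x -> bar x = x by move=> h; case/dvdnP: o3 => j ->; apply: fr_mul_fix.
have a1b := sfix _ a1s.
have a1r : phi a1 != a1 by apply: contraNneq a1o => h; apply/eqP/og => //; apply: rs_q.
have x1O : X (0, 1, a1) \in Omega2 B.
  have [l1 [l2 [l3 [l4 [lq [ld lE]]]]]] := sl2_trans cardK e0 a0s a0r a1b a1r.
  case: (lq) => q1 q2 q3 q4; have [a [aB aE]] := sunit_aut (sunit_S q1 q2 q3 q4 ld).
  by rewrite -(sl2_act lq ld a0s a1b lE aE); apply: Omega2J.
have [sg [sgB sgE]] := sunit_aut (sunit_fr (3 * o)).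
have sgX a : bar a = a -> sg (X (0, 1, a)) = X (0, 1, fr_of ch (3 * o) a).
  by move=> h; rewrite sgE ?nzm ?absl ?h //; congr X; apply: vecP; rewrite //= ?fr0 ?fr1.
have sginf : sg inft = inft by rewrite sgE ?nzr ?abs_inf //; congr X; apply: vecP; rewrite //= ?fr0 ?fr1.
have sgk : (sg ^+ (2 ^ k) = 1)%g.
  apply: aut_eq => v vn va; rewrite perm1.
  have -> (j : nat) : (sg ^+ j)%g (X v) = X (vmap (fr_of ch (j * (3 * o))) v).
    elim: j => [|j IH]; first by rewrite perm1; congr X; apply: vecP; rewrite /= fr0e.
    have sS := sunit_fr (j * (3 * o)).
    rewrite expgSr permM IH sgE ?(sunit_neq0 sS) ?(sunit_absv _ sS) //.
    by congr X; apply: vecP; rewrite /= frD mulSn.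
  by rewrite -ke; congr X; apply: vecP; rewrite /= (fr6e ch cardK).
(* Conjugation as a permutation of permutations, so that [card_fix_mod] can count translations. *)
pose cj (a : {perm U}) : {perm {perm U}} := perm (@conjg_inj _ a).
have cjE a t : cj a t = (t ^ a)%g by rewrite permE.
have cjX a i : (cj a ^+ i = cj (a ^+ i))%g.
  elim: i => [|i IH]; apply/permP => t; first by rewrite perm1 cjE conjg1.
  by rewrite expgSr permM IH !cjE -conjgM -expgSr.
have cj1 : cj 1%g = 1%g by apply/permP => t; rewrite cjE conjg1 perm1.
(* The group of translations has even order and [sg] acts as a 2-group, so besides the identity some
   translation is fixed by conjugation; a power of it is an involution. *)
have [t1 [t1T t12 t1s]] : exists t1, [/\ t1 \in T (X (0, 1, a1)), #[t1]%g = 2%N & (t1 ^ sg = t1)%g].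
  have ck : (cj sg ^+ (2 ^ k) = 1)%g by rewrite cjX sgk cj1.
  have st t : t \in T (X (0, 1, a1)) -> cj sg t \in T (X (0, 1, a1)).
    move=> tT; rewrite cjE; have sg1 := etrans (sgX a1 a1b) (congr1 (fun z => X (0, 1, z)) a1s).
    by rewrite -sg1; apply: transJ sgB tT.
  have := card_fix_mod (isT : prime 2) ck st.
  have [t0 t0T t02] := Omega2P _ _ x1O.
  have dT : (#[t0]%g %| #|transG B (X (0, 1, a1)%R)|)%N by apply: order_dvdG.
  rewrite t02 in dT; rewrite (eqP dT : (#|trans B (X (0, 1, a1)%R)| %% 2 = 0)%N).
  set C := [set t in _ | _]; have C1 : 1%g \in C.
    by rewrite inE (group1 (transG B _)) cjE conj1g eqxx.
  have [C0|[t]] := set_0Vmem (C :\ 1%g).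
    by rewrite (cardsD1 1%g) C1 C0 cards0.
  rewrite !inE cjE => /and3P[t1 tT /eqP ts] _.
  have tT' : t \in T (X (0, 1, a1)) by rewrite inE.
  have [i oi] := trans_order2 erefl k3 U_card block_card block_join block_uniq tT' t1.
  exists (t ^+ i)%g; split; [exact: (@groupX _ (transG B (X (0, 1, a1))) t i tT')|exact: oi|by rewrite conjXg ts].
have t1t := sq_tt t12.
have a1a : absv (0, 1, a1) by rewrite absl a1b.
have t1n : (t1 != 1)%g by rewrite -order_eq1 t12.
have x'l : t1 inft \in lblk by apply: trans_in t1T l_in (pt_l a1b) inf_l.
have x'ne : t1 inft != inft.
  by apply/eqP => h; have := inf_pt a1a; rewrite -(tF t1T t1n h) eqxx.
have [h|[a' a's x'E]] := lblk_pts x'l; first by rewrite h eqxx in x'ne.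
have a'r := swap_nrat a1b a1r t1T t12 a's x'E.
have a'a : absv (0, 1, a') by rewrite absl a's.
have sgx : fr_of ch (3 * o) a' = a'.
  apply: X_line_inj => //; first by rewrite frC a's.
  by rewrite -sgX // -x'E -(conj_comm _ t1s) sginf.
pose x' := X (0, 1, a').
have t1x : t1 x' = inft by rewrite /x' -x'E t1t.
have toInf t : t \in T x' -> (t ^ t1)%g \in T inft.
  by move=> tT; have := transJ (trans_aut t1T) tT; rewrite t1x.
have fromInf t : t \in T inft -> (t ^ t1)%g \in T x'.
  by move=> tT; have := transJ (trans_aut t1T) tT; rewrite x'E.
have cj2 t : ((t ^ t1) ^ t1 = t)%g.
  have t11 : (t1 * t1 = 1)%g by apply/permP => x; rewrite permM t1t perm1.
  by rewrite -conjgM t11 conjg1.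
have a00 : absv (0, 1, 0) by apply: q_pt; rewrite fr0.
(* Conjugation by [t1], which commutes with [sg], carries the translations at infinity that commute
   with [sg] to those at [x']. The former are the elations with parameter in the field of order
   2^o. *)
pose C0 := [set t in T inft | (t ^ sg == t)%g].
pose C := [set t in T x' | (t ^ sg == t)%g].
have cC0 : #|C0| = (2 ^ o)%N.
  have <- : #|[set X (0, 1, g) | g in [set g : K | fr_of ch o g == g]]| = (2 ^ o)%N.
    rewrite card_in_imset ?(card_frfix ch cardK e0) ?(dvdn_trans oe) ?dvdn_mull //.
    move=> g g'; rewrite !inE => /eqP gq /eqP g'q; case/dvdnP: oe => j jE; apply: X_line_inj; apply: q_bar;
      by rewrite jE fr_mul_fix.
  rewrite -(card_in_imset (f := fun t : {perm U} => t (X (0, 1, 0))) (D := C0)); last first.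
    move=> t t'; rewrite !inE => /andP[tT _] /andP[t'T _] h.
    by apply: (tE _ _ (inf_pt a00) h); rewrite inE.
  apply: eq_card => y; apply/imsetP/imsetP => -[].
    move=> t; rewrite in_set => /andP[tT /eqP ts] ->; have [g gq gE] := trans_inf tT.
    have tg : t (X (0, 1, 0)) = X (0, 1, g).
      by rewrite gE ?nzm //; congr X; apply: vecP; rewrite //= add0r mulr1.
    exists g => //; rewrite inE; apply/eqP; apply: og => //.
    have gb := q_bar gq; apply: X_line_inj; [by rewrite frC gb|exact: gb|].
    by rewrite -sgX ?(q_bar gq) // -tg -(conj_comm _ ts) sgX ?fr0.
  move=> g; rewrite inE => /eqP go ->.
  have gq : fr_of ch e g = g by case/dvdnP: oe => j ->; apply: fr_mul_fix.
  have [a aT aE] := E_trans gq.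
  have ag : a (X (0, 1, 0)) = X (0, 1, g).
    by rewrite aE ?nzm //; congr X; apply: vecP; rewrite //= add0r mulr1.
  exists a => //; rewrite in_set aT; apply/eqP.
  have sT : (a ^ sg)%g \in T inft by have := transJ sgB aT; rewrite sginf.
  apply: (tE sT aT (inf_pt a00)).
  have s0 : sg (X (0, 1, 0)) = X (0, 1, 0) by rewrite sgX ?fr0.
  by rewrite -{1}s0 permJ ag sgX ?(q_bar gq) // fr_mul_fix.
have cC : #|C| = (2 ^ o)%N.
  have -> : C = [set (t ^ t1)%g | t in C0].
    apply/setP => t; apply/idP/imsetP.
      rewrite in_set => /andP[tT /eqP ts]; exists (t ^ t1)%g; last by rewrite cj2.
      by rewrite in_set (toInf _ tT) /= conjJg ts t1s eqxx.
    case=> v; rewrite in_set => /andP[uT /eqP us] ->; rewrite in_set (fromInf _ uT) /=.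
    by rewrite conjJg us t1s eqxx.
  by rewrite card_imset ?cC0 //; apply: (@conjg_inj _ t1).
have pa's : bar (phi a') = phi a' by rewrite frC a's.
have pa'r : phi (phi a') != phi a' by rewrite (inj_eq (fr_inj (ch := ch) (i := 2 * e))).
(* The matrix taking [phi a'] to [a'] makes [p] below fix [x']. Uniqueness of the matrix shows that
   its entries are fixed by the field automorphism, so [p] commutes with [sg]; its cube is 1 by
   [sl2_order3]. *)
have [m1 [m2 [m3 [m4 [mq [md mE]]]]]] := sl2_trans cardK e0 pa's pa'r a's a'r.
case: (mq) => q1 q2 q3 q4.
have [r1 r2 r3 r4] : [/\ phi m1 = m1, phi m2 = m2, phi m3 = m3 & phi m4 = m4] by split; apply: q_phi.
have sP := sunit_comp (sunit_S q1 q2 q3 q4 md) (sunit_fr (2 * e)).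
have [p [pB pE]] := sunit_aut sP.
have px : p x' = x'.
  have pa'a : absv (0, 1, phi a') by rewrite absl pa's.
  have [aS [_ aSE]] := sunit_aut (sunit_S q1 q2 q3 q4 md).
  have := sl2_act mq md pa's a's mE aSE; rewrite aSE ?nzm // => h.
  rewrite /x' pE ?nzm // -[RHS]h /=.
  by congr (X (FS _ _ _ _ _)); apply: vecP; rewrite //= ?fr0 ?fr1.
have [n1 n2 n3 n4] : [/\ fr_of ch (3 * o) m1 = m1, fr_of ch (3 * o) m2 = m2, fr_of ch (3 * o) m3 = m3 & fr_of ch (3 * o) m4 = m4].
  apply: (sl2_uniq cardK pa's pa'r _ _ mq md _ mE).
  - by split; rewrite frC ?q1 ?q2 ?q3 ?q4.
  - by rewrite -!frM -frA md fr1.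
  - have pe : fr_of ch (3 * o) (phi a') = phi a' by rewrite frC sgx.
    by have := congr1 (fr_of ch (3 * o)) mE; rewrite !(frA, frM) pe sgx.
have psg : (p ^ sg = p)%g.
  have sS := sunit_fr (3 * o).
  apply: perm_commJ => v vn va; rewrite !sgE ?pE ?sgE ?(sunit_neq0 sP) ?(sunit_absv _ sP) ?(sunit_neq0 sS) ?(sunit_absv _ sS) //=.
  by congr X; apply: vecP; rewrite /= ?(frA, frM) ?n1 ?n2 ?n3 ?n4 ![fr_of ch (3 * o) (phi _)]frC.
have p3 : (p ^+ (3 ^ 1) = 1)%g.
  {
  have [o1 o2 o3' o4] := sl2_order3 cardK a's a'r mq md mE.
  apply: aut_eq => v vn va; rewrite perm1 expn1.
  have sPP := sunit_comp sP sP.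
  have -> : (p ^+ 3)%g (X v) = p (p (p (X v))) by rewrite !expgSr expg0 mul1g !permM.
  rewrite pE // pE ?(sunit_neq0 sP) ?(sunit_absv _ sP) // pE ?(sunit_neq0 sPP v) ?(sunit_absv _ sPP) //.
  - congr X; rewrite /=; case: v {vn va} => [[x y] z].
    have f2 : FS m1 m2 m3 m4 (vphi (FS m1 m2 m3 m4 (vphi (x, y, z)))) = FS m4 m2 m3 m1 (vphi (vphi (x, y, z))).
      apply: vecP; rewrite //= !(frA, frM) r1 r2 r3 r4.
        by transitivity ((m1 * m1 + m2 * m3) * phi (phi y) + (m1 * m2 + m2 * m4) * phi (phi z)); [ring|rewrite o1 o2].
      by transitivity ((m3 * m1 + m4 * m3) * phi (phi y) + (m3 * m2 + m4 * m4) * phi (phi z)); [ring|rewrite o3' o4].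
    rewrite f2; apply: vecP; rewrite /= ?(frA, frM) ?r1 ?r2 ?r3 ?r4 !phi3 //.
      transitivity ((m1 * m4 + m2 * m3) * y); last by rewrite md mul1r.
      by apply: (c2 (z := m1 * m2 * z)); ring.
    transitivity ((m1 * m4 + m2 * m3) * z); last by rewrite md mul1r.
    by apply: (c2 (z := m3 * m4 * y)); ring.
  all: by rewrite ?(sunit_neq0 sP) ?(sunit_neq0 sPP) ?(sunit_absv _ sP) ?(sunit_absv _ sPP).
  }
(* As [o] is odd, [C] has 2 modulo 3 elements, so the identity is not the only one fixed by [p]. *)
have [t [tT tn tp]] : exists t, [/\ t \in T x', (t != 1)%g & (t ^ p = t)%g].
  have ck : (cj p ^+ (3 ^ 1) = 1)%g by rewrite cjX p3 cj1.
  have st t : t \in C -> cj p t \in C.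
    rewrite !in_set cjE => /andP[tT /eqP ts]; apply/andP; split.
      have tT' : t \in T x' by rewrite in_set.
      by have := transJ pB tT'; rewrite px in_set.
    by rewrite conjJg ts psg.
  have := card_fix_mod (isT : prime 3) ck st; rewrite cC.
  set S := [set t in _ | _].
  have T1 : 1%g \in T x' by exact: (group1 (transG B x')).
  have C1 : 1%g \in C by rewrite in_set T1 conj1g eqxx.
  have S1 : 1%g \in S by rewrite in_set C1 cjE conj1g eqxx.
  have [S0|[t]] := set_0Vmem (S :\ 1%g).
    rewrite (cardsD1 1%g S) S1 S0 cards0 => h.
    have h2 : (2 ^ o %% 3 = 2)%N.
      rewrite -(odd_double_half o) oo -mul2n expnD expnM -modnMmr -modnXm.
      by rewrite -[(2 ^ 2 %% 3)%N]/1%N exp1n.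
    by move: h; rewrite h2.
  rewrite in_setD1 in_set => /andP[tn /andP[+ /eqP tp]] _; rewrite in_set => /andP[tT _].
  by exists t; split=> //; rewrite -cjE.
have t2 : #[t]%g = 2%N.
  have tt1 : ((t ^ t1) * (t ^ t1) = 1)%g by apply: inf_sq; exact: (toInf _ tT).
  have : ((t * t) ^ t1 = 1)%g by rewrite (conjMg t t t1) tt1.
  move/eqP; rewrite conjg_eq1 => /eqP tsq.
  have o1 : #[t]%g != 1%N by rewrite order_eq1.
  by apply/(prime_nt_dvdP (isT : prime 2) o1); rewrite order_dvdn expgS expg1 tsq.
have [l1 [l2 [l3 [l4 [lq [ld lE]]]]]] := sl2_trans cardK e0 a's a'r bs br.
case: (lq) => k1 k2 k3' k4; have sL := sunit_S k1 k2 k3' k4 ld; have [a [aB aE]] := sunit_aut sL.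
exists (t ^ a)%g; split.
- by have := transJ aB tT; rewrite (sl2_act lq ld a's bs lE aE).
- by rewrite orderJ.
have [f1 f2 f3 f4] : [/\ phi l1 = l1, phi l2 = l2, phi l3 = l3 & phi l4 = l4] by split; apply: q_phi.
have lE' : l3 + l4 * phi a' = phi b * (l1 + l2 * phi a').
  by rewrite -{1}f3 -{1}f4 -frM -frA lE !(frA, frM) f1 f2.
case: (bq) => b1 b2 b3 b4.
(* Both matrix products take [phi a'] to [b], so regularity identifies them; this is the equation
   [p ^ a = ps] in matrix form. *)
have [c1 c2' c3 c4] : [/\ al * l1 + be * l3 = l1 * m1 + l2 * m3, al * l2 + be * l4 = l1 * m2 + l2 * m4,
    ga * l1 + de * l3 = l3 * m1 + l4 * m3 & ga * l2 + de * l4 = l3 * m2 + l4 * m4].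
  apply: (sl2_uniq cardK pa's pa'r _ _ _ _ (mob_comp lE' bE) (mob_comp mE lE)).
  - by rewrite !(frA, frM) b1 b2 b3 b4 k1 k2 k3' k4.
  - transitivity ((al * de + be * ga) * (l1 * l4 + l2 * l3)); last by rewrite bd ld mulr1.
    by apply: (c2 (z := al * l1 * ga * l2 + be * l3 * de * l4)); ring.
  - by rewrite !(frA, frM) q1 q2 q3 q4 k1 k2 k3' k4.
  - transitivity ((l1 * l4 + l2 * l3) * (m1 * m4 + m2 * m3)); last by rewrite ld md mulr1.
    by apply: (c2 (z := l1 * m1 * l3 * m2 + l2 * m3 * l4 * m4)); ring.
have pa : (p ^ a = ps)%g.
  apply: (mulgI a); rewrite -conjgC; apply: aut_eq => v vn va; rewrite !permM.
  rewrite pE // aE ?(sunit_neq0 sP) ?(sunit_absv _ sP) // aE // psE ?(sunit_neq0 sL) ?(sunit_absv _ sL) //.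
  congr X; apply: vecP; rewrite //= !(frA, frM) f1 f2 f3 f4.
    transitivity ((l1 * m1 + l2 * m3) * phi v.1.2 + (l1 * m2 + l2 * m4) * phi v.2); first by ring.
    by rewrite -c1 -c2'; ring.
  transitivity ((l3 * m1 + l4 * m3) * phi v.1.2 + (l3 * m2 + l4 * m4) * phi v.2); first by ring.
  by rewrite -c3 -c4; ring.
by rewrite -pa -conjJg tp.
Qed.

(** * No involutory center off the subunital for even e *)

Theorem no_II_even a0 : ~~ odd e -> bar a0 = a0 -> phi a0 != a0 -> X (0, 1, a0) \notin Omega2 B.
Proof.
move=> ev a0s a0r; apply/negP => a0O.
have [w [w1 wr]] := cube_root ch cardK; rewrite (negbTE ev) => wb; have wq := rs_q wr wb.
(* The resolvent satisfies [phi b = w * b], so the point [(0, 1, b)] is fixed by the diagonal matrix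
   [(w ^+ 2, w)] composed with [phi]. *)
have [g [gs bn0]] := resolvent cardK e0 w1 wr; pose b := g + w ^+ 2 * phi g + w * phi (phi g); rewrite -/b in bn0.
have w3 : w ^+ 3 = 1.
  by apply/eqP; rewrite -subr_eq0; apply/eqP; transitivity ((w - 1) * (1 + w + w ^+ 2)); [ring|rewrite w1 mulr0].
have w0 : w != 0 by apply: contra_eq_neq w3 => ->; rewrite expr0n eq_sym oner_eq0.
have bs : bar b = b by rewrite /b !frA !frM frX ![bar (phi _)]frC wb gs.
have bw : phi b = w * b.
  rewrite /b !frA (frM ch (2 * e) (w ^+ 2)) frX (frM ch (2 * e) w) phi3 wr.
  transitivity (w * g + w ^+ 3 * phi g + w ^+ 2 * phi (phi g)); first by rewrite w3; ring.
  by ring.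
have br : phi b != b by rewrite bw; apply: cube_eq1_neq.
have q0 := fr0 ch e; have q2 : fr_of ch e (w ^+ 2) = w ^+ 2 by rewrite frX wq.
have r2 := q_phi q2.
have d : w ^+ 2 * w + 0 * 0 = 1 by rewrite mulr0 addr0 -exprSr.
have EE : 0 + w * phi b = b * (w ^+ 2 + 0 * phi b) by rewrite bw; ring.
have hq : [/\ fr_of ch e (w ^+ 2) = w ^+ 2, fr_of ch e 0 = 0, fr_of ch e 0 = 0 & fr_of ch e w = w] by [].
have sP := sunit_comp (sunit_S q2 q0 q0 wq d) (sunit_fr (2 * e)).
have [p [pB pE]] := sunit_aut sP.
have [t [tT t2 tp]] := commuting_involution a0s a0r a0O bs br hq d EE pB pE.
have tt := sq_tt t2; have t1 : (t != 1)%g by rewrite -order_eq1 t2.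
have ba : absv (0, 1, b) by rewrite absl bs.
have w20 : w ^+ 2 != 0 by rewrite expf_neq0.
have pX f : bar f = f -> p (X (0, 1, f)) = X (0, 1, w ^+ 2 * phi f).
  move=> fs; have fa : absv (0, 1, f) by rewrite absl fs.
  have fa' : absv (0, 1, w ^+ 2 * phi f) by rewrite absl frM frC fs frX wb.
  rewrite pE ?nzm // -[RHS](X_scale (k := w ^+ 2)) ?nzm //; congr X; apply: vecP; rewrite /= ?fr0 ?fr1 ?mulr0 ?mulr1 ?mul0r ?addr0 ?add0r //.
  by rewrite mulrA -exprD (_ : 2 + 2 = 3 + 1)%N // exprD w3 mul1r.
have pinf : p inft = inft.
  rewrite pE ?nzr ?abs_inf // -[RHS](X_scale (k := w)) ?nzr ?abs_inf //; congr X; apply: vecP; rewrite /= ?fr0 ?fr1 ?mulr0 ?mulr1 ?mul0r ?addr0 ?add0r //.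
have x'l : t inft \in lblk by apply: trans_in tT l_in (pt_l bs) inf_l.
have x'ne : t inft != inft.
  by apply/eqP => h; have := inf_pt ba; rewrite -(tF tT t1 h) eqxx.
have [h|[f fs fE]] := lblk_pts x'l; first by rewrite h eqxx in x'ne.
have fr := swap_nrat bs br tT t2 fs fE.
have fw : w ^+ 2 * phi f = f.
  apply: X_line_inj; rewrite ?frM ?frX ?wb 1?[bar (phi _)]frC ?fs //.
  by rewrite -pX // -fE -(conj_comm _ tp) pinf.
have f0 : f != 0 by apply: contraNneq fr => ->; rewrite fr0.
(* Both [f] and [b] are eigenvectors of [phi] for [w], so [c] lies in F_q. With [m] its square root,
   the diagonal matrix [(m^-1, m)] takes [b] to [f] and commutes with [p]. *)
pose c := f / b.
have cr : phi c = c.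
  rewrite /c frM frV bw; have -> : phi f = w * f by rewrite -{2}fw mulrA -exprS w3 mul1r.
  by field; rewrite w0 bn0.
have cs : bar c = c by rewrite /c frM frV fs bs.
have [m [mq mc]] := q_sqrt e0 (rs_q cr cs).
have m0 : m != 0.
  by apply: contraNneq f0 => m0; move: mc; rewrite m0 expr0n /c => /esym/eqP; rewrite mulf_eq0 invr_eq0 (negbTE bn0) orbF.
have mvq : fr_of ch e m^-1 = m^-1 by rewrite frV mq.
have dd : m^-1 * m + 0 * 0 = 1 by rewrite mulVf // mulr0 addr0.
have hq' : [/\ fr_of ch e m^-1 = m^-1, fr_of ch e 0 = 0, fr_of ch e 0 = 0 & fr_of ch e m = m] by [].
have EE' : 0 + m * b = f * (m^-1 + 0 * b).
  have -> : f = m ^+ 2 * b by rewrite mc /c divfK.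
  by field.
have sD := sunit_S mvq q0 q0 mq dd; have [a [aB aE]] := sunit_aut sD.
have ab := sl2_act hq' dd bs fs EE' aE.
have mr := q_phi mq; have mvr := q_phi mvq.
have pa : (p ^ a = p)%g.
  apply: perm_commJ => v vn va; rewrite pE // !aE ?pE ?(sunit_neq0 sD) ?(sunit_absv _ sD) ?(sunit_neq0 sP) ?(sunit_absv _ sP) //=.
  by congr X; apply: vecP; rewrite /= ?(frA, frM) ?mr ?mvr ?fr0 //; ring.
(* The center of [t'] is the image of infinity under [t], so the conjugate of [t'] by [t] is a
   translation at infinity commuting with [p]. Its parameter satisfies [w * g0 = g0] and hence
   vanishes. *)
pose t' := (t ^ a)%g.
have t'T : t' \in T (X (0, 1, f)) by have := transJ aB tT; rewrite ab.
have t'p : (t' ^ p = t')%g by rewrite /t' -{1}pa -conjJg tp.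
have uT : (t' ^ t)%g \in T inft by have := transJ (trans_aut tT) t'T; rewrite -fE tt.
have up : ((t' ^ t) ^ p = t' ^ t)%g by rewrite conjJg t'p tp.
have [g0 g0q g0E] := trans_inf uT.
have z0 : absv (0, 1, 0) by apply: q_pt.
have u0 : (t' ^ t)%g (X (0, 1, 0)) = X (0, 1, g0).
  by rewrite g0E ?nzm //; congr X; apply: vecP; rewrite //= add0r mulr1.
have p0 : p (X (0, 1, 0)) = X (0, 1, 0) by rewrite pX ?fr0 // mulr0.
have gw : w ^+ 2 * phi g0 = g0.
  have gb := q_bar g0q; apply: X_line_inj; rewrite ?frM ?frX ?wb 1?[bar (phi _)]frC ?gb //.
  by rewrite -pX // -u0 -(conj_comm _ up) p0.
have g00 : g0 = 0.
  apply/eqP; apply: contraT => gn; have : w * g0 = g0 by rewrite -{1}gw (q_phi g0q) mulrA -exprS w3 mul1r.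
  by move/eqP; rewrite (negbTE (cube_eq1_neq ch w1 gn)).
have u1 : (t' ^ t = 1)%g.
  apply/eqP; apply: contraT => un; have := inf_pt z0.
  have h : (t' ^ t)%g (X (0, 1, 0)) = X (0, 1, 0) by rewrite u0 g00.
  by rewrite -(tF uT un h) eqxx.
have : t = 1%g by apply: (@conjg_inj _ a); apply: (@conjg_inj _ t); rewrite -/t' u1 !conj1g.
by move/eqP; rewrite (negbTE t1).
Qed.


(** * Odd e: an orthonormal frame *)

Lemma res_phi (w g : K) : phi w = w -> w ^+ 3 = 1 ->
  phi (g + w ^+ 2 * phi g + w * phi (phi g)) = w * (g + w ^+ 2 * phi g + w * phi (phi g)).
Proof.
move=> wr w3; rewrite !frA (frM ch (2 * e) (w ^+ 2)) frX (frM ch (2 * e) w) phi3 wr.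
transitivity (w * g + w ^+ 3 * phi g + w ^+ 2 * phi (phi g)); first by rewrite w3; ring.
by ring.
Qed.

Section OddCase.
Variables (k u i : K).
Hypotheses (k2 : k ^+ 2 = k + 1) (kr : phi k = k) (kb : bar k = k + 1) (ui1 : u * i = 1)
  (ub : bar u = i) (uphi : phi u = (k + 1) * u).

(* Certificate for an identity modulo the ideal generated by [k ^+ 2 - k - 1], [u * i - 1] and [2]:
   [A], [C], [Z] are the cofactors. *)
Lemma kc (x y A C Z : K) : x - y = A * (k ^+ 2 - k - 1) + C * (u * i - 1) + (Z + Z) -> x = y.
Proof.
rewrite k2 ui1 adddK // => h; apply/eqP; rewrite -subr_eq0 h; apply/eqP; ring.
Qed.

Let u0 : u != 0. Proof. by apply: contra_eq_neq ui1 => ->; rewrite mul0r eq_sym oner_eq0. Qed.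
Let i0 : i != 0. Proof. by apply: contra_eq_neq ui1 => ->; rewrite mulr0 eq_sym oner_eq0. Qed.
Let ib : bar i = u. Proof. by rewrite -ub bK. Qed.
Let iphi : phi i = k * i.
Proof.
apply: (mulfI u0); transitivity (k * (u * i)); last by ring.
have : (k + 1) * u * phi i = 1 by rewrite -uphi -frM ui1 fr1.
move=> h; transitivity (k * ((k + 1) * u * phi i)); last by rewrite h ui1.
move: (phi i) => x; apply: (kc (A := - u * x) (C := 0) (Z := - k * u * x)); ring.
Qed.
Let k1r : phi (k + 1) = k + 1. Proof. by rewrite frA kr fr1. Qed.
Let k1b : bar (k + 1) = k. Proof. by rewrite frA kb fr1 -addrA adddK // addr0. Qed.
Let k0 : k != 0. Proof. by apply: contra_eq_neq k2 => ->; rewrite expr0n add0r eq_sym oner_eq0. Qed.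
Let k10 : k + 1 != 0. Proof. by rewrite -k2 expf_neq0. Qed.
Let kn1 : k != 1. Proof. by apply: contraNneq k10 => ->; rewrite adddK. Qed.
Let kN : k * bar k = 1. Proof. by rewrite kb; apply: (kc (A := 1) (C := 0) (Z := k)); ring. Qed.
Let eqk (x : K) : k * x = (k + 1) * x -> x = 0.
Proof. by move=> h; apply: (addrI (k * x)); rewrite addr0 {2}h; ring. Qed.

(** Passage from an orthonormal frame of the subplane to the hyperbolic one; [Oi] is its inverse and
    [hS] the form in the orthonormal frame. *)
Definition O x : vec K := (x.1.1, x.1.2 + x.2, k * x.1.2 + (k + 1) * x.2).
Definition Oi c : vec K := (c.1.1, c.2 + (k + 1) * c.1.2, c.2 + k * c.1.2).
Definition hS (x y : vec K) := bar x.1.1 * y.1.1 + bar x.1.2 * y.1.2 + bar x.2 * y.2.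

Lemma OK x : Oi (O x) = x.
Proof.
case: x => [[x y] z]; apply: vecP; rewrite //=.
  by apply: (c2 (z := k * y + (k + 1) * z)); ring.
by apply: (c2 (z := k * y + k * z)); ring.
Qed.
Lemma OiK x : O (Oi x) = x.
Proof.
case: x => [[x y] z]; apply: vecP; rewrite //=.
  by apply: (c2 (z := z + k * y)); ring.
by apply: (c2 (z := k * z + k * (k + 1) * y)); ring.
Qed.
Lemma OZ c x : O (vscale c x) = vscale c (O x).
Proof. by apply: vecP; rewrite /=; ring. Qed.
Lemma Oph x : O (vphi x) = vphi (O x).
Proof. by apply: vecP; rewrite //= !(frA, frM) ?kr ?fr1. Qed.
Lemma Oiph x : Oi (vphi x) = vphi (Oi x).
Proof. by apply: vecP; rewrite //= !(frA, frM) ?kr ?fr1. Qed.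
Lemma hO x y : herm (O x) (O y) = hS x y.
Proof.
rewrite hE /hS /= !(frA, frM) kb fr1.
by apply: (c2 (z := k * bar x.1.2 * y.1.2 + (k + 1) * bar x.1.2 * y.2 + (k + 1) * bar x.2 * y.1.2 + (k + 1) * bar x.2 * y.2)); ring.
Qed.
Lemma O_neq0 x : x != v0 K -> O x != v0 K.
Proof. by apply: contraNneq => h; rewrite -(OK x) h; apply/eqP; apply: vecP; rewrite /= ?mulr0 ?addr0. Qed.
Lemma t3O x : type3 (O x) = type3 x.
Proof.
rewrite /Frames.type3 -!Oph; congr (_ != 0); move: (vphi (vphi x)) (vphi x) => z y.
by rewrite /det3 /dot /cross /=; ring.
Qed.

Definition Y x := X (O x).
Definition aO x := absv (O x).
Notation bO y := (blk (pol (O y))).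

Lemma aON x : ~~ type3 x -> aO x = (hS x x == 0).
Proof. by move=> t; rewrite /aO absvN ?t3O // hO. Qed.
Lemma in_bO x y : x != v0 K -> aO x -> y != v0 K -> (Y x \in bO y) = finc (O x) (pol (O y)).
Proof. by move=> xn xa yn; rewrite in_blk ?pol_eq0 ?O_neq0. Qed.
Lemma in_bOl x y : x != v0 K -> aO x -> y != v0 K -> ~~ type3 x -> (Y x \in bO y) = (hS y x == 0).
Proof. by move=> xn xa yn t; rewrite in_bO // finc_polE !t3O (negbTE t) hO. Qed.
Lemma in_bOr x y : x != v0 K -> aO x -> y != v0 K -> ~~ type3 y -> (Y x \in bO y) = (hS y x == 0).
Proof. by move=> xn xa yn t; rewrite in_bO // finc_polE !t3O (negbTE t) andbF hO. Qed.
Lemma Y_surj p : exists x, [/\ x != v0 K, aO x & p = Y x].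
Proof.
have [v [vn va ->]] := X_surj p; exists (Oi v); rewrite /aO /Y OiK; split=> //.
by apply: contraNneq vn => h; rewrite -(OiK v) h; apply/eqP; apply: vecP; rewrite /= ?mulr0 ?addr0.
Qed.
Lemma Y_scale c x : c != 0 -> x != v0 K -> aO x -> Y (vscale c x) = Y x.
Proof. by move=> c0 xn xa; rewrite /Y OZ X_scale ?O_neq0. Qed.
Lemma Y_par x y : x != v0 K -> aO x -> y != v0 K -> aO y -> Y x = Y y -> exists2 c, c != 0 & y = vscale c x.
Proof.
move=> xn xa yn ya /(X_par (O_neq0 xn) xa (O_neq0 yn) ya)[c c0 h]; exists c => //.
by rewrite -(OK y) h -OZ OK.
Qed.
Lemma aOZ c x : c != 0 -> aO (vscale c x) = aO x.
Proof. by move=> c0; rewrite /aO OZ absvZ. Qed.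
Lemma bO_in y p p' : p \in bO y -> p' \in bO y -> p != p' -> bO y \in B.
Proof. by move=> h1 h2 h; apply: blk_in; apply/card_gt1P; exists p, p'. Qed.

Lemma Y_aut M : (forall c x, M (vscale c x) = vscale c (M x)) -> (forall x y, hS (M x) (M y) = hS x y) ->
  (forall x, M (vphi x) = vphi (M x)) -> exists a : {perm U}, [/\ block_aut B a,
  forall x, x != v0 K -> aO x -> a (Y x) = Y (M x), forall x, aO (M x) = aO x & forall x, x != v0 K -> M x != v0 K].
Proof.
move=> h1 h2 h3; have sM : sunit 0 (O \o M \o Oi).
  split=> [c v|v w|v] /=; rewrite ?fr0e.
  - have -> : Oi (vscale c v) = vscale c (Oi v) by apply: vecP; rewrite /=; ring.
    by rewrite h1 OZ.
  - by rewrite hO h2 -hO !OiK.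
  - by rewrite Oiph h3 Oph.
have [a [aB aE]] := sunit_aut sM; exists a; split=> //.
- by move=> x xn xa; rewrite /Y aE ?O_neq0 //= OK.
- by move=> x; have := sunit_absv (O x) sM; rewrite /= OK.
- move=> x xn; have := sunit_neq0 sM (O_neq0 xn); rewrite /= OK; apply: contraNneq => ->.
  by apply/eqP; apply: vecP; rewrite /= ?mulr0 ?addr0.
Qed.

(** The point [xx] is of type II because [u] is not fixed by [phi]; it is the exotic center, while
    [hh] belongs to the hermitian subunital. *)
Definition xx : vec K := (0, 1, u).
Definition hh : vec K := (1, 1, 0).
Let pk0 := ph0.

Let t3r (x : vec K) : x.2 = 0 -> ~~ type3 x. Proof. exact: t3N_r. Qed.
Let t3l (x : vec K) : x.1.1 = 0 -> ~~ type3 x. Proof. exact: t3N_l. Qed.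
Let t3m (x : vec K) : x.1.2 = 0 -> ~~ type3 x.
Proof. by move=> h; apply: (@t3N x 0 1 0 ph0 ph1 ph0 (nzm _ _)); rewrite h; ring. Qed.

Lemma xx_a : aO xx.
Proof. by rewrite aON ?t3l // /hS /= fr0 fr1 mul0r add0r mul1r ub [i * u]mulrC ui1 adddK. Qed.
Lemma hh_a : aO hh.
Proof. by rewrite aON ?t3r // /hS /= fr0 fr1 !mulr0 !mul1r addr0 adddK. Qed.
Let xxn : xx != v0 K. Proof. exact: nzm. Qed.
Let hhn : hh != v0 K. Proof. exact: nzl. Qed.

Let D0 : 1 + u != 0.
Proof.
apply/eqP => h; have u1 : u = 1 by apply/eqP; rewrite -addr_eq0C // addrC h.
by move: uphi; rewrite u1 fr1 mulr1 => /eqP; rewrite -subr_eq0 opprD addrCA subrr addr0 oppr_eq0 (negbTE k0).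
Qed.

(** The coordinate of [xx] on [lblk]: [O xx] is a multiple of [(0, 1, bet)]. *)
Definition bet := (k + (k + 1) * u) / (1 + u).

Lemma bet_s : bar bet = bet.
Proof.
have D1 : 1 + i != 0 by rewrite -(fr1 ch (3 * e)) -ub -frA fr_eq0.
rewrite /bet frM frV !frA !frM k1b kb ub fr1; apply/eqP; rewrite eqr_div //; apply/eqP.
by apply: (kc (A := 0) (C := - 1) (Z := 0)); ring.
Qed.

(** The matrix [(0, 1, 1, 1)] has order 3 and becomes diagonal, with entries [k] and [k + 1], in the
    orthonormal frame. It takes [phi bet] to [bet], as [commuting_involution] requires. *)
Lemma bet_mob : 1 + 1 * phi bet = bet * (0 + 1 * phi bet).
Proof.
have D1 : 1 + (k + 1) * u != 0.
  by have -> : 1 + (k + 1) * u = phi (1 + u); [rewrite frA fr1 uphi|rewrite fr_eq0].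
have -> : phi bet = (k + (k + 1) * ((k + 1) * u)) / (1 + (k + 1) * u).
  by rewrite /bet frM frV !frA !frM k1r kr uphi fr1.
rewrite /bet; set N := k + (k + 1) * u; set N' := k + (k + 1) * ((k + 1) * u).
have main : (1 + (k + 1) * u + N') * (1 + u) = N * N'.
  by rewrite /N /N'; apply: (kc (A := - 3 * u ^+ 2 - 3 * u - 1 - k * u - k * u ^+ 2) (C := 0) (Z := - u ^+ 2 - 2 * k * u ^+ 2 - k * u)); ring.
rewrite add0r !mul1r mulf_div -main -{1}(divff D1) -mulrDl [(1 + u) * _]mulrC.
by rewrite -mulf_div divff // mulr1.
Qed.

Lemma bet_r : phi bet != bet.
Proof.
apply/eqP => h; have := bet_mob; rewrite h; have := bet_s; move: bet => x xs m.
have : (x + k) * (x + (k + 1)) = 0.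
  transitivity (x * (0 + 1 * x) - (1 + 1 * x)); last by rewrite m subrr.
  by apply: (kc (A := 1) (C := 0) (Z := k * x + x + k + 1)); ring.
move/eqP; rewrite mulf_eq0 !addr_eq0C // => /orP[] /eqP xk; move: xs; rewrite xk ?k1b ?kb => /eqP.
  by rewrite -subr_eq0 addrAC subrr add0r oner_eq0.
by rewrite -subr_eq0 opprD addrA subrr sub0r oppr_eq0 oner_eq0.
Qed.

Lemma Yxx : Y xx = X (0, 1, bet).
Proof.
have ba : absv (0, 1, bet) by rewrite absl bet_s.
have hE : O xx = vscale (1 + u) (0, 1, bet).
  by apply: vecP; rewrite /= ?mulr0 ?mulr1 //; rewrite /bet [RHS]mulrC divfK //; ring.
by rewrite /Y hE (X_scale D0 (nzm _ _) ba).
Qed.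

Let az : exists2 a : {perm U}, block_aut B a & (forall v, v != v0 K -> absv v -> a (X v) = X (Fz k v)) /\
  (forall x, x != v0 K -> aO x -> a (Y x) = Y (k * x.1.1, x.1.2, x.2)).
Proof.
have [a [aB aE]] := sunit_aut (sunit_z kr kN); exists a => //; split=> // x xn xa.
by rewrite /Y aE ?O_neq0.
Qed.

Lemma psi_aO x : aO (phi x.1.1, phi x.1.2, k * phi x.2) = aO x.
Proof.
rewrite /aO -(absvZ (O _) k0) -(sunit_absv (O x) (sunit_comp (sunit_z kr kN) (sunit_comp (sunit_S (fr0 ch e) (fr1 ch e) (fr1 ch e) (fr1 ch e) (_ : 0 * 1 + 1 * 1 = 1)) (sunit_fr (2 * e))))); last by ring.
congr absv; apply: vecP; rewrite /= ?(frA, frM) ?kr ?fr1; move: (phi x.1.1) (phi x.1.2) (phi x.2) => x1 y1 z1.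
- by ring.
- by apply: (kc (A := z1) (C := 0) (Z := 0)); ring.
- by apply: (kc (A := y1 + k * z1 + 2 * z1) (C := 0) (Z := k * z1)); ring.
Qed.

(** The involution also commutes with the homology of factor [k], as its center is on [lblk].
    Composing with this homology and dividing by the scalar [k] leaves the simple map
    [diag(1, 1, k) phi]. *)
Lemma p0_ex a0 : bar a0 = a0 -> phi a0 != a0 -> X (0, 1, a0) \in Omega2 B ->
  exists t p, [/\ t \in T (Y xx), #[t]%g = 2%N, (t ^ p = t)%g, block_aut B p &
    forall x, x != v0 K -> aO x -> p (Y x) = Y (phi x.1.1, phi x.1.2, k * phi x.2)].
Proof.
move=> h1 h2 h3; have q0 := fr0 ch e; have q1 := fr1 ch e.
have d : 0 * 1 + 1 * 1 = 1 :> K by ring.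
have sP := sunit_comp (sunit_S q0 q1 q1 q1 d) (sunit_fr (2 * e)).
have [ps [psB psE]] := sunit_aut sP.
have hq : [/\ fr_of ch e 0 = 0, fr_of ch e 1 = 1, fr_of ch e 1 = 1 & fr_of ch e 1 = 1] by [].
have [t [tT t2 tp]] := commuting_involution h1 h2 h3 bet_s bet_r hq d bet_mob psB psE.
have [a aB [aE _]] := az; rewrite -Yxx in tT.
have tz : (t ^ a = t)%g by apply: (z_comm aB aE _ tT); rewrite Yxx; apply: pt_l; apply: bet_s.
exists t, (ps * a)%g; split=> //; first by rewrite conjgM tp.
  by have := @groupM _ (autG B) ps a; rewrite !inE; apply.
move=> x xn xa; rewrite permM psE ?O_neq0 // aE; last first.
- by have := sunit_absv (O x) sP; rewrite /= => ->.
- by have := sunit_neq0 sP (O_neq0 xn).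
have ya : aO (phi x.1.1, phi x.1.2, k * phi x.2).
  by rewrite psi_aO.
have yn : (phi x.1.1, phi x.1.2, k * phi x.2) != v0 K.
  apply: contraNneq xn => -[e1 e2 e3]; apply/eqP; apply: vecP; apply/eqP; rewrite -(fr_eq0 ch (2 * e)) ?e1 ?e2 //.
  by move/eqP: e3; rewrite mulf_eq0 (negbTE k0).
rewrite -[RHS](Y_scale k0) //; congr X; apply: vecP; rewrite /= ?(frA, frM) ?kr ?fr1; move: (phi x.1.1) (phi x.1.2) (phi x.2) => x1 y1 z1.
- by ring.
- by apply: (kc (A := - z1) (C := 0) (Z := 0)); ring.
- by apply: (kc (A := - y1 - k * z1 - 2 * z1) (C := 0) (Z := - k * z1)); ring.
Qed.

Definition Rv (x : vec K) : vec K := (x.1.1 + x.1.2 + x.2, x.1.1 + x.1.2, x.1.2 + x.2).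

(** Carries [hh] to infinity, so that [trans_inf] describes the translations with center [hh] as
    explicit transvections. *)
Lemma R_ex : exists2 a : {perm U}, block_aut B a & [/\ a (Y hh) = inft,
  forall x, x != v0 K -> aO x -> a (Y x) = X (Rv x), forall x, absv (Rv x) = aO x & forall x, x != v0 K -> Rv x != v0 K].
Proof.
have dk : k + bar k = 1 * bar 1 by rewrite kb fr1 mulr1 addrA adddK // add0r.
have q0 := fr0 ch e; have q1 := fr1 ch e.
have d : 1 * 0 + 1 * 1 = 1 :> K by ring.
have sR := sunit_comp (sunit_S q1 q1 q1 q0 d) (sunit_H ph1 kr dk).
have [a [aB aE]] := sunit_aut sR; exists a => //.
have RE x : (FS 1 1 1 0 \o FH 1 k) (O x) = Rv x.
  case: x => [[x y] z]; apply: vecP; rewrite /= ?fr1.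
  - by ring.
  - by apply: (c2 (z := z + k * y + k * z)); ring.
  - by ring.
have E1 x : x != v0 K -> aO x -> a (Y x) = X (Rv x) by move=> xn xa; rewrite /Y aE ?O_neq0 // RE.
split=> //.
- by rewrite (E1 _ hhn hh_a) /inft; congr X; apply: vecP; rewrite /= ?addr0 ?adddK.
- by move=> x; rewrite -RE (sunit_absv _ sR).
- by move=> x xn; rewrite -RE; apply: (sunit_neq0 sR); apply: O_neq0.
Qed.

Lemma trans_hh s : s \in T (Y hh) -> exists2 g, fr_of ch e g = g &
  forall x, x != v0 K -> aO x -> let x' := (x.1.1 + g * (x.1.1 + x.1.2), x.1.2 + g * (x.1.1 + x.1.2), x.2) in
  [/\ x' != v0 K, aO x' & s (Y x) = Y x'].
Proof.
move=> sT; have [a aB [ah aE aa an]] := R_ex.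
have saT : (s ^ a)%g \in T inft by rewrite -ah; apply: transJ.
have [g gq gE] := trans_inf saT; exists g => // x xn xa x'.
have RE : Rv x' = FE g (Rv x).
  rewrite /x'; case: x xn xa @x' => [[x y] z] _ _ _; apply: vecP; rewrite /=.
  - by apply: (c2 (z := g * (x + y))); ring.
  - by apply: (c2 (z := g * (x + y))); ring.
  - by ring.
have sE := sunit_E gq.
have x'a : aO x' by rewrite -aa RE (sunit_absv _ sE) aa.
have x'n : x' != v0 K.
  have : Rv x' != v0 K by rewrite RE; apply: (sunit_neq0 sE); apply: an.
  by apply: contraNneq => ->; apply/eqP; apply: vecP; rewrite /= ?addr0.
split=> //; apply: (@perm_inj _ a); rewrite -permJ !aE // gE ?an ?aa //.
by rewrite RE.
Qed.

(** If [y] and [s y] were both on [b], then [b] would be their join and so pass through the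
    center. *)
Lemma trans_leave s c b y : s \in T c -> (s != 1)%g -> b \in B -> c \notin b -> y \in b -> s y \notin b.
Proof.
move=> sT s1 bB cb yb; have cy : c != y by apply: contraNneq cb => ->.
apply: contra cb => syb; have [h1 h2 h3] := blP block_join cy.
have sy : y != s y by rewrite eq_sym; apply: contraNneq cy => /(tF sT s1) ->.
by rewrite (block_uniq sy bB h1 yb syb h3 (trans_in sT h1 h2 h3)).
Qed.

Lemma card_transJ a c : block_aut B a -> (#|T c| <= #|T (a c)|)%N.
Proof.
move=> aB; apply: (@leq_trans #|[set (s ^ a)%g | s in T c]|).
  by rewrite card_imset //; apply: conjg_inj.
apply: subset_leq_card; apply/subsetP => _ /imsetP[s sT ->].
exact: transJ.
Qed.

Lemma card_inf : (2 ^ e <= #|T inft|)%N.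
Proof.
apply: (@leq_trans #|[set X (0, 1, g)%R | g in [set g : K | fr_of ch e g == g]]|).
  rewrite card_in_imset; first by rewrite (card_frfix ch cardK e0 e0 (dvdn_mull 6 (dvdnn e))).
  by move=> g g'; rewrite !inE => /eqP gq /eqP g'q; apply: X_line_inj; apply: q_bar.
apply: leq_trans (leq_imset_card (fun t : {perm U} => t (X (0, 1, 0)%R)) _).
apply: subset_leq_card; apply/subsetP => y /imsetP[g]; rewrite inE => /eqP gq ->.
have [a aT aE] := E_trans gq; apply/imsetP; exists a => //.
rewrite aE ?nzm ?q_pt ?fr0 //; congr X; apply: vecP; rewrite //= add0r mulr1 //.
Qed.

Let yn2 (x y : K) : (x, y, u) != v0 K. Proof. by rewrite !xpair_eqE (negbTE u0) andbF. Qed.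
Lemma l2P x : x != v0 K -> aO x -> (Y x \in bO (0, 0, 1)) = (x.2 == 0).
Proof.
move=> xn xa; rewrite in_bOr ?nzr ?t3l // /hS /= !fr0 fr1 !mul0r !add0r mul1r //.
Qed.
Lemma l1P x : x != v0 K -> aO x -> (Y x \in bO (0, 1, 0)) = (x.1.2 == 0).
Proof.
move=> xn xa; rewrite in_bOr ?nzm ?t3l // /hS /= !fr0 fr1 !mul0r add0r addr0 mul1r //.
Qed.

Section Psi.
Variable p : {perm U}.
Hypothesis pE : forall x, x != v0 K -> aO x -> p (Y x) = Y (phi x.1.1, phi x.1.2, k * phi x.2).
Hypothesis pB : block_aut B p.

Let pn x : x != v0 K -> (phi x.1.1, phi x.1.2, k * phi x.2) != v0 K.
Proof.
move=> xn; apply: contraNneq xn => -[e1 e2 e3]; apply/eqP; apply: vecP; apply/eqP; rewrite -(fr_eq0 ch (2 * e)) ?e1 ?e2 //.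
by move/eqP: e3; rewrite mulf_eq0 (negbTE k0).
Qed.

(** The last coordinate is normalized to [u] because [k * phi u = u]; proportionality then becomes
    equality, so the other two coordinates are fixed by [phi]. Such a point lies on a line of the
    subplane and is therefore isotropic, which gives the norm equation. *)
Lemma fix_psi y : p y = y -> y \notin bO (0, 0, 1) ->
  exists a b, [/\ phi a = a, phi b = b, aO (a, b, u), a * bar a + b * bar b = 1 & y = Y (a, b, u)].
Proof.
have [x [xn xa ->]] := Y_surj y => py; rewrite l2P // => x20.
have c0 : u / x.2 != 0 by rewrite mulf_eq0 invr_eq0 (negbTE u0).
pose a := u / x.2 * x.1.1; pose b := u / x.2 * x.1.2.
have xE : vscale (u / x.2) x = (a, b, u) by apply: vecP; rewrite //= divfK.
have ya : aO (a, b, u) by rewrite -xE aOZ.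
have yE : Y x = Y (a, b, u) by rewrite -xE Y_scale.
have [c _ [e1 e2 e3]] : exists2 c, c != 0 & (phi a, phi b, k * phi u) = vscale c (a, b, u).
  by apply: Y_par => //; rewrite ?(pn (yn2 a b)) ?(psi_aO (a, b, u)) // -(pE (yn2 _ _) ya) -yE py.
have c1 : c = 1.
  apply: (mulIf u0); rewrite mul1r -e3 uphi; apply: (kc (A := u) (C := 0) (Z := k * u)); ring.
rewrite c1 !mul1r in e1 e2.
have t : ~~ type3 (a, b, u).
  have [z|nz] := eqVneq (b, a, 0) (v0 K).
    by apply: t3l; case: z.
  apply: (@t3N (a, b, u) b a 0 e2 e1 ph0 nz) => /=.
  by apply: (c2 (z := a * b)); ring.
exists a, b; split=> //; move: ya; rewrite aON // /hS /= ub [i * u]mulrC ui1 => /eqP h.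
by apply/eqP; rewrite -addr_eq0C // -h; apply/eqP; ring.
Qed.

Lemma xxhh : Y xx != Y hh.
Proof. by apply/eqP => /(Y_par xxn xx_a hhn hh_a)[c _ [/eqP]]; rewrite mulr0 oner_eq0. Qed.

Lemma hh_l2 : Y hh \in bO (0, 0, 1). Proof. by rewrite (l2P hhn hh_a) /= eqxx. Qed.
Lemma xx_l2 : Y xx \notin bO (0, 0, 1). Proof. by rewrite (l2P xxn xx_a) /= u0. Qed.

Let kha : aO (k, 1, 0) /\ (k, 1, 0) != v0 K.
Proof.
split; last exact: nzm.
by rewrite aON ?t3r // /hS /= kb fr1 fr0 mulr0 addr0 mul1r; apply/eqP; apply: (kc (A := 1) (C := 0) (Z := k + 1)); ring.
Qed.

Lemma l2_in : bO (0, 0, 1) \in B.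
Proof.
case: kha => h1 h2; apply: (bO_in (p := Y hh) (p' := Y (k, 1, 0))); [exact: hh_l2|by rewrite (l2P h2 h1) /= eqxx|].
apply/eqP => /(Y_par hhn hh_a h2 h1)[c _ [e1 e2 _]]; case/eqP: kn1.
by rewrite e1 -e2.
Qed.

Lemma phh : p (Y hh) = Y hh.
Proof. by rewrite (pE hhn hh_a); congr Y; apply: vecP; rewrite /= ?fr0 ?fr1 ?mulr0. Qed.

Lemma trans_hh_psi s : s \in T (Y hh) -> (s ^ p = s)%g.
Proof.
move=> sT; have [g gq gE] := trans_hh sT; have gr := q_phi gq.
apply: perm_commJ => v vn va; have [x [xn xa ->]] := Y_surj (X v).
have [x'n x'a sx] := gE x xn xa; rewrite sx !pE //.
have [_ _ ->] := gE (phi x.1.1, phi x.1.2, k * phi x.2) (pn xn) (etrans (psi_aO x) xa).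
by congr X; apply: vecP; rewrite /= !(frA, frM) ?frA ?gr.
Qed.

Lemma trans_xx_psi t : t \in T (Y xx) -> #[t]%g = 2%N -> (t ^ p = t)%g ->
  (forall s, s \in T (Y xx) -> (s ^ p = s)%g /\ (s * s = 1)%g) /\ (2 ^ e <= #|T (Y xx)|)%N.
Proof.
move=> tT t2 tp; have tt := sq_tt t2; have t1 : (t != 1)%g by rewrite -order_eq1 t2.
have pth : p (t (Y hh)) = t (Y hh) by rewrite -(conj_comm _ tp) phh.
have [al [be [ar br _ N1 tE']]] := fix_psi pth (trans_leave tT t1 l2_in xx_l2 hh_l2).
have arb := r_bar ar; have brb := r_bar br.
pose M (x : vec K) : vec K := (be * x.1.1 + al * x.1.2, bar al * x.1.1 + bar be * x.1.2, x.2).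
have [a [aB aE aa an]] : exists a : {perm U}, [/\ block_aut B a,
  forall x, x != v0 K -> aO x -> a (Y x) = Y (M x), forall x, aO (M x) = aO x & forall x, x != v0 K -> M x != v0 K].
  apply: Y_aut => [c x|x y|x]; first by apply: vecP; rewrite /=; ring.
    rewrite /hS /= !(frA, frM) !bK.
    transitivity ((al * bar al + be * bar be) * (bar x.1.1 * y.1.1 + bar x.1.2 * y.1.2) + bar x.2 * y.2); last by rewrite N1; ring.
    by apply: (c2 (z := bar be * al * bar x.1.1 * y.1.2 + be * bar al * bar x.1.2 * y.1.1)); ring.
  by apply: vecP; rewrite //= !(frA, frM) ?ar ?br ?arb ?brb.
have ap : (a ^ p = a)%g.
  apply: perm_commJ => v vn va; have [x [xn xa ->]] := Y_surj (X v).
  rewrite aE // !pE ?an ?aa // aE ?pn ?psi_aO //.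
  by congr X; apply: vecP; rewrite //= !(frA, frM) ?ar ?br ?arb ?brb.
have ta : (t * a)%g (Y hh) = Y xx.
  have wa : aO (al, be, u).
    rewrite aON; last first.
      have [z|nz] := eqVneq (be, al, 0) (v0 K); first by apply: t3l; case: z.
      apply: (@t3N (al, be, u) be al 0 br ar ph0 nz) => /=.
      by apply: (c2 (z := al * be)); ring.
    rewrite /hS /= ub [i * u]mulrC ui1 [bar al * al]mulrC [bar be * be]mulrC N1 adddK //.
  rewrite permM tE' aE //; congr Y; apply: vecP; rewrite //=.
    by rewrite mulrC adddK.
  by rewrite [bar al * al]mulrC [bar be * be]mulrC N1.
have taB : block_aut B (t * a)%g by have := @groupM _ (autG B) t a; rewrite !inE; apply => //; apply: trans_aut tT.
have taB' : block_aut B (t * a)^-1%g by have := @groupV _ (autG B) (t * a)%g; rewrite !inE taB.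
have [rr rB [rh _ _ _]] := R_ex.
have rB' : block_aut B rr^-1%g by have := @groupV _ (autG B) rr; rewrite !inE rB.
have rh' : rr^-1%g inft = Y hh by rewrite -rh permK.
split=> [s sT|].
  have s'T : (s ^ (t * a)^-1)%g \in T (Y hh) by have := transJ taB' sT; rewrite -ta permK.
  split.
    have sE : s = ((s ^ (t * a)^-1) ^ (t * a))%g by rewrite -conjgM mulVg conjg1.
    by rewrite sE conjJg (conjMg t a p) tp ap (trans_hh_psi s'T).
  have s''T : ((s ^ (t * a)^-1) ^ rr)%g \in T inft by rewrite -rh; apply: transJ.
  have := inf_sq s''T; rewrite -!conjMg => /eqP; rewrite !conjg_eq1 => /eqP //.
apply: leq_trans card_inf _; apply: leq_trans (card_transJ inft rB') _; rewrite rh' -ta.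
exact: card_transJ.
Qed.

(** The images of [hh] under the nontrivial translations at [xx] are fixed by [p] and lie on the
    join of [xx] and [hh], which leaves [Y (a, a + 1, u)] with nonzero a in F_q. There are at least
    q - 1 such translations, so all these points occur; the one with a = 1 is taken. *)
Lemma special_trans t : t \in T (Y xx) -> #[t]%g = 2%N -> (t ^ p = t)%g ->
  exists s, [/\ s \in T (Y xx), #[s]%g = 2%N & s (Y hh) = Y (1, 0, u)].
Proof using All.
move=> tT t2 tp; have [allp cT] := trans_xx_psi tT t2 tp.
pose W := [set Y (a, a + 1, u) | a in [set a : K | fr_of ch e a == a] :\ 0].
have b1n : (1, 1, u) != v0 K by exact: yn2.
have b1t : ~~ type3 (1, 1, u).
  by apply: (@t3N (1, 1, u) 1 1 0 ph1 ph1 ph0 hhn); rewrite /= mulr0 addr0 mulr1 adddK.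
have xb : Y xx \in bO (1, 1, u).
  by rewrite (in_bOr xxn xx_a b1n b1t) /hS /= fr1 mulr0 add0r mul1r ub [i * u]mulrC ui1 adddK.
have hb : Y hh \in bO (1, 1, u).
  by rewrite (in_bOr hhn hh_a b1n b1t) /hS /= fr1 !mulr1 mulr0 addr0 adddK.
have bB := bO_in xb hb xxhh.
have img : (fun s : {perm U} => s (Y hh)) @: (T (Y xx) :\ 1%g) \subset W.
  apply/subsetP => y /imsetP[s]; rewrite in_setD1 => /andP[s1 sT] ->; have [sp _] := allp s sT.
  have psh : p (s (Y hh)) = s (Y hh) by rewrite -(conj_comm _ sp) phh.
  have [a [b [ar br ya N1 sE]]] := fix_psi psh (trans_leave sT s1 l2_in xx_l2 hh_l2).
  have := trans_in sT bB xb hb; rewrite sE (in_bOr (yn2 _ _) ya b1n b1t) /hS /= fr1 !mul1r ub [i * u]mulrC ui1 => /eqP ab.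
  have bE : b = a + 1 by apply/eqP; rewrite -addr_eq0C // -ab; apply/eqP; ring.
  have as_ : bar a = a.
    apply/eqP; rewrite -addr_eq0C //; apply/eqP; move: N1; rewrite bE frA fr1 => N1.
    transitivity ((a * bar a + (a + 1) * (bar a + 1)) - 1 - (a * bar a + a * bar a)); first by ring.
    by rewrite N1 subrr adddK // subr0.
  apply/imsetP; exists a; last by rewrite bE.
  rewrite in_setD1 inE (rs_q ar as_) eqxx andbT; apply/eqP => a0.
  have : s (Y hh) = s (Y xx) by rewrite sE (trans_c sT) bE a0 add0r.
  by move/perm_inj/esym/eqP; rewrite (negbTE xxhh).
have inj : {in T (Y xx) :\ 1%g &, injective (fun s : {perm U} => s (Y hh))}.
  move=> s s'; rewrite !in_setD1 => /andP[_ sT] /andP[_ s'T] h.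
  by apply: (tE sT s'T _ h); rewrite eq_sym xxhh.
have cW : (#|W| <= (2 ^ e).-1)%N.
  apply: leq_trans (leq_imset_card _ _) _.
  have := card_frfix ch cardK e0 e0 (dvdn_mull 6 (dvdnn e)); rewrite (cardsD1 0) inE fr0 eqxx add1n => <-.
  by [].
have imgE : (fun s : {perm U} => s (Y hh)) @: (T (Y xx) :\ 1%g) = W.
  apply/eqP; rewrite eqEcard img /= (card_in_imset inj); apply: leq_trans cW _.
  by move: cT; rewrite (cardsD1 1%g) (group1 (transG B _)) add1n -{1}(prednK (_ : 0 < 2 ^ e)%N) ?expn_gt0.
have : Y (1, 0, u) \in W.
  apply/imsetP; exists 1; first by rewrite in_setD1 inE oner_eq0 fr1 eqxx.
  by rewrite adddK.
rewrite -imgE => /imsetP[s]; rewrite in_setD1 => /andP[s1 sT] sE; exists s; split=> //.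
have [_ /eqP] := allp s sT; rewrite -[(s * s)%g]/(s ^+ 2)%g -order_dvdn => d2.
by apply/eqP; rewrite -(dvdn_prime2 _ (isT : prime 2)); [exact: d2|]; move/(prime_nt_dvdP (isT : prime 2)): d2 => -> //; rewrite order_eq1.
Qed.

End Psi.

(** For independent [Pv] and [Q] the vector [W] is a multiple of their cross product, and by
    Binet-Cauchy its isotropy is the vanishing of their Gram determinant. *)
Lemma iso_plane (W Pv Q : vec K) : W != v0 K -> dot W (vbar W) = 0 -> dot Pv W = 0 -> dot Q W = 0 ->
  dot (vbar Pv) Pv * dot (vbar Q) Q - dot (vbar Pv) Q * dot (vbar Q) Pv = 0.
Proof.
move=> Wn WW PW QW; rewrite -binet -(vmap_cross bar).
have [->|c0] := eqVneq (cross Pv Q) (v0 K); first by rewrite /dot /= fr0; ring.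
have [c cE] := perp_cross c0 PW QW.
have cn : c != 0 by apply: contraNneq Wn => c0'; rewrite cE c0' vscale0.
move: WW; rewrite cE dotZl => /eqP; rewrite mulf_eq0 (negbTE cn) /=.
have -> : vbar (vscale c (cross Pv Q)) = vscale (bar c) (vbar (cross Pv Q)) by apply: vecP; rewrite /= frM.
by rewrite dotZr mulf_eq0 fr_eq0 (negbTE cn) dotC => /eqP.
Qed.

Section Special.
Variable s : {perm U}.
Hypotheses (sT : s \in T (Y xx)) (s2 : #[s]%g = 2%N) (sh : s (Y hh) = Y (1, 0, u)).

Let aa10 : aO (1, 0, u).
Proof. by rewrite aON ?t3m // /hS /= fr1 fr0 mul0r addr0 mul1r ub [i * u]mulrC ui1 adddK. Qed.
Let ak0 : aO (k, 0, u).
Proof. by rewrite aON ?t3m // /hS /= kb fr0 mul0r addr0 ub [i * u]mulrC ui1; apply/eqP; apply: (kc (A := 1) (C := 0) (Z := k + 1)); ring. Qed.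
Let au1 : aO (u, 1, 0).
Proof. by rewrite aON ?t3r // /hS /= fr1 fr0 mul0r addr0 mul1r ub [i * u]mulrC ui1 adddK. Qed.
Let a101 : aO (1, 0, 1).
Proof. by rewrite aON ?t3m // /hS /= fr1 fr0 mul0r addr0 mul1r adddK. Qed.
Let akh : aO (k, 1, 0).
Proof. by rewrite aON ?t3r // /hS /= kb fr1 fr0 mulr0 addr0 mul1r; apply/eqP; apply: (kc (A := 1) (C := 0) (Z := k + 1)); ring. Qed.

(** Commuting with the homology of factor [k] yields the image of a second point [(k, 1, 0)] of the
    block, besides that of [hh]. *)
Lemma s_l2 : s @: bO (0, 0, 1) = bO (0, 1, 0).
Proof.
have [a aB [aE aY]] := az.
have sz : (s ^ a = s)%g by apply: (z_comm aB aE _ sT); rewrite Yxx; apply: pt_l; apply: bet_s.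
have ah : a (Y hh) = Y (k, 1, 0) by rewrite (aY _ hhn hh_a); congr Y; apply: vecP; rewrite //= mulr1.
have sk : s (Y (k, 1, 0)) = Y (k, 0, u).
  rewrite -ah (conj_comm _ sz) sh (aY _ (nzl _ _) aa10); congr Y; apply: vecP; rewrite //= mulr1 //.
have ne : Y (1, 0, u) != Y (k, 0, u).
  apply/eqP => /(Y_par (nzl _ _) aa10 (yn2 _ _) ak0)[c _ [e1 _ e3]]; case/eqP: kn1; rewrite e1 mulr1.
  by apply: (mulIf u0); rewrite mul1r -e3.
have kn : (k, 1, 0) != v0 K by exact: nzm.
have i1 : Y (1, 0, u) \in bO (0, 1, 0) by rewrite (l1P (nzl _ _) aa10) /= eqxx.
have i2 : Y (k, 0, u) \in bO (0, 1, 0) by rewrite (l1P (yn2 _ _) ak0) /= eqxx.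
have l1B := bO_in i1 i2 ne.
have l2B := autP (trans_aut sT) l2_in.
apply: (block_uniq ne l2B l1B _ _ i1 i2).
- by rewrite -sh; apply: imset_f; exact: hh_l2.
- by rewrite -sk; apply: imset_f; rewrite (l2P kn akh) /= eqxx.
Qed.

(** The image lies on [bO (0, 0, 1)], because [s] is involutory and swaps the two blocks of [s_l2],
    and on the invariant join of [(1, 0, 1)] with the center. *)
Lemma s_101 : s (Y (1, 0, 1)) = Y (u, 1, 0).
Proof.
have ss := sq_tt s2.
have m1 : s (Y (1, 0, 1)) \in bO (0, 0, 1).
  have -> : bO (0, 0, 1) = s @: bO (0, 1, 0).
    by rewrite -s_l2 -imsetM; have -> : (s * s = 1)%g; [apply/permP => x; rewrite permM ss perm1|rewrite imset_perm1].
  by rewrite imset_f // (l1P (nzl _ _) a101) /= eqxx.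
have b1t : ~~ type3 (1, i, 1).
  by apply: (@t3N (1, i, 1) 1 0 1 ph1 ph0 ph1 (nzl _ _)); rewrite /= mulr0 addr0 mulr1 adddK.
have b1n : (1, i, 1) != v0 K by exact: nzl.
have xb : Y xx \in bO (1, i, 1) by rewrite (in_bOr xxn xx_a b1n b1t) /hS /= fr1 ib mulr0 add0r mulr1 mul1r adddK.
have gb : Y (1, 0, 1) \in bO (1, i, 1) by rewrite (in_bOr (nzl _ _) a101 b1n b1t) /hS /= fr1 ib mulr0 addr0 mulr1 adddK.
have ne : Y xx != Y (1, 0, 1).
  by apply/eqP => /(Y_par xxn xx_a (nzl _ _) a101)[c _ [/eqP]]; rewrite mulr0 oner_eq0.
have m2 := trans_in sT (bO_in xb gb ne) xb gb.
have [x [xn xa xE]] := Y_surj (s (Y (1, 0, 1))); rewrite xE in m1 m2 *.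
move: m1; rewrite (l2P xn xa) => /eqP x2.
move: m2; rewrite (in_bOr xn xa b1n b1t) => /eqP; rewrite /hS /= fr1 ib x2 mulr0 addr0 mul1r => h.
have x0E : x.1.1 = u * x.1.2 by apply/eqP; rewrite -addr_eq0C // h.
have x1 : x.1.2 != 0 by apply: contraNneq xn => x1; apply/eqP; apply: vecP; rewrite ?x0E ?x1 ?mulr0.
have -> : x = vscale x.1.2 (u, 1, 0) by apply: vecP; rewrite /= ?mulr1 ?mulr0 // x0E mulrC.
by rewrite (Y_scale x1 (nzm _ _) au1).
Qed.

(** Two points of the line of the subplane with pole [(1, 1, 1)] have known images, namely
    [(1, 0, u)] and [(u, 1, 0)]; the pole of their join has type III. *)
Lemma s_m : s @: bO (1, 1, 1) = bO (1, i, u).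
Proof.
have ne : Y hh != Y (1, 0, 1).
  by apply/eqP => /(Y_par hhn hh_a (nzl _ _) a101)[c _ [_ _ /eqP]]; rewrite mulr0 oner_eq0.
have mt : ~~ type3 (1, 1, 1).
  by apply: (@t3N (1, 1, 1) 1 1 0 ph1 ph1 ph0 hhn); rewrite /= mulr0 addr0 mulr1 adddK.
have hm : Y hh \in bO (1, 1, 1) by rewrite in_bOr ?hh_a ?nzl // /hS /= fr1 !mulr1 mulr0 addr0 adddK.
have gm : Y (1, 0, 1) \in bO (1, 1, 1) by rewrite (in_bOr (nzl _ _) a101 (nzl _ _) mt) /hS /= fr1 !mulr1 mulr0 addr0 adddK.
have ne' : Y (1, 0, u) != Y (u, 1, 0) by rewrite -sh -s_101 (inj_eq (@perm_inj _ s)).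
have h1 : Y (1, 0, u) \in bO (1, i, u).
  by rewrite (in_bOl (nzl _ _) aa10 (nzl _ _)) ?t3m // /hS /= fr1 ib ub mulr0 addr0 mul1r [i * u]mulrC ui1 adddK.
have h2 : Y (u, 1, 0) \in bO (1, i, u).
  by rewrite (in_bOl (nzm _ _) au1 (nzl _ _)) ?t3r // /hS /= fr1 ib mulr0 addr0 mul1r mulr1 adddK.
apply: (block_uniq ne' _ (bO_in h1 h2 ne')) => //.
- exact: autP (trans_aut sT) (bO_in hm gm ne).
- by rewrite -sh imset_f.
- by rewrite -s_101 imset_f.
Qed.

(** The image [w] of [yt] lies on the blocks with poles [(1, i, u)] and [yl], the latter joining
    [yt] to the center; the last assumption makes [yl] a vector of type III. These two incidences
    and the absoluteness of [w] say that [W = w x phi w] is isotropic and orthogonal to two known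
    vectors, whose Gram determinant then vanishes by [iso_plane]. *)
Lemma key_eq t : bar t = t -> t != 0 -> phi (phi t) = t + phi t ->
  (k * t + phi t) + i * ((k + 1) * t + phi t) != 0 ->
  (1 + t + phi t) * (k * u + (k + 1) * i) + i ^+ 2 * (phi t + t ^+ 2 + (k + 1) * (t + phi t ^+ 2))
    + u ^+ 2 * (phi t + t ^+ 2 + k * (t + phi t ^+ 2)) = 0.
Proof.
move=> ts tn t2E good; set t1 := phi t in t2E good *.
have t1s : bar t1 = t1 by rewrite frC ts.
have p1 : phi t = t1 by []; have p2 : phi t1 = t + t1 by [].
pose yt : vec K := (1, t, 1 + t).
have ytn : yt != v0 K by exact: nzl.
have ytt : ~~ type3 yt.
  by apply: (@t3N yt 1 1 1 ph1 ph1 ph1 (nzl _ _)); rewrite /= !mulr1 adddK.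
have yta : aO yt by rewrite aON // /hS /= frA fr1 ts; apply/eqP; apply: (c2 (z := 1 + t + t ^+ 2)); ring.
have mt : ~~ type3 (1, 1, 1).
  by apply: (@t3N (1, 1, 1) 1 1 0 ph1 ph1 ph0 hhn); rewrite /= mulr0 addr0 mulr1 adddK.
have ym : Y yt \in bO (1, 1, 1) by rewrite in_bOr ?nzl // /hS /= fr1 !mul1r adddK.
pose yl : vec K := (1 + t + i * t, i, 1).
have yln : yl != v0 K by exact: nzr.
have xl : Y xx \in bO yl by rewrite (in_bOl xxn xx_a yln) ?t3l // /hS /= ib fr1 mulr0 add0r mulr1 mul1r adddK.
have yl' : Y yt \in bO yl.
  by rewrite in_bOl // /hS /= !(frA, frM) ts ib fr1; apply/eqP; apply: (c2 (z := 1 + t + u * t)); ring.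
have ne : Y xx != Y yt.
  by apply/eqP => /(Y_par xxn xx_a ytn yta)[c _ [/eqP]]; rewrite mulr0 oner_eq0.
have wl := trans_in sT (bO_in xl yl' ne) xl yl'.
have wn : s (Y yt) \in bO (1, i, u) by rewrite -s_m imset_f.
have nn : (1, i, u) != v0 K by exact: nzl.
have [w [w0 wa wE]] := Y_surj (s (Y yt)); rewrite wE !in_bO // in wl wn.
have pph x : phi (k * x) = k * phi x by rewrite frM kr.
have pphi : phi (phi i) = k * (k * i) by rewrite iphi pph iphi.
have pphu : phi (phi u) = (k + 1) * ((k + 1) * u) by rewrite uphi frM k1r uphi.
have nv1 : vphi (1, i, u) = (1, k * i, (k + 1) * u) by apply: vecP; rewrite /= ?fr1 ?iphi ?uphi.
have nv2 : vphi (1, k * i, (k + 1) * u) = (1, k * (k * i), (k + 1) * ((k + 1) * u)).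
  by apply: vecP; rewrite /= ?fr1 ?frM ?kr ?k1r ?iphi ?uphi.
have nT : type3 (1, i, u).
  rewrite /Frames.type3 nv1 nv2 /det3 /dot /cross /=.
  suff -> : 1 * (k * i * ((k + 1) * ((k + 1) * u)) - (k + 1) * u * (k * (k * i))) + i * ((k + 1) * u * 1 - 1 * ((k + 1) * ((k + 1) * u))) + u * (1 * (k * (k * i)) - k * i * 1) = 1 by rewrite oner_eq0.
  by apply: (kc (A := u * i) (C := 1) (Z := 0)); ring.
have lv1 : vphi yl = (1 + t1 + k * i * t1, k * i, 1) by apply: vecP; rewrite /= ?(frA, frM) ?fr1 ?iphi.
have lv2 : vphi (1 + t1 + k * i * t1, k * i, 1) = (1 + (t + t1) + k * (k * i) * (t + t1), k * (k * i), 1).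
  by apply: vecP; rewrite /= ?(frA, frM) ?fr1 ?kr ?iphi ?p2.
have lT : type3 yl.
  rewrite /Frames.type3 lv1 lv2 /yl /det3 /dot /cross /=.
  have -> : forall z, z = i * ((k * t + t1) + i * ((k + 1) * t + t1)) -> z != 0 by move=> z ->; rewrite mulf_eq0 negb_or i0.
    by [].
  by apply: (kc (A := - i * t + i ^+ 2 * t1 + i * t1 - k * i ^+ 2 * t - i ^+ 2 * t) (C := 0) (Z := - k * i * t - i ^+ 2 * t - k * i ^+ 2 * t)); ring.
have e2 : t ^+ 2 + t * t1 + t1 ^+ 2 != 0.
  have -> : t ^+ 2 + t * t1 + t1 ^+ 2 = (t1 + k * t) * (t1 + (k + 1) * t) by apply: (kc (A := - t ^+ 2) (C := 0) (Z := - k * t * t1 - k * t ^+ 2)); ring.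
  have nz : t1 + k * t != 0.
    apply/eqP => h; have h' : t1 + (k + 1) * t = 0 by rewrite -(fr0 ch (3 * e)) -h frA frM t1s kb ts.
    by case/eqP: tn; apply: eqk; apply: (addrI t1); rewrite h h'.
  by rewrite mulf_neq0 // -(fr_eq0 ch (3 * e)) frA frM t1s k1b ts.
(* Otherwise [w] would be the ordinary intersection of the two lines; but that point is of type III,
   since its determinant is the nonzero element in [e2]. *)
have wT : type3 w.
  apply: contraT => wT; exfalso; move: wl wn; rewrite !finc_polE !t3O (negbTE wT) /= !hO => /eqP d1 /eqP d2.
  pose yl_ : vec K := (1 + t + u * t, u, 1); pose yn_ : vec K := (1, u, i).
  have d1' : dot yl_ w = 0 by rewrite -[RHS]d1 /hS /dot /= !(frA, frM) fr1 ts ib.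
  have d2' : dot yn_ w = 0 by rewrite -[RHS]d2 /hS /dot /= fr1 ib ub.
  have cE : cross yl_ yn_ = vscale (1 + u) (1, (1 + t) * i, u * t).
    apply: vecP; rewrite /=.
    - by apply: (kc (A := 0) (C := 1) (Z := - u)); ring.
    - by apply: (kc (A := 0) (C := - 2 * t - 1) (Z := - i * t - i - t)); ring.
    - by apply: (kc (A := 0) (C := 0) (Z := 0)); ring.
  have c0 : cross yl_ yn_ != v0 K by rewrite cE vscale_eq0 ?D0 ?nzl.
  have cv1 : vphi (1, (1 + t) * i, u * t) = (1, (1 + t1) * (k * i), (k + 1) * u * t1).
    by apply: vecP; rewrite /= ?(frA, frM) ?fr1 ?iphi ?uphi.
  have cv2 : vphi (1, (1 + t1) * (k * i), (k + 1) * u * t1) = (1, (1 + (t + t1)) * (k * (k * i)), (k + 1) * ((k + 1) * u) * (t + t1)).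
    by apply: vecP; rewrite /= ?(frA, frM) ?fr1 ?kr ?iphi ?uphi ?p2.
  have [c wcE] := perp_cross c0 d1' d2'.
  have cn : c != 0 by apply: contraNneq w0 => c0'; rewrite wcE c0' vscale0.
  have cD : c * (1 + u) != 0 by rewrite mulf_eq0 negb_or cn D0.
  move: wT; rewrite wcE cE vscaleA type3Z // /Frames.type3 cv1 cv2 /det3 /dot /cross /= negbK => /eqP h.
  case/eqP: e2; rewrite -[RHS]h.
  by apply: (kc (A := - u * i * t1 ^+ 2 - k * u * i * t - 3 * u * i * t - u * i * t * t1) (C := - 2 * k * t1 ^+ 2 - 2 * k * t + 2 * k * t ^+ 2 + t ^+ 2 - 2 * t - t1 ^+ 2 - t * t1) (Z := t ^+ 2 - k * t1 ^+ 2 - k * t + k * t ^+ 2 - t)); ring.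
pose W := cross w (vphi w).
have Wn : W != v0 K by apply: type3_cross.
have bin y : type3 y -> finc (O w) (pol (O y)) -> dot (cross (vbar y) (vphi (vbar y))) W = 0.
  move=> ty; rewrite finc_polE !t3O wT ty /= -!Oph !hO => /eqP h.
  have hSE (a b : vec K) : dot (vbar a) b = hS a b by [].
  rewrite /W binet -phi_dot hSE h.
  have -> : vphi (vbar y) = vbar (vphi y) by apply: vecP; rewrite /= frC.
  by rewrite !hSE [hS (vphi y) w * _]mulrC subrr.
have bl := bin _ lT wl; have bn := bin _ nT wn.
have bw : dot W (vbar W) = 0.
  have -> : vbar W = cross (vbar w) (vphi (vbar w)).
    rewrite /W (vmap_cross bar); congr cross; apply: vecP; rewrite /= frC //.
  by rewrite dotC; apply: bin.
have := iso_plane Wn bw bl bn.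
have bPl : cross (vbar yl) (vphi (vbar yl)) = (k * u, (t + t1) + u * (t + (k + 1) * t1), u * (k + (k + 1) * t + t1) + u ^+ 2 * (k + 1) * (t + t1)).
  apply: vecP; rewrite /= ?(frA, frM) ?ts ?ib ?fr1 ?p1 ?uphi ?fr1.
  - by apply: (kc (A := 0) (C := 0) (Z := - k * u)); ring.
  - by apply: (kc (A := 0) (C := 0) (Z := - t - u * t)); ring.
  - by apply: (kc (A := 0) (C := 0) (Z := - u * t1 - k * u ^+ 2 * t1 - u ^+ 2 * t1)); ring.
have bQ : cross (vbar (1, i, u)) (vphi (vbar (1, i, u))) = (1, (k + 1) * i, k * u).
  apply: vecP; rewrite /= ?fr1 ?ib ?ub ?iphi ?uphi ?fr1.
  - by apply: (kc (A := 0) (C := - 1) (Z := - 1)); ring.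
  - by apply: (kc (A := 0) (C := 0) (Z := - k * i)); ring.
  - by apply: (kc (A := 0) (C := 0) (Z := 0)); ring.
rewrite bPl bQ.
have -> : vbar (k * u, t + t1 + u * (t + (k + 1) * t1), u * (k + (k + 1) * t + t1) + u ^+ 2 * (k + 1) * (t + t1)) =
   ((k + 1) * i, t + t1 + i * (t + k * t1), i * ((k + 1) + k * t + t1) + i ^+ 2 * k * (t + t1)).
  have k11 : k + 1 + 1 = k by rewrite -addrA adddK // addr0.
  by apply: vecP; rewrite /= ?(frA, frM, frX) ?kb ?fr1 ?k11 ?ub ?ts ?t1s.
have -> : vbar (1, (k + 1) * i, k * u) = (1, k * u, (k + 1) * i).
  by apply: vecP; rewrite /= ?frM ?fr1 ?k1b ?kb ?ib ?ub.
have QQ : dot (1, k * u, (k + 1) * i) (1, (k + 1) * i, k * u) = 1.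
  by rewrite /dot /=; apply: (kc (A := 2 * u * i) (C := 4 * k + 2) (Z := 2 * k + 1)); ring.
have QP : dot (1, k * u, (k + 1) * i) (k * u, t + t1 + u * (t + (k + 1) * t1), u * (k + (k + 1) * t + t1) + u ^+ 2 * (k + 1) * (t + t1)) =
   1 + k * t + (k + 1) * t1 + k * u + (k * t + t1) * u ^+ 2.
  by rewrite /dot /=; apply: (kc (A := u ^+ 2 * t1 + u * i + u * i * t + u ^+ 2 * i * t + u ^+ 2 * i * t1) (C := 3 * k * t + k * t1 + 3 * k * u * t + 3 * k * u * t1 + 2 * k + 2 * t + t1 + 2 * u * t + 2 * u * t1 + 1) (Z := 2 * k * u * t + 2 * k * u * t1 + k * u ^+ 2 * t1 + k * t + k + t + u * t + u * t1)); ring.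
have PQ : dot ((k + 1) * i, t + t1 + i * (t + k * t1), i * ((k + 1) + k * t + t1) + i ^+ 2 * k * (t + t1)) (1, (k + 1) * i, k * u) =
   1 + (k + 1) * t + k * t1 + (k + 1) * i + ((k + 1) * t + t1) * i ^+ 2.
  by rewrite /dot /=; apply: (kc (A := i ^+ 2 * t1 + u * i + u * i * t + u * i ^+ 2 * t + u * i ^+ 2 * t1) (C := 2 * k + k * t1 + 1 + k * t + t + k * i * t + i * t + k * i * t1 + i * t1) (Z := k * i * t + i * t + k * i * t1 + i * t1 + k * i ^+ 2 * t1 + k)); ring.
have PP : dot ((k + 1) * i, t + t1 + i * (t + k * t1), i * ((k + 1) + k * t + t1) + i ^+ 2 * k * (t + t1))
    (k * u, t + t1 + u * (t + (k + 1) * t1), u * (k + (k + 1) * t + t1) + u ^+ 2 * (k + 1) * (t + t1)) = (t + t1) * (1 + k * u + (k + 1) * i).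
  by rewrite /dot /=; apply: (kc (A := 2 * u * i + u * i * t1 ^+ 2 + 2 * u * i * t + u ^+ 2 * i * t + u ^+ 2 * i * t1 + u * i * t ^+ 2 + u ^+ 2 * i * t ^+ 2 + u ^+ 2 * i * t * t1 + u * i ^+ 2 * t + u * i ^+ 2 * t ^+ 2 + u ^+ 2 * i ^+ 2 * t ^+ 2 + 2 * u ^+ 2 * i ^+ 2 * t * t1 + u * i ^+ 2 * t1 + u * i ^+ 2 * t * t1 + u ^+ 2 * i ^+ 2 * t1 ^+ 2) (C := 4 * k + 3 * t ^+ 2 + 8 * k * t * t1 + 4 * t * t1 + 4 * k * t1 ^+ 2 + 4 * k * t + 2 * k * t1 + 3 * k * u * t + 3 * k * u * t1 + 3 * t + t1 + 2 * u * t + 2 * u * t1 + 4 * k * t ^+ 2 + 2 * k * u * t ^+ 2 + 3 * k * u * t * t1 + 3 * t1 ^+ 2 + k * u * t1 ^+ 2 + 2 * u * t * t1 + u * t1 ^+ 2 + 2 * k * i * t ^+ 2 + 3 * k * i * t * t1 + 2 * k * u * i * t ^+ 2 + 4 * k * u * i * t * t1 + k * i * t1 ^+ 2 + 2 * k * u * i * t1 ^+ 2 + 2 + u * t ^+ 2 + k * i * t + i * t + i * t ^+ 2 + u * i * t ^+ 2 + 2 * u * i * t * t1 + k * i * t1 + i * t1 + i * t * t1 + u * i * t1 ^+ 2) (Z := 2 * t ^+ 2 + 3 * t * t1 + u * t ^+ 2 + 2 * k * u * t * t1 + 2 * u * t * t1 + 2 * t1 ^+ 2 + k * u * t1 ^+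 2 + u * t1 ^+ 2 + i * t ^+ 2 + i * t * t1 + 2 * k * i * t * t1 + k * i * t1 ^+ 2 + k * u * t + t + k * u * t1 + 2 * k + 4 * k * t * t1 + 2 * k * t1 ^+ 2 + 2 * k * t + k * t1 + u * t + u * t1 + 2 * k * t ^+ 2 + k * u * t ^+ 2 + k * i * t ^+ 2 + 1)); ring.
rewrite QQ QP PQ PP => h; rewrite -[RHS]h.
by apply: (kc (A := t ^+ 2 + 2 * t * t1 + u * t + u ^+ 2 * t ^+ 2 + t1 ^+ 2 + u * t1 + u ^+ 2 * t * t1 + i * t + i * t1 + u * i + u ^+ 2 * i * t + i ^+ 2 * t ^+ 2 + i ^+ 2 * t * t1 + u * i ^+ 2 * t + u ^+ 2 * i ^+ 2 * t ^+ 2) (C := k * u * t1 + 2 * k + 2 * k * u * t + u * t1 + 2 * k * u * i * t * t1 + 2 * k * i * t + 2 * k * u * i * t ^+ 2 + u * i * t * t1 + k * i * t1 + u * i * t1 ^+ 2 + 1 + u * t + i * t + u * i * t ^+ 2 + 2 * k * t * t1 + 2 * k * t ^+ 2 + t * t1 + t1 ^+ 2 + t ^+ 2) (Z := 2 * k * u * t + 2 * k * i * t + k * u + k * i + i + 2 * k * i * t1 + i * t1 + i ^+ 2 * t1 + i ^+ 2 * t ^+ 2 + k * i ^+ 2 * t + k * i ^+ 2 * t1 ^+ 2 + i ^+ 2 * t + i ^+ 2 * t1 ^+ 2 + u ^+ 2 * t1 + u ^+ 2 * t ^+ 2 + k * u ^+ 2 * t + k * u ^+ 2 * t1 ^+ 2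 + k * t + 3 * k * t * t1 + k * u ^+ 2 * t * t1 + 2 * k * t ^+ 2 + 2 * t * t1 + k * u ^+ 2 * t ^+ 2 + u ^+ 2 * t * t1 + 1 + k * t1 + k * t1 ^+ 2 + 2 * k * i ^+ 2 * t * t1 + k * i ^+ 2 * t ^+ 2 + i ^+ 2 * t * t1 + t ^+ 2 + u * t + t1 ^+ 2 + k * u * t1 + u * t1 + i * t + k)); ring.
Qed.

(** When [t] is replaced by a multiple [la * t] with [la] in F_q, the equation of [key_eq] has the
    constant term [k * u + (k + 1) * i], and the rest is additive in [la] because only [la] and its
    square occur. Adding the instances for 1, m and 1 + m isolates the nonzero constant term. This
    needs q > 2; the case q = 2 is a direct computation. *)
Lemma special_false : odd e -> False.
Proof using All.
move=> eo.
have cn : k * u + (k + 1) * i != 0.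
  apply/eqP => h; have uk : u ^+ 2 = k.
    transitivity (u ^+ 2 + (k + 1) * u * (k * u + (k + 1) * i)); first by rewrite h mulr0 addr0.
    by apply: (kc (A := u ^+ 2 + u * i) (C := 3 * k + 2) (Z := u ^+ 2 + k * u ^+ 2 + k + 1)); ring.
  have : phi (u ^+ 2) = k by rewrite uk kr.
  rewrite frX uphi exprMn uk => /eqP; have -> : (k + 1) ^+ 2 * k = k + 1 by apply: (kc (A := k + 3) (C := 0) (Z := 1 + 2 * k)); ring.
  by rewrite -subr_eq0 addrAC subrr add0r oner_eq0.
have [g [gs gq]] := @fr_diff K ch e cardK e0 e (3 * e) e0 (ltn_mul3 e0) (dvdn_mull _ (dvdnn _)) (dvd6 e0 (i := 3) isT).
have gr : phi g != g by apply: contraNneq gq => h; apply/eqP/rs_q.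
pose good t := (k * t + phi t) + i * ((k + 1) * t + phi t).
have tr0 t : phi (phi t) = t + phi t -> phi (phi (phi t)) = phi t + phi (phi t) by move=> h; rewrite {1}h frA.
(* An element [g + phi g] has trace 0. If the condition [good] fails for it, it holds for its
   conjugate. *)
have [t [ts tn tt tg]] : exists t, [/\ bar t = t, t != 0, phi (phi t) = t + phi t & good t != 0].
  pose t := g + phi g.
  have ts : bar t = t by rewrite /t frA gs frC gs.
  have tn : t != 0 by rewrite /t addr_eq0C // eq_sym.
  have tt : phi (phi t) = t + phi t.
    by rewrite /t !frA phi3; apply/esym; apply: (c2 (z := phi g)); ring.
  have [g0|] := eqVneq (good t) 0; last by exists t.
  exists (phi t); split; [by rewrite frC ts|by rewrite fr_eq0|exact: tr0|apply/eqP => g1].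
  move: g0 g1; rewrite /good tt; set t1 := phi t => g0 g1.
  have t1s : bar t1 = t1 by rewrite frC ts.
  have X0 : k * t + t1 = 0.
    apply/eqP; apply: contraT => nz; exfalso.
    have h : (k + 1) * (k * t + t1) = k * (k * t + t1).
      transitivity ((k + 1) * (k * t + t1) + (k * t1 + (t + t1) + i * ((k + 1) * t1 + (t + t1))) + k * ((k * t + t1) + i * ((k + 1) * t + t1))); first by rewrite g0 g1 mulr0 !addr0.
      by apply: (kc (A := t + i * t) (C := 0) (Z := k * t1 + k * t + t1 + t + k * i * t1 + i * t1 + i * t + k * i * t)); ring.
    by case/eqP: nz; apply: eqk; rewrite h.
  have X1 : (k + 1) * t + t1 = 0 by rewrite -(fr0 ch (3 * e)) -X0 frA frM kb ts t1s.
  by case/eqP: tn; apply: eqk; apply: (addIr t1); rewrite X0 X1.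
have key la : fr_of ch e la = la -> la != 0 ->
  (1 + la * t + la * phi t) * (k * u + (k + 1) * i) + i ^+ 2 * (la * phi t + (la * t) ^+ 2 + (k + 1) * (la * t + (la * phi t) ^+ 2))
    + u ^+ 2 * (la * phi t + (la * t) ^+ 2 + k * (la * t + (la * phi t) ^+ 2)) = 0.
  move=> lq ln; have lr := q_phi lq; have pl x : phi (la * x) = la * phi x by rewrite frM lr.
  rewrite -pl; apply: key_eq.
  - by rewrite frM ts (q_bar lq).
  - by rewrite mulf_neq0.
  - by rewrite !pl tt mulrDr.
  - rewrite pl; have -> : k * (la * t) + la * phi t + i * ((k + 1) * (la * t) + la * phi t) = la * good t by rewrite /good; ring.
    by rewrite mulf_neq0.
have k1 := key 1 (fr1 ch e) (oner_neq0 K).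
have [e1|e1] := eqVneq e 1%N; last first.
  have [m [mq m1]] := @fr_diff K ch e cardK e0 1 e isT (ltn1_neq e0 e1) (dvd1n _) (dvdn_mull _ (dvdnn _)).
  have m0 : m != 0 by apply: contraNneq m1 => ->; rewrite fr0.
  have m10 : 1 + m != 0.
    apply: contraNneq m1 => h; have -> : m = 1 by apply/eqP; rewrite -addr_eq0C // addrC h.
    by rewrite fr1.
  have km := key m mq m0; have km1 := key (1 + m) (etrans (frA _ _ _ _) (f_equal2 +%R (fr1 ch e) mq)) m10.
  case/eqP: cn; move: k1 km km1; move: (phi t) => t1 k1 km km1.
  transitivity (0 + 0 + 0 : K); last by rewrite !addr0.
  rewrite -{1}k1 -{1}km -{1}km1.
  pose cc := k * u + (k + 1) * i.
  apply: (c2 (z := - cc - (1 + m) * (t + t1) * cc - i ^+ 2 * ((1 + m) * t1 + (k + 1) * ((1 + m) * t) + (1 + m + m ^+ 2) * (t ^+ 2 + (k + 1) * t1 ^+ 2)) - u ^+ 2 * ((1 + m) * t1 + k * ((1 + m) * t) + (1 + m + m ^+ 2) * (t ^+ 2 + k * t1 ^+ 2)))).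
  by rewrite /cc; ring.
(* With q = 2 the maps [phi] and [bar] are the powers 4 and 8, so [u] and [t] satisfy explicit
   low-degree relations. *)
have f4 x : phi x = x ^+ 4 by rewrite /fr_of e1.
have f8 x : bar x = x ^+ 8 by rewrite /fr_of e1.
have u3 : u ^+ 3 = k + 1 by apply: (mulfI u0); rewrite -exprS -f4 uphi mulrC.
have t18 : phi t ^+ 2 = t by rewrite f4 -exprM -f8.
have t22 : t ^+ 2 = t + phi t.
  by rewrite -tt !f4 -exprM; have := congr1 (fun x => x ^+ 2) ts; rewrite f8 -exprM => <-.
have i2 : i ^+ 2 = k * u.
  transitivity (i ^+ 2 * ((k + 1) * k)); first by apply: (kc (A := - i ^+ 2) (C := 0) (Z := - k * i ^+ 2)); ring.
  by rewrite -u3; apply: (kc (A := 0) (C := k * u ^+ 2 * i + k * u) (Z := 0)); ring.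
have u2 : u ^+ 2 = (k + 1) * i.
  by rewrite -u3; apply: (kc (A := 0) (C := - u ^+ 2) (Z := 0)); ring.
move: k1; rewrite !mul1r t18 t22 i2 u2; move: (phi t) t22 t18 => t1 t22 t18 k1.
have : (1 + t1) * (k * u + (k + 1) * i) = 0.
  rewrite -[RHS]k1; by apply: (kc (A := - 2 * u * t - 2 * i * t) (C := 0) (Z := - k * u * t1 - k * i * t1 - i * t1 - 3 * k * u * t - 3 * k * i * t - 2 * i * t - u * t)); ring.
move/eqP; rewrite mulf_eq0 (negbTE cn) orbF addr_eq0C // => /eqP t11.
by move: t18 t22; rewrite -t11 expr1n => <-; rewrite expr1n adddK // => /eqP; rewrite oner_eq0.
Qed.

End Special.
End OddCase.

(** The constants of the odd case come from the resolvent [b] with [phi b = w * b] for [w = k + 1].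
    Since [bar w = w ^+ 2], the quotient [u = bar b / b] satisfies [phi u = w * u] and
    [bar u = u^-1]. *)
Theorem no_II_odd a0 : odd e -> bar a0 = a0 -> phi a0 != a0 -> X (0, 1, a0) \notin Omega2 B.
Proof.
move=> eo a0s a0r; apply/negP => a0O.
have [k [k1 kr kb]] := cube_root ch cardK; rewrite eo in kb.
have k2 : k ^+ 2 = k + 1 by apply/eqP; rewrite -addr_eq0C // -k1; apply/eqP; ring.
rewrite k2 in kb.
have w1 : 1 + (k + 1) + (k + 1) ^+ 2 = 0.
  transitivity ((1 + k + k ^+ 2) + (1 + k + (1 + k)) ); first by ring.
  by rewrite k1 add0r adddK.
have wr : phi (k + 1) = k + 1 by rewrite frA kr fr1.
have [g [gs bn]] := resolvent cardK e0 w1 wr.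
pose w := k + 1; pose b := g + w ^+ 2 * phi g + w * phi (phi g); rewrite -/w -/b in bn.
have w3 : w ^+ 3 = 1.
  by apply/eqP; rewrite -subr_eq0; apply/eqP; transitivity ((w - 1) * (1 + w + w ^+ 2)); [ring|rewrite w1 mulr0].
have bw : phi b = w * b by apply: res_phi.
have bbn : bar b != 0 by rewrite fr_eq0.
have wb : bar w = k by rewrite /w frA kb fr1 -addrA adddK // addr0.
have wn : w != 0 by apply: contra_eq_neq w3 => ->; rewrite expr0n eq_sym oner_eq0.
have kw : k = w ^+ 2.
  by rewrite /w; apply/esym; transitivity (k ^+ 2 + 1 + (k + k)); [ring|rewrite adddK // addr0 k2 -addrA adddK // addr0].
pose u := bar b / b; pose i := b / bar b.
have ui : u * i = 1 by rewrite /u /i; field; rewrite bn bbn.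
have ub : bar u = i by rewrite /u /i frM frV bK.
have uphi : phi u = (k + 1) * u.
  rewrite -/w /u frM frV [phi (bar b)]frC bw frM wb kw.
  apply/eqP; rewrite mulrA eqr_div ?mulf_neq0 //; apply/eqP.
  by ring.
have [t [p [tT t2 tp pB pE]]] := p0_ex k2 kr kb ui ub uphi a0s a0r a0O.
have [s [sT s2 sh]] := special_trans k2 kr kb ui ub uphi pE pB tT t2 tp.
exact: (special_false k2 kr kb ui ub uphi sT s2 sh eo).
Qed.


(** * Identification of the subunital and extension of translations to the plane *)

Lemma Omega2_sub x : x \in Omega2 B -> x \in hpoints (2 ^ e) pi.
Proof.
move=> xO; apply: contraT => xH; have [a [as_ ar aO']] := Omega2_II xO xH.
have [eo|eo] := boolP (odd e); first by have := no_II_odd eo as_ ar; rewrite aO'.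
by have := no_II_even eo as_ ar; rewrite aO'.
Qed.

(** The unitary group of the subplane is transitive on its absolute points: a map [FH] makes the
    first coordinate 0, and a matrix of SL_2(q) then moves the point to infinity. *)
Lemma hpoint_inf x : x \in hpoints (2 ^ e) pi -> exists F v, [/\ sunit 0 F, v != v0 K, absv v, x = X v & X (F v) = inft].
Proof.
have [v' [v'n v'a ->]] := X_surj x; rewrite hpX // => /eqP /(phi_line v'n)[v vf [c c0 v'E]].
have vn : v != v0 K by move: v'n; rewrite v'E vscale_eq0.
have va : absv v by move: v'a; rewrite v'E absvZ.
have -> : X v' = X v by rewrite v'E X_scale.
have f0 : phi v.1.1 = v.1.1 := congr1 (fun u : vec K => u.1.1) vf.
have f1 : phi v.1.2 = v.1.2 := congr1 (fun u : vec K => u.1.2) vf.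
have f2 : phi v.2 = v.2 := congr1 (fun u : vec K => u.2) vf.
have q0 := fr0 ch e; have q1 := fr1 ch e.
have [v1|v1] := eqVneq v.1.2 0.
  have t : ~~ type3 v by apply: (@t3N v 0 1 0 ph0 ph1 ph0 (nzm _ _)); rewrite v1; ring.
  have v00 : v.1.1 = 0.
    by move: va; rewrite absvN // hE v1 fr0 mul0r mulr0 !addr0 mulf_eq0 fr_eq0 orbb => /eqP.
  have v20 : v.2 != 0 by apply: contraNneq vn => v20; apply/eqP; apply: vecP.
  have d : 1 * 1 + 0 * 0 = 1 :> K by ring.
  exists (FS 1 0 0 1), v; split=> //; first exact: sunit_S.
  rewrite -[RHS](X_scale v20 (nzr 0 0) abs_inf); congr X; apply: vecP; rewrite /= ?v00 ?v1 ?mulr0 ?mul0r ?mul1r ?mulr1 ?addr0 ?add0r //.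
have [ab vE] := @X_aff v (v.1.1 / v.1.2) (v.2 / v.1.2) vn va (esym (divfK v1 _)) (esym (divfK v1 _)).
have ar : phi (v.1.1 / v.1.2) = v.1.1 / v.1.2 by rewrite frM frV f0 f1.
have yr : phi (v.2 / v.1.2) = v.2 / v.1.2 by rewrite frM frV f2 f1.
move: (v.1.1 / v.1.2) (v.2 / v.1.2) ab vE ar yr => al y ab -> ar yr.
have [d [dr dN]] := trace_r cardK e0 (r_norm cardK ar).
have sH := sunit_H ar dr dN.
pose y' := y + bar al * al + d.
have ab' : absv (0, 1, y').
  by have := sunit_absv (al, 1, y) sH; rewrite /FH /= mulr1 adddK // mulr1 => ->.
have y's : bar y' = y' by apply/eqP; rewrite -absl.
have y'r : phi y' = y' by rewrite /y' !frA frM ar (r_bar ar) yr dr.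
have y'q := rs_q y'r y's.
have d1 : y' * 0 + 1 * 1 = 1 by ring.
exists (FS y' 1 1 0 \o FH al d), (al, 1, y); split; rewrite ?nzm //.
  exact: (sunit_comp (sunit_S y'q q1 q1 q0 d1) sH).
rewrite /inft; congr X; rewrite /FH /FS /=; apply: vecP; rewrite /= ?mulr1 ?mul1r ?mul0r ?addr0 ?adddK //.
Qed.

Lemma inf_Omega2 : inft \in Omega2 B.
Proof.
have [a aT aE] := E_trans (fr1 ch e).
have a00 : absv (0, 1, 0) by apply: q_pt; rewrite fr0.
apply: (trans_Omega2 erefl k3 U_card block_card block_join block_uniq aT).
apply/eqP => a1; have := aE _ (nzm 0 0) a00; rewrite a1 perm1.
have -> : FE 1 (0, 1, 0) = (0, 1, 1) by apply: vecP; rewrite //= add0r mulr1.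
move/(X_line_inj (fr0 _ _) (fr1 _ _))/eqP; by rewrite eq_sym oner_eq0.
Qed.

Lemma hpoints_Omega2 : hpoints (2 ^ e) pi = Omega2 B.
Proof.
apply/eqP; rewrite eqEsubset; apply/andP; split; apply/subsetP => x; last exact: Omega2_sub.
move=> /hpoint_inf[F [v [sF vn va xE Fv]]]; have [a [aB aE]] := sunit_aut sF.
have aB' : block_aut B a^-1%g by have := @groupV _ (autG B) a; rewrite !inE aB.
have -> : x = a^-1%g inft by rewrite xE -Fv -aE // permK.
exact: Omega2J aB' inf_Omega2.
Qed.

Lemma trans_hpoint c t : t \in T c -> (t != 1)%g -> exists2 a : {perm U}, block_aut B a & (t ^ a)%g \in T inft.
Proof.
move=> tT t1; have := trans_Omega2 erefl k3 U_card block_card block_join block_uniq tT t1.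
rewrite -hpoints_Omega2 => /hpoint_inf[F [v [sF vn va xE Fv]]]; have [a [aB aE]] := sunit_aut sF.
exists a; first exact: aB.
have ac : a c = inft.
  by rewrite xE (aE _ vn va); exact: Fv.
by rewrite -ac; apply: transJ.
Qed.

Lemma line_inD (l : fline K) (x y : U) : x \in hpoints (2 ^ e) pi -> y \in hpoints (2 ^ e) pi -> x != y ->
  inc (val x) l -> inc (val y) l -> inD ((2 ^ e) ^ 2) l.
Proof.
have rat z : z \in hpoints (2 ^ e) pi -> exists v, [/\ v != v0 K, absv v, vphi v = v & z = X v].
  have [v' [v'n v'a ->]] := X_surj z; rewrite hpX // => /eqP /(phi_line v'n)[v vf [c c0 v'E]].
  have vn : v != v0 K by move: v'n; rewrite v'E vscale_eq0.
  have va : absv v by move: v'a; rewrite v'E absvZ.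
  by exists v; split=> //; rewrite v'E X_scale.
have [n nn ->] := lnP Eu l.
move=> /rat[v [vn va vf ->]] /rat[w [wn wa wf ->]] vw; rewrite !val_X // !inc_pt //.
have tv : ~~ type3 v by apply: fix_neg3.
have tw : ~~ type3 w by apply: fix_neg3.
rewrite !fincNl // => /eqP d1 /eqP d2.
have c0 : cross v w != v0 K.
  by apply: contraNneq vw => h; apply/eqP; apply: val_inj; rewrite !val_X //; apply: pt_par.
have [c cE] := perp_cross c0 d1 d2.
have cn : c != 0 by apply: contraNneq nn => h; rewrite cE h vscale0.
have -> : ln n = ln (cross v w) by apply/esym/eqP/(ln_eqP Eu c0 nn); exists c.
have cf : vphi (cross v w) = cross v w by rewrite (vmap_cross phi) vf wf.
have := frob_lnm EF (cross v w); rewrite cf => h.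
by rewrite /inD val_ln //; apply/eqmxP; exact: h.
Qed.

Lemma hblocks_blocks2 : hblocks (2 ^ e) pi = blocks2 B.
Proof.
apply/setP => b; rewrite inE -hpoints_Omega2; apply/imsetP/andP.
  case=> l; rewrite inE => /andP[_ h] ->; split=> //; apply/imsetP; exists l => //; rewrite inE.
  by apply: leq_trans h _; apply: subset_leq_card; apply: subsetIl.
case=> /imsetP[l]; rewrite inE => _ -> h; exists l => //; rewrite inE h andbT.
case/card_gt1P: h => x [y [xb yb xy]]; move: xb yb; rewrite !in_setI => /andP[xl xh] /andP[yl yh].
by apply: (line_inD xh yh xy); [move: xl; rewrite inE|move: yl; rewrite inE].
Qed.

(** A collineation that moves the center to infinity conjugates the translation to some [FE g],
    which acts on the whole plane; conjugating back gives the elation, with center [c] and axis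
    [pi (val c)]. *)
Lemma inf_elation c t : t \in T c -> (t != 1)%g -> exists (f : {perm fpoint K}) (g : {perm fline K}),
  [/\ elation inc f g, f @: [set p | absolute (2 ^ e) pi p] = [set p | absolute (2 ^ e) pi p] &
      forall x : U, val (t x) = f (val x)].
Proof.
move=> tT t1; have := trans_Omega2 erefl k3 U_card block_card block_join block_uniq tT t1.
rewrite -hpoints_Omega2 => /hpoint_inf[F [v [sF vn va cE Fv]]].
have [f1 [g1 [a [[col1 _ pg1 aB] [aE fE]]]]] := sunit_perm sF.
have ac : a c = inft.
  by apply: val_inj; rewrite aE cE val_X // fE // -Fv val_X ?(sunit_neq0 sF) ?(sunit_absv _ sF).
have taT : (t ^ a)%g \in T inft by rewrite -ac; apply: transJ.
have [g gq gE] := trans_inf taT.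
have [f2 [g2 [b [[col2 _ pg2 bB] [bE f2E]]]]] := sunit_perm (sunit_E gq).
have tb x : val ((t ^ a)%g x) = f2 (val x).
  have [w [wn wa ->]] := X_surj x; have sE := sunit_E gq.
  by rewrite gE // !val_X ?(sunit_neq0 sE) ?(sunit_absv _ sE) // f2E.
pose f := (f1 * f2 * f1^-1)%g; pose gg := (g1 * g2 * g1^-1)%g.
have fEE p : f p = f1^-1%g (f2 (f1 p)) by rewrite !permM.
have pgV p : g1^-1%g (pi p) = pi (f1^-1%g p) by apply: (@perm_inj _ g1); rewrite permKV pg1 permKV.
have pg p : gg (pi p) = pi (f p) by rewrite !permM pg1 pg2 pgV.
have col p l : inc (f p) (gg l) = inc p l.
  by rewrite !permM -col1 !permKV col2 col1.
have fixp p : inc p (pi (val c)) -> f p = p.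
  move=> pc; rewrite fEE; suff -> : f2 (f1 p) = f1 p by rewrite permK.
  move: pc; rewrite -col1 pg1 -aE ac val_X ?nzr ?abs_inf //.
  have [w wn ->] := ptP Eu (f1 p); rewrite inc_pi ?nzr // fincN ?polE ?fr0 ?fr1 ?t3N_l //.
  rewrite /dot /= !mulr0 add0r addr0 mulr1 => /eqP w1; rewrite f2E //; congr pt.
  by apply: vecP; rewrite //= w1 mulr0 addr0.
exists f, gg; split.
- split=> //; exists (val c), (pi (val c)); split=> //; first exact: (valP c).
  (* The lines through the center are the polars of the points on the axis, and the collineation
     commutes with [pi]. *)
  move=> l; have [y ->] := lineP l => h; by rewrite pg fixp //; have := r_sym y (val c); rewrite /r => ->.
- apply/eqP; rewrite eqEcard card_imset ?leqnn ?andbT; last exact: perm_inj.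
  apply/subsetP => y /imsetP[x]; rewrite !inE => xa ->.
  by rewrite /absolute -pg col.
move=> x; rewrite fEE -aE -tb; apply: (@perm_inj _ f1); rewrite permKV -aE; congr val.
by rewrite permJ.
Qed.

Theorem coordinate_main :
  [/\ forall (c : U) (s : {perm U}), involutory_translation B c s -> c \in hpoints (2 ^ e) pi /\
        exists (f : {perm fpoint K}) (g : {perm fline K}),
          [/\ elation inc f g, f @: [set p | absolute (2 ^ e) pi p] = [set p | absolute (2 ^ e) pi p] &
              forall x : U, val (s x) = f (val x)],
      hpoints (2 ^ e) pi = Omega2 B /\ hblocks (2 ^ e) pi = blocks2 B,
      forall s : {perm U}, block_aut B s -> s @: hpoints (2 ^ e) pi = hpoints (2 ^ e) pi /\
        (fun b : {set U} => s @: b) @: hblocks (2 ^ e) pi = hblocks (2 ^ e) pi &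
      forall (c : U) (s : {perm U}), translation B c s -> s <> 1%g -> #[s]%g = 2].
Proof using All.
split.
- move=> c t /andP[tT /eqP t2]; have tT' : t \in T c by rewrite inE.
  have t1 : (t != 1)%g by rewrite -order_eq1 t2.
  split; last exact: inf_elation tT' t1.
  rewrite hpoints_Omega2; exact: (trans_Omega2 erefl k3 U_card block_card block_join block_uniq tT' t1).
- by split; [apply: hpoints_Omega2|apply: hblocks_blocks2].
- move=> t tB; rewrite hblocks_blocks2 hpoints_Omega2.
  have tO : t @: Omega2 B = Omega2 B.
    apply/eqP; rewrite eqEcard card_imset ?leqnn ?andbT; last exact: perm_inj.
    by apply/subsetP => y /imsetP[x xO ->]; apply: Omega2J.
  split=> //; apply/eqP; rewrite eqEcard card_imset ?leqnn ?andbT; last exact: (imset_inj (@perm_inj _ t)).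
  apply/subsetP => b' /imsetP[b]; rewrite inE => /andP[bB b1] ->; rewrite inE autP //=.
  by rewrite -{1}tO -imsetI ?card_imset //; [apply: perm_inj|move=> ? ? _ _; apply: perm_inj].
- move=> c t tT /eqP t1; have tT' : t \in T c by rewrite inE.
  have [a aB taT] := trans_hpoint tT' t1.
  have /eqP := inf_sq taT; rewrite -[(_ * _)%g]/((t ^ a) ^+ 2)%g -order_dvdn orderJ => d2.
  by move/(prime_nt_dvdP (isT : prime 2)): d2 => -> //; rewrite order_eq1.
Qed.

End Coordinates.

End PolarUnitalCoordinates.
Import PolarUnitalCoordinates.

(** * Hyperbolic frames for the hermitian form on the subplane *)

Module HyperbolicFrames.
Local Open Scope ring_scope.

Section HyperbolicFrame.
Variables (K : finFieldType) (ch : 2 \in [pchar K]) (e : nat).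
Hypothesis cardK : #|K| = ((2 ^ e) ^ 6)%N.
Hypothesis e0 : (0 < e)%N.
Notation phi := (fr_of ch (2 * e)).
Notation bar := (fr_of ch (3 * e)).
Notation vphi := (vmap phi).
Implicit Types u v w n : vec K.

Definition G0 : 'M[K]_3 := \matrix_(i < 3, j < 3)
  nth 0 (nth [::] [:: [:: 1; 0; 0]; [:: 0; 0; 1]; [:: 0; 1; 0]] i) j.

Lemma G0_unit : G0 \in unitmx.
Proof.
have /mulmx1_unit[] // : G0 *m G0 = 1%:M.
apply/matrixP => i j; rewrite !mxE !big_ord_recl big_ord0 !mxE.
case: i => [[|[|[|//]]] ?]; case: j => [[|[|[|//]]] ?];
  by rewrite /= ?mulr0 ?mul0r ?mulr1 ?addr0 ?add0r.
Qed.

Lemma G0_phi : map_mx phi G0 = G0.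
Proof.
apply/matrixP => i j; rewrite !mxE.
by case: i => [[|[|[|//]]] ?]; case: j => [[|[|[|//]]] ?]; rewrite /= ?fr0 ?fr1.
Qed.

Lemma G0_bar : G0^T = map_mx bar G0.
Proof.
apply/matrixP => i j; rewrite !mxE.
by case: i => [[|[|[|//]]] ?]; case: j => [[|[|[|//]]] ?]; rewrite /= ?fr0 ?fr1.
Qed.

Lemma G0_pol a b c : pol ch e G0 (a, b, c) = (bar a, bar c, bar b).
Proof.
apply: (@rv_inj K); rewrite rv_pol; apply/rowP => j; rewrite !mxE !big_ord_recl big_ord0 !mxE.
by case: j => [[|[|[|//]]] ?]; rewrite /= ?mulr0 ?mulr1 ?addr0 ?add0r.
Qed.

Variable H : 'M[K]_3.
Hypotheses (HF : map_mx phi H = H) (Hh : H^T = map_mx bar H) (Hu : H \in unitmx).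
Notation h := (herm ch e H).

Let hC := hermC cardK Hh.

Lemma herm_q v : vphi v = v -> fr_of ch e (h v v) = h v v.
Proof. by move=> vf; apply: rs_q; [rewrite (herm_phi HF) vf|rewrite hC]. Qed.

Lemma rat_add v w : vphi v = v -> vphi w = w -> vphi (vadd v w) = vadd v w.
Proof. by move=> vf wf; rewrite -{2}vf -{2}wf; apply: vecP; rewrite /= frA. Qed.

Lemma rat_scale t v : phi t = t -> vphi v = v -> vphi (vscale t v) = vscale t v.
Proof. by move=> tf vf; rewrite -{2}vf -{2}tf; apply: vecP; rewrite /= frM. Qed.

Lemma rat_perp n : vphi n = n -> n.1.1 != 0 -> exists w, [/\ w != v0 K, vphi w = w & dot w n = 0].
Proof.
move=> nf n0; have f1 : phi n.1.1 = n.1.1 by rewrite -{2}nf.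
have f2 : phi n.1.2 = n.1.2 by rewrite -{2}nf.
exists (n.1.2, n.1.1, 0); split.
- by rewrite !xpair_eqE (negbTE n0) andbF.
- by apply: vecP; rewrite /= ?fr0.
- by rewrite /dot /= mul0r addr0 [n.1.1 * _]mulrC adddK.
Qed.

Lemma rat_nperp n : n != v0 K -> exists2 x, vphi x = x & dot x n != 0.
Proof.
case/vec_neq0 => n0; [exists (1, 0, 0)|exists (0, 1, 0)|exists (0, 0, 1)];
  by [apply: vecP; rewrite /= ?fr0 ?fr1|rewrite /dot /= !mul0r mul1r ?addr0 ?add0r].
Qed.

Lemma herm_v0 v : h v (v0 K) = 0.
Proof. by rewrite /PolarityForm.herm /dot /= !mul0r !addr0. Qed.

(** If two orthogonal vectors of the subplane are both anisotropic, the quotient of their values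
    lies in F_q and is a norm, which yields an isotropic combination. *)
Lemma iso_ex : exists v, [/\ v != v0 K, vphi v = v & h v v = 0].
Proof.
pose v : vec K := (1, 0, 0).
have vf : vphi v = v by apply: vecP; rewrite /= ?fr1 ?fr0.
have vn : v != v0 K by rewrite !xpair_eqE oner_eq0.
have [h0|hv] := eqVneq (h v v) 0; first by exists v.
have nf : vphi (pol ch e H v) = pol ch e H v by rewrite (pol_phi HF) vf.
have n0 : (pol ch e H v).1.1 != 0.
  by move: hv; rewrite /PolarityForm.herm; move: (pol ch e H v) => n; rewrite /dot /= mul1r !mul0r !addr0.
have [w [wn wf wv]] := rat_perp nf n0; rewrite -/(h v w) in wv.
have [h0|hw] := eqVneq (h w w) 0; first by exists w.
have cq : fr_of ch e (h v v / h w w) = h v v / h w w by rewrite frM frV !herm_q.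
have [t [tf tN]] := norm_r cardK e0 cq.
exists (vadd v (vscale t w)); split.
- apply: contraNneq hv => z.
  have : h v (vadd v (vscale t w)) = h v v by rewrite hermDr hermZr wv mulr0 addr0.
  by rewrite z herm_v0 => <-.
- by apply: rat_add => //; apply: rat_scale.
- have wv' : h w v = 0 by rewrite -hC wv fr0.
  rewrite hermDl !hermDr !hermZl !hermZr wv wv' !mulr0 addr0 add0r mulrA [bar t * t]mulrC tN.
  by rewrite divfK // adddK.
Qed.

(** A vector [w] with [h v w = 1] becomes isotropic after adding a multiple of [v] whose factor has
    trace [h w w]. *)
Lemma hyp_pair : exists v w, [/\ vphi v = v, vphi w = w, h v v = 0, h w w = 0 & h v w = 1].
Proof.
have [v [vn vf vv]] := iso_ex.
have pn : pol ch e H v != v0 K by rewrite pol_eq0.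
have [x xf xv] := rat_nperp pn; rewrite -/(h v x) in xv.
have xv' : phi (h v x) = h v x by rewrite (herm_phi HF) vf xf.
have [w [wf vw]] : exists w, vphi w = w /\ h v w = 1.
  by exists (vscale (h v x)^-1 x); rewrite hermZr mulVf //; split=> //; apply: rat_scale; rewrite // frV xv'.
have wv : h w v = 1 by rewrite -hC vw fr1.
have [t [tf tt]] := trace_r cardK e0 (herm_q wf).
exists v, (vadd w (vscale t v)); split=> //.
- by apply: rat_add => //; apply: rat_scale.
- rewrite hermDl !hermDr !hermZl !hermZr vv vw wv !mulr0 !mulr1 addr0 -addrA tt.
  by rewrite adddK.
- by rewrite hermDr hermZr vv vw mulr0 addr0.
Qed.

(** The cross product of the two polar vectors is orthogonal to the hyperbolic pair; nondegeneracy
    makes it anisotropic, and surjectivity of the norm normalizes its value to 1. *)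
Lemma hyp_triple : exists u v w, [/\ vphi u = u, vphi v = v & vphi w = w] /\
  [/\ h u u = 1, h v v = 0, h w w = 0 & [/\ h v w = 1, h w v = 1, h v u = 0 & h w u = 0]].
Proof.
have [v [w [vf wf vv ww vw]]] := hyp_pair.
have wv : h w v = 1 by rewrite -hC vw fr1.
pose x := cross (pol ch e H v) (pol ch e H w).
have vx : h v x = 0 by rewrite /PolarityForm.herm dotC dot_crossl.
have wx : h w x = 0 by rewrite /PolarityForm.herm dotC dot_crossr.
have d0 : det3 x v w != 0.
  have -> : det3 x v w = h v v * h w w - h w v * h v w.
    rewrite /x /PolarityForm.herm; move: (pol ch e H v) (pol ch e H w) => n m.
    by rewrite /det3 /dot /cross /=; ring.
  by rewrite vv wv vw mul0r mul1r sub0r oppr_eq0 oner_eq0.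
have xn : x != v0 K.
  by apply: contraNneq d0 => ->; rewrite /det3 /dot /= !mul0r !addr0.
have xf : vphi x = x by rewrite /x (vmap_cross phi) !(pol_phi HF) vf wf.
have xx : h x x != 0.
  apply: contraNneq xn => xx; rewrite -(pol_eq0 ch e Hu); apply/eqP; apply: (det3_perp d0) => //.
    by rewrite -/(h x v) -hC vx fr0.
  by rewrite -/(h x w) -hC wx fr0.
have cq : fr_of ch e (h x x)^-1 = (h x x)^-1 by rewrite frV herm_q.
have [t [tf tN]] := norm_r cardK e0 cq.
exists (vscale t x), v, w; split; first by split=> //; apply: rat_scale.
split=> //; last by rewrite !hermZr vx wx mulr0.
by rewrite hermZl hermZr mulrA [bar t * t]mulrC tN mulVf.
Qed.

Lemma hyp_frame : exists E, [/\ E \in unitmx, map_mx phi E = E & map_mx bar E *m H *m E^T = G0].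
Proof.
have [u [v [w [[uf vf wf] [uu vv ww [vw wv vu wu]]]]]] := hyp_triple.
pose f (i : 'I_3) : vec K := nth (v0 K) [:: u; v; w] i.
pose E : 'M[K]_3 := \matrix_(i < 3) rv (f i).
have uv : h u v = 0 by rewrite -hC vu fr0.
have uw : h u w = 0 by rewrite -hC wu fr0.
have GE : map_mx bar E *m H *m E^T = G0.
  apply/matrixP => i j; transitivity (h (f i) (f j)).
    rewrite hermE -map_rv !mxE; apply: eq_bigr => k _; rewrite !mxE; congr (_ * _).
    by apply: eq_bigr => l _; rewrite !mxE.
  by rewrite mxE /f; case: i => [[|[|[|//]]] ?]; case: j => [[|[|[|//]]] ?].
exists E; split=> //.
  by have := G0_unit; rewrite -GE !unitmx_mul unitmx_tr => /andP[].
apply/row_matrixP => i; rewrite -map_row !rowK map_rv; congr rv.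
by rewrite /f; case: i => [[|[|[|//]]] ?].
Qed.

End HyperbolicFrame.

End HyperbolicFrames.
Import HyperbolicFrames.

Theorem theorem5p3 (e q : nat) (K : finFieldType)
    (pi : fpoint K -> fline K) (pi' : fline K -> fpoint K) :
  (0 < e)%N -> q = (2 ^ e)%N -> #|K| = (q ^ 6)%N ->
  polarity (@fig_inc K (q ^ 2)) pi pi' ->
  extends_unitary_polarity q pi ->
  [/\ forall (c : upoint q pi) (s : {perm upoint q pi}),
        involutory_translation (ublocks q pi) c s ->
        c \in hpoints q pi /\
        exists (f : {perm fpoint K}) (g : {perm fline K}),
          [/\ elation (@fig_inc K (q ^ 2)) f g,
              f @: [set p | absolute q pi p] = [set p | absolute q pi p] &
              forall x : upoint q pi, val (s x) = f (val x)],
      hpoints q pi = Omega2 (ublocks q pi) /\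
      hblocks q pi = blocks2 (ublocks q pi),
      forall s : {perm upoint q pi}, block_aut (ublocks q pi) s ->
        s @: hpoints q pi = hpoints q pi /\
        (fun b : {set upoint q pi} => s @: b) @: hblocks q pi = hblocks q pi &
      forall (c : upoint q pi) (s : {perm upoint q pi}),
        translation (ublocks q pi) c s -> s <> 1%g -> #[s]%g = 2].
Proof.
move=> e0 -> cardK Hpol [H [HF0 Hh0 Hu HpiD]].
have ch : (2 \in [pchar K])%R by apply: (card_finPcharP (n := e * 6)); rewrite // cardK -expnM.
have HF : map_mx (fr_of ch (2 * e)) H = H by rewrite -frobE; exact: HF0.
have Hh : (H^T)%R = map_mx (fr_of ch (3 * e)) H.
  (* The entries of [H] lie in the field of order q^2, where x^q and x^(q^3) agree. *)
  rewrite Hh0; apply/matrixP => i j; rewrite !mxE.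
  have hf : fr_of ch (2 * e) (H i j) = H i j by have := congr1 (fun A : 'M_3 => A i j) HF; rewrite mxE.
  by rewrite (bar_r hf).
have [E [Eu EF GE]] := hyp_frame cardK e0 HF Hh Hu.
have piE v : v != v0 K -> pi (pt Eu v) = ln Eu (pol ch e (G0 K) v).
  move=> vn; rewrite -GE; apply: (frame_pi cardK Hpol) => //; last by rewrite GE G0_unit.
  exact: (pi_eq cardK HF Hh Hu Hpol HpiD).
have Hab := isotropic_count cardK Hpol EF (G0_phi ch e) (G0_bar ch e) (G0_unit K) piE e0 (G0_pol ch e).
have [p] : exists p, p \in [set p | absolute (2 ^ e) pi p].
  by apply/set0Pn; rewrite -card_gt0; apply: leq_ltn_trans Hab.
rewrite inE => pa.
exact: (coordinate_main cardK Hpol EF (G0_phi ch e) (G0_bar ch e) (G0_unit K) piE Hab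
          (exist _ p pa : upoint (2 ^ e) pi) e0 (G0_pol ch e)).
Qed.
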